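(* Let $n\ge 1$, let $\frac12<r<\infty$ and let $1<p_1,p_2,q_1,q_2\le\infty$ satisfy $\frac1r=\frac1{p_1}+\frac1{q_1}=\frac1{p_2}+\frac1{q_2}$. Let $s>\max\left(0,\frac nr-n\right)$ or $s\in 2\mathbf N$. Then there exists a constant $C=C(n,s,r,p_1,q_1,p_2,q_2)<\infty$ such that for all $f,g\in\mathcal S(\mathbf R^n)$, $$\|D^s(fg)\|_{L^r(\mathbf R^n)}\le C\left[\|D^sf\|_{L^{p_1}(\mathbf R^n)}\|g\|_{L^{q_1}(\mathbf R^n)}+\|f\|_{L^{p_2}(\mathbf R^n)}\|D^sg\|_{L^{q_2}(\mathbf R^n)}\right],\qquad (a)$$ $$\|J^s(fg)\|_{L^r(\mathbf R^n)}\le C\left[\|f\|_{L^{p_1}(\mathbf R^n)}\|J^sg\|_{L^{q_1}(\mathbf R^n)}+\|J^sf\|_{L^{p_2}(\mathbf R^n)}\|g\|_{L^{q_2}(\mathbf R^n)}\right].\qquad (b)$$ Moreover, for $\frac12\le r<1$ and $1\le p_1,p_2,q_1,q_2\le\infty$ satisfying $\frac1r=\frac1{p_1}+\frac1{q_1}=\frac1{p_2}+\frac1{q_2}$, and with $s>\max(0,\frac nr-n)$ or $s\in2\mathbf N$, if one of the indices $p_1,p_2,q_1,q_2$ is equal to $1$, then (a) and (b) hold, for all $f,g\in\mathcal S(\mathbf R^n)$ with a finite constant depending only on $n,s,r,p_1,q_1,p_2,q_2$, when the $L^r(\mathbf R^n)$ norms on the left-hand sides are replaced by the $L^{r,\infty}(\mathbf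 R^n)$ quasi-norm.
   Context: $\mathbf N=\{1,2,3,\dots\}$, so $2\mathbf N$ is the set of positive even integers. $\mathcal S(\mathbf R^n)$ is the space of Schwartz functions. The Fourier transform is $\widehat f(\xi)=\int_{\mathbf R^n}f(x)e^{-2\pi i\langle x,\xi\rangle}\,dx$. $D^s=(-\Delta)^{s/2}$ (Riesz potential) and $J^s=(1-\Delta)^{s/2}$ (Bessel potential) are the Fourier multiplier operators which, in the paper's normalization (factors of $2\pi$ suppressed), are given by $$D^sf(x)=\int_{\mathbf R^n}|\xi|^s\widehat f(\xi)e^{2\pi i\langle\xi,x\rangle}\,d\xi,\qquad J^sf(x)=\int_{\mathbf R^n}(1+|\xi|^2)^{s/2}\widehat f(\xi)e^{2\pi i\langle\xi,x\rangle}\,d\xi .$$ $L^{r,\infty}(\mathbf R^n)$ is weak $L^r$, with quasi-norm $\|h\|_{L^{r,\infty}}=\sup_{\lambda>0}\lambda\,|\{x:|h(x)|>\lambda\}|^{1/r}$. When $r<1$, $\|\cdot\|_{L^r}$ is the usual quasi-norm $(\int|h|^r)^{1/r}$. *)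

(* Defs.v *)
From HB Require Import structures.
From mathcomp Require Import all_boot all_order all_algebra.
From mathcomp Require Import all_classical all_reals all_analysis.
From mathcomp.real_closed Require Import complex.

Set Implicit Arguments.
Unset Strict Implicit.
Unset Printing Implicit Defensive.

Import Order.TTheory GRing.Theory Num.Theory.
Import numFieldNormedType.Exports.

Local Open Scope classical_set_scope.
Local Open Scope ring_scope.

Definition rV_display : measure_display. Proof. exact: default_measure_display. Qed.

(* 'rV[R]_n carries the product sigma-algebra generated by the coordinates;
   for R^n this is the Borel sigma-algebra. *)
Section rV_measurable.
Context (R : realType) (n : nat).

Let coords : 'I_n -> 'rV[R]_n -> measurableTypeR R := fun i x => x 0 i.

Let rV_measurable0 : g_sigma_preimage coords set0.
Proof. exact: sigma_algebra0. Qed.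

Let rV_measurableC A : g_sigma_preimage coords A -> g_sigma_preimage coords (~` A).
Proof. exact: sigma_algebraC. Qed.

Let rV_measurable_bigcup (F : _^nat) :
  (forall i, g_sigma_preimage coords (F i)) ->
  g_sigma_preimage coords (\bigcup_i F i).
Proof. exact: sigma_algebra_bigcup. Qed.

HB.instance Definition _ := @isMeasurable.Build rV_display 'rV[R]_n
  (g_sigma_preimage coords) rV_measurable0 rV_measurableC rV_measurable_bigcup.

End rV_measurable.

Section rV_measurability.
Context (R : realType) (n : nat).

Lemma measurable_coord (i : 'I_n) :
  measurable_fun setT (fun x : 'rV[R]_n => x 0 i : measurableTypeR R).
Proof.
move=> _ Y mY; rewrite setTI; apply: sub_sigma_algebra => /=.
rewrite -bigcup_seq/=; exists i => /=; first by rewrite mem_index_enum.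
by exists Y => //; rewrite setTI.
Qed.

Lemma measurable_fun_rV d (T : measurableType d) (f : T -> 'rV[R]_n) :
  (forall i, measurable_fun setT (fun t => f t 0 i : measurableTypeR R)) ->
  measurable_fun setT f.
Proof.
move=> mf _ A mA; rewrite setTI.
have : g_sigma_preimage (fun i t => f t 0 i : measurableTypeR R) (f @^-1` A).
  rewrite (@g_sigma_preimage_comp _ _ n _
    (fun i (x : 'rV[R]_n) => x 0 i : measurableTypeR R)).
  by exists A => //; rewrite setTI.
apply: smallest_sub; first exact: sigma_algebra_measurable.
rewrite -bigcup_seq => B [i /= _ [C mC <-]].
exact: mf.
Qed.

End rV_measurability.

Section lebesgue_measure_rV.
Context (R : realType).

Definition rV_cons n (p : measurableTypeR R * 'rV[R]_n) : 'rV[R]_n.+1 :=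
  \row_i (if unlift ord0 i is Some j then p.2 0 j else p.1).

Definition rV_uncons n (x : 'rV[R]_n.+1) : measurableTypeR R * 'rV[R]_n :=
  (x 0 ord0, \row_j x 0 (lift ord0 j)).

Lemma rV_consK n : cancel (@rV_cons n) (@rV_uncons n).
Proof.
case=> a x; rewrite /rV_uncons /rV_cons !mxE unlift_none; congr pair.
by apply/rowP => j; rewrite !mxE liftK.
Qed.

Lemma measurable_rV_cons n : measurable_fun setT (@rV_cons n).
Proof.
apply: measurable_fun_rV => i.
under eq_fun do rewrite mxE.
case: (unlift ord0 i) => [j|]; last exact: measurable_fst.
exact: (measurableT_comp (measurable_coord j) measurable_snd).
Qed.

Lemma measurable_rV_uncons n : measurable_fun setT (@rV_uncons n).
Proof.
apply/measurable_fun_pair; first exact: measurable_coord.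
apply: measurable_fun_rV => i; under eq_fun do rewrite mxE.
exact: measurable_coord.
Qed.

Section step.
Context (n : nat) (mu : {sigma_finite_measure set 'rV[R]_n -> \bar R}).

Definition rV_step : set 'rV[R]_n.+1 -> \bar R :=
  pushforward (@lebesgue_measure R \x mu)%E (@rV_cons n).

Let rV_step0 : rV_step set0 = 0%E.
Proof. by rewrite /rV_step /pushforward preimage_set0 measure0. Qed.

Let rV_step_ge0 A : (0 <= rV_step A)%E.
Proof. by apply: integral_ge0 => x _; exact: measure_ge0. Qed.

Let rV_step_sigma_additive : semi_sigma_additive rV_step.
Proof.
move=> F mF tF mUF.
exact: (@measure_semi_sigma_additive _ _ _
  (measure_function_pushforward__canonical__measure_function_Measure
    (@lebesgue_measure R \x mu)%E (@measurable_rV_cons n)) F).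
Qed.

HB.instance Definition _ := isMeasure.Build _ _ _ rV_step
  rV_step0 rV_step_ge0 rV_step_sigma_additive.

Let rV_step_sigma_finite : sigma_finite setT rV_step.
Proof.
have /sigma_finiteP[F [TF ndF Foo]] := sigma_finiteT (@lebesgue_measure R).
have /sigma_finiteP[G [TG ndG Goo]] := sigma_finiteT mu.
exists (fun k => @rV_uncons n @^-1` (F k `*` G k)).
  rewrite -preimage_bigcup (_ : \bigcup_k _ = setT) ?preimage_setT//.
  rewrite -setXTT TF TG predeqE => -[x y]; split.
    by move=> [k _ []/= ? ?]; split; exists k.
  move=> [/= [k _ Fkx] [l _ Gly]]; exists (maxn k l) => //; split.
  - by move: x Fkx; exact/subsetPset/ndF/leq_maxl.
  - by move: y Gly; exact/subsetPset/ndG/leq_maxr.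
move=> k; have [? ?] := Foo k; have [? ?] := Goo k; split.
  rewrite -[X in measurable X]setTI; apply: measurable_rV_uncons => //.
  exact: measurableX.
rewrite /rV_step /pushforward -comp_preimage (_ : _ \o _ = id); last first.
  by apply/funext => p /=; rewrite rV_consK.
by rewrite preimage_id product_measure1E// lte_mul_pinfty// ge0_fin_numE.
Qed.

HB.instance Definition _ := Measure_isSigmaFinite.Build _ _ _ rV_step
  rV_step_sigma_finite.

End step.

(* n-dimensional Lebesgue measure, by iterated products *)
Fixpoint lebesgue_rV n : {sigma_finite_measure set 'rV[R]_n -> \bar R} :=
  if n is m.+1 then rV_step (lebesgue_rV m) else dirac (0 : 'rV[R]_0).

Lemma lebesgue_rV_box n (A : 'I_n -> set (measurableTypeR R)) :
  (forall i, measurable (A i)) ->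
  lebesgue_rV n [set x | forall i, A i (x 0 i)] =
  (\prod_(i < n) lebesgue_measure (A i))%E.
Proof.
elim: n => [|n IH] in A *; move=> mA.
  rewrite big_ord0 /= diracE mem_set//; by move=> [].
set B := [set x : 'rV[R]_n | forall i, A (lift ord0 i) (x 0 i)].
have mB : measurable B.
  have -> : B = \bigcap_(i in [set: 'I_n])
      ((fun x : 'rV[R]_n => x 0 i) @^-1` A (lift ord0 i)).
    by apply/seteqP; split => x /= h i => [_|]; apply: h.
  apply: fin_bigcap_measurable => // i _.
  by rewrite -[X in measurable X]setTI; exact: measurable_coord.
rewrite big_ord_recl -IH// -/B -(product_measure1E _ (lebesgue_rV n))//.
rewrite /= /rV_step /pushforward; congr product_measure1.
apply/seteqP; split => -[a x] /=.
  move=> h; split => [|i].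
    by have := h ord0; rewrite mxE unlift_none.
  by have := h (lift ord0 i); rewrite mxE liftK.
move=> [ha hx] i; rewrite mxE.
by case: unliftP => [j ->|->].
Qed.

End lebesgue_measure_rV.

Import Normc.

Local Open Scope complex_scope.

Section schwartz.
Context (R : realType) (n : nat).
Implicit Types (f : 'rV[R]_n -> R[i]) (x : 'rV[R]_n).

(* R[i] is not a normed module over R: differentiability and derivatives of
   complex-valued functions are taken on real and imaginary parts. *)
Definition cdifferentiable f x :=
  differentiable (fun y => complex.Re (f y)) x /\
  differentiable (fun y => complex.Im (f y)) x.

Definition cpartial (i : 'I_n) f : 'rV[R]_n -> R[i] := fun x =>
  'D_(delta_mx 0 i) (fun y => complex.Re (f y)) x +i*
  'D_(delta_mx 0 i) (fun y => complex.Im (f y)) x.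

(* [:: i1; ...; ik] indexes the partial derivative d_i1 ... d_ik f; letting the
   list vary covers all multi-indices. *)
Definition cpartials (l : seq 'I_n) f : 'rV[R]_n -> R[i] := foldr cpartial f l.

Definition monomial (a : 'I_n -> nat) x : R := \prod_i x 0 i ^+ a i.

Definition smooth f := forall (l : seq 'I_n) x, cdifferentiable (cpartials l f) x.

Definition schwartz f := smooth f /\
  forall (a : 'I_n -> nat) (l : seq 'I_n),
    exists M : R, forall x, `|monomial a x| * normc (cpartials l f x) <= M.

End schwartz.

Section fourier.
Context (R : realType) (n : nat).
Implicit Types (f : 'rV[R]_n -> R[i]) (x xi : 'rV[R]_n).

Local Notation mu := (lebesgue_rV R n).

Definition cintegral f : R[i] :=
  (\int[mu]_x complex.Re (f x)) +i* (\int[mu]_x complex.Im (f x)).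

Definition dotprod x xi : R := \sum_i x 0 i * xi 0 i.

(* the norm of 'rV[R]_n in the library is the sup norm *)
Definition enorm x : R := Num.sqrt (dotprod x x).

Definition cis (t : R) : R[i] := cos t +i* sin t.

Definition fourier f xi : R[i] :=
  cintegral (fun x => f x * cis (- (2 * pi * dotprod x xi))).

Definition multiplier (m : 'rV[R]_n -> R) f x : R[i] :=
  cintegral (fun xi => (m xi)%:C * fourier f xi * cis (2 * pi * dotprod xi x)).

(* The factors of 2 pi in the symbols of (-Delta)^(s/2) and (1-Delta)^(s/2) are
   suppressed. *)
Definition riesz (s : R) f := multiplier (fun xi => enorm xi `^ s) f.

Definition bessel (s : R) f :=
  multiplier (fun xi => (1 + enorm xi ^+ 2) `^ (s / 2)) f.

Definition LpN (p : \bar R) f : \bar R := Lnorm mu p (fun x => (normc (f x))%:E).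

Definition weakLpN (r : R) f : \bar R :=
  ereal_sup [set (l%:E * poweR (mu [set x | (l < normc (f x))%R]) r^-1)%E
            | l in [set l : R | 0 < l]].

End fourier.

(* Main.v *)
From HB Require Import structures.
Require Import Defs.
From mathcomp Require Import all_boot all_order all_algebra.
From mathcomp Require Import all_classical all_reals all_analysis.
From mathcomp Require Import measurable_realfun ess_sup_inf.
From mathcomp.real_closed Require Import complex.
From mathcomp Require Import ring lra.

(**
  Write [L xi] for [|xi|^2] (Riesz case) or [1 + |xi|^2] (Bessel case) and [h = s/2].  Everything reduces to a
  pointwise bound of the Leibniz defect [D^s(fg) - f D^s g - g D^s f], a bilinear multiplier with symbol
  [L(xi+eta)^h - L(xi)^h - L(eta)^h], by [C (X1 Y0 + X0 Y1)], where [X0], [X1], [Y0], [Y1] are the values at [x] of the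
  maximal functions [M(|F|^a)^(1/a)] of [f], [D^s f], [g], [D^s g] for suitable exponents [a].  No Littlewood-Paley
  theory is used: multiplying by the resolution of the identity [c \int (e^v L)^k exp(-e^v L) dv] in each frequency
  splits the defect into pieces living at scales [r = e^(v/2)] and [s = e^(w/2)].  For [r <= s] the Gaussian
  factorisation of [exp(-r^2 L(xi)) exp(-s^2 L(eta))] turns the first two terms of the defect into one multiplier
  [L^h exp(-r^2 L / 4)], with kernel decaying like [|y|^(-n-2h)], applied to [F(v) (G(v) - G(x))]; the subtraction
  gains a power of [r/s], and the growth of the maximal averages away from [x] is absorbed by the kernel exactly when
  [2h > n/r - n], or always when [h] is an integer, the kernel then decaying rapidly.  Each piece decays
  exponentially in [|v - w|] and in [|v - v0|], [v0] being the scale at which the two available bounds balance, so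
  the pieces are summable.  Hölder's inequality with the strong (resp. weak) maximal inequality concludes.
*)

Set Implicit Arguments.
Unset Strict Implicit.
Unset Printing Implicit Defensive.

Import Order.TTheory GRing.Theory Num.Theory.
Import numFieldNormedType.Exports.
Import Normc.

Local Open Scope classical_set_scope.
Local Open Scope ring_scope.
Local Open Scope complex_scope.

(** * Lebesgue integration on R^n *)

(** For [r < 1] the space L^r has neither duality nor a triangle inequality, so the sum over scales
    must be carried out pointwise, before any norm is taken; hence everything is estimated at one
    fixed point [x] through maximal functions. The threshold on [s] has the same origin. The maximal
    exponents of the two factors of a product have reciprocals adding up to at most [1 + th], where
    [th >= 1/r - 1], so the product of the two averages may grow like
    [(1 + |y - x|/r)^(n (1 + th))], up to a small power. One power of the averages costs nothing,
    because an average of an average is again an average; the excess [n th] must be paid by the tail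
    [|y|^(-n-2h)] of the kernel, that is, [n th < 2h]. The Gaussian factorisation is the
    parallelogram law [|xi + eta|^2 + |eta - xi|^2 = 2|xi|^2 + 2|eta|^2]: the Gaussian in [xi + eta]
    regularises [L^h], and the one in [eta - xi] only averages [F(v - y) G(v + y)] over [|y|] of
    order [r]. *)

Section lebesgue_line.
Context {R : realType}.
Local Notation leb := (@lebesgue_measure R).

(** Uniqueness of Lebesgue measure from its values on half-open intervals: the flip pulls []a, b]]
    back to [[c - b, c - a[], of the same length. *)
Lemma lebesgue_measure_flip (c : R) (A : set R) : measurable A ->
  pushforward leb ((fun x => c - x) : _ -> measurableTypeR R) A = leb A.
Proof.
move=> mA; apply/esym/lebesgue_measure_unique => //=.
  by apply: measurable_funB.
move=> mf _ [[a b]] _ <-.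
rewrite /pushforward.
have -> : (fun x => c - x) @^-1` `]a, b] = `[c - b, c - a[%classic.
  apply/seteqP; split => x /=; rewrite !in_itv/=; lra.
rewrite !lebesgue_measure_itv/= !lte_fin ltrD2l ltrN2.
by case: ifP => // _; rewrite -!EFinB; congr EFin; ring.
Qed.

Lemma ge0_integral_flip (c : R) (f : R -> \bar R) :
  measurable_fun [set: R] f -> (forall x, 0 <= f x)%E ->
  (\int[leb]_x f (c - x)%R = \int[leb]_x f x)%E.
Proof.
move=> mf f0.
transitivity (\int[pushforward leb ((fun x : R => (c - x)%R) : _ -> measurableTypeR R)]_x f x)%E.
  by rewrite ge0_integral_pushforward//=; apply: measurable_funB.
apply: eq_measure_integral; first by apply: measurable_funB.
by move=> mg A mA _; exact: (lebesgue_measure_flip c mA).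
Qed.
End lebesgue_line.

Section rV_measurability.
Context {R : realType} {n : nat} {d} {T : measurableType d}.
Implicit Types f g : T -> 'rV[R]_n.

Lemma measurable_rVD f g : measurable_fun [set: T] f -> measurable_fun [set: T] g ->
  measurable_fun [set: T] (fun x => f x + g x).
Proof.
move=> mf mg; apply: measurable_fun_rV => i; under eq_fun do rewrite mxE.
by apply: measurable_funD;
  [exact: measurableT_comp (measurable_coord i) mf|exact: measurableT_comp (measurable_coord i) mg].
Qed.

Lemma measurable_rVN f : measurable_fun [set: T] f -> measurable_fun [set: T] (fun x => - f x).
Proof.
move=> mf; apply: measurable_fun_rV => i; under eq_fun do rewrite mxE.
by apply: measurable_funN; exact: measurableT_comp (measurable_coord i) mf.
Qed.

Lemma measurable_rVB f g : measurable_fun [set: T] f -> measurable_fun [set: T] g ->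
  measurable_fun [set: T] (fun x => f x - g x).
Proof. by move=> mf mg; apply: measurable_rVD => //; exact: measurable_rVN. Qed.

Lemma measurable_dotprod f g : measurable_fun [set: T] f -> measurable_fun [set: T] g ->
  measurable_fun [set: T] (fun x => dotprod (f x) (g x)).
Proof.
move=> mf mg; apply: measurable_sum => i; apply: measurable_funM.
  exact: measurableT_comp (measurable_coord i) mf.
exact: measurableT_comp (measurable_coord i) mg.
Qed.

Lemma rV_norm_leP (x : 'rV[R]_n) (r : R) : 0 <= r ->
  (`|x| <= r) <-> (forall i, `|x 0 i| <= r).
Proof.
move=> r0; have -> : `|x| = mx_norm x by [].
rewrite mx_normE -[r]/((NngNum r0)%:num) num_le.
split => [/bigmax_leP[_ h] i|h]; first by have := h (0, i) isT; rewrite -num_le.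
by apply/bigmax_leP; split => [|[i j] _]; rewrite -num_le//= ord1.
Qed.

Lemma rV_norm_ltP (x : 'rV[R]_n) (r : R) : 0 < r ->
  (`|x| < r) <-> (forall i, `|x 0 i| < r).
Proof.
move=> r0; have -> : `|x| = mx_norm x by [].
rewrite mx_normE -[r]/((NngNum (ltW r0))%:num) num_lt.
split => [/bigmax_ltP[_ h] i|h]; first by have := h (0, i) isT; rewrite -num_lt.
by apply/bigmax_ltP; split => [|[i j] _]; rewrite -num_lt//= ord1.
Qed.

Lemma le_rV_norm (x : 'rV[R]_n) i : `|x 0 i| <= `|x|.
Proof. by move: i; apply/rV_norm_leP. Qed.

Lemma measurable_rV_norm f : measurable_fun [set: T] f ->
  measurable_fun [set: T] (fun x => `|f x|).
Proof.
move=> mf; rewrite (_ : (fun x => _) = (fun x => \big[Order.max/0]_(i < n) `|f x 0 i|)).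
  have : forall s : seq 'I_n, measurable_fun [set: T] (fun x => \big[Order.max/0]_(i <- s) `|f x 0 i|).
    elim => [|i s ih]; first by (under eq_fun do rewrite big_nil); exact: measurable_cst.
    under eq_fun do rewrite big_cons.
    apply: measurable_maxr => //; apply: measurableT_comp => //.
    exact: measurableT_comp (measurable_coord i) mf.
  exact.
apply/funext => x; apply/eqP; rewrite eq_le; apply/andP; split.
  apply/rV_norm_leP; first by elim/big_ind : _ => // a b a0 b0; rewrite le_max a0.
  by move=> i; exact: le_bigmax.
by apply/bigmax_leP; split => // i _; exact: le_rV_norm.
Qed.

End rV_measurability.

Section rV_integral.
Context {R : realType}.

Lemma ge0_integral_rV_cons n (F : 'rV[R]_n.+1 -> \bar R) :
  measurable_fun [set: 'rV[R]_n.+1] F -> (forall x, 0 <= F x)%E ->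
  (\int[lebesgue_rV R n.+1]_x F x =
   \int[lebesgue_measure]_a \int[lebesgue_rV R n]_x F (rV_cons (a, x)))%E.
Proof.
move=> mF F0.
rewrite -(fubini_tonelli1 (fun p => F (rV_cons p)))//; last first.
  by apply: measurableT_comp => //; exact: measurable_rV_cons.
rewrite -(preimage_setT (@rV_cons R n)) -ge0_integral_pushforward//; last exact: measurable_rV_cons.
Qed.

Lemma rV_cons_sub n a b (x y : 'rV[R]_n) :
  rV_cons (a, x) - rV_cons (b, y) = rV_cons (a - b, x - y).
Proof. by apply/rowP => i; rewrite !mxE; case: unlift => [j|]//=; rewrite !mxE. Qed.

Lemma rV_consP n (x : 'rV[R]_n.+1) : exists (a : R) y, x = rV_cons (a, y).
Proof.
exists (x 0 ord0), (\row_j x 0 (lift ord0 j)); apply/rowP => i; rewrite mxE.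
by case: unliftP => [j ->|->]/=; rewrite ?mxE.
Qed.

(** Induction on the dimension by Tonelli, with the one-dimensional flip in the first coordinate.
    Reflections are taken as primitive because convolutions involve [c - x] and two reflections
    compose to a translation. *)
Lemma ge0_integral_rV_flip n (c : 'rV[R]_n) (F : 'rV[R]_n -> \bar R) :
  measurable_fun [set: 'rV[R]_n] F -> (forall x, 0 <= F x)%E ->
  (\int[lebesgue_rV R n]_x F (c - x)%R = \int[lebesgue_rV R n]_x F x)%E.
Proof.
elim: n => [|n ih] in c F *; move=> mF F0.
  by apply: eq_integral => x _; congr F; apply/rowP => -[].
have mFc : measurable_fun [set: 'rV[R]_n.+1] (fun x => F (c - x)).
  by apply: measurableT_comp => //; exact: measurable_rVB.
rewrite (ge0_integral_rV_cons mF F0) (ge0_integral_rV_cons mFc) => [|x]; last exact: F0.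
have [a [y ->]] := rV_consP c.
transitivity (\int[lebesgue_measure]_(b in [set: R]) \int[lebesgue_rV R n]_x F (rV_cons (a - b : R, x)%R))%E.
  apply: eq_integral => b _; under eq_integral do rewrite rV_cons_sub.
  rewrite (ih y (fun x => F (rV_cons (a - b : R, x))))//.
  apply: measurableT_comp => //; apply: measurableT_comp; first exact: measurable_rV_cons.
  exact: pair1_measurable.
rewrite (ge0_integral_flip a (f := fun b : R => (\int[lebesgue_rV R n]_x F (rV_cons (b, x)))%E))//.
  apply: (measurable_fun_fubini_tonelli_F (fun p => F (rV_cons p))) => //.
  by apply: measurableT_comp => //; exact: measurable_rV_cons.
by move=> b; apply: integral_ge0.
Qed.

Lemma ge0_integral_rV_shift n (c : 'rV[R]_n) (F : 'rV[R]_n -> \bar R) :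
  measurable_fun [set: 'rV[R]_n] F -> (forall x, 0 <= F x)%E ->
  (\int[lebesgue_rV R n]_x F (x + c)%R = \int[lebesgue_rV R n]_x F x)%E.
Proof.
move=> mF F0; rewrite -(ge0_integral_rV_flip 0 (F := fun x => F (x + c)))//; last first.
  by apply: measurableT_comp => //; exact: measurable_rVD.
rewrite -(ge0_integral_rV_flip c mF F0); apply: eq_integral => x _; congr F.
by rewrite sub0r addrC.
Qed.

End rV_integral.

(** * Integrals of complex functions *)

Section complex_arith.
Context {R : realType}.
Implicit Types z w : R[i].

Lemma normc_sqrt z : normc z = Num.sqrt (complex.Re z ^+ 2 + complex.Im z ^+ 2).
Proof. by case: z. Qed.

Lemma normc_ge0 z : 0 <= normc z.
Proof. by rewrite normc_sqrt sqrtr_ge0. Qed.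

Lemma normr_Re_le z : `|complex.Re z| <= normc z.
Proof. by rewrite normc_sqrt -sqrtr_sqr ler_wsqrtr// lerDl sqr_ge0. Qed.

Lemma normr_Im_le z : `|complex.Im z| <= normc z.
Proof. by rewrite normc_sqrt -sqrtr_sqr ler_wsqrtr// lerDr sqr_ge0. Qed.

Lemma normc_le_ReIm z : normc z <= `|complex.Re z| + `|complex.Im z|.
Proof.
rewrite normc_sqrt -[leRHS]ger0_norm ?addr_ge0// -sqrtr_sqr ler_wsqrtr//.
rewrite sqrrD !real_normK ?num_real//.
by rewrite addrAC lerDl mulrn_wge0// mulr_ge0.
Qed.

Lemma normc_real (r : R) : normc r%:C = `|r|.
Proof. by rewrite normc_sqrt/= expr0n addr0 sqrtr_sqr. Qed.

Lemma normcD_le z w : normc (z + w) <= normc z + normc w.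
Proof. exact: le_normcD. Qed.

Lemma normcB_le z w : normc (z - w) <= normc z + normc w.
Proof. by rewrite -(normcN w) normcD_le. Qed.

Lemma Re_mul z w : complex.Re (z * w) = complex.Re z * complex.Re w - complex.Im z * complex.Im w.
Proof. by case: z; case: w. Qed.

Lemma Im_mul z w : complex.Im (z * w) = complex.Re z * complex.Im w + complex.Im z * complex.Re w.
Proof. by case: z => ? ?; case: w => ? ? /=; rewrite addrC. Qed.

Lemma Re_add z w : complex.Re (z + w) = complex.Re z + complex.Re w.
Proof. by case: z; case: w. Qed.

Lemma Im_add z w : complex.Im (z + w) = complex.Im z + complex.Im w.
Proof. by case: z; case: w. Qed.

Lemma Re_opp z : complex.Re (- z) = - complex.Re z.
Proof. by case: z. Qed.

Lemma Im_opp z : complex.Im (- z) = - complex.Im z.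
Proof. by case: z. Qed.

Lemma complex_eqP z w : complex.Re z = complex.Re w -> complex.Im z = complex.Im w -> z = w.
Proof. by case: z => a b; case: w => c d /= -> ->. Qed.

Lemma normc_cis (t : R) : normc (cis t) = 1.
Proof. by rewrite normc_sqrt/= cos2Dsin2 sqrtr1. Qed.

Lemma cisD (s t : R) : cis (s + t) = cis s * cis t.
Proof. by apply: complex_eqP; rewrite ?Re_mul ?Im_mul/= ?cosD ?sinD//; ring. Qed.

Lemma cis0 : cis (0 : R) = 1.
Proof. by rewrite /cis cos0 sin0. Qed.

End complex_arith.

Section cmeas.
Context {R : realType} {d} {T : measurableType d}.
Implicit Types f g : T -> R[i].

Definition cmeas f := measurable_fun [set: T] (fun x => complex.Re (f x)) /\
  measurable_fun [set: T] (fun x => complex.Im (f x)).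

Lemma cmeas_cst (c : R[i]) : cmeas (fun=> c).
Proof. by split; exact: measurable_cst. Qed.

Lemma cmeasD f g : cmeas f -> cmeas g -> cmeas (fun x => f x + g x).
Proof.
by move=> [f1 f2] [g1 g2]; split; under eq_fun do rewrite ?Re_add ?Im_add; exact: measurable_funD.
Qed.

Lemma cmeasN f : cmeas f -> cmeas (fun x => - f x).
Proof.
by move=> [f1 f2]; split; under eq_fun do rewrite ?Re_opp ?Im_opp; exact: measurable_funN.
Qed.

Lemma cmeasB f g : cmeas f -> cmeas g -> cmeas (fun x => f x - g x).
Proof. by move=> mf mg; apply: cmeasD => //; exact: cmeasN. Qed.

Lemma cmeasM f g : cmeas f -> cmeas g -> cmeas (fun x => f x * g x).
Proof.
move=> [f1 f2] [g1 g2]; split.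
  under eq_fun do rewrite Re_mul; apply: measurable_funB; exact: measurable_funM.
under eq_fun do rewrite Im_mul; apply: measurable_funD; exact: measurable_funM.
Qed.

Lemma cmeas_real (u : T -> R) : measurable_fun [set: T] u -> cmeas (fun x => (u x)%:C).
Proof. by move=> mu; split => //=; exact: measurable_cst. Qed.

Lemma cmeas_cis (u : T -> R) : measurable_fun [set: T] u -> cmeas (fun x => cis (u x)).
Proof.
move=> mu; split => /=; apply: measurableT_comp mu => //; apply: continuous_measurable_fun.
  exact: continuous_cos.
exact: continuous_sin.
Qed.

Lemma measurable_normc f : cmeas f -> measurable_fun [set: T] (fun x => normc (f x)).
Proof.
move=> [f1 f2]; under eq_fun do rewrite normc_sqrt.
apply: (measurableT_comp (f := @Num.sqrt R)).
  by apply: continuous_measurable_fun; exact: sqrt_continuous.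
by apply: measurable_funD; exact: measurable_funX.
Qed.

Lemma cmeas_comp d' (T' : measurableType d') f (h : T' -> T) : cmeas f ->
  measurable_fun [set: T'] h -> @measurable_fun _ _ T' R [set: T'] (fun x => complex.Re (f (h x))) /\
  @measurable_fun _ _ T' R [set: T'] (fun x => complex.Im (f (h x))).
Proof.
move=> [f1 f2] mh; split.
  exact: (measurableT_comp f1 mh).
exact: (measurableT_comp f2 mh).
Qed.

End cmeas.

Section cint.
Context {R : realType} {d} {T : measurableType d} (mu : {measure set T -> \bar R}).
Implicit Types f g : T -> R[i].

(** For Lebesgue measure this is convertible to [cintegral]; arbitrary measures are allowed because
    plane waves will be integrated over arbitrary parameter spaces. *)
Definition cint f : R[i] := (\int[mu]_x complex.Re (f x)) +i* (\int[mu]_x complex.Im (f x)).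

Definition cintegrable f := cmeas f /\ (\int[mu]_x (normc (f x))%:E < +oo)%E.

Lemma cintegrable_le f (u : T -> R) : cmeas f -> measurable_fun [set: T] u ->
  (forall x, normc (f x) <= u x) -> (\int[mu]_x (u x)%:E < +oo)%E -> cintegrable f.
Proof.
move=> mf mu' fu uoo; split=> //; apply: le_lt_trans uoo.
apply: ge0_le_integral => //.
- by move=> x _; rewrite lee_fin normc_ge0.
- by apply/measurable_EFinP; exact: measurable_normc.
- by apply/measurable_EFinP.
- by move=> x _; rewrite lee_fin.
Qed.

Lemma cintegrable_Re f : cintegrable f -> mu.-integrable [set: T] (EFin \o (fun x => complex.Re (f x))).
Proof.
move=> [mf foo]; apply/integrableP; split; first by apply/measurable_EFinP; exact: mf.1.
apply: le_lt_trans foo; apply: ge0_le_integral => //.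
- by apply/measurable_EFinP; apply: measurableT_comp => //; exact: mf.1.
- by apply/measurable_EFinP; exact: measurable_normc.
- by move=> x _; rewrite /= lee_fin normr_Re_le.
Qed.

Lemma cintegrable_Im f : cintegrable f -> mu.-integrable [set: T] (EFin \o (fun x => complex.Im (f x))).
Proof.
move=> [mf foo]; apply/integrableP; split; first by apply/measurable_EFinP; exact: mf.2.
apply: le_lt_trans foo; apply: ge0_le_integral => //.
- by apply/measurable_EFinP; apply: measurableT_comp => //; exact: mf.2.
- by apply/measurable_EFinP; exact: measurable_normc.
- by move=> x _; rewrite /= lee_fin normr_Im_le.
Qed.

Lemma eq_cint f g : f =1 g -> cint f = cint g.
Proof. by move=> fg; rewrite /cint; congr (_ +i* _); apply: eq_Rintegral => x _; rewrite fg. Qed.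

Lemma cintegrableZ (c : R[i]) f : cintegrable f -> cintegrable (fun x => c * f x).
Proof.
move=> [mf foo]; split; first by apply: cmeasM => //; exact: cmeas_cst.
under eq_integral do rewrite normcM EFinM.
rewrite ge0_integralZl//.
- by rewrite lte_mul_pinfty// ?lee_fin ?normc_ge0.
- by apply/measurable_EFinP; exact: measurable_normc.
- by move=> x _; rewrite lee_fin normc_ge0.
- by rewrite lee_fin normc_ge0.
Qed.

Lemma cintegrableD f g : cintegrable f -> cintegrable g -> cintegrable (fun x => f x + g x).
Proof.
move=> [mf foo] [mg goo].
have mnf := measurable_normc mf; have mng := measurable_normc mg.
apply: (@cintegrable_le _ (fun x => normc (f x) + normc (g x))).
- exact: cmeasD.
- exact: measurable_funD.
- by move=> x; exact: normcD_le.
- under eq_integral do rewrite EFinD.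
  rewrite ge0_integralD//; first exact: lte_add_pinfty.
  + by move=> x _; rewrite lee_fin normc_ge0.
  + exact/measurable_EFinP.
  + by move=> x _; rewrite lee_fin normc_ge0.
  + exact/measurable_EFinP.
Qed.

Lemma cintD f g : cintegrable f -> cintegrable g ->
  cint (fun x => f x + g x) = cint f + cint g.
Proof.
move=> fi gi; apply: complex_eqP; rewrite ?Re_add ?Im_add/=.
  rewrite -RintegralD//; [|exact: cintegrable_Re|exact: cintegrable_Re].
  by apply: eq_Rintegral => x _; rewrite Re_add.
rewrite -RintegralD//; [|exact: cintegrable_Im|exact: cintegrable_Im].
by apply: eq_Rintegral => x _; rewrite Im_add.
Qed.

Lemma cintZ (c : R[i]) f : cintegrable f -> cint (fun x => c * f x) = c * cint f.
Proof.
move=> fi; have fr := cintegrable_Re fi; have fm := cintegrable_Im fi.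
have zr (k : R) : mu.-integrable [set: T] (EFin \o (fun x => k * complex.Re (f x))).
  by rewrite (_ : _ \o _ = fun x => (k%:E * (complex.Re (f x))%:E)%E)//; exact: integrableZl.
have zi (k : R) : mu.-integrable [set: T] (EFin \o (fun x => k * complex.Im (f x))).
  by rewrite (_ : _ \o _ = fun x => (k%:E * (complex.Im (f x))%:E)%E)//; exact: integrableZl.
apply: complex_eqP; rewrite ?Re_mul ?Im_mul/= -!RintegralZl// -?RintegralB// -?RintegralD//.
  by apply: eq_Rintegral => x _; rewrite Re_mul.
by apply: eq_Rintegral => x _; rewrite Im_mul.
Qed.

Lemma cintegrableN f : cintegrable f -> cintegrable (fun x => - f x).
Proof. by move=> fi; under eq_fun do rewrite -mulN1r; exact: cintegrableZ. Qed.

Lemma cintegrableB f g : cintegrable f -> cintegrable g -> cintegrable (fun x => f x - g x).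
Proof. by move=> fi gi; apply: cintegrableD => //; exact: cintegrableN. Qed.

Lemma cintB f g : cintegrable f -> cintegrable g ->
  cint (fun x => f x - g x) = cint f - cint g.
Proof.
move=> fi gi; rewrite cintD//; last exact: cintegrableN.
by congr (_ + _); rewrite -mulN1r -cintZ//; apply: eq_cint => x; rewrite mulN1r.
Qed.

(** A unimodular constant [c] rotates the integral onto the positive real axis, which reduces the
    claim to [|Re w| <= |w|] under the integral. *)
Lemma normc_cint f : cintegrable f ->
  ((normc (cint f))%:E <= \int[mu]_x (normc (f x))%:E)%E.
Proof.
move=> fi; set z := cint f; have [z0|z0] := eqVneq (normc z) 0.
  by rewrite z0; apply: integral_ge0 => x _; rewrite lee_fin normc_ge0.
have nz0 : 0 < normc z by rewrite lt_neqAle eq_sym z0 normc_ge0.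
pose c := ((complex.Re z) +i* (- complex.Im z)) / (normc z)%:C.
have nc : normc c = 1.
  rewrite normcM normcV normc_real ger0_norm ?normc_ge0//.
  have -> : normc (complex.Re z +i* - complex.Im z) = normc z by rewrite !normc_sqrt/= sqrrN.
  by rewrite divff.
have cz : complex.Re (c * z) = normc z.
  rewrite /c mulrAC -fmorphV Re_mul/= mulr0 subr0.
  apply: (mulIf z0); rewrite mulfVK// mulNr opprK.
  have zz : normc z * normc z = complex.Re z * complex.Re z + complex.Im z * complex.Im z.
    by rewrite normc_sqrt -expr2 sqr_sqrtr ?addr_ge0 ?sqr_ge0// !expr2.
  exact/esym/zz.
have ci := cintegrableZ c fi.
rewrite -cz -cintZ//=.
apply: (@le_trans _ _ (\int[mu]_x `|complex.Re (c * f x)|%:E)%E).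
  rewrite -[leLHS]/((\int[mu]_x (complex.Re (c * f x)))%:E).
  apply: le_trans (le_abse_integral mu measurableT (measurable_int _ (cintegrable_Re ci))).
  rewrite -EFin_normr_Rintegral//; last exact: cintegrable_Re.
  by rewrite lee_fin ler_norm.
apply: ge0_le_integral => //.
- by apply/measurable_EFinP; apply: measurableT_comp => //; exact: ci.1.1.
- by apply/measurable_EFinP; exact: measurable_normc fi.1.
- by move=> x _; rewrite lee_fin (le_trans (normr_Re_le _))// normcM nc mul1r.
Qed.

End cint.

(** * Fubini's theorem and tensor products of complex integrands *)

Section cint_product.
Context {R : realType} {d1 d2} {T1 : measurableType d1} {T2 : measurableType d2}.
Context (m1 : {sigma_finite_measure set T1 -> \bar R}).
Context (m2 : {sigma_finite_measure set T2 -> \bar R}).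
Local Notation m12 := (m1 \x m2)%E.

(** The inner integrals are finite only almost everywhere, so real-valued and extended-real-valued
    inner integrals agree only almost everywhere, which the outer integral does not see. *)
Lemma Rintegral_fubini1 (f : T1 * T2 -> R) : m12.-integrable [set: T1 * T2] (EFin \o f) ->
  \int[m12]_z f z = \int[m1]_x \int[m2]_y f (x, y).
Proof.
move=> fi; rewrite /Rintegral -(fubini1 fi); congr fine.
have mF := measurable_fubini_F fi.
apply: ae_eq_integral => //.
  by apply/measurable_EFinP; apply: measurableT_comp mF => //; exact: measurable_fine.
apply: filterS (ae_integrable1 fi) => x fxi _ /=; rewrite /fubini_F fineK//.
exact: (integrable_fin_num measurableT fxi).
Qed.

Lemma Rintegral_fubini2 (f : T1 * T2 -> R) : m12.-integrable [set: T1 * T2] (EFin \o f) ->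
  \int[m12]_z f z = \int[m2]_y \int[m1]_x f (x, y).
Proof.
move=> fi; rewrite /Rintegral -(fubini2 fi); congr fine.
have mF := measurable_fubini_G fi.
apply: ae_eq_integral => //.
  by apply/measurable_EFinP; apply: measurableT_comp mF => //; exact: measurable_fine.
apply: filterS (ae_integrable2 fi) => x fxi _ /=; rewrite /fubini_G fineK//.
exact: (integrable_fin_num measurableT fxi).
Qed.

Lemma cint_fubini1 (f : T1 * T2 -> R[i]) : cintegrable m12 f ->
  cint m12 f = cint m1 (fun x => cint m2 (fun y => f (x, y))).
Proof.
move=> fi; rewrite /cint; congr (_ +i* _) => /=; rewrite Rintegral_fubini1//.
  exact: cintegrable_Re.
exact: cintegrable_Im.
Qed.

Lemma cint_fubini2 (f : T1 * T2 -> R[i]) : cintegrable m12 f ->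
  cint m12 f = cint m2 (fun y => cint m1 (fun x => f (x, y))).
Proof.
move=> fi; rewrite /cint; congr (_ +i* _) => /=; rewrite Rintegral_fubini2//.
  exact: cintegrable_Re.
exact: cintegrable_Im.
Qed.

Lemma cint_fubini (f : T1 * T2 -> R[i]) : cintegrable m12 f ->
  cint m1 (fun x => cint m2 (fun y => f (x, y))) = cint m2 (fun y => cint m1 (fun x => f (x, y))).
Proof. by move=> fi; rewrite -cint_fubini1// cint_fubini2. Qed.

Lemma cintegrable_tensor (f : T1 -> R[i]) (g : T2 -> R[i]) (h : T1 * T2 -> R[i]) :
  cintegrable m1 f -> cintegrable m2 g -> cmeas h ->
  (forall z, normc (h z) <= normc (f z.1) * normc (g z.2)) -> cintegrable m12 h.
Proof.
move=> [mf foo] [mg goo] mh hfg.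
have mnf := measurable_normc mf; have mng := measurable_normc mg.
have n0 (u : T2 -> R[i]) y : (0 <= (normc (u y))%:E)%E by rewrite lee_fin normc_ge0.
have n0' (u : T1 -> R[i]) y : (0 <= (normc (u y))%:E)%E by rewrite lee_fin normc_ge0.
apply: (cintegrable_le mh (u := fun z => normc (f z.1) * normc (g z.2))) => //.
  apply: measurable_funM.
    exact: measurableT_comp mnf measurable_fst.
  exact: measurableT_comp mng measurable_snd.
rewrite fubini_tonelli1//; last 2 first.
- apply/measurable_EFinP; apply: measurable_funM.
    exact: measurableT_comp mnf measurable_fst.
  exact: measurableT_comp mng measurable_snd.
- by move=> x; rewrite lee_fin mulr_ge0 ?normc_ge0.
rewrite /fubini_F/=; under eq_integral => x _.
  under eq_integral do rewrite EFinM.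
  rewrite ge0_integralZl//; last exact/measurable_EFinP.
  over.
rewrite ge0_integralZr//; [|exact/measurable_EFinP|exact: integral_ge0].
rewrite lte_mul_pinfty//; first exact: integral_ge0.
by rewrite ge0_fin_numE//; exact: integral_ge0.
Qed.

Lemma cint_tensor (f : T1 -> R[i]) (g : T2 -> R[i]) : cintegrable m1 f -> cintegrable m2 g ->
  cint m12 (fun z => f z.1 * g z.2) = cint m1 f * cint m2 g.
Proof.
move=> fi gi; have fgi : cintegrable m12 (fun z => f z.1 * g z.2).
  apply: (cintegrable_tensor fi gi) => [|z]; last by rewrite normcM.
  apply: cmeasM; first exact: cmeas_comp fi.1 measurable_fst.
  exact: cmeas_comp gi.1 measurable_snd.
rewrite cint_fubini1//=; transitivity (cint m1 (fun x => cint m2 g * f x)).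
  by apply: eq_cint => x; rewrite cintZ// mulrC.
by rewrite cintZ// mulrC.
Qed.

End cint_product.

(** * Dominated convergence *)

Section cint_limit.
Context {R : realType} {d} {T : measurableType d} (mu : {measure set T -> \bar R}).

Lemma cint_dominated (f_ : (T -> R[i])^nat) (f : T -> R[i]) (u : T -> R) :
  (forall k, cmeas (f_ k)) -> cmeas f ->
  (forall x, complex.Re (f_ k x) @[k --> \oo] --> complex.Re (f x)) ->
  (forall x, complex.Im (f_ k x) @[k --> \oo] --> complex.Im (f x)) ->
  measurable_fun [set: T] u -> (\int[mu]_x (u x)%:E < +oo)%E ->
  (forall k x, normc (f_ k x) <= u x) ->
  complex.Re (cint mu (f_ k)) @[k --> \oo] --> complex.Re (cint mu f) /\
  complex.Im (cint mu (f_ k)) @[k --> \oo] --> complex.Im (cint mu f).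
Proof.
move=> mf_ mf cRe cIm mu' uoo fu.
have u0 x : 0 <= u x by apply: le_trans (fu 0%N x); exact: normc_ge0.
have ui : mu.-integrable [set: T] (EFin \o u).
  apply/integrableP; split; first exact/measurable_EFinP.
  by under eq_integral do rewrite /= ger0_norm//.
have H (v_ : (T -> R)^nat) (v : T -> R) : (forall k, measurable_fun [set: T] (v_ k)) ->
    measurable_fun [set: T] v -> (forall x, v_ k x @[k --> \oo] --> v x) ->
    (forall k x, `|v_ k x| <= u x) ->
    (\int[mu]_x v_ k x) @[k --> \oo] --> \int[mu]_x v x.
  move=> mv_ mv cv vu.
  have [|||||vi _ vc] := @dominated_convergence _ _ _ mu _ measurableT
    (fun k => EFin \o v_ k) (EFin \o v) (EFin \o u).
  - by move=> k; exact/measurable_EFinP.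
  - exact/measurable_EFinP.
  - apply: aeW => x _; apply: cvg_EFin; first exact: nearW.
    exact: cv.
  - exact: ui.
  - by apply: aeW => x k _; rewrite /= lee_fin.
  apply: fine_cvg; rewrite fineK; last exact: integrable_fin_num.
  exact: vc.
split; apply: H => //.
- by move=> k; exact: (mf_ k).1.
- exact: mf.1.
- by move=> k x; exact: le_trans (normr_Re_le _) _.
- by move=> k; exact: (mf_ k).2.
- exact: mf.2.
- by move=> k x; exact: le_trans (normr_Im_le _) _.
Qed.

Lemma normc_cvg (z_ : R[i]^nat) (z : R[i]) :
  complex.Re (z_ k) @[k --> \oo] --> complex.Re z ->
  complex.Im (z_ k) @[k --> \oo] --> complex.Im z ->
  normc (z_ k) @[k --> \oo] --> normc z.
Proof.
move=> cRe cIm; under eq_fun do rewrite normc_sqrt; rewrite normc_sqrt.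
apply: (cvg_comp _ Num.sqrt); last exact: sqrt_continuous.
by apply: cvgD; rewrite !expr2; under eq_fun do rewrite expr2; exact: cvgM.
Qed.

End cint_limit.

(** * The Hardy-Littlewood maximal function *)

Section weights.
Context {R : realType} {n : nat}.
Local Notation X := 'rV[R]_n.
Local Notation mu := (lebesgue_rV R n).
Implicit Types (x y z : X) (r s N : R).

(* L^1-normalised bump at spatial scale [r] decaying like [|x|^-N] *)
Definition wgt r N x : R := r^-1 ^+ n * (1 + `|x| / r) `^ (- N).

Lemma one_plus_ge1 r x : 0 < r -> 1 <= 1 + `|x| / r.
Proof. by move=> r0; rewrite lerDl divr_ge0// ltW. Qed.

Lemma one_plus_gt0 r x : 0 < r -> 0 < 1 + `|x| / r.
Proof. by move=> r0; rewrite (lt_le_trans ltr01)// one_plus_ge1. Qed.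

Lemma one_plus_submul r x y : 0 < r ->
  1 + `|x + y| / r <= (1 + `|x| / r) * (1 + `|y| / r).
Proof.
move=> r0; apply: (@le_trans _ _ (1 + (`|x| / r + `|y| / r))).
  by rewrite lerD2l -mulrDl ler_pM2r ?invr_gt0// ler_normD.
have := divr_ge0 (normr_ge0 x) (ltW r0); have := divr_ge0 (normr_ge0 y) (ltW r0).
by move=> a b; have := mulr_ge0 a b; lra.
Qed.

Lemma le_powRN (N a b : R) : 0 <= N -> 0 < a -> a <= b -> b `^ (- N) <= a `^ (- N).
Proof.
move=> N0 a0 ab; have b0 := lt_le_trans a0 ab.
by rewrite !powRN lef_pV2 ?posrE ?powR_gt0// ge0_ler_powR ?nnegrE ?(ltW a0) ?(ltW b0).
Qed.

Lemma wgt_gt0 r N x : 0 < r -> 0 < wgt r N x.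
Proof. by move=> r0; rewrite mulr_gt0 ?exprn_gt0 ?invr_gt0 ?powR_gt0 ?one_plus_gt0. Qed.

Lemma wgt_ge0 r N x : 0 < r -> 0 <= wgt r N x.
Proof. by move=> r0; rewrite ltW// wgt_gt0. Qed.

Lemma wgtN r N x : wgt r N (- x) = wgt r N x.
Proof. by rewrite /wgt normrN. Qed.

Lemma measurable_wgt d (T : measurableType d) (f : T -> X) r N :
  measurable_fun [set: T] f -> measurable_fun [set: T] (fun t => wgt r N (f t)).
Proof.
move=> mf; apply: measurable_funM => //.
apply: (measurableT_comp (f := @powR R ^~ (- N))); first exact: measurable_powR.
by apply: measurable_funD => //; apply: measurable_funM => //; exact: measurable_rV_norm.
Qed.

Lemma wgt_mono r N N' x : 0 < r -> N <= N' -> wgt r N' x <= wgt r N x.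
Proof.
move=> r0 NN; rewrite ler_wpM2l ?exprn_ge0 ?invr_ge0 ?(ltW r0)//.
by rewrite ler_powR ?one_plus_ge1// lerN2.
Qed.

(** Peetre's inequality, from the submultiplicativity of [1 + |x| / r]. *)
Lemma wgt_peetre r N x y : 0 < r -> 0 <= N ->
  wgt r N (x - y) <= wgt r N x * (1 + `|y| / r) `^ N.
Proof.
move=> r0 N0; rewrite /wgt -mulrA ler_wpM2l ?exprn_ge0 ?invr_ge0 ?(ltW r0)//.
have pxy := powR_gt0 N (one_plus_gt0 (x - y) r0).
have px := powR_gt0 N (one_plus_gt0 x r0).
have a0 := ltW (one_plus_gt0 (x - y) r0); have b0 := ltW (one_plus_gt0 y r0).
have c0 := ltW (one_plus_gt0 x r0).
have h := one_plus_submul (x - y) y r0; rewrite subrK in h.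
rewrite !powRN [leRHS]mulrC ler_pdivlMr// mulrC ler_pdivrMr//.
by rewrite [leRHS]mulrC -powRM// ge0_ler_powR ?nnegrE ?mulr_ge0.
Qed.

(** At infinity the two weights behave like [s^(N-n) |x|^(-N)] and [r^(N-n) |x|^(-N)], which is
    where the factor comes from. *)
Lemma wgt_scale r s N x : 0 < r -> r <= s -> n%:R <= N ->
  wgt s N x <= (s / r) `^ (N - n%:R) * wgt r N x.
Proof.
move=> r0 rs nN; have s0 := lt_le_trans r0 rs; have N0 : 0 <= N by rewrite (le_trans _ nN).
have q0 : 0 < s / r by rewrite divr_gt0.
rewrite /wgt powRB ?(gt_eqF q0) ?implybT// powR_mulrn ?(ltW q0)//.
have -> : (s / r) `^ N / (s / r) ^+ n * (r^-1 ^+ n * (1 + `|x| / r) `^ (- N)) =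
  s^-1 ^+ n * ((s / r) `^ N * (1 + `|x| / r) `^ (- N)).
  by rewrite !exprMn !exprVn; field; rewrite !expf_neq0// gt_eqF.
rewrite ler_wpM2l ?exprn_ge0 ?invr_ge0 ?(ltW s0)//.
have a0 := one_plus_gt0 x r0; have b0 := one_plus_gt0 x s0.
rewrite !powRN ler_pdivlMr ?powR_gt0// mulrC ler_pdivrMr ?powR_gt0//.
rewrite -powRM ?(ltW q0) ?(ltW b0)// ge0_ler_powR ?nnegrE ?(ltW a0) ?mulr_ge0 ?(ltW q0) ?(ltW b0) ?(ltW s0) ?invr_ge0 ?(ltW r0)//.
rewrite mulrDr mulr1 (_ : s / r * (`|x| / s) = `|x| / r); last by field; rewrite !gt_eqF.
by rewrite lerD2r ler_pdivlMr// mul1r.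
Qed.

(** If [z] carries at least half of [|x|], or if [|x| <= s], then [wgt s N z] is at most a constant
    times [wgt s N x]. Otherwise [y] carries half of [|x| > s] and, as [N >= n], the finer weight at
    [y] is small enough. The weight that is not estimated stays on the right, ready to be
    integrated. *)
Lemma wgt_conv_pt r s N x y z : 0 < r -> r <= s -> n%:R <= N -> `|x| <= `|y| + `|z| ->
  wgt r N y * wgt s N z <= 4 `^ N * wgt s N x * (wgt r N y + wgt s N z).
Proof.
move=> r0 rs nN xyz; have s0 := lt_le_trans r0 rs; have N0 : 0 <= N by rewrite (le_trans _ nN).
have wr := wgt_gt0 N y r0; have ws := wgt_gt0 N z s0; have wx := wgt_gt0 N x s0.
have p4 : 0 < 4 `^ N :> R by rewrite powR_gt0.
have comp (k A B : R) : 0 < k -> k <= 4 -> 0 < A -> A <= k * B -> B `^ (- N) <= 4 `^ N * A `^ (- N).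
  move=> k0 k4 A0 AB; have B0 : 0 < B by rewrite -(pmulr_rgt0 _ k0) (lt_le_trans A0).
  rewrite !powRN ler_pdivlMr ?powR_gt0// mulrC ler_pdivrMr ?powR_gt0// -powRM ?(ltW B0)//.
  by rewrite ge0_ler_powR ?nnegrE ?mulr_ge0 ?(ltW A0) ?(ltW B0)// (le_trans AB)// ler_pM2r.
have ax := one_plus_gt0 x s0.
have nx := normr_ge0 x; have ny := normr_ge0 y; have nz := normr_ge0 z.
have easy : wgt s N z <= 4 `^ N * wgt s N x ->
    wgt r N y * wgt s N z <= 4 `^ N * wgt s N x * (wgt r N y + wgt s N z).
  move=> h; rewrite mulrDr (le_trans (y := wgt r N y * (4 `^ N * wgt s N x)))//.
    by rewrite ler_pM2l.
  by rewrite [leLHS]mulrC lerDl mulr_ge0// ?(ltW ws)// mulr_ge0// ltW.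
have pull (u : X) : (1 + `|u| / s) `^ (- N) <= 4 `^ N * (1 + `|x| / s) `^ (- N) ->
    wgt s N u <= 4 `^ N * wgt s N x.
  by move=> h; rewrite /wgt mulrCA ler_wpM2l ?exprn_ge0 ?invr_ge0 ?(ltW s0).
have [xz|zx] := lerP `|x| (2 * `|z|).
  apply: easy; apply: pull; apply: (comp 2); [by []|lra|by []|].
  rewrite mulrDr mulrA mulr1; apply: lerD; first lra.
  by rewrite ler_pM2r ?invr_gt0.
have [xs|sx] := lerP `|x| s.
  apply: easy; apply: pull; apply: (comp 2); [by []|lra|by []|].
  rewrite (_ : 2 * _ = 1 + (1 + 2 * (`|z| / s))); last by ring.
  rewrite lerD2l (le_trans (y := 1))//; first by rewrite ler_pdivrMr// mul1r.
  by rewrite lerDl mulr_ge0// divr_ge0// ltW.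
suff h : wgt r N y <= 4 `^ N * wgt s N x.
  rewrite mulrDr (le_trans (y := 4 `^ N * wgt s N x * wgt s N z))//.
    by rewrite ler_pM2r.
  by rewrite lerDr mulr_ge0// ?(ltW wr)// mulr_ge0// ltW.
have yx : `|x| <= 2 * `|y| by lra.
have q1 : 1 <= s / r by rewrite ler_pdivlMr// mul1r.
(* The constant 4 is used up here: [s < |x| <= 2|y|] gives [s + |x| <= 4|y|]. *)
have h1 : (1 + `|y| / r) `^ (- N) <= 4 `^ N * ((s / r) * (1 + `|x| / s)) `^ (- N).
  apply: (comp 4); [by []|by []|by rewrite mulr_gt0// (lt_le_trans ltr01)|].
  rewrite mulrDr mulr1 (_ : s / r * (`|x| / s) = `|x| / r); last by field; rewrite !gt_eqF.
  have -> : s / r + `|x| / r = (s + `|x|) / r by rewrite mulrDl.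
  have -> : 4 * (1 + `|y| / r) = (4 * r + 4 * `|y|) / r by field; rewrite gt_eqF.
  by rewrite ler_pM2r ?invr_gt0//; lra.
rewrite /wgt (le_trans (y := r^-1 ^+ n * (4 `^ N * (s / r * (1 + `|x| / s)) `^ (- N))))//.
  by rewrite ler_wpM2l ?exprn_ge0 ?invr_ge0 ?(ltW r0).
rewrite powRM ?(le_trans ler01 q1) ?(ltW ax)// mulrCA ler_pM2l// mulrA ler_pM2r ?powR_gt0//.
have h2 : (s / r) `^ (- N) <= (s / r) ^- n.
  by rewrite -powR_mulrn ?(le_trans ler01 q1)// -powRN ler_powR// lerN2.
rewrite (le_trans (y := r^-1 ^+ n * (s / r) ^- n))//.
  by rewrite ler_wpM2l ?exprn_ge0 ?invr_ge0 ?(ltW r0).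
rewrite le_eqVlt; apply/orP; left; apply/eqP; rewrite !exprMn !exprVn.
by field; rewrite !expf_neq0// gt_eqF.
Qed.

End weights.

(** * Cubes, a finite Vitali covering argument and the weak type (1,1) bound *)

Section maximal.
Context {R : realType} {n : nat}.
Local Notation X := 'rV[R]_n.
Local Notation mu := (lebesgue_rV R n).
Implicit Types (psi : X -> R) (x y c : X) (r : R).

Definition cube c r : set X := [set x | `|x - c| < r].

Lemma measurable_cube c r : measurable (cube c r).
Proof.
have mf : measurable_fun [set: X] (fun x : X => `|x - c|).
  by apply: measurable_rV_norm; exact: measurable_rVB.
by rewrite -[X in measurable X]setTI; exact: (measurable_fun_ltr mf (measurable_cst r)).
Qed.
Hint Resolve measurable_cube : core.

Lemma lebesgue_cube c r : 0 < r -> mu (cube c r) = ((2 * r) ^+ n)%:E.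
Proof.
move=> r0; pose A (i : 'I_n) : set (measurableTypeR R) := `]c 0 i - r, c 0 i + r[%classic.
have -> : cube c r = [set x | forall i, A i (x 0 i)].
  apply/seteqP; split => x.
    move=> /(rV_norm_ltP _ r0) h i; have := h i; rewrite !mxE ltr_norml /A/= in_itv/=; lra.
  move=> h; apply/(rV_norm_ltP _ r0) => i; have := h i; rewrite !mxE ltr_norml /A/= in_itv/=; lra.
rewrite lebesgue_rV_box => [|i]; last exact: measurable_itv.
rewrite (eq_bigr (fun=> (2 * r)%:E)) => [|i _].
  rewrite -(big_morph EFin EFinM (erefl _)) prodr_const card_ord//.
rewrite lebesgue_measure_itv/= lte_fin ifT; last lra.
by rewrite -EFinB; congr EFin; ring.
Qed.

Lemma cube_self c r : 0 < r -> cube c r c.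
Proof. by move=> r0; rewrite /cube/= subrr normr0. Qed.

Lemma cube_dilate c d r s : 0 < r -> s <= r -> cube d s `&` cube c r !=set0 ->
  cube d s `<=` cube c (3 * r).
Proof.
move=> r0 sr [z [zd zc]] x xd; rewrite /cube/=.
rewrite (_ : x - c = (x - d) - (z - d) + (z - c)); last first.
  by apply/rowP => i; rewrite !mxE; ring.
have := ler_normD (x - d - (z - d)) (z - c); have := ler_normB (x - d) (z - d).
by move: xd zd zc; rewrite /cube/=; lra.
Qed.

Definition cubes (s : seq (X * R)) : set X := [set x | exists2 p, p \in s & cube p.1 p.2 x].

Lemma cubes_cons p s : cubes (p :: s) = cube p.1 p.2 `|` cubes s.
Proof.
apply/seteqP; split => x.
  by move=> [q]; rewrite in_cons => /orP[/eqP->|qs] qx; [left|right; exists q].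
move=> [px|[q qs qx]]; first by exists p => //; rewrite mem_head.
by exists q => //; rewrite in_cons qs orbT.
Qed.

Lemma measurable_cubes s : measurable (cubes s).
Proof.
elim: s => [|p s ih]; last by rewrite cubes_cons; exact: measurableU.
by rewrite (_ : cubes [::] = set0)//; apply/seteqP; split => x // [].
Qed.
Hint Resolve measurable_cubes : core.

Lemma ge0_le_integral_cubes psi (A B : set X) : measurable A -> measurable B ->
  measurable_fun [set: X] psi -> (forall x, 0 <= psi x) -> A `<=` B ->
  (\int[mu]_(x in A) (psi x)%:E <= \int[mu]_(x in B) (psi x)%:E)%E.
Proof.
move=> mA mB mpsi p0 AB; apply: ge0_subset_integral => //.
- by apply/measurable_EFinP; exact: measurable_funS mpsi.
- by move=> x _; rewrite lee_fin.
Qed.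

(** Vitali's selection as an induction on the number of cubes: a largest cube [p] is kept, every
    cube meeting it lies in its triple, and the induction applies to the remaining ones. These are
    disjoint from [p], so the integrals over [p] and over their union add up. *)
Lemma vitali_cubes psi (lam : R) (s : seq (X * R)) :
  measurable_fun [set: X] psi -> (forall x, 0 <= psi x) -> 0 <= lam ->
  (forall p, p \in s -> 0 < p.2) ->
  (forall p, p \in s -> lam%:E * mu (cube p.1 p.2) <= \int[mu]_(x in cube p.1 p.2) (psi x)%:E)%E ->
  (lam%:E * mu (cubes s) <= (3 ^+ n)%:E * \int[mu]_(x in cubes s) (psi x)%:E)%E.
Proof.
move=> mpsi p0 lam0.
have [k] := ubnP (size s); elim: k => // k IH in s *.
move=> sk s0 sl; case: s sk s0 sl => [_ _ _|p0' s0'].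
  rewrite (_ : cubes [::] = set0); last by apply/seteqP; split => x // [].
  by rewrite measure0 mule0 integral_set0 mule0.
set s := p0' :: s0' => sk s0 sl.
have [p ps pmax] : exists2 p, p \in s & forall q, q \in s -> q.2 <= p.2.
  rewrite /s; elim: s0' p0' {s sk s0 sl} => [|q t ih] p.
    by exists p; [rewrite mem_head|move=> q; rewrite inE => /eqP ->].
  have [m mt mm] := ih q; have [pm|mp] := lerP p.2 m.2.
    by exists m; [rewrite in_cons mt orbT|move=> z; rewrite in_cons => /orP[/eqP->//|/mm]].
  exists p; first by rewrite mem_head.
  by move=> z; rewrite in_cons => /orP[/eqP->//|/mm/le_trans]; apply; exact: ltW.
pose far (q : X * R) := `[< cube q.1 q.2 `&` cube p.1 p.2 = set0 >].
pose t := [seq q <- s | far q].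
have pr0 := s0 _ ps.
have ts q : q \in t -> q \in s by rewrite mem_filter => /andP[].
have tk : (size t < k)%N.
  apply: (@leq_trans (size s)) => //; rewrite size_filter -(count_predC far s) -[ltnLHS]addn0 ltn_add2l.
  rewrite -has_count; apply/hasP; exists p => //=; apply/negP => /asboolP.
  by move/seteqP => -[/(_ p.1) h _]; apply: h; split; exact: cube_self.
have disj : [disjoint cube p.1 p.2 & cubes t].
  apply/disj_setPS => x [px [q qt qx]]; move: qt; rewrite mem_filter => /andP[/asboolP f _].
  by move/seteqP : f => -[/(_ x) h _]; apply: h.
have cov : cubes s `<=` cube p.1 (3 * p.2) `|` cubes t.
  move=> x [q qs qx]; have [f|/asboolPn nf] := boolP (far q).
    by right; exists q => //; rewrite mem_filter f.
  left; apply: (cube_dilate pr0 (pmax _ qs)) qx; apply/set0P; apply/eqP; exact: nf.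
have sub : cube p.1 p.2 `|` cubes t `<=` cubes s.
  by move=> x [px|[q /ts qs qx]]; [exists p|exists q].
apply: (@le_trans _ _ (lam%:E * (mu (cube p.1 (3 * p.2)) + mu (cubes t)))%E).
  rewrite lee_wpmul2l// ?lee_fin//.
  apply: (le_trans (le_measure _ _ _ cov)); rewrite ?inE//; first exact: measurableU.
  exact: measureU2.
apply: (@le_trans _ _ ((3 ^+ n)%:E * \int[mu]_(x in cube p.1 p.2 `|` cubes t) (psi x)%:E)%E); last first.
  rewrite lee_wpmul2l ?lee_fin ?exprn_ge0//.
  by apply: ge0_le_integral_cubes => //; exact: measurableU.
rewrite ge0_integral_setU//; last 2 first.
- by apply/measurable_EFinP; exact: measurable_funS mpsi.
- by move=> x _; rewrite lee_fin.
have IHt : (lam%:E * mu (cubes t) <= (3 ^+ n)%:E * \int[mu]_(x in cubes t) (psi x)%:E)%E.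
  by apply: (IH t tk) => q /ts; [exact: s0|exact: sl].
have i0 A : (0 <= \int[mu]_(x in A) (psi x)%:E)%E by apply: integral_ge0 => x _; rewrite lee_fin.
rewrite ge0_muleDr ?measure_ge0// [leRHS]ge0_muleDr//.
apply: leeD => //.
rewrite lebesgue_cube ?mulr_gt0//.
rewrite (_ : (2 * (3 * p.2)) ^+ n = 3 ^+ n * (2 * p.2) ^+ n); last by rewrite -exprMn; congr (_ ^+ _); ring.
rewrite EFinM muleCA lee_wpmul2l ?lee_fin ?exprn_ge0//.
by rewrite -(lebesgue_cube p.1)//; exact: sl.
Qed.

(* Rational cubes suffice for the uncentred maximal function, which makes it a
   countable supremum. *)
Definition hlp (k : nat) : X * R :=
  if (unpickle k : option ('rV[rat]_n * rat)) is Some p then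
    if 0 < p.2 then (map_mx ratr p.1, ratr p.2) else (0, 1)
  else (0, 1).

Lemma hlp_gt0 k : 0 < (hlp k).2.
Proof. by rewrite /hlp; case: unpickle => [p|]//; case: ifP => //= p0; rewrite ltr0q. Qed.

Definition hlcube k := cube (hlp k).1 (hlp k).2.

Definition hlavg psi k : \bar R :=
  (((2 * (hlp k).2) ^+ n)^-1%:E * \int[mu]_(x in hlcube k) (psi x)%:E)%E.

Definition HL psi x : \bar R := ereal_sup (range (fun k => hlavg psi k * (\1_(hlcube k) x)%:E)%E).

Lemma hlavg_ge0 psi k : (forall x, 0 <= psi x) -> (0 <= hlavg psi k)%E.
Proof.
move=> p0; apply: mule_ge0; last by apply: integral_ge0 => x _; rewrite lee_fin.
by rewrite lee_fin invr_ge0 exprn_ge0// mulr_ge0// ltW// hlp_gt0.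
Qed.

Lemma HL_ge0 psi x : (forall x, 0 <= psi x) -> (0 <= HL psi x)%E.
Proof.
move=> p0; apply: (@le_trans _ _ (hlavg psi 0 * (\1_(hlcube 0) x)%:E)%E).
  by apply: mule_ge0; [exact: hlavg_ge0|rewrite lee_fin].
by apply: ereal_sup_ubound; exists 0%N.
Qed.

Lemma measurable_HL psi : (forall x, 0 <= psi x) -> measurable_fun [set: X] (HL psi).
Proof.
move=> p0; pose f k x := (hlavg psi k * (\1_(hlcube k) x)%:E)%E.
rewrite (_ : HL psi = fun x => esups (f ^~ x) 0%N); last first.
  apply/funext => x; rewrite /HL /esups /=; congr ereal_sup.
  by apply/seteqP; split => [y [k _ <-]|y [k _ <-]]; exists k.
apply: measurable_fun_esups => k; apply: emeasurable_funM => //.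
by apply/measurable_EFinP; apply: measurable_indic; exact: measurable_cube.
Qed.

(** The superlevel set is the increasing union of finite unions of rational cubes with large
    average, and [vitali_cubes] bounds their measures uniformly. *)
Lemma HL_weak11 psi (lam : R) : measurable_fun [set: X] psi -> (forall x, 0 <= psi x) ->
  0 < lam ->
  (lam%:E * mu [set x | lam%:E < HL psi x] <= (3 ^+ n)%:E * \int[mu]_x (psi x)%:E)%E.
Proof.
move=> mpsi p0 lam0.
pose good k := (lam%:E < hlavg psi k)%E.
pose s k := [seq hlp i | i <- iota 0 k & good i].
pose F k := cubes (s k).
have i0 : (0 <= \int[mu]_x (psi x)%:E)%E by apply: integral_ge0 => x _; rewrite lee_fin.
have sP k p : p \in s k -> exists2 i, good i & (i < k)%N /\ p = hlp i.
  move/mapP => [j]; rewrite mem_filter mem_iota add0n => /andP[gj jk] ->.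
  by exists j.
have FE : [set x | (lam%:E < HL psi x)%E] = \bigcup_k F k.
  apply/seteqP; split => x /=.
    move=> /ereal_sup_gt[_ [k _ <-]].
    have [xk|xk] := boolP (x \in hlcube k); last first.
      by rewrite indicE (negbTE xk) mule0 lte_fin => /(lt_trans lam0); rewrite ltxx.
    rewrite indicE xk mule1 => gk; exists k.+1 => //; exists (hlp k); last exact: set_mem.
    by apply/mapP; exists k => //; rewrite mem_filter /good gk mem_iota/= add0n ltnS.
  move=> [k _ [p /sP[i gi [_ ->]] xi]].
  apply: (lt_le_trans gi); apply: ereal_sup_ubound; exists i => //.
  by rewrite indicE mem_set// mule1.
have nd : nondecreasing_seq F.
  move=> a b ab; apply/subsetPset => x [p /sP[i gi [ia ->]] xi].
  exists (hlp i) => //; apply/mapP; exists i => //; rewrite mem_filter gi mem_iota/=.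
  by rewrite add0n (leq_trans ia).
have bnd k : (mu (F k) <= lam^-1%:E * ((3 ^+ n)%:E * \int[mu]_x (psi x)%:E))%E.
  rewrite lee_pdivlMl//.
  apply: (@le_trans _ _ ((3 ^+ n)%:E * \int[mu]_(x in F k) (psi x)%:E)%E).
    apply: vitali_cubes => //; first exact: ltW.
      by move=> p /sP[i _ [_ ->]]; exact: hlp_gt0.
    move=> p /sP[i gi [_ ->]].
    rewrite lebesgue_cube ?hlp_gt0//; move: gi; rewrite /good /hlavg => /ltW.
    have q0 : 0 < (2 * (hlp i).2) ^+ n by rewrite exprn_gt0// mulr_gt0// hlp_gt0.
    by rewrite lee_pdivlMl// muleC.
  rewrite lee_wpmul2l ?lee_fin ?exprn_ge0//.
  by apply: ge0_le_integral_cubes => //; exact: measurable_cubes.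
rewrite FE -lee_pdivlMl//.
have cv := nondecreasing_cvg_mu (fun k => measurable_cubes (s k)) (bigcup_measurable (fun k _ => measurable_cubes (s k))) nd.
rewrite -(cvg_lim _ (cv _ mu))//; apply: lime_le; first by apply/cvg_ex; eexists; exact: (cv _ mu).
exact: nearW.
Qed.

(** A rational cube of radius between [2r] and [3r] whose centre is within [r] of [x] contains both
    [x] and the given cube; its side is less than [6r]. *)
Lemma HL_dominates psi x r : measurable_fun [set: X] psi -> (forall x, 0 <= psi x) -> 0 < r ->
  (\int[mu]_(y in cube x r) (psi y)%:E <= ((6 * r) ^+ n)%:E * HL psi x)%E.
Proof.
move=> mpsi p0 r0.
have /choice[g hg] : forall i : 'I_n, exists q : rat, ratr q \in `](x 0 i - r), (x 0 i + r)[.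
  by move=> i; apply: rat_in_itvoo; lra.
have [q] : exists q : rat, ratr q \in `](2 * r), (3 * r)[ by apply: rat_in_itvoo; lra.
rewrite in_itv/= => /andP[q2 q3].
have q0 : 0 < ratr q :> R by lra.
pose k := pickle (\row_i g i, q).
have hk : hlp k = (map_mx ratr (\row_i g i), ratr q).
  by rewrite /hlp /k pickleK -(ltr0q R) q0.
have h1 : (hlp k).1 = map_mx ratr (\row_i g i) by rewrite hk.
have h2 : (hlp k).2 = ratr q by rewrite hk.
have xc : `|x - (hlp k).1| < r.
  rewrite h1; apply/(rV_norm_ltP _ r0) => i; rewrite !mxE.
  by have := hg i; rewrite in_itv/= ltr_norml; lra.
have sub : cube x r `<=` hlcube k.
  move=> y; rewrite /hlcube /cube/= h2 => yx.
  by have := ler_normD (y - x) (x - (hlp k).1); rewrite subrKA; lra.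
have xk : hlcube k x by rewrite /hlcube /cube/= h2; lra.
apply: (@le_trans _ _ (\int[mu]_(y in hlcube k) (psi y)%:E)%E).
  by apply: ge0_le_integral_cubes => //; exact: measurable_cube.
have q20 : 0 < (2 * (hlp k).2) ^+ n by rewrite exprn_gt0// mulr_gt0// hlp_gt0.
apply: (@le_trans _ _ (((2 * (hlp k).2) ^+ n)%:E * HL psi x)%E); last first.
  rewrite lee_wpmul2r ?HL_ge0// lee_fin h2 lerXn2r ?nnegrE; lra.
rewrite -lee_pdivrMl//.
apply: ereal_sup_ubound; exists k => //; rewrite /hlavg indicE mem_set// mule1.
by rewrite muleC.
Qed.

Lemma HL_le_cst psi (K : R) x : measurable_fun [set: X] psi -> (forall x, 0 <= psi x) -> 0 <= K ->
  {ae mu, forall y, psi y <= K} -> (HL psi x <= K%:E)%E.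
Proof.
move=> mpsi p0 K0 pK; apply: ge_ereal_sup => _ [k _ <-].
have q0 : 0 < (2 * (hlp k).2) ^+ n by rewrite exprn_gt0// mulr_gt0// hlp_gt0.
apply: (@le_trans _ _ (hlavg psi k)).
  rewrite -[leRHS]mule1 lee_wpmul2l ?hlavg_ge0// lee_fin indicE; by case: (_ \in _).
rewrite /hlavg lee_pdivrMl//.
apply: (@le_trans _ _ (\int[mu]_(y in hlcube k) K%:E)%E).
  apply: ae_ge0_le_integral => //.
  - exact: measurable_cube.
  - by move=> y _; rewrite lee_fin.
  - by apply/measurable_EFinP; exact: measurable_funS mpsi.
  - by apply: filterS pK => y yK _; rewrite lee_fin.
rewrite integral_cst; last exact: measurable_cube.
rewrite [X in (_ * X)%E](_ : _ = ((2 * (hlp k).2) ^+ n)%:E) 1?muleC//.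
exact: lebesgue_cube (hlp_gt0 k).
Qed.

End maximal.

(** * Weighted averages against the maximal function *)

Section wgt_maximal.
Context {R : realType} {n : nat}.
Local Notation X := 'rV[R]_n.
Local Notation mu := (lebesgue_rV R n).
Implicit Types (psi : X -> R) (x y v : X) (r : R).

Lemma geometric_nneseries_le (K q : R) : 0 <= K -> 0 <= q -> q < 1 ->
  (\sum_(l <oo) (K * q ^+ l)%:E <= (K / (1 - q))%:E)%E.
Proof.
move=> K0 q0 q1; apply: lime_le.
  by apply: is_cvg_nneseries => l _ _; rewrite lee_fin mulr_ge0// exprn_ge0.
apply: nearW => m; rewrite sumEFin lee_fin.
have -> : \sum_(0 <= i < m) K * q ^+ i = series (geometric K q) m.
  by rewrite seriesEnat.
rewrite geometric_seriesE ?lt_eqF//= ler_pM2r ?invr_gt0 ?subr_gt0//.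
by rewrite ler_piMr// gerBl exprn_ge0.
Qed.

Lemma dyadic_shell r (u : X) : 0 < r ->
  exists2 l : nat, `|u| < 2 ^+ l * r & 2 ^+ l <= 2 * (1 + `|u| / r).
Proof.
move=> r0; have h1 := one_plus_ge1 u r0.
have [m hm] : exists m : nat, `|u| < 2 ^+ m * r.
  exists (Num.bound (`|u| / r)); rewrite -ltr_pdivrMr//.
  apply: lt_le_trans (archi_boundP _) _; first by rewrite divr_ge0// ltW.
  by rewrite -natrX ler_nat ltnW// ltn_expl.
have [l hl lmin] := ex_minnP (ex_intro (fun m : nat => `|u| < 2 ^+ m * r) m hm).
exists l => //; case: l hl lmin => [|l] hl lmin; first by rewrite expr0; lra.
have : ~~ (`|u| < 2 ^+ l * r) by apply/negP => /lmin; rewrite ltnn.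
rewrite -leNgt -ler_pdivlMr// => h; rewrite exprS ler_pM2l//; lra.
Qed.

(** The weight is majorised by a series of multiples of indicators of the cubes of radius [2^l r]
    around [v]. Each of these lies in a cube around [x] larger by the factor [1 + |v - x|/r], and
    the series converges because [2^(n-N) < 1]. *)
Lemma wgt_HL (N : R) : n%:R < N -> exists2 C : R, 0 < C &
  forall r v x psi, 0 < r -> measurable_fun [set: X] psi -> (forall y, 0 <= psi y) ->
  (\int[mu]_y (wgt r N (v - y) * psi y)%:E <= (C * (1 + `|v - x| / r) ^+ n)%:E * HL psi x)%E.
Proof.
move=> nN; have N0 : 0 <= N by rewrite (le_trans _ (ltW nN)).
pose q : R := 2 ^+ n * 2 `^ (- N).
have q0 : 0 < q by rewrite mulr_gt0// powR_gt0.
have q1 : q < 1.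
  rewrite /q powRN ltr_pdivrMr ?powR_gt0// mul1r -powR_mulrn// /powR pnatr_eq0/= ltr_expR.
  by rewrite ltr_pM2r// ln_gt0//; lra.
pose C := 2 `^ N * 6 ^+ n / (1 - q).
exists C; first by rewrite !mulr_gt0 ?powR_gt0 ?invr_gt0 ?subr_gt0.
move=> r v x psi r0 mpsi p0.
pose a l : R := r^-1 ^+ n * 2 `^ N * (2 `^ (- N)) ^+ l.
have a0 l : 0 < a l by rewrite !mulr_gt0 ?exprn_gt0 ?powR_gt0 ?invr_gt0.
pose B l := cube v (2 ^+ l * r).
have mB l : measurable (B l) by exact: measurable_cube.
have mpB l : measurable_fun [set: X] (psi \_ (B l)).
  by apply/(measurable_restrictT _ (mB l)); exact: measurable_funTS.
have mt l : measurable_fun [set: X] (fun y => a l * (psi \_ (B l)) y).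
  exact: measurable_funM.
have t0 l y : 0 <= a l * (psi \_ (B l)) y.
  by rewrite mulr_ge0 ?(ltW (a0 l))// patchE; case: ifP.
apply: (@le_trans _ _ (\int[mu]_y \sum_(l <oo) (a l * (psi \_ (B l)) y)%:E)%E).
  apply: ge0_le_integral => //.
  - by move=> y _; rewrite lee_fin mulr_ge0// wgt_ge0.
  - apply/measurable_EFinP; apply: measurable_funM => //; apply: measurable_wgt; exact: measurable_rVB.
  - apply: ge0_emeasurable_sum => [k y _ _|k _]; first by rewrite lee_fin.
    exact/measurable_EFinP.
  (* A single term of the series, that of the dyadic shell of [v - y], already dominates the
     weight. *)
  move=> y _; have [l hl1 hl2] := dyadic_shell (v - y) r0.
  apply: (@le_trans _ _ (a l * (psi \_ (B l)) y)%:E); last first.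
    apply: le_trans (nneseries_lim_ge l.+1 (fun k _ _ => _)) => [|k]; last by rewrite lee_fin.
    rewrite big_nat_recr//= leeDr// sume_ge0// => k _; by rewrite lee_fin.
  rewrite lee_fin patchE mem_set; last by rewrite /B /cube/= distrC.
  rewrite ler_wpM2r// /wgt /a -mulrA ler_wpM2l ?exprn_ge0 ?invr_ge0 ?(ltW r0)//.
  have e : (2 `^ (- N)) ^+ l = ((2 ^+ l) `^ N)^-1 :> R.
    by rewrite powRN exprVn -(powR_mulrn l (powR_ge0 2 N)) -(powR_mulrn l (ler0n R 2)) -!powRrM mulrC.
  have d0 := one_plus_gt0 (v - y) r0.
  rewrite e powRN ler_pdivlMr ?powR_gt0 ?exprn_gt0// ler_pdivrMl ?powR_gt0//.
  rewrite mulrC -powRM ?(ltW d0)// ge0_ler_powR ?nnegrE ?exprn_ge0 ?mulr_ge0 ?(ltW d0)//.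
rewrite integral_nneseries//; last 2 first.
- by move=> l; apply/measurable_EFinP.
- by move=> l y _; rewrite lee_fin.
set d := 1 + `|v - x| / r; have d0 : 0 < d by exact: one_plus_gt0.
have HL0 := HL_ge0 x p0.
apply: (@le_trans _ _ (\sum_(l <oo) (2 `^ N * 6 ^+ n * d ^+ n * q ^+ l)%:E * HL psi x)%E); last first.
  have [HLoo|HLy] := eqVneq (HL psi x) +oo%E.
    rewrite HLoo gt0_muley ?leey// lte_fin mulr_gt0 ?exprn_gt0//.
    by rewrite !mulr_gt0 ?powR_gt0 ?invr_gt0 ?subr_gt0.
  have [h hE] : exists h : R, HL psi x = h%:E.
    by exists (fine (HL psi x)); rewrite fineK// ge0_fin_numE// ltey.
  move: HL0; rewrite hE lee_fin => h0.
  under eq_eseriesr do rewrite -EFinM mulrAC.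
  apply: le_trans (geometric_nneseries_le _ (ltW q0) q1) _.
    by rewrite !mulr_ge0 ?exprn_ge0 ?powR_ge0 ?(ltW d0).
  by rewrite -EFinM lee_fin /C le_eqVlt; apply/orP; left; apply/eqP; field; rewrite gt_eqF// subr_gt0.
apply: lee_nneseries => l _.
  by move=> _; apply: integral_ge0 => y _; rewrite lee_fin.
under eq_integral do rewrite EFinM.
rewrite ge0_integralZl//; last 3 first.
- exact/measurable_EFinP.
- by move=> y _; rewrite lee_fin patchE; case: ifP.
- by rewrite lee_fin ltW.
have -> : (\int[mu]_y ((psi \_ (B l)) y)%:E = \int[mu]_(y in B l) (psi y)%:E)%E.
  by rewrite [RHS]integral_mkcond; apply: eq_integral => y _; rewrite restrict_EFin.
have sub : B l `<=` cube x (2 ^+ l * r * d).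
  move=> y; rewrite /B /cube/= => yv; rewrite -(subrKA v) (le_lt_trans (ler_normD _ _))//.
  have : `|v - x| <= 2 ^+ l * `|v - x| by rewrite ler_peMl// exprn_ege1// ler1n.
  rewrite (_ : 2 ^+ l * r * d = 2 ^+ l * r + 2 ^+ l * `|v - x|); first lra.
  by rewrite /d; field; rewrite gt_eqF.
apply: (@le_trans _ _ ((a l)%:E * (((6 * (2 ^+ l * r * d)) ^+ n)%:E * HL psi x))%E).
  rewrite lee_wpmul2l ?lee_fin ?(ltW (a0 l))//.
  apply: le_trans (HL_dominates x mpsi p0 _); last by rewrite !mulr_gt0 ?exprn_gt0.
  by apply: ge0_le_integral_cubes => //; exact: measurable_cube.
rewrite muleA -EFinM le_eqVlt; apply/orP; left; apply/eqP; congr (_%:E * _)%E.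
rewrite /a /q !exprMn !exprVn -(exprM 2 l n) mulnC exprM.
by field; rewrite expf_neq0// gt_eqF.
Qed.

Lemma HL_cst (K : R) x : 0 <= K -> (HL (cst K : X -> R) x <= K%:E)%E.
Proof. by move=> K0; apply: HL_le_cst => //; exact: aeW. Qed.

Lemma wgt_integral_le (N : R) : n%:R < N -> exists2 C : R, 0 < C &
  forall r v, 0 < r -> (\int[mu]_y (wgt r N (v - y))%:E <= C%:E)%E.
Proof.
move=> nN; have [C C0 H] := wgt_HL nN; exists C => // r v r0.
have := H r v v (cst 1) r0 (measurable_cst _) (fun=> ler01).
under eq_integral do rewrite mulr1.
rewrite subrr normr0 mul0r addr0 expr1n mulr1 => /le_trans; apply.
rewrite -[leRHS]mule1 lee_wpmul2l ?lee_fin ?(ltW C0)//; exact: HL_cst.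
Qed.

Lemma wgt_integral_le0 (N : R) : n%:R < N -> exists2 C : R, 0 < C &
  forall r, 0 < r -> (\int[mu]_y (wgt r N y)%:E <= C%:E)%E.
Proof.
move=> nN; have [C C0 H] := wgt_integral_le nN; exists C => // r r0.
have := H r 0 r0; rewrite (ge0_integral_rV_flip 0 (F := fun y => (wgt r N y)%:E))//.
  by apply/measurable_EFinP; apply: measurable_wgt.
by move=> y; rewrite lee_fin wgt_ge0.
Qed.

End wgt_maximal.

(** * Gaussian kernels *)

Section gauss_line.
Context {R : realType}.
Local Notation leb := (@lebesgue_measure R).
Implicit Types (a b s x y : R).

Lemma is_derive_under_integral (f df : R -> R -> R) (G : R -> R) (a : R) :
  (forall x, `|x - a| < 1 -> leb.-integrable [set: R] (EFin \o f x)) ->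
  (forall x y, `|x - a| < 1 -> is_derive x 1 (f ^~ y) (df x y)) ->
  (forall y, 0 <= G y) -> leb.-integrable [set: R] (EFin \o G) ->
  (forall x y, `|x - a| < 1 -> `|df x y| <= G y) ->
  is_derive a 1 (fun x => \int[leb]_y f x y) (\int[leb]_y df a y).
Proof.
move=> fi fdf G0 Gi dfG.
pose I : set R := `]a - 1, a + 1[%classic.
have Ia : I a by rewrite /I/= in_itv/=; apply/andP; split; lra.
have Ix x : I x -> `|x - a| < 1 by rewrite /I/= in_itv/= ltr_norml; lra.
have d1E x y : I x -> partial1of2 f x y = df x y.
  by move=> /Ix xa; rewrite partial1of2E; have [] := fdf x y xa.
have fi' x : I x -> leb.-integrable [set: R] (EFin \o f x) by move=> /Ix; exact: fi.
have dab x y : I x -> [set: R] y -> derivable (f ^~ y) x 1.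
  by move=> /Ix xa _; have [] := fdf x y xa.
have ub x y : I x -> [set: R] y -> `|partial1of2 f x y| <= G y.
  by move=> xa _; rewrite d1E//; apply: dfG; exact: Ix.
apply: DeriveDef.
  exact: (derivable_under_integral measurableT Ia fi' dab G0 Gi ub).
rewrite -derive1E (differentiation_under_integral measurableT Ia fi' dab G0 Gi ub).
by apply: eq_Rintegral => y _; exact: d1E.
Qed.

Lemma integral_flip (c : R) (f : R -> \bar R) : measurable_fun [set: R] f ->
  (\int[leb]_x f (c - x)%R = \int[leb]_x f x)%E.
Proof.
move=> mf; rewrite [LHS]integralE [RHS]integralE; congr (_ - _)%E.
  rewrite -(ge0_integral_flip c (f := f^\+%E))//; last exact: measurable_funepos.
  by apply: eq_integral => x _; rewrite !funeposE.
rewrite -(ge0_integral_flip c (f := f^\-%E))//; last exact: measurable_funeneg.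
by apply: eq_integral => x _; rewrite !funenegE.
Qed.

Lemma Rintegral_shift (c : R) (f : R -> R) : measurable_fun [set: R] f ->
  \int[leb]_x f (x + c) = \int[leb]_x f x.
Proof.
move=> mf; rewrite /Rintegral; congr fine.
rewrite -(integral_flip 0 (f := fun x => (f (x + c))%:E)); last first.
  by apply/measurable_EFinP; apply: measurableT_comp => //; exact: measurable_funD.
rewrite -(integral_flip c (f := fun x => (f x)%:E)); last exact/measurable_EFinP.
by apply: eq_integral => x _; rewrite sub0r addrC.
Qed.

Definition gline s y : R := expR (- (s * y ^+ 2)).

Lemma gline_ge0 s y : 0 <= gline s y.
Proof. exact: expR_ge0. Qed.

Lemma measurable_gline s : measurable_fun [set: R] (gline s).
Proof.
apply: measurableT_comp => //; apply: measurable_funN => //.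
by apply: measurable_funM => //; exact: measurable_funX.
Qed.

Lemma gline_normal_pdf s y : 0 < s ->
  normal_pdf 0 (Num.sqrt (2 * s)^-1) y = Num.sqrt (s / pi) * gline s y.
Proof.
move=> s0; have q0 : 0 < (2 * s)^-1 by rewrite invr_gt0 mulr_gt0.
have p0 := @pi_gt0 R.
rewrite normal_pdfE ?gt_eqF ?sqrtr_gt0// /normal_peak /normal_fun subr0 sqr_sqrtr ?ltW//.
congr (_ * _).
  rewrite (_ : s / pi = ((2 * s)^-1 * pi *+ 2)^-1); last by rewrite -mulr_natr; field; lra.
  by rewrite sqrtrV// mulrn_wge0// mulr_ge0// ltW.
by congr expR; rewrite -mulr_natr; field; lra.
Qed.

Lemma integrable_gline s : 0 < s -> leb.-integrable [set: R] (EFin \o gline s).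
Proof.
move=> s0; have p0 := @pi_gt0 R.
have q0 : 0 < Num.sqrt (s / pi) by rewrite sqrtr_gt0 divr_gt0.
have -> : EFin \o gline s = fun y =>
    ((Num.sqrt (s / pi))^-1%:E * (normal_pdf 0 (Num.sqrt (2 * s)^-1) y)%:E)%E.
  by apply/funext => y; rewrite /= gline_normal_pdf// -EFinM mulKf// gt_eqF.
by apply: integrableZl => //; exact: integrable_normal_pdf.
Qed.

(** The constant comes from [N ln(1 + rho) <= |N| rho] and from completing the square in
    [|N| rho <= c rho^2 + N^2/(4c)]. *)
Lemma poly_le_gauss (N c : R) : 0 < c -> exists2 C : R, 0 < C &
  forall rho, 0 <= rho -> (1 + rho) `^ N <= C * expR (c * rho ^+ 2).
Proof.
move=> c0; exists (expR (N ^+ 2 / (4 * c))); first exact: expR_gt0.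
move=> rho r0; rewrite -expRD /powR gt_eqF ?ler_expR; last lra.
apply: (@le_trans _ _ (`|N| * rho)).
  apply: (@le_trans _ _ (`|N| * ln (1 + rho))).
    by rewrite ler_wpM2r ?ler_norm// ln_ge0//; lra.
  by rewrite ler_wpM2l// le_ln1Dx//; lra.
rewrite -subr_ge0 -(real_normK (num_real N)).
rewrite (_ : _ - _ = (`|N| / (2 * c) - rho) ^+ 2 * c); first by rewrite mulr_ge0// ?sqr_ge0// ltW.
by field; rewrite gt_eqF.
Qed.

(** Half of the Gaussian pays for the polynomial factor; the other half, [exp(-s (y + x)^2 / 2)], is
    compared with [exp(-s y^2 / 4)] by a completed square, uniformly in [|x| <= 1]. This is the
    integrable majorant for differentiating under the integral. *)
Lemma gline_translate_dom s : 0 < s -> exists2 C : R, 0 < C &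
  forall x y, `|x| <= 1 -> (1 + `|y + x|) * gline s (y + x) <= C * gline (s / 4) y.
Proof.
move=> s0; have s20 : 0 < s / 2 by lra.
have [C C0 H] := poly_le_gauss 1 s20.
exists (C * expR (s / 2)); first by rewrite mulr_gt0 ?expR_gt0.
move=> x y x1; have := H `|y + x| (normr_ge0 _).
rewrite powRr1 => [h|]; last by rewrite addr_ge0.
apply: (@le_trans _ _ (C * expR (s / 2 * `|y + x| ^+ 2) * gline s (y + x))).
  by rewrite ler_wpM2r// gline_ge0.
rewrite -!mulrA ler_pM2l// /gline -!expRD ler_expR real_normK ?num_real//.
have : 0 <= s * ((y + 2 * x) ^+ 2 + 2 * (1 - x ^+ 2)).
  rewrite mulr_ge0 ?(ltW s0)// addr_ge0 ?sqr_ge0// mulr_ge0// subr_ge0.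
  by rewrite -(real_normK (num_real x)) exprn_ile1.
move: x1 => _; lra.
Qed.

(** [exp(x^2/(4s))] is an integrating factor. *)
Lemma gauss_ode (K : R -> R) s b : 0 < s ->
  (forall x, is_derive x 1 K (- (x / (2 * s)) * K x)) ->
  K b = K 0 * expR (- (b ^+ 2 / (4 * s))).
Proof.
move=> s0 dK; pose J x := K x * expR (x ^+ 2 / (4 * s)).
have JJ : J b = J 0.
  apply: is_derive_0_is_cst => x; rewrite /J.
  apply: is_derive_eq; rewrite /GRing.scale/=.
  move: (K x) (expR (x ^+ 2 / (4 * s))) => k e.
  by field; rewrite gt_eqF.
by move: JJ; rewrite /J expr0n/= mul0r expR0 mulr1 => <-; rewrite -mulrA -expRD addrN expR0 mulr1.
Qed.

(* Both identities below come from differentiating under the integral: in the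
   translation variable the integral is constant, in the frequency variable it
   then solves a linear first-order equation. *)
Lemma gline_fourier s (al b : R) : 0 < s ->
  \int[leb]_y (gline s y * cos (al + b * y)) =
  cos al * expR (- (b ^+ 2 / (4 * s))) * \int[leb]_y gline s y.
Proof.
move=> s0; move: b; have s40 : 0 < s / 4 by lra.
have [C C0 dom] := gline_translate_dom s0.
have ms (u : R -> R) (b : R) : continuous u -> measurable_fun [set: R] (fun y => gline s y * u (al + b * y)).
  move=> cu; apply: measurable_funM; first exact: measurable_gline.
  apply: measurableT_comp; first exact: continuous_measurable_fun.
  by apply: measurable_funD => //; exact: measurable_funM.
have is_dom (f : R -> R) (K : R) : measurable_fun [set: R] f -> 
    (forall y, `|f y| <= K * gline (s / 4) y) -> leb.-integrable [set: R] (EFin \o f).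
  move=> mf fK; apply: (le_integrable measurableT _ _ (integrableZl measurableT K (integrable_gline s40))).
    exact/measurable_EFinP.
  by move=> y _; rewrite /= lee_fin (le_trans (fK y))// ler_norm.
have dom0 y : gline s y <= C * gline (s / 4) y.
  have := dom 0 y; rewrite normr0 addr0 => /(_ ler01); apply: le_trans.
  by rewrite ler_peMl ?gline_ge0// lerDl.
have dg x y : is_derive x 1 (fun h => gline s (y + h)) (- (2 * s) * (y + x) * gline s (y + x)).
  rewrite /gline; apply: is_derive_eq; rewrite /GRing.scale/=; ring.
have ibp (b : R) : \int[leb]_y (- (2 * s) * y * gline s y * sin (al + b * y) + gline s y * (b * cos (al + b * y))) = 0.
  pose f (x y : R) := gline s (y + x) * sin (al + b * (y + x)).
  pose df (x y : R) := - (2 * s) * (y + x) * gline s (y + x) * sin (al + b * (y + x)) +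
     gline s (y + x) * (b * cos (al + b * (y + x))).
  have D : is_derive (0 : R) 1 (fun x => \int[leb]_y f x y) (\int[leb]_y df 0 y).
    apply: (is_derive_under_integral (G := fun y => (2 * s + `|b|) * C * gline (s / 4) y)).
    - move=> x; rewrite subr0 => /ltW x1; apply: (is_dom _ C).
        apply: (measurableT_comp (f := fun z => gline s z * sin (al + b * z))).
          by apply: ms; exact: continuous_sin.
        exact: measurable_funD.
      move=> y; rewrite /f normrM (ger0_norm (gline_ge0 _ _)).
      apply: le_trans (dom x y x1); rewrite mulrC ler_wpM2r ?gline_ge0//.
      rewrite (le_trans (y := 1)) ?lerDl//.
      by rewrite ler_norml sin_geN1 sin_le1.
    - move=> x y _; rewrite /f /df.
      apply: is_derive_eq; rewrite /GRing.scale/=; ring.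
    - by move=> y; rewrite !mulr_ge0 ?addr_ge0 ?mulr_ge0 ?(ltW s0) ?(ltW C0)// gline_ge0.
    - exact: (integrableZl measurableT _ (integrable_gline s40)).
    - move=> x y; rewrite subr0 => /ltW x1; rewrite /df.
      have sc : `|sin (al + b * (y + x))| <= 1 by rewrite ler_norml sin_geN1 sin_le1.
      have cc : `|cos (al + b * (y + x))| <= 1 by rewrite ler_norml cos_geN1 cos_le1.
      have n2 : `|2 * s| = 2 * s by rewrite ger0_norm// mulr_ge0// ltW.
      rewrite (le_trans (ler_normD _ _))// !normrM normrN n2 !(ger0_norm (gline_ge0 _ _)).
      rewrite -[leRHS]mulrA; apply: (@le_trans _ _ ((2 * s + `|b|) * ((1 + `|y + x|) * gline s (y + x)))); last first.
        by rewrite ler_wpM2l ?dom// addr_ge0// mulr_ge0// ltW.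
      have g0 := gline_ge0 s (y + x); have n0 := normr_ge0 (y + x); have b0 := normr_ge0 b.
      have h1 : 0 <= 2 * s * (`|y + x| * gline s (y + x) * (1 - `|sin (al + b * (y + x))|)).
        by rewrite !mulr_ge0 ?(ltW s0)// subr_ge0.
      have h2 : 0 <= `|b| * (gline s (y + x) * (1 - `|cos (al + b * (y + x))|)).
        by rewrite !mulr_ge0// subr_ge0.
      have h3 : 0 <= s * gline s (y + x) by rewrite mulr_ge0 ?(ltW s0).
      have h4 : 0 <= `|b| * `|y + x| * gline s (y + x) by rewrite !mulr_ge0.
      lra.
  have cst : (fun x => \int[leb]_y f x y) = cst (\int[leb]_y f 0 y).
    apply/funext => x; rewrite /f (Rintegral_shift x (f := fun z => gline s z * sin (al + b * z))).
      by apply: eq_Rintegral => y _; rewrite addr0.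
    by apply: ms; exact: continuous_sin.
  rewrite cst in D; have [_] := D; rewrite derive_cst => ->.
  by apply: eq_Rintegral => y _; rewrite /df addr0.
pose K b := \int[leb]_y (gline s y * cos (al + b * y)).
have fi (u : R -> R) (b : R) : continuous u -> (forall z, `|u z| <= 1) ->
    leb.-integrable [set: R] (EFin \o (fun y => gline s y * u (al + b * y))).
  move=> cu u1; apply: (is_dom _ C); first exact: ms.
  move=> y; rewrite normrM (ger0_norm (gline_ge0 _ _)) (le_trans _ (dom0 y))//.
  by rewrite ler_piMr ?gline_ge0.
have yfi (b : R) : leb.-integrable [set: R] (EFin \o (fun y => - y * gline s y * sin (al + b * y))).
  apply: (is_dom _ C).
    under eq_fun do rewrite -mulrA; apply: measurable_funM; first exact: measurable_funN.
    by apply: ms; exact: continuous_sin.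
  move=> y; rewrite !normrM normrN (ger0_norm (gline_ge0 _ _)).
  have := dom 0 y; rewrite normr0 addr0 => /(_ ler01); apply: le_trans.
  rewrite -[leRHS]mulr1 ler_pM ?mulr_ge0 ?gline_ge0//; last by rewrite ler_norml sin_geN1 sin_le1.
  by rewrite ler_wpM2r ?gline_ge0// lerDr.
have cos1 z : `|cos z| <= 1 :> R by rewrite ler_norml cos_geN1 cos_le1.
have dK (b0 : R) : is_derive b0 1 K (- (b0 / (2 * s)) * K b0).
  have -> : - (b0 / (2 * s)) * K b0 = \int[leb]_y (- y * gline s y * sin (al + b0 * y)).
    (* Integration by parts reads [2s K' + b K = 0], with the formal derivative of [K] in the place
       of [K']. *)
    have e : 2 * s * \int[leb]_y (- y * gline s y * sin (al + b0 * y)) + b0 * K b0 = 0.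
      rewrite -(ibp b0) /K -!RintegralZl ?fi//; last exact: continuous_cos.
      rewrite -RintegralD//.
      - by apply: eq_Rintegral => y _; ring.
      - exact: (integrableZl measurableT _ (yfi b0)).
      - by apply: (integrableZl measurableT _ (fi cos b0 _ _)) => //; exact: continuous_cos.
    by apply/eqP; rewrite -subr_eq0; apply/eqP; move/eqP: e; rewrite addr_eq0 => /eqP e;
      apply: (mulfI (x := 2 * s)); [rewrite mulf_neq0// gt_eqF|rewrite mulr0 mulrBr e; field; rewrite gt_eqF].
  apply: (is_derive_under_integral (f := fun b y => gline s y * cos (al + b * y))
    (df := fun b y => - y * gline s y * sin (al + b * y)) (G := fun y => C * gline (s / 4) y)).
  - by move=> x _; apply: fi => //; exact: continuous_cos.
  - by move=> x y _; apply: is_derive_eq; rewrite /GRing.scale/=; ring.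
  - by move=> y; rewrite mulr_ge0 ?(ltW C0) ?gline_ge0.
  - exact: (integrableZl measurableT _ (integrable_gline s40)).
  - move=> x y _; rewrite !normrM normrN (ger0_norm (gline_ge0 _ _)).
    have := dom 0 y; rewrite normr0 addr0 => /(_ ler01); apply: le_trans.
    rewrite -[leRHS]mulr1 ler_pM ?mulr_ge0 ?gline_ge0//; last by rewrite ler_norml sin_geN1 sin_le1.
    by rewrite ler_wpM2r ?gline_ge0// lerDr.
move=> b.
have K0 : K 0 = cos al * \int[leb]_y gline s y.
  rewrite /K -RintegralZl//; last exact: integrable_gline.
  by apply: eq_Rintegral => y _; rewrite mul0r addr0 mulrC.
by rewrite -/(K b) (gauss_ode b s0 dK) K0 mulrAC.
Qed.

End gauss_line.

(** * The inner product, compared with the sup norm *)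

Section dotprod.
Context {R : realType} {n : nat}.
Implicit Types (x y z : 'rV[R]_n).

Lemma dotprodC x y : dotprod x y = dotprod y x.
Proof. by apply: eq_bigr => i _; rewrite mulrC. Qed.

Lemma dotprodDl x y z : dotprod (x + y) z = dotprod x z + dotprod y z.
Proof. by rewrite -big_split; apply: eq_bigr => i _; rewrite mxE mulrDl. Qed.

Lemma dotprodNl x z : dotprod (- x) z = - dotprod x z.
Proof. by rewrite -sumrN; apply: eq_bigr => i _; rewrite mxE mulNr. Qed.

Lemma dotprodBl x y z : dotprod (x - y) z = dotprod x z - dotprod y z.
Proof. by rewrite dotprodDl dotprodNl. Qed.

Lemma dotprodDr x y z : dotprod z (x + y) = dotprod z x + dotprod z y.
Proof. by rewrite !(dotprodC z) dotprodDl. Qed.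

Lemma dotprodNr x z : dotprod z (- x) = - dotprod z x.
Proof. by rewrite !(dotprodC z) dotprodNl. Qed.

Lemma dotprodBr x y z : dotprod z (x - y) = dotprod z x - dotprod z y.
Proof. by rewrite !(dotprodC z) dotprodBl. Qed.

Lemma dotprod_ge0 x : 0 <= dotprod x x.
Proof. by apply: sumr_ge0 => i _; rewrite -expr2 sqr_ge0. Qed.

Lemma sqr_norm_le_dotprod x : `|x| ^+ 2 <= dotprod x x.
Proof.
rewrite -(sqr_sqrtr (dotprod_ge0 x)) lerXn2r ?nnegrE ?sqrtr_ge0//.
apply/rV_norm_leP; first exact: sqrtr_ge0.
move=> i; rewrite -sqrtr_sqr ler_wsqrtr// /dotprod (bigD1 i)//= -expr2 lerDl.
by apply: sumr_ge0 => j _; rewrite -expr2 sqr_ge0.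
Qed.

Lemma normr_dotprod_le x y : `|dotprod x y| <= n%:R * (`|x| * `|y|).
Proof.
apply: (le_trans (ler_norm_sum _ _ _)).
rewrite -[X in X%:R * _]card_ord mulr_natl -sumr_const; apply: ler_sum => i _.
by rewrite normrM ler_pM// le_rV_norm.
Qed.

Lemma dotprod_le_sqr_norm x : dotprod x x <= n%:R * `|x| ^+ 2.
Proof. by rewrite (le_trans (ler_norm _))// (le_trans (normr_dotprod_le x x))// expr2. Qed.

End dotprod.

(** * Gaussian integrals in n dimensions *)

Section gauss_rV.
Context {R : realType}.

Lemma dotprod_cons n a b (x y : 'rV[R]_n) :
  dotprod (rV_cons (a, x)) (rV_cons (b, y)) = a * b + dotprod x y.
Proof.
rewrite /dotprod big_ord_recl !mxE unlift_none/=; congr (_ + _).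
by apply: eq_bigr => i _; rewrite !mxE liftK.
Qed.

Lemma Rintegral_rV_cons n (F : 'rV[R]_n.+1 -> R) :
  (lebesgue_rV R n.+1).-integrable [set: 'rV[R]_n.+1] (EFin \o F) ->
  \int[lebesgue_rV R n.+1]_x F x =
  \int[lebesgue_measure]_a \int[lebesgue_rV R n]_x F (rV_cons (a, x)).
Proof.
move=> Fi; have mF := measurable_int _ Fi.
have mc := @measurable_rV_cons R n.
have i2 : (lebesgue_measure \x lebesgue_rV R n)%E.-integrable
    [set: measurableTypeR R * 'rV[R]_n] (EFin \o (F \o @rV_cons R n)).
  apply/integrableP; split.
    exact: (measurableT_comp mF mc).
  move/integrableP : Fi => [_]; apply: le_lt_trans.
  rewrite ge0_integral_rV_cons//; last exact: measurableT_comp.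
  rewrite fubini_tonelli1//; apply: measurableT_comp => //.
  exact: (measurableT_comp mF mc).
rewrite -(Rintegral_fubini1 i2) /Rintegral; congr fine.
by rewrite -[in RHS](preimage_setT (@rV_cons R n)) -(integral_pushforward mc mF i2).
Qed.

Definition gx n (s : R) (x : 'rV[R]_n) : R := expR (- (s * dotprod x x)).

Lemma gx_ge0 n s (x : 'rV[R]_n) : 0 <= gx s x.
Proof. exact: expR_ge0. Qed.

Lemma gx_cons n s a (x : 'rV[R]_n) : gx s (rV_cons (a, x)) = gline s a * gx s x.
Proof. by rewrite /gx /gline dotprod_cons -expRD -expr2; congr expR; ring. Qed.

Lemma measurable_gx n s d (T : measurableType d) (f : T -> 'rV[R]_n) :
  measurable_fun [set: T] f -> measurable_fun [set: T] (fun t => gx s (f t)).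
Proof.
move=> mf; apply: (measurableT_comp (f := @expR R)) => //; apply: measurable_funN.
by apply: measurable_funM => //; exact: measurable_dotprod.
Qed.

Lemma integral_gline (s : R) : 0 < s ->
  (\int[lebesgue_measure]_y (gline s y)%:E = (Num.sqrt (pi / s))%:E)%E.
Proof.
move=> s0; have p0 := @pi_gt0 R.
have q0 : 0 < Num.sqrt (s / pi) by rewrite sqrtr_gt0 divr_gt0.
have := integral_normal_pdf 0 (Num.sqrt (2 * s)^-1).
under eq_integral do rewrite gline_normal_pdf// EFinM.
rewrite integralZl//; last exact: integrable_gline.
move=> h; have : ((Num.sqrt (s / pi))^-1%:E * ((Num.sqrt (s / pi))%:E * \int[lebesgue_measure]_y (gline s y)%:E) = (Num.sqrt (s / pi))^-1%:E)%E.
  by rewrite h mule1.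
rewrite muleA -EFinM mulVf ?gt_eqF// mul1e => ->.
by rewrite -sqrtrV ?divr_ge0 ?ltW// invf_div.
Qed.

Lemma integral_gx n (s : R) : 0 < s ->
  (\int[lebesgue_rV R n]_x (gx s x)%:E = (Num.sqrt (pi / s) ^+ n)%:E)%E.
Proof.
move=> s0; elim: n => [|n ih].
  rewrite expr0 /= integral_dirac//; first by rewrite diracE in_setT mul1e /gx /dotprod big_ord0 mulr0 oppr0 expR0.
  by apply/measurable_EFinP; apply: measurable_gx.
rewrite ge0_integral_rV_cons; last 2 first.
- by apply/measurable_EFinP; apply: measurable_gx.
- by move=> x; rewrite lee_fin gx_ge0.
under eq_integral => a _.
  under eq_integral do rewrite gx_cons EFinM.
  rewrite ge0_integralZl//; last 3 first.
  - by apply/measurable_EFinP; apply: measurable_gx.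
  - by move=> x _; rewrite lee_fin gx_ge0.
  - by rewrite lee_fin gline_ge0.
  rewrite ih.
  over.
rewrite ge0_integralZr//; last 2 first.
- by apply/measurable_EFinP; exact: measurable_gline.
- by move=> x _; rewrite lee_fin gline_ge0.
by rewrite integral_gline// -EFinM exprS.
Qed.

Lemma integrable_gx n (s : R) : 0 < s ->
  (lebesgue_rV R n).-integrable [set: 'rV[R]_n] (EFin \o gx s).
Proof.
move=> s0; apply/integrableP; split.
  by apply/measurable_EFinP; apply: measurable_gx.
under eq_integral do rewrite /= ger0_norm ?gx_ge0//.
by rewrite integral_gx// ltry.
Qed.

Lemma integrable_gx_cos n (s al : R) (eta : 'rV[R]_n) : 0 < s ->
  (lebesgue_rV R n).-integrable [set: 'rV[R]_n] (EFin \o (fun x => gx s x * cos (al + dotprod x eta))).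
Proof.
move=> s0; apply: (le_integrable measurableT _ _ (@integrable_gx n s s0)).
  apply/measurable_EFinP; apply: measurable_funM; first exact: measurable_gx.
  apply: (measurableT_comp (f := @cos R)); first by apply: continuous_measurable_fun; exact: continuous_cos.
  by apply: measurable_funD => //; exact: measurable_dotprod.
move=> x _; rewrite /= lee_fin normrM ler_piMr//.
by rewrite ler_norml cos_geN1 cos_le1.
Qed.

(** The free phase [al] makes the induction on the dimension possible: the first coordinate merely
    shifts the phase of the cosine in the remaining ones. *)
Lemma gx_fourier n (s al : R) (eta : 'rV[R]_n) : 0 < s ->
  \int[lebesgue_rV R n]_x (gx s x * cos (al + dotprod x eta)) =
  cos al * expR (- (dotprod eta eta / (4 * s))) * Num.sqrt (pi / s) ^+ n.
Proof.
move=> s0; elim: n al eta => [|n ih] al eta.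
  rewrite /Rintegral /= integral_dirac//; last first.
    exact: measurable_int (@integrable_gx_cos 0 s al eta s0).
  by rewrite diracE in_setT mul1e /gx /dotprod !big_ord0 mul0r mulr0 oppr0 expR0 addr0 mul1r !mulr1.
have [b [y ->]] := rV_consP eta.
rewrite Rintegral_rV_cons; last exact: integrable_gx_cos.
have p0 := @pi_gt0 R.
under eq_Rintegral => a _.
  under eq_Rintegral => x _ do rewrite gx_cons dotprod_cons addrA -mulrA.
  rewrite RintegralZl//; last exact: integrable_gx_cos.
  rewrite ih -mulrA mulrA.
  over.
rewrite RintegralZr//; last first.
  apply: (le_integrable measurableT _ _ (integrable_gline s0)).
    apply/measurable_EFinP; apply: measurable_funM; first exact: measurable_gline.
    apply: (measurableT_comp (f := @cos R)); first by apply: continuous_measurable_fun; exact: continuous_cos.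
    by apply: measurable_funD => //; exact: measurable_funM.
  by move=> x _; rewrite /= lee_fin normrM ler_piMr// ler_norml cos_geN1 cos_le1.
under eq_Rintegral => a _ do rewrite (mulrC a b).
rewrite gline_fourier// dotprod_cons {1}/Rintegral integral_gline//= [_ ^+ n.+1]exprS.
have -> : - ((b * b + dotprod y y) / (4 * s)) = - (b ^+ 2 / (4 * s)) - dotprod y y / (4 * s).
  by rewrite -opprD -mulrDl expr2.
by rewrite expRD; ring.
Qed.

End gauss_rV.

(** * The heat kernel and its regularity *)

Section gauss_kernel.
Context {R : realType} {n : nat}.
Local Notation X := 'rV[R]_n.
Local Notation mu := (lebesgue_rV R n).
Implicit Types (x y xi u : X) (a e r : R).

(** The heat kernel in the normalisation with characters [exp(2 pi i x.xi)]: its Fourier transform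
    is [exp(-a |xi|^2)]. *)
Definition gk a x : R := Num.sqrt (pi / a) ^+ n * gx (pi ^+ 2 / a) x.

Lemma gk_ge0 a x : 0 <= gk a x.
Proof. by rewrite mulr_ge0 ?gx_ge0// exprn_ge0// sqrtr_ge0. Qed.

Lemma measurable_gk a d (T : measurableType d) (f : T -> X) :
  measurable_fun [set: T] f -> measurable_fun [set: T] (fun t => gk a (f t)).
Proof. by move=> mf; apply: measurable_funM => //; exact: measurable_gx. Qed.

Lemma gk_cstM a : 0 < a -> Num.sqrt (pi / a) ^+ n * Num.sqrt (pi / (pi ^+ 2 / a)) ^+ n = 1 :> R.
Proof.
move=> a0; have p0 := @pi_gt0 R.
rewrite -exprMn -sqrtrM ?divr_ge0 ?(ltW p0) ?(ltW a0)//.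
rewrite (_ : _ * _ = 1); first by rewrite sqrtr1 expr1n.
have pn : pi != 0 :> R by rewrite gt_eqF.
have an : a != 0 by rewrite gt_eqF.
by move: (pi) pn => p pn; field; rewrite pn an.
Qed.

Lemma integral_gk a : 0 < a -> (\int[mu]_x (gk a x)%:E = 1)%E.
Proof.
move=> a0; have p0 := @pi_gt0 R; have q0 : 0 < pi ^+ 2 / a by rewrite divr_gt0// exprn_gt0.
under eq_integral do rewrite EFinM.
rewrite ge0_integralZl//; last 2 first.
- by apply/measurable_EFinP; exact: measurable_gx.
- by move=> x _; rewrite lee_fin gx_ge0.
by rewrite integral_gx// -EFinM gk_cstM.
Qed.

Lemma gk_fourier a (th : R) xi : 0 < a ->
  cint mu (fun y => (gk a y)%:C * cis (th + 2 * pi * dotprod y xi)) =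
  (expR (- (a * dotprod xi xi)))%:C * cis th.
Proof.
move=> a0; have p0 := @pi_gt0 R; have q0 : 0 < pi ^+ 2 / a by rewrite divr_gt0// exprn_gt0.
pose eta := (2 * pi) *: xi.
have dE y : 2 * pi * dotprod y xi = dotprod y eta.
  by rewrite /dotprod mulr_sumr; apply: eq_bigr => i _; rewrite !mxE; ring.
have H (al : R) : \int[mu]_y (gk a y * cos (al + dotprod y eta)) = cos al * expR (- (a * dotprod xi xi)).
  under eq_Rintegral do rewrite /gk -mulrA.
  rewrite RintegralZl//; last exact: integrable_gx_cos.
  rewrite gx_fourier// mulrC -[LHS]mulrA [X in _ * X]mulrC gk_cstM// mulr1; congr (_ * expR (- _)).
  have pn : pi != 0 :> R by rewrite gt_eqF.
  have an : a != 0 by rewrite gt_eqF.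
  rewrite (_ : dotprod eta eta = 4 * pi ^+ 2 * dotprod xi xi).
    by move: (pi) pn => p pn; field; rewrite pn an.
  by rewrite -(dE eta) dotprodC -dE; ring.
(* A shift of the free phase by [pi / 2] turns the imaginary part into another cosine integral. *)
have sC (t : R) : sin t = cos (t - pi / 2) by rewrite cosB cos_pihalf sin_pihalf; ring.
apply: complex_eqP; rewrite ?Re_mul ?Im_mul/= ?mul0r ?addr0 ?subr0.
  rewrite [RHS]mulrC -H; apply: eq_Rintegral => y _.
  by rewrite mul0r subr0 dE.
rewrite [RHS]mulrC sC -H; apply: eq_Rintegral => y _.
by rewrite mul0r addr0 dE sC addrAC.
Qed.

Lemma gkE a x : gk a x = Num.sqrt (pi / a) ^+ n * expR (- (pi ^+ 2 * dotprod x x / a)).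
Proof. by rewrite /gk /gx mulrAC. Qed.

Lemma expR_dotprod_wgt (N c : R) : 0 <= N -> 0 < c -> exists2 C : R, 0 < C &
  forall r x, 0 < r -> r^-1 ^+ n * expR (- (c * dotprod x x / r ^+ 2)) <= C * wgt r N x.
Proof.
move=> N0 c0; have [C C0 H] := poly_le_gauss N c0; exists C => // r x r0.
have rn0 : 0 <= r^-1 ^+ n by rewrite exprn_ge0// invr_ge0 ltW.
rewrite /wgt mulrCA ler_wpM2l// powRN expRN ler_pdivlMr ?powR_gt0 ?one_plus_gt0//.
rewrite ler_pdivrMl ?expR_gt0// [leRHS]mulrC.
apply: le_trans (H _ (divr_ge0 (normr_ge0 x) (ltW r0))) _.
rewrite ler_pM2l// ler_expR -mulrA ler_pM2l// expr_div_n ler_pM2r ?invr_gt0 ?exprn_gt0//.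
exact: sqr_norm_le_dotprod.
Qed.

Lemma sqrt_div_pow (a : R) : 0 < a -> Num.sqrt (pi / a) ^+ n = Num.sqrt pi ^+ n * (Num.sqrt a)^-1 ^+ n :> R.
Proof. by move=> a0; rewrite -exprMn sqrtrM ?pi_ge0// sqrtrV// ltW. Qed.

Lemma gk_le_wgt (N : R) : 0 <= N -> exists2 C : R, 0 < C &
  forall r x, 0 < r -> gk (r ^+ 2) x <= C * wgt r N x.
Proof.
move=> N0; have p20 : 0 < pi ^+ 2 :> R by rewrite exprn_gt0// pi_gt0.
have [C C0 H] := expR_dotprod_wgt N0 p20.
have q0 : 0 < Num.sqrt pi ^+ n :> R by rewrite exprn_gt0// sqrtr_gt0 pi_gt0.
exists (Num.sqrt pi ^+ n * C); first exact: mulr_gt0.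
move=> r x r0; rewrite gkE sqrt_div_pow ?exprn_gt0// sqrtr_sqr (gtr0_norm r0).
by rewrite -[leLHS]mulrA -[leRHS]mulrA ler_pM2l//; exact: H.
Qed.

Lemma expR_diff_le (A B : R) : `|expR A - expR B| <= `|A - B| * expR (Num.max A B).
Proof.
wlog AB : A B / B <= A.
  move=> H; have /orP[BA|AB] := le_total B A; first exact: H.
  by have := H _ _ AB; rewrite distrC [`|B - A|]distrC maxC.
rewrite (max_idPl AB) ger0_norm ?subr_ge0 ?ler_expR// ger0_norm ?subr_ge0//.
have := expR_ge1Dx (B - A); have := expR_gt0 A => a0.
by rewrite expRB => /(ler_wpM2l (ltW a0)); rewrite mulrCA divff ?gt_eqF//; lra.
Qed.

(** For [|x - y| >= r] the two values are bounded separately. Otherwise the exponents differ by a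
    multiple of [(x - y).(x + y) / r^2], and the factor [|x + y| / r] is absorbed by asking the
    Gaussian for one more power of decay, [N + 1]. *)
Lemma gk_increment (N : R) (ep : R) : 0 <= N -> 0 < ep <= 1 -> exists2 C : R, 0 < C &
  forall r x y, 0 < r ->
  `|gk (r ^+ 2) x - gk (r ^+ 2) y| <= C * (`|x - y| / r) `^ ep * (wgt r N x + wgt r N y).
Proof.
move=> N0 /andP[ep0 ep1]; have p20 : 0 < pi ^+ 2 :> R by rewrite exprn_gt0// pi_gt0.
have [C1 C10 H1] := gk_le_wgt N0.
have N10 : 0 <= N + 1 by lra.
have [C2 C20 H2] := gk_le_wgt N10.
pose K : R := pi ^+ 2 * n%:R * 2 * C2.
have pin0 : 0 <= pi ^+ 2 * n%:R :> R by rewrite mulr_ge0 ?ler0n ?(ltW p20).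
have K0 : 0 <= K by rewrite /K mulr_ge0 ?(ltW C20)// mulr_ge0.
exists (C1 + K); first by rewrite ltr_wpDr.
move=> r x y r0.
have wx := wgt_gt0 N x r0; have wy := wgt_gt0 N y r0.
have gx0 := gk_ge0 (r ^+ 2) x; have gy0 := gk_ge0 (r ^+ 2) y.
set del := `|x - y| / r; have del0 : 0 <= del by rewrite divr_ge0// ltW.
have [del1|del1] := lerP 1 del.
  have dep : 1 <= del `^ ep by rewrite -(powRr0 del) ler_powR// ltW.
  apply: (@le_trans _ _ (C1 * (wgt r N x + wgt r N y))).
    by have := H1 r x r0; have := H1 r y r0; rewrite ler_norml; lra.
  rewrite ler_wpM2r ?(addr_ge0 (ltW wx) (ltW wy))//.
  rewrite (le_trans (y := C1 * del `^ ep)) ?ler_peMr ?(ltW C10)//.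
  by rewrite mulrDl lerDl mulr_ge0// powR_ge0.
have depd : del <= del `^ ep.
  have [->|dn0] := eqVneq del 0; first by rewrite powR_ge0.
  have d0 : 0 < del by rewrite lt_neqAle eq_sym dn0.
  by rewrite -{1}(powRr1 del0) ger_powR// d0 ltW.
suff h : `|gk (r ^+ 2) x - gk (r ^+ 2) y| <= K * del * (wgt r N x + wgt r N y).
  apply: (le_trans h); rewrite ler_wpM2r ?addr_ge0 ?(ltW wx) ?(ltW wy)//.
  rewrite (le_trans (y := K * del `^ ep)) ?ler_wpM2l// mulrDl lerDr mulr_ge0 ?(ltW C10) ?powR_ge0//.
rewrite !gkE -mulrBr normrM ger0_norm ?exprn_ge0 ?sqrtr_ge0//.
set cst := Num.sqrt _ ^+ n; have cst0 : 0 <= cst by rewrite exprn_ge0 ?sqrtr_ge0.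
have rho x' y' : `|x' - y'| / r < 1 -> `|x' + y'| / r <= 2 * (1 + `|x'| / r).
  move=> h; rewrite -ler_pdivlMr ?invr_gt0// invrK.
  have := ler_normD (x' - (x' - y')) x'; rewrite subKr addrC => a.
  have := ler_normB x' (x' - y'); rewrite subKr; move: h a; rewrite ltr_pdivrMr// => h a b.
  rewrite (_ : 2 * _ * r = 2 * r + 2 * `|x'|); last by field; rewrite gt_eqF.
  by have := ler_normD x' y'; lra.
apply: (@le_trans _ _ (cst * (pi ^+ 2 * n%:R * del * (`|x + y| / r) *
   (expR (- (pi ^+ 2 * dotprod x x / r ^+ 2)) + expR (- (pi ^+ 2 * dotprod y y / r ^+ 2)))))).
  rewrite ler_wpM2l//; apply: le_trans (expR_diff_le _ _) _.
  rewrite ler_pM ?expR_ge0//.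
    rewrite (_ : _ - _ = - (pi ^+ 2 * (dotprod (x - y) (x + y)) / r ^+ 2)); last first.
      by rewrite dotprodBl !dotprodDr (dotprodC y x) -mulrN; ring.
    rewrite normrN 2!normrM (ger0_norm (ltW p20)) [`|(r ^+ 2)^-1|]ger0_norm ?invr_ge0 ?sqr_ge0//.
    rewrite (_ : pi ^+ 2 * n%:R * del * (`|x + y| / r) =
      pi ^+ 2 * (n%:R * (`|x - y| * `|x + y|)) / r ^+ 2); last first.
      by rewrite /del; move: (pi) => p; field; rewrite gt_eqF.
    rewrite ler_pM2r ?invr_gt0 ?exprn_gt0// ler_pM2l//; exact: normr_dotprod_le.
  by rewrite /Num.max; case: ifP => _; rewrite ?lerDl ?lerDr expR_ge0.
have half (z : X) : cst * ((1 + `|z| / r) * expR (- (pi ^+ 2 * dotprod z z / r ^+ 2))) <= C2 * wgt r N z.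
  have o0 := one_plus_gt0 z r0.
  rewrite mulrCA -gkE; apply: (@le_trans _ _ ((1 + `|z| / r) * (C2 * wgt r (N + 1) z))).
    by apply: ler_wpM2l; [exact: ltW|exact: H2].
  rewrite mulrCA ler_pM2l// /wgt opprD powRD; last by rewrite (gt_eqF o0) implybT.
  rewrite powR_inv1 ?(ltW o0)// [leLHS](_ : _ = r^-1 ^+ n * (1 + `|z| / r) `^ (- N))//.
  by rewrite mulrCA; congr (_ * _); rewrite mulrC mulfVK// gt_eqF.
have hx := half x; have hy := half y.
have rx := rho x y del1; have ry : `|x + y| / r <= 2 * (1 + `|y| / r).
  by rewrite addrC; apply: rho; rewrite distrC.
set ex := expR _ in hx *; set ey := expR _ in hy *.
have ex0 : 0 <= ex by exact: expR_ge0. have ey0 : 0 <= ey by exact: expR_ge0.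
have A1 : cst * (`|x + y| / r * ex) <= 2 * (C2 * wgt r N x).
  apply: (@le_trans _ _ (2 * (cst * ((1 + `|x| / r) * ex)))); last by rewrite ler_pM2l.
  by rewrite [leRHS]mulrCA; apply: ler_wpM2l => //; rewrite mulrA; apply: ler_wpM2r.
have A2 : cst * (`|x + y| / r * ey) <= 2 * (C2 * wgt r N y).
  apply: (@le_trans _ _ (2 * (cst * ((1 + `|y| / r) * ey)))); last by rewrite ler_pM2l.
  by rewrite [leRHS]mulrCA; apply: ler_wpM2l => //; rewrite mulrA; apply: ler_wpM2r.
have pn0 : 0 <= pi ^+ 2 * n%:R * del by rewrite mulr_ge0.
have := ler_wpM2l pn0 (lerD A1 A2).
rewrite /K; lra.
Qed.

End gauss_kernel.

Lemma normcB_real (R : realType) (a b : R) : normc (a%:C - b%:C) = `|a - b|.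
Proof. by rewrite normc_sqrt Re_add Im_add Re_opp Im_opp/= subr0 expr0n addr0 sqrtr_sqr. Qed.

Section real_integrals.
Context {R : realType} {d} {T : measurableType d} (mu : {measure set T -> \bar R}).
Implicit Types f g : T -> R.

Lemma ge0_integralrZl (k : R) f : 0 <= k -> measurable_fun [set: T] f -> (forall x, 0 <= f x) ->
  (\int[mu]_x (k * f x)%:E = k%:E * \int[mu]_x (f x)%:E)%E.
Proof.
move=> k0 mf f0; under eq_integral do rewrite EFinM.
by apply: ge0_integralZl; rewrite ?lee_fin//; [exact/measurable_EFinP|move=> x _; rewrite lee_fin].
Qed.

Lemma ge0_le_integralr f g : measurable_fun [set: T] f -> measurable_fun [set: T] g ->
  (forall x, 0 <= f x) -> (forall x, f x <= g x) ->
  (\int[mu]_x (f x)%:E <= \int[mu]_x (g x)%:E)%E.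
Proof.
move=> mf mg f0 fg; apply: ge0_le_integral => //; try exact/measurable_EFinP.
- by move=> x _; rewrite lee_fin.
- by move=> x _; rewrite lee_fin.
Qed.

Lemma ge0_integralrD f g : measurable_fun [set: T] f -> measurable_fun [set: T] g ->
  (forall x, 0 <= f x) -> (forall x, 0 <= g x) ->
  (\int[mu]_x (f x + g x)%:E = \int[mu]_x (f x)%:E + \int[mu]_x (g x)%:E)%E.
Proof.
move=> mf mg f0 g0; under eq_integral do rewrite EFinD.
by apply: ge0_integralD => //; try exact/measurable_EFinP; move=> x _; rewrite lee_fin.
Qed.

Lemma integralr_ge0 f : (forall x, 0 <= f x) -> (0 <= \int[mu]_x (f x)%:E)%E.
Proof. by move=> f0; apply: integral_ge0 => x _; rewrite lee_fin. Qed.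

End real_integrals.

Section more_cint.
Context {R : realType} {d1 d2} {T1 : measurableType d1} {T2 : measurableType d2}.
Context (m2 : {sigma_finite_measure set T2 -> \bar R}).

Lemma measurable_ge0_param (F : T1 * T2 -> \bar R) : measurable_fun [set: T1 * T2] F ->
  (forall z, 0 <= F z)%E -> measurable_fun [set: T1] (fun x => \int[m2]_y F (x, y))%E.
Proof. by move=> mF F0; exact: measurable_fun_fubini_tonelli_F. Qed.

Lemma measurable_Rintegral_param (F : T1 * T2 -> R) : measurable_fun [set: T1 * T2] F ->
  measurable_fun [set: T1] (fun x => \int[m2]_y F (x, y)).
Proof.
move=> mF; have mE : measurable_fun [set: T1 * T2] (EFin \o F) by exact/measurable_EFinP.
apply: measurableT_comp => //.
under eq_fun do rewrite integralE.
apply: emeasurable_funB.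
  rewrite (_ : (fun x => _) = (fun x => \int[m2]_y ((EFin \o F)^\+ (x, y)))%E).
    exact: (measurable_ge0_param (measurable_funepos mE) (fun z => funepos_ge0 _ z)).
  by apply/funext => x; apply: eq_integral => y _; rewrite !funeposE.
rewrite (_ : (fun x => _) = (fun x => \int[m2]_y ((EFin \o F)^\- (x, y)))%E).
  exact: (measurable_ge0_param (measurable_funeneg mE) (fun z => funeneg_ge0 _ z)).
by apply/funext => x; apply: eq_integral => y _; rewrite !funenegE.
Qed.

Lemma cmeas_param (F : T1 * T2 -> R[i]) : cmeas F ->
  cmeas (fun x => cint m2 (fun y => F (x, y))).
Proof.
by move=> [F1 F2]; split => /=; [exact: measurable_Rintegral_param F1|exact: measurable_Rintegral_param F2].
Qed.

End more_cint.

(** * Superpositions of plane waves *)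

Section wave.
Context {R : realType} {n : nat}.
Local Notation X := 'rV[R]_n.
Local Notation mu := (lebesgue_rV R n).
Implicit Types (m : X -> R) (x y xi : X).

Definition symbol m := measurable_fun [set: X] m /\
  exists C k, 0 <= C /\ forall xi, `|m xi| <= C * (1 + `|xi|) ^+ k.

Lemma one_plus_norm_ge1 (xi : X) : 1 <= 1 + `|xi|.
Proof. by rewrite lerDl. Qed.

Lemma symbol_bounded m (C : R) : measurable_fun [set: X] m -> (forall xi, `|m xi| <= C) -> symbol m.
Proof.
move=> mm mC; split=> //; exists C, 0%N; split=> [|xi]; last by rewrite expr0 mulr1.
exact: le_trans (mC 0).
Qed.

Lemma symbolM m1 m2 : symbol m1 -> symbol m2 -> symbol (fun xi => m1 xi * m2 xi).
Proof.
move=> [mm1 [C1 [k1 [C10 h1]]]] [mm2 [C2 [k2 [C20 h2]]]]; split; first exact: measurable_funM.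
exists (C1 * C2), (k1 + k2)%N; split=> [|xi]; first by rewrite mulr_ge0.
by rewrite normrM exprD mulrACA ler_pM.
Qed.

Lemma symbolX m k : symbol m -> symbol (fun xi => m xi ^+ k).
Proof.
move=> sm; elim: k => [|k ih].
  by apply: (@symbol_bounded _ 1) => [|xi]; [exact: measurable_cst|rewrite expr0 normr1].
by under eq_fun do rewrite exprS; exact: symbolM.
Qed.

Section fixed_wave.
Context {d} {T : measurableType d} (rho : {sigma_finite_measure set T -> \bar R}) (Z : T -> X).
Implicit Types phi : T -> R[i].

(** Moments of every order are required so that densities are stable under multiplication by a
    [symbol], which may grow polynomially. *)
Definition wave phi := [/\ measurable_fun [set: T] Z, cmeas phi &
  forall k, (\int[rho]_w ((1 + `|Z w|) ^+ k * normc (phi w))%:E < +oo)%E].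

Definition wv phi x := cint rho (fun w => phi w * cis (2 * pi * dotprod x (Z w))).

Lemma wave_moment phi k : wave phi ->
  measurable_fun [set: T] (fun w => (1 + `|Z w|) ^+ k * normc (phi w)).
Proof.
move=> [mZ mphi _]; apply: measurable_funM; last exact: measurable_normc.
by apply: measurable_funX; apply: measurable_funD => //; exact: measurable_rV_norm.
Qed.

Lemma waveM m phi : symbol m -> wave phi -> wave (fun w => (m (Z w))%:C * phi w).
Proof.
move=> [mm [C [k0 [C0 h]]]] wp; have [mZ mphi hp] := wp.
have mp : cmeas (fun w => (m (Z w))%:C * phi w).
  by apply: cmeasM => //; apply: cmeas_real; exact: measurableT_comp mm mZ.
split=> // k.
apply: (@le_lt_trans _ _ (\int[rho]_w (C%:E * ((1 + `|Z w|) ^+ (k + k0) * normc (phi w))%:E))%E).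
  apply: ge0_le_integral => //.
  - by move=> w _; rewrite lee_fin; apply: mulr_ge0; [exact: exprn_ge0|exact: normc_ge0].
  - apply/measurable_EFinP; apply: measurable_funM; last exact: measurable_normc.
    by apply: measurable_funX; apply: measurable_funD => //; exact: measurable_rV_norm.
  - by apply: measurable_funeM; apply/measurable_EFinP; exact: wave_moment.
  - move=> w _; rewrite -EFinM lee_fin normcM normc_real exprD -[X in C * X]mulrA [leRHS]mulrCA.
    apply: ler_wpM2l; first exact: exprn_ge0.
    by rewrite mulrA; apply: ler_wpM2r; [exact: normc_ge0|exact: h].
rewrite ge0_integralZl//; last 2 first.
- by apply/measurable_EFinP; exact: wave_moment.
- by move=> w _; rewrite lee_fin; apply: mulr_ge0; [exact: exprn_ge0|exact: normc_ge0].
rewrite lte_mul_pinfty// ge0_fin_numE//.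
Qed.

Lemma wave_int phi : wave phi -> cintegrable rho phi.
Proof.
move=> [_ mphi hp]; split => //; have := hp 0%N.
by congr (_ < _)%E; apply: eq_integral => w _; rewrite expr0 mul1r.
Qed.

Lemma cmeas_wv_integrand phi : wave phi ->
  cmeas (fun z : X * T => phi z.2 * cis (2 * pi * dotprod z.1 (Z z.2))).
Proof.
move=> [mZ mphi _]; apply: cmeasM; first exact: cmeas_comp mphi measurable_snd.
apply: cmeas_cis; apply: measurable_funM => //; apply: measurable_dotprod => //.
exact: measurableT_comp mZ measurable_snd.
Qed.

Lemma cmeas_wv phi : wave phi -> cmeas (wv phi).
Proof. by move=> wp; exact: cmeas_param (cmeas_wv_integrand wp). Qed.

Lemma measurable_normc_wv phi dd (U : measurableType dd) (f : U -> X) : wave phi ->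
  measurable_fun [set: U] f -> measurable_fun [set: U] (fun u => normc (wv phi (f u))).
Proof. by move=> wp mf; apply: measurable_normc; exact: cmeas_comp (cmeas_wv wp) mf. Qed.

Lemma wave_cis_int phi x : wave phi ->
  cintegrable rho (fun w => phi w * cis (2 * pi * dotprod x (Z w))).
Proof.
move=> wp; have [mZ mphi _] := wp; have [_ foo] := wave_int wp.
apply: (cintegrable_le (u := fun w => normc (phi w))) => //.
- apply: cmeasM => //; apply: cmeas_cis; apply: measurable_funM => //.
  exact: measurable_dotprod.
- exact: measurable_normc.
- by move=> w; rewrite normcM normc_cis mulr1.
Qed.

Lemma wv_bounded phi : wave phi -> exists j : R, forall x, normc (wv phi x) <= j.
Proof.
move=> wp; have [_ foo] := wave_int wp.
exists (fine (\int[rho]_w (normc (phi w))%:E)) => x.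
rewrite -lee_fin fineK; last first.
  by rewrite ge0_fin_numE// integral_ge0// => w _; rewrite lee_fin normc_ge0.
apply: le_trans (normc_cint (wave_cis_int x wp)) _.
by under eq_integral do rewrite normcM normc_cis mulr1.
Qed.

End fixed_wave.

(* The domination is required on superpositions of plane waves over arbitrary parameter spaces: on
   [X * X] with [Z z = z.1 + z.2] it covers bilinear multipliers. *)
Definition FB m (W : X -> R) := forall d (T : measurableType d)
  (rho : {sigma_finite_measure set T -> \bar R}) (Z : T -> X) (phi : T -> R[i]) x,
  wave rho Z phi ->
  ((normc (wv rho Z (fun w => (m (Z w))%:C * phi w) x))%:E <=
   \int[mu]_y (W (x - y) * normc (wv rho Z phi y))%:E)%E.

(** Fubini turns the multiplier into convolution with [K]; the free phase [th] receives the phase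
    [2 pi x.Z(w)] of the plane wave at [x]. *)
Lemma FB_kernel (K : X -> R) m : measurable_fun [set: X] K ->
  (\int[mu]_x (`|K x|)%:E < +oo)%E ->
  (forall th xi, cint mu (fun y => (K y)%:C * cis (th - 2 * pi * dotprod y xi)) = (m xi)%:C * cis th) ->
  FB m (fun x => `|K x|).
Proof.
move=> mK Koo Km d T rho Z phi x wp; have [mZ mphi _] := wp.
have Ki : cintegrable mu (fun y => (K y)%:C).
  split; first exact: cmeas_real.
  by under eq_integral do rewrite normc_real.
have mF : cmeas (fun z : X * T => ((K z.1)%:C * phi z.2) * cis (2 * pi * dotprod (x - z.1) (Z z.2))).
  apply: cmeasM; first apply: cmeasM.
  - by apply: cmeas_real; exact: measurableT_comp mK measurable_fst.
  - exact: cmeas_comp mphi measurable_snd.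
  - apply: cmeas_cis; apply: measurable_funM => //; apply: measurable_dotprod.
      by apply: measurable_rVB => //; exact: measurable_cst.
    exact: measurableT_comp mZ measurable_snd.
have Fi : cintegrable (mu \x rho)%E (fun z : X * T => ((K z.1)%:C * phi z.2) * cis (2 * pi * dotprod (x - z.1) (Z z.2))).
  apply: (cintegrable_tensor Ki (wave_int wp)) => // z.
  by rewrite normcM normc_cis mulr1 normcM.
have eqw : wv rho Z (fun w => (m (Z w))%:C * phi w) x =
    cint mu (fun y => (K y)%:C * wv rho Z phi (x - y)).
  rewrite /wv; transitivity (cint rho (fun w => cint mu (fun y => ((K y)%:C * phi w) * cis (2 * pi * dotprod (x - y) (Z w))))).
    apply: eq_cint => w.
    rewrite mulrAC -Km mulrC -cintZ; last first.
      apply: (cintegrable_le (u := fun y => `|K y|)) => //.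
      - apply: cmeasM; first exact: cmeas_real.
        apply: cmeas_cis; apply: measurable_funB => //; apply: measurable_funM => //.
        exact: measurable_dotprod.
      - exact: measurableT_comp.
      - by move=> y; rewrite normcM normc_cis mulr1 normc_real.
    by apply: eq_cint => y; rewrite dotprodBl mulrBr mulrA (mulrC (phi w)).
  rewrite -(cint_fubini Fi); apply: eq_cint => y.
  rewrite -cintZ; last exact: wave_cis_int.
  by apply: eq_cint => w; rewrite mulrA.
rewrite eqw; apply: le_trans (normc_cint _) _.
  have [j jE] := wv_bounded wp.
  apply: (cintegrable_le (u := fun y => `|K y| * j)) => //.
  - apply: cmeasM; first exact: cmeas_real.
    by apply: cmeas_comp (cmeas_wv wp) _; apply: measurable_rVB.
  - by apply: measurable_funM => //; exact: measurableT_comp.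
  - by move=> y; rewrite normcM normc_real; apply: ler_wpM2l.
  - have j0 : 0 <= j by apply: le_trans (jE 0); exact: normc_ge0.
    under eq_integral do rewrite mulrC.
    rewrite ge0_integralrZl//; last exact: measurableT_comp.
    by rewrite lte_mul_pinfty.
under eq_integral do rewrite normcM normc_real.
rewrite -(ge0_integral_rV_flip x)//.
- by rewrite le_eqVlt; apply/orP; left; apply/eqP; apply: eq_integral => y _; rewrite subKr.
- apply/measurable_EFinP; apply: measurable_funM.
    apply: (measurableT_comp (f := @Num.norm R R)) => //; apply: measurableT_comp mK _.
    exact: measurable_rVB.
  apply: measurable_normc_wv => //; apply: measurable_rVB => //.
- by move=> y; rewrite lee_fin; apply: mulr_ge0 => //; exact: normc_ge0.
Qed.

Lemma FB_mono m W W' : FB m W -> measurable_fun [set: X] W -> measurable_fun [set: X] W' ->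
  (forall x, 0 <= W x) -> (forall x, W x <= W' x) -> FB m W'.
Proof.
move=> H mW mW' W0 WW' d T rho Z phi x wp; apply: le_trans (H _ _ _ _ _ x wp) _.
apply: ge0_le_integral => //.
- by move=> y _; rewrite lee_fin; apply: mulr_ge0 => //; exact: normc_ge0.
- apply/measurable_EFinP; apply: measurable_funM; last exact: measurable_normc_wv.
  by apply: measurableT_comp mW _; exact: measurable_rVB.
- apply/measurable_EFinP; apply: measurable_funM; last exact: measurable_normc_wv.
  by apply: measurableT_comp mW' _; exact: measurable_rVB.
- by move=> y _; rewrite lee_fin; apply: ler_wpM2r => //; exact: normc_ge0.
Qed.

(** [wgt_conv_pt] integrated over the middle point [v]: the two weights left over have bounded
    integrals. *)
Lemma wgt_smooth (N : R) : n%:R < N -> exists2 C : R, 0 < C &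
  forall r s (psi : X -> R) x, 0 < r -> r <= s -> measurable_fun [set: X] psi -> (forall y, 0 <= psi y) ->
  (\int[mu]_v ((wgt r N (x - v))%:E * \int[mu]_y (wgt s N (v - y) * psi y)%:E) <=
   C%:E * \int[mu]_y (wgt s N (x - y) * psi y)%:E)%E.
Proof.
move=> nN; have [C C0 H] := wgt_integral_le nN.
have q0 : 0 < 4 `^ N :> R by rewrite powR_gt0.
exists (4 `^ N * (C + C)) => [|r s psi x r0 rs mpsi p0]; first by rewrite mulr_gt0// addr_gt0.
have s0 := lt_le_trans r0 rs.
have mw (t : R) dd (U : measurableType dd) (f g : U -> X) : measurable_fun [set: U] f ->
    measurable_fun [set: U] g -> measurable_fun [set: U] (fun u => wgt t N (f u - g u)).
  by move=> mf mg; apply: measurable_wgt; exact: measurable_rVB.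
have mpsi2 : measurable_fun [set: X * X] (fun z => psi z.2).
  exact: measurableT_comp mpsi measurable_snd.
pose F (z : X * X) := (wgt r N (x - z.1) * (wgt s N (z.1 - z.2) * psi z.2))%:E.
have mF : measurable_fun [set: X * X] F.
  apply/measurable_EFinP; apply: measurable_funM; first by apply: mw => //; exact: measurable_cst.
  by apply: measurable_funM => //; apply: mw => //.
have F0 z : (0 <= F z)%E.
  by rewrite lee_fin; apply: mulr_ge0; [exact: wgt_ge0|apply: mulr_ge0 => //; exact: wgt_ge0].
rewrite [leLHS](_ : _ = \int[mu]_v \int[mu]_y F (v, y))%E; last first.
  apply: eq_integral => v _; rewrite -ge0_integralZl//.
  - apply/measurable_EFinP; apply: measurable_funM => //; apply: mw => //; exact: measurable_cst.
  - by move=> y _; rewrite lee_fin; apply: mulr_ge0 => //; exact: wgt_ge0.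
  - by rewrite lee_fin wgt_ge0.
rewrite (fubini_tonelli _ mF F0).
rewrite -ge0_integralZl//; last 3 first.
- apply/measurable_EFinP; apply: measurable_funM => //; apply: mw => //; exact: measurable_cst.
- by move=> y _; rewrite lee_fin; apply: mulr_ge0 => //; exact: wgt_ge0.
- by rewrite lee_fin; apply: mulr_ge0; [exact: ltW|rewrite addr_ge0// ltW].
apply: ge0_le_integral => //.
- by move=> y _; apply: integral_ge0.
- exact: measurable_fun_fubini_tonelli_G.
- apply: measurable_funeM; apply/measurable_EFinP; apply: measurable_funM => //; apply: mw => //; exact: measurable_cst.
move=> y _.
have k0 : 0 <= 4 `^ N * (wgt s N (x - y) * psi y).
  by apply: mulr_ge0; [exact: ltW|apply: mulr_ge0 => //; exact: wgt_ge0].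
have mwv t (z : X) : measurable_fun [set: X] (fun v => wgt t N (z - v)).
  by apply: mw => //; exact: measurable_cst.
apply: (@le_trans _ _ (\int[mu]_v ((4 `^ N * (wgt s N (x - y) * psi y)) * (wgt r N (x - v) + wgt s N (y - v)))%:E)%E).
  apply: ge0_le_integralr.
  - have := measurableT_comp mF (measurable_pair2 y); move/measurable_EFinP; exact.
  - by apply: measurable_funM => //; exact: measurable_funD.
  - move=> v; apply: mulr_ge0; first exact: wgt_ge0.
    by apply: mulr_ge0 => //; exact: wgt_ge0.
  - move=> v; rewrite /= -(wgtN s N (y - v)) opprB.
    have := @wgt_conv_pt R n r s N (x - y) (x - v) (v - y) r0 rs (ltW nN).
    rewrite -{1}(subrKA v x (- y)) => /(_ (ler_normD _ _)) h.
    rewrite mulrA (le_trans (ler_wpM2r (p0 y) h))//.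
    move: (4 `^ N) (wgt s N (x - y)) (wgt r N (x - v) + wgt s N (v - y)) => a b c.
    by rewrite -!mulrA (mulrC c).
rewrite ge0_integralrZl//; last 2 first.
- exact: measurable_funD.
- by move=> v; apply: addr_ge0; exact: wgt_ge0.
rewrite ge0_integralrD//; last 2 first.
- by move=> v; exact: wgt_ge0.
- by move=> v; exact: wgt_ge0.
apply: (@le_trans _ _ ((4 `^ N * (wgt s N (x - y) * psi y))%:E * (C%:E + C%:E))%E).
  by rewrite lee_wpmul2l ?lee_fin//; apply: leeD; exact: H.
rewrite -EFinD -!EFinM lee_fin.
by move: (4 `^ N) (wgt s N (x - y) * psi y) => a b; rewrite mulrAC.
Qed.

Lemma FB_comp (N : R) : n%:R < N -> exists2 C : R, 0 < C &
  forall r m1 m2 (C1 C2 : R), 0 < r -> 0 <= C1 -> 0 <= C2 -> symbol m2 ->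
  FB m1 (fun x => C1 * wgt r N x) -> FB m2 (fun x => C2 * wgt r N x) ->
  FB (fun xi => m1 xi * m2 xi) (fun x => C * C1 * C2 * wgt r N x).
Proof.
move=> nN; have [C C0 H] := wgt_smooth nN; exists C; first exact: C0.
move=> r m1 m2 C1 C2 r0 C10 C20 s2 h1 h2.
move=> d T rho Z phi x wp.
have wp2 := waveM s2 wp.
rewrite (_ : wv _ _ _ _ = wv rho Z (fun w => (m1 (Z w))%:C * ((m2 (Z w))%:C * phi w)) x); last first.
  by apply: eq_cint => w; rewrite rmorphM/= !mulrA.
apply: le_trans (h1 _ _ _ _ _ x wp2) _.
have mwv y : measurable_fun [set: X] (fun v => wgt r N (y - v) * normc (wv rho Z phi v)).
  apply: measurable_funM; last exact: measurable_normc_wv.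
  by apply: measurable_wgt; exact: measurable_rVB.
have wv0 y v : (0 <= (wgt r N (y - v) * normc (wv rho Z phi v))%:E)%E.
  by rewrite lee_fin; apply: mulr_ge0; [exact: wgt_ge0|exact: normc_ge0].
have mI : measurable_fun [set: X] (fun v : X => \int[mu]_y (wgt r N (v - y) * normc (wv rho Z phi y))%:E)%E.
  have mG : measurable_fun [set: X * X] (fun z : X * X => (wgt r N (z.1 - z.2) * normc (wv rho Z phi z.2))%:E).
    apply/measurable_EFinP; apply: measurable_funM.
      by apply: measurable_wgt; exact: measurable_rVB.
    exact: measurable_normc_wv.
  exact: (measurable_ge0_param mu mG (fun z => wv0 z.1 z.2)).
have nwv0 y : 0 <= normc (wv rho Z phi y) by exact: normc_ge0.
have C120 : (0 <= (C1 * C2)%:E :> \bar R)%E by rewrite lee_fin mulr_ge0.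
apply: (@le_trans _ _ (\int[mu]_v ((C1 * C2)%:E * ((wgt r N (x - v))%:E * \int[mu]_y (wgt r N (v - y) * normc (wv rho Z phi y))%:E)))%E).
  apply: ge0_le_integral => //.
  - by move=> y _; rewrite lee_fin; apply: mulr_ge0; [apply: mulr_ge0 => //; exact: wgt_ge0|exact: normc_ge0].
  - apply/measurable_EFinP; apply: measurable_funM; last exact: measurable_normc_wv.
    by apply: measurable_funM => //; apply: measurable_wgt; exact: measurable_rVB.
  - apply: measurable_funeM; apply: emeasurable_funM => //; apply/measurable_EFinP.
    by apply: measurable_wgt; exact: measurable_rVB.
  move=> v _; rewrite EFinM.
  apply: (@le_trans _ _ ((C1 * wgt r N (x - v))%:E * (C2%:E * \int[mu]_y (wgt r N (v - y) * normc (wv rho Z phi y))%:E))%E).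
    apply: lee_wpmul2l; first by rewrite lee_fin; apply: mulr_ge0 => //; exact: wgt_ge0.
    apply: le_trans (h2 _ _ _ _ _ v wp) _.
    under eq_integral do rewrite -mulrA.
    by rewrite ge0_integralrZl// => y; apply: mulr_ge0 => //; exact: wgt_ge0.
  by rewrite !muleA -!EFinM mulrAC.
rewrite ge0_integralZl//; last 2 first.
- apply: emeasurable_funM => //; apply/measurable_EFinP.
  by apply: measurable_wgt; exact: measurable_rVB.
- by move=> v _; apply: mule_ge0; [rewrite lee_fin wgt_ge0|exact: integral_ge0].
apply: le_trans (lee_wpmul2l C120 (H r r _ x r0 (lexx r) (measurable_normc_wv wp (@measurable_id _ _ setT)) nwv0)) _.
rewrite muleA -EFinM -ge0_integralZl//; last 2 first.
- exact/measurable_EFinP.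
- by rewrite lee_fin mulr_ge0 ?mulr_ge0// ltW.
rewrite le_eqVlt; apply/orP; left; apply/eqP; apply: eq_integral => y _.
rewrite -EFinM; congr EFin; move: (wgt _ _ _) (normc _) => p q; ring.
Qed.

(** Symbols converging at rate [t], up to a factor [M] of polynomial growth, give converging waves,
    because [M] times the density is integrable. *)
Lemma FB_lim (m M : X -> R) (m_ : R -> X -> R) (W : X -> R) (a : R) : 0 < a ->
  symbol m -> symbol M -> (forall t, 0 < t <= a -> symbol (m_ t)) ->
  (forall t xi, 0 < t <= a -> `|m xi - m_ t xi| <= t * M xi) ->
  (forall t, 0 < t <= a -> FB (m_ t) W) -> FB m W.
Proof.
move=> a0 sm sM sm_ hM hW d T rho Z phi x wp.
have [mZ mphi _] := wp.
have wm := waveM sm wp; have [mwM wMoo] := wave_int (waveM sM wp).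
set J := (\int[rho]_w _)%E in wMoo.
have J0 : (0 <= J)%E by apply: integral_ge0 => w _; rewrite lee_fin normc_ge0.
have [j jE] : exists j : R, J = j%:E by exists (fine J); rewrite fineK// ge0_fin_numE.
have j0 : 0 <= j by rewrite -lee_fin -jE.
apply/lee_addgt0Pr => e e0.
pose t := Num.min a (e / (j + 1)).
have t0 : 0 < t by rewrite lt_min a0 divr_gt0// ltr_wpDl.
have ta : 0 < t <= a by rewrite t0 ge_min lexx.
have wmt := waveM (sm_ t ta) wp.
apply: (@le_trans _ _ ((normc (wv rho Z (fun w => (m_ t (Z w))%:C * phi w) x))%:E + (t * j)%:E)%E); last first.
  apply: leeD; first exact: hW.
  rewrite lee_fin; apply: (@le_trans _ _ (e / (j + 1) * j)).
    by apply: ler_wpM2r => //; rewrite ge_min lexx orbT.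
  by rewrite mulrAC ler_pdivrMr ?ltr_wpDl// ler_pM2l//; lra.
rewrite -EFinD lee_fin -lerBlDl.
set z1 := wv _ _ _ x; set z2 := wv _ _ _ x.
apply: (@le_trans _ _ (normc (z1 - z2))).
  by rewrite lerBlDl -{1}(subrK z2 z1) addrC normcD_le.
rewrite /z1 /z2 /wv -cintB; [|exact: wave_cis_int|exact: wave_cis_int].
rewrite -lee_fin; apply: le_trans (normc_cint _) _.
  by apply: cintegrableB; exact: wave_cis_int.
rewrite EFinM -jE -ge0_integralZl//; last 3 first.
- by apply/measurable_EFinP; exact: measurable_normc.
- by move=> w _; rewrite lee_fin normc_ge0.
- by rewrite lee_fin ltW.
apply: ge0_le_integral => //.
- by move=> w _; rewrite lee_fin normc_ge0.
- apply/measurable_EFinP; apply: measurable_normc.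
  by apply: cmeasB; [exact: (wave_cis_int x wm).1|exact: (wave_cis_int x wmt).1].
- by apply: measurable_funeM; apply/measurable_EFinP; exact: measurable_normc.
move=> w _; rewrite -EFinM lee_fin -mulrBl -mulrBl normcM normc_cis mulr1 !normcM mulrA.
apply: ler_wpM2r; first exact: normc_ge0.
rewrite normcB_real normc_real (le_trans (hM t (Z w) ta))// ler_pM2l//; exact: ler_norm.
Qed.

(** Minkowski's inequality for a symbol that is a superposition of the [M v]. As [M >= 0], absolute
    integrability of the double integral follows from that of [m] times the density. *)
Lemma FB_int (M : R -> X -> R) m (c : R -> R) (c' : R) (W : X -> R) :
  measurable_fun [set: (measurableTypeR R * X)%type] (fun z : measurableTypeR R * X => M z.1 z.2) -> (forall v xi, 0 <= M v xi) ->
  (forall v, symbol (M v)) ->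
  (forall xi, (\int[lebesgue_measure]_v (M v xi)%:E = (m xi)%:E)%E) -> symbol m ->
  measurable_fun [set: R] c -> (forall v, 0 <= c v) ->
  (\int[lebesgue_measure]_v (c v)%:E <= c'%:E)%E ->
  measurable_fun [set: X] W -> (forall x, 0 <= W x) ->
  (forall v, FB (M v) (fun x => c v * W x)) -> FB m (fun x => c' * W x).
Proof.
move=> mM M0 sM Mm sm mc c0 cc' mW W0 hM d T rho Z phi x wp.
have [mZ mphi _] := wp; have wm := waveM sm wp.
have mMZ : measurable_fun [set: (measurableTypeR R * T)%type] (fun z : measurableTypeR R * T => M z.1 (Z z.2)).
  apply: (measurableT_comp mM (g := fun z : measurableTypeR R * T => (z.1, Z z.2) : measurableTypeR R * X)).
  by apply/measurable_fun_pair => //; exact: measurableT_comp mZ measurable_snd.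
have mF : cmeas (fun z : measurableTypeR R * T => ((M z.1 (Z z.2))%:C * phi z.2) * cis (2 * pi * dotprod x (Z z.2))).
  apply: cmeasM; first apply: cmeasM.
  - exact: cmeas_real.
  - exact: cmeas_comp mphi measurable_snd.
  - apply: cmeas_cis; apply: measurable_funM => //; apply: measurable_dotprod; first exact: measurable_cst.
    exact: measurableT_comp mZ measurable_snd.
have m0 xi : 0 <= m xi by rewrite -lee_fin -Mm; apply: integral_ge0 => v _; rewrite lee_fin.
have mMv xi : measurable_fun [set: R] (fun v => M v xi).
  exact: measurableT_comp mM (measurable_pair2 _).
have c'0 : 0 <= c' by rewrite -lee_fin; apply: le_trans cc'; apply: integral_ge0 => v _; rewrite lee_fin.
have Fi : cintegrable (lebesgue_measure \x rho)%E (fun z : measurableTypeR R * T => ((M z.1 (Z z.2))%:C * phi z.2) * cis (2 * pi * dotprod x (Z z.2))).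
  split=> //; rewrite fubini_tonelli2//; last 2 first.
  - by apply/measurable_EFinP; exact: measurable_normc.
  - by move=> z; rewrite lee_fin normc_ge0.
  have [_] := wave_int wm; apply: le_lt_trans.
  rewrite le_eqVlt; apply/orP; left; apply/eqP; apply: eq_integral => w _.
  rewrite /fubini_G/=; under eq_integral do rewrite 2!normcM normc_cis mulr1 normc_real ger0_norm// mulrC.
  rewrite ge0_integralrZl; [|exact: normc_ge0|exact: mMv|by move=> v; exact: M0].
  rewrite normcM normc_real ger0_norm// mulrC EFinM.
  congr (_ * _)%E; exact: Mm.
have Mi xi : cintegrable lebesgue_measure (fun v : measurableTypeR R => (M v xi)%:C).
  split; first exact: (cmeas_real (mMv xi)).
  rewrite (_ : (\int[_]_v _)%E = (m xi)%:E) ?ltry// -Mm.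
  by apply: eq_integral => v _; rewrite normc_real ger0_norm.
have eqw : wv rho Z (fun w => (m (Z w))%:C * phi w) x =
    cint lebesgue_measure (fun v : measurableTypeR R => wv rho Z (fun w => (M v (Z w))%:C * phi w) x).
  rewrite {2}/wv (cint_fubini Fi); apply: eq_cint => w /=.
  transitivity (cint lebesgue_measure (fun v : measurableTypeR R => (phi w * cis (2 * pi * dotprod x (Z w))) * (M v (Z w))%:C)).
    rewrite cintZ// -mulrA mulrC; congr (_ * _).
    by apply: complex_eqP => /=; rewrite /Rintegral ?Mm//= integral0.
  by apply: eq_cint => v; rewrite mulrC mulrA.
have mwv : cmeas (fun v : measurableTypeR R => wv rho Z (fun w => (M v (Z w))%:C * phi w) x).
  exact: cmeas_param mF.
rewrite eqw; apply: le_trans (normc_cint _) _.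
  split=> //; have [_] := Fi; rewrite fubini_tonelli1//; last 2 first.
  - by apply/measurable_EFinP; exact: measurable_normc.
  - by move=> z; rewrite lee_fin normc_ge0.
  apply: le_lt_trans; apply: ge0_le_integral => //.
  - by move=> v _; rewrite lee_fin normc_ge0.
  - by apply/measurable_EFinP; exact: measurable_normc.
  - apply: measurable_fun_fubini_tonelli_F => //.
    by apply/measurable_EFinP; exact: measurable_normc.
  - by move=> z; rewrite lee_fin normc_ge0.
  by move=> v _; exact: normc_cint (wave_cis_int x (waveM (sM v) wp)).
set I := (\int[mu]_y (W (x - y) * normc (wv rho Z phi y))%:E)%E.
have mI : measurable_fun [set: X] (fun y => W (x - y) * normc (wv rho Z phi y)).
  apply: measurable_funM; last exact: measurable_normc_wv.
  by apply: measurableT_comp mW _; exact: measurable_rVB.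
have I0' y : (0 <= (W (x - y) * normc (wv rho Z phi y))%:E)%E.
  by rewrite lee_fin; apply: mulr_ge0 => //; exact: normc_ge0.
have I0 : (0 <= I)%E by exact: integral_ge0.
apply: (@le_trans _ _ (\int[lebesgue_measure]_v ((c v)%:E * I))%E).
  apply: ge0_le_integral => //.
  - by move=> v _; rewrite lee_fin normc_ge0.
  - by apply/measurable_EFinP; exact: measurable_normc.
  - by apply: emeasurable_funM => //; exact/measurable_EFinP.
  move=> v _; apply: le_trans (hM v _ _ _ _ _ x wp) _.
  rewrite -ge0_integralZl//; last 2 first.
  - exact/measurable_EFinP.
  - by rewrite lee_fin.
  by rewrite le_eqVlt; apply/orP; left; apply/eqP; apply: eq_integral => y _; rewrite -mulrA EFinM.
rewrite ge0_integralZr//; last 2 first.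
- exact/measurable_EFinP.
- by move=> v _; rewrite lee_fin.
apply: (@le_trans _ _ (c'%:E * I)%E); first exact: lee_wpmul2r.
rewrite -ge0_integralZl//; last exact/measurable_EFinP.
by rewrite le_eqVlt; apply/orP; left; apply/eqP; apply: eq_integral => y _; rewrite -EFinM mulrA.
Qed.

End wave.

(** * Fractional powers of the Laplacian *)

Section line_integrals.
Context {R : realType}.
Local Notation leb := (@lebesgue_measure R).

Lemma ge0_integral_shift (c : R) (f : R -> \bar R) :
  measurable_fun [set: R] f -> (forall x, 0 <= f x)%E ->
  (\int[leb]_x f (x + c)%R = \int[leb]_x f x)%E.
Proof.
move=> mf f0; rewrite -(ge0_integral_flip 0 (f := fun x => f (x + c)))//.
  rewrite -[RHS](ge0_integral_flip c)//; apply: eq_integral => x _; congr f; ring.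
by apply: measurableT_comp mf _; exact: measurable_funD.
Qed.

Lemma integral_exp_abs (c : R) : 0 < c ->
  (\int[leb]_v (expR (- (c * `|v|)))%:E <= (2 / c)%:E)%E.
Proof.
move=> c0; have me := @measurable_exponential_pdf R c.
have e0 v : 0 <= exponential_pdf c v by exact/exponential_pdf_ge0/ltW.
apply: (@le_trans _ _ (\int[leb]_v (c^-1 * (exponential_pdf c v + exponential_pdf c (0 - v)))%:E)%E).
  apply: ge0_le_integralr.
  - apply: measurableT_comp => //; apply: measurable_funN; apply: measurable_funM => //.
  - apply: measurable_funM => //; apply: measurable_funD => //.
    by apply: measurableT_comp me _; exact: measurable_funB.
  - by move=> v; exact: expR_ge0.
  - move=> v; rewrite mulrDr sub0r; have [v0|v0] := lerP 0 v.
      rewrite (ger0_norm v0) (exponential_pdfE _ v0) mulrA mulVf ?gt_eqF// mul1r mulNr lerDl.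
      by apply: mulr_ge0 => //; rewrite invr_ge0 ltW.
    have v0' : 0 <= - v by rewrite oppr_ge0 ltW.
    rewrite (ltr0_norm v0) (exponential_pdfE _ v0') [c^-1 * (c * _)]mulrA mulVf ?gt_eqF// mul1r mulNr lerDr.
    by apply: mulr_ge0 => //; rewrite invr_ge0 ltW.
rewrite ge0_integralrZl//; last 3 first.
- by rewrite invr_ge0 ltW.
- by apply: measurable_funD => //; apply: measurableT_comp me _; exact: measurable_funB.
- by move=> v; exact: addr_ge0.
rewrite ge0_integralrD//; last by apply: measurableT_comp me _; exact: measurable_funB.
rewrite (ge0_integral_flip 0 (f := fun v => (exponential_pdf c v)%:E))//; last exact/measurable_EFinP.
by rewrite integral_exponential_pdf// -EFinD -EFinM lee_fin mulrC.
Qed.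

(* the logarithmic substitution [u = e^v] turns Euler's integral for [Gamma b] into this one *)
Definition eulerG (b : R) : R := \int[leb]_v (expR (b * v) * expR (- expR v)).

(** In the variable [u = e^v] its integral is a Beta integral, finite for [0 < b < k]. *)
Definition logistic (b k : R) (v : R) : R := expR (b * v) * (1 + expR v) `^ (- k).

Lemma one_plus_expR_gt0 (v : R) : 0 < 1 + expR v.
Proof. by rewrite addr_gt0// expR_gt0. Qed.

Lemma logistic_ge0 b k v : 0 <= logistic b k v.
Proof. by rewrite mulr_ge0 ?expR_ge0 ?powR_ge0. Qed.

Lemma measurable_logistic b k : measurable_fun [set: R] (logistic b k).
Proof.
apply: measurable_funM; first by apply: measurableT_comp => //; exact: measurable_funM.
apply: (measurableT_comp (f := @powR R ^~ (- k))); first exact: measurable_powR.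
exact: measurable_funD.
Qed.

Lemma integral_logistic b k : 0 < b -> b < k -> exists2 C : R, 0 < C &
  (\int[leb]_v (logistic b k v)%:E <= C%:E)%E.
Proof.
move=> b0 bk; pose c := Num.min b (k - b).
have c0 : 0 < c by rewrite lt_min b0 subr_gt0.
exists (2 / c); first exact: divr_gt0.
apply: le_trans (integral_exp_abs c0); apply: ge0_le_integralr.
- exact: measurable_logistic.
- apply: measurableT_comp => //; apply: measurable_funN; apply: measurable_funM => //.
- exact: logistic_ge0.
move=> v; rewrite /logistic; have k0 : 0 <= k by exact/ltW/(lt_trans b0).
have [v0|v0] := lerP 0 v.
  apply: (@le_trans _ _ (expR (b * v) * expR v `^ (- k))).
    apply: ler_wpM2l; first exact: expR_ge0.
    by apply: le_powRN => //; rewrite ?expR_gt0// lerDr.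
  rewrite -expRM -expRD ler_expR; have : c <= k - b by rewrite ge_min lexx orbT.
  rewrite (ger0_norm v0) => /(ler_wpM2r v0); lra.
apply: (@le_trans _ _ (expR (b * v) * 1)).
  apply: ler_wpM2l; first exact: expR_ge0.
  have h1 : (1 : R) `^ (- k) = 1 by rewrite powR1.
  by rewrite -[leRHS]h1; apply: le_powRN => //; rewrite lerDl expR_ge0.
rewrite mulr1 ler_expR; have : c <= b by rewrite ge_min lexx.
rewrite (ltr0_norm v0) => /ler_wnM2r => /(_ v (ltW v0)); lra.
Qed.

(** [poly_le_gauss] at [sqrt y]; since [1 + y <= (1 + sqrt y)^2], the exponent is [2k]. *)
Lemma powR_le_expR (k : R) : 0 <= k -> exists2 C : R, 0 < C &
  forall y, 0 <= y -> (1 + y) `^ k <= C * expR y.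
Proof.
move=> k0; have [C C0 H] := poly_le_gauss (2 * k) (@ltr01 R); exists C => // y y0.
have := H _ (sqrtr_ge0 y); rewrite mul1r sqr_sqrtr//; apply: le_trans.
have s0 := sqrtr_ge0 y; rewrite powRrM powR_mulrn ?addr_ge0//.
apply: ge0_ler_powR => //; rewrite ?nnegrE ?exprn_ge0 ?addr_ge0//.
rewrite -{1}(sqr_sqrtr y0) sqrrD expr1n mul1r lerD2r lerDl mulrn_wge0//.
Qed.

Lemma measurable_eulerG_integrand (b c : R) :
  measurable_fun [set: R] (fun v => expR (b * v) * expR (- (c * expR v))).
Proof.
apply: measurable_funM; first by apply: measurableT_comp => //; exact: measurable_funM.
apply: measurableT_comp => //; apply: measurable_funN; apply: measurable_funM => //.
Qed.

Lemma integral_eulerG (b : R) : 0 < b ->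
  (\int[leb]_v (expR (b * v) * expR (- expR v))%:E = (eulerG b)%:E)%E /\ 0 < eulerG b.
Proof.
move=> b0; have b20 : 0 <= b + 1 by lra.
have [C C0 HC] := powR_le_expR b20.
have bb : b < b + 1 by lra.
have [D D0 HD] := integral_logistic b0 bb.
have m2 : measurable_fun [set: R] (fun v : R => expR (b * v) * expR (- expR v)).
  by have := measurable_eulerG_integrand b 1; under eq_fun do rewrite mul1r.
have p0 (v : R) : 0 <= expR (b * v) * expR (- expR v) by rewrite mulr_ge0 ?expR_ge0.
have foo : (\int[leb]_v (expR (b * v) * expR (- expR v))%:E < +oo)%E.
  apply: (@le_lt_trans _ _ (\int[leb]_v (C * logistic b (b + 1) v)%:E)%E).
    apply: ge0_le_integralr => //; first by apply: measurable_funM => //; exact: measurable_logistic.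
    move=> v; rewrite /logistic mulrCA; apply: ler_wpM2l; first exact: expR_ge0.
    rewrite expRN powRN ler_pdivlMr ?powR_gt0 ?one_plus_expR_gt0// mulrC ler_pdivrMr ?expR_gt0//.
    exact/HC/expR_ge0.
  rewrite ge0_integralrZl ?(ltW C0)//; [|exact: measurable_logistic|exact: logistic_ge0].
  by apply: le_lt_trans (lee_wpmul2l _ HD) _; rewrite ?lee_fin ?(ltW C0)// -EFinM ltry.
have i0 : (0 <= \int[leb]_v (expR (b * v) * expR (- expR v))%:E)%E by exact: integralr_ge0.
have fE : (\int[leb]_v (expR (b * v) * expR (- expR v))%:E = (eulerG b)%:E)%E.
  by rewrite /eulerG /Rintegral fineK// ge0_fin_numE.
split=> //; rewrite -lte_fin -fE.
(* Positivity: on [[0, 1]] the integrand is at least [exp(-e)]. *)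
apply: (@lt_le_trans _ _ (\int[leb]_(v in `[0%R, 1%R]) (expR (- expR 1))%:E)%E).
  have h1 : leb `[0%R, 1%R]%classic = 1%E.
    by rewrite lebesgue_measure_itv/= lte_fin ltr01 oppr0 adde0.
  rewrite integral_cst// [X in (_ < _ * X)%E](_ : _ = 1%E); last exact: h1.
  by rewrite mule1 lte_fin expR_gt0.
apply: (@le_trans _ _ (\int[leb]_(v in `[0%R, 1%R]) (expR (b * v) * expR (- expR v))%:E)%E).
  apply: ge0_le_integral => //.
  - by apply/measurable_EFinP; exact: measurable_funTS.
  - move=> v /=; rewrite in_itv/= lee_fin => /andP[v0 v1].
    rewrite -[leLHS]mul1r; apply: ler_pM => //; rewrite ?expR_ge0//.
      by rewrite -expR0 ler_expR mulr_ge0// ltW.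
    by rewrite ler_expR lerN2 ler_expR.
by apply: ge0_subset_integral => //; exact/measurable_EFinP.
Qed.

(** In the logarithmic variable, multiplication by [c] is a shift by [ln c]. *)
Lemma integral_eulerG_scale (b c : R) : 0 < b -> 0 < c ->
  (\int[leb]_v (expR (b * v) * expR (- (expR v * c)))%:E = (c `^ (- b) * eulerG b)%:E)%E.
Proof.
move=> b0 c0; rewrite EFinM.
have m1 := measurable_eulerG_integrand b 1.
have m2 : measurable_fun [set: R] (fun v : R => expR (b * v) * expR (- expR v)).
  by move: m1; under eq_fun do rewrite mul1r.
have p0 (v : R) : 0 <= expR (b * v) * expR (- expR v) by rewrite mulr_ge0 ?expR_ge0.
have [<- _] := integral_eulerG b0.
rewrite -[X in (_ * X)%E](ge0_integral_shift (ln c)); last 2 first.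
- exact/measurable_EFinP.
- by move=> v; rewrite lee_fin.
rewrite -ge0_integralrZl; last 3 first.
- exact: powR_ge0.
- by apply: (measurableT_comp m2); exact: measurable_funD.
- by move=> v; exact: p0.
apply: eq_integral => v _; congr EFin.
rewrite [expR (v + _)]expRD lnK// mulrDr expRD.
rewrite (_ : expR (b * ln c) = c `^ b); last by rewrite /powR gt_eqF.
rewrite powRN; move: (powR_gt0 b c0) => cb; rewrite mulrA; congr (_ * _).
by rewrite mulrCA mulVf ?mulr1// gt_eqF.
Qed.

End line_integrals.

(** * The heat semigroup and its time derivative *)

Section heat.
Context {R : realType} {n : nat}.
Local Notation X := 'rV[R]_n.
Local Notation mu := (lebesgue_rV R n).
Implicit Types (x y xi : X) (a e r : R).

(** [e = 0] is the Riesz case and [e = 1] the Bessel case; with [e >= 0] as a parameter both are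
    treated at once, with constants uniform in [e]. *)
Definition lap e xi : R := e + dotprod xi xi.

Lemma lap_ge0 e xi : 0 <= e -> 0 <= lap e xi.
Proof. by move=> e0; rewrite addr_ge0// dotprod_ge0. Qed.

Lemma measurable_lap e : measurable_fun [set: X] (lap e).
Proof. by apply: measurable_funD => //; exact: measurable_dotprod. Qed.

Lemma symbol_lap e : 0 <= e -> symbol (lap e).
Proof.
move=> e0; split; first exact: measurable_lap.
exists (e + n%:R), 2%N; split=> [|xi]; first by rewrite addr_ge0.
rewrite ger0_norm ?lap_ge0// mulrDl; apply: lerD.
  by rewrite ler_peMr// exprn_ege1// one_plus_norm_ge1.
apply: (le_trans (dotprod_le_sqr_norm xi)); apply: ler_wpM2l => //.
by rewrite lerXn2r ?nnegrE ?addr_ge0// lerDr.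
Qed.

Lemma symbol_heat e a : 0 <= e -> 0 <= a -> symbol (fun xi => expR (- (a * lap e xi))).
Proof.
move=> e0 a0; apply: (@symbol_bounded _ _ _ 1) => [|xi].
  apply: measurableT_comp => //; apply: measurable_funN; apply: measurable_funM => //.
  exact: measurable_lap.
by rewrite ger0_norm ?expR_ge0// -expR0 ler_expR oppr_le0 mulr_ge0// lap_ge0.
Qed.

Definition hk e a x : R := expR (- (e * a)) * gk a x.

Lemma hk_ge0 e a x : 0 <= hk e a x.
Proof. by rewrite /hk; apply: mulr_ge0; [exact: expR_ge0|exact: gk_ge0]. Qed.

Lemma measurable_hk e a : measurable_fun [set: X] (hk e a).
Proof. by apply: measurable_funM => //; exact: measurable_gk. Qed.

Lemma hk_int e a : 0 < a -> cintegrable mu (fun x => (hk e a x)%:C).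
Proof.
move=> a0; split; first by apply: cmeas_real; exact: measurable_hk.
under eq_integral do rewrite normc_real ger0_norm ?hk_ge0//.
rewrite ge0_integralrZl ?expR_ge0//; last 2 first.
- exact: measurable_gk.
- exact: gk_ge0.
by rewrite integral_gk// mule1 ltry.
Qed.

Lemma hk_cis_int e a (th : R) xi : 0 < a ->
  cintegrable mu (fun y => (hk e a y)%:C * cis (th - 2 * pi * dotprod y xi)).
Proof.
move=> a0; have [mh hoo] := hk_int e a0.
apply: (cintegrable_le (u := fun y => hk e a y)).
- apply: cmeasM => //; apply: cmeas_cis; apply: measurable_funB => //.
  by apply: measurable_funM => //; exact: measurable_dotprod.
- exact: measurable_hk.
- by move=> y; rewrite normcM normc_cis mulr1 normc_real ger0_norm// hk_ge0.
- by move: hoo; under eq_integral do rewrite normc_real ger0_norm ?hk_ge0//.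
Qed.

Lemma hk_fourier e a (th : R) xi : 0 < a ->
  cint mu (fun y => (hk e a y)%:C * cis (th - 2 * pi * dotprod y xi)) =
  (expR (- (a * lap e xi)))%:C * cis th.
Proof.
move=> a0; have := gk_fourier th (- xi) a0; rewrite dotprodNr dotprodNl opprK => h.
rewrite (_ : expR (- (a * lap e xi)) = expR (- (e * a)) * expR (- (a * dotprod xi xi))); last first.
  by rewrite -expRD /lap; congr expR; ring.
rewrite rmorphM/= -mulrA -h -cintZ.
  by apply: eq_cint => y; rewrite dotprodNr mulrN /hk rmorphM/= mulrA.
rewrite (_ : (fun y => _) = (fun y => (hk 0 a y)%:C * cis (th - 2 * pi * dotprod y xi))).
  exact: hk_cis_int.
by apply/funext => y; rewrite /hk mul0r oppr0 expR0 mul1r dotprodNr mulrN.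
Qed.

Lemma FB_heat e a : 0 < a -> FB (fun xi => expR (- (a * lap e xi))) (hk e a).
Proof.
move=> a0; have := @FB_kernel R n (hk e a) (fun xi => expR (- (a * lap e xi))).
rewrite (_ : (fun x => `|hk e a x|) = hk e a); last by apply/funext => x; rewrite ger0_norm// hk_ge0.
apply; first exact: measurable_hk.
- by have [_] := hk_int e a0; under eq_integral do rewrite normc_real.
- by move=> th xi; exact: hk_fourier.
Qed.

Lemma FB_heat_diff e a b : 0 < a -> 0 < b ->
  FB (fun xi => expR (- (a * lap e xi)) - expR (- (b * lap e xi))) (fun x => `|hk e a x - hk e b x|).
Proof.
move=> a0 b0; apply: FB_kernel.
- by apply: measurable_funB; exact: measurable_hk.
- have [_] := cintegrableB (hk_int e a0) (hk_int e b0).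
  by under eq_integral do rewrite normcB_real.
- move=> th xi; rewrite rmorphB/= mulrBl -!hk_fourier// -cintB; [|exact: hk_cis_int|exact: hk_cis_int].
  by apply: eq_cint => y; rewrite rmorphB/= mulrBl.
Qed.

Lemma wgt_up r s (N : R) x : 0 < r -> r <= s -> 0 <= N -> wgt r N x <= (s / r) ^+ n * wgt s N x.
Proof.
move=> r0 rs N0; have s0 := lt_le_trans r0 rs.
rewrite /wgt mulrA -exprMn mulrAC mulfV ?gt_eqF// mul1r; apply: ler_wpM2l.
  by rewrite exprn_ge0// invr_ge0 ltW.
apply: le_powRN => //; first exact: one_plus_gt0.
by rewrite lerD2l; apply: ler_wpM2l => //; rewrite lef_pV2.
Qed.

(** The exponent of the heat kernel including the normalisation [a^(-n/2)], so that a change of time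
    becomes a change of this single exponent. *)
Definition hexp e a x : R := - (e * a) - n%:R / 2 * ln a - pi ^+ 2 * dotprod x x / a.

Lemma hkE e a x : 0 < a -> hk e a x = Num.sqrt pi ^+ n * expR (hexp e a x).
Proof.
move=> a0; have hs : Num.sqrt a = expR (2^-1 * ln a) by rewrite -powR12_sqrt ?ltW// /powR gt_eqF.
rewrite /hk gkE sqrt_div_pow// /hexp 2!expRD hs -expRN -expRM_natl.
rewrite (_ : n%:R * - (2^-1 * ln a) = - (n%:R / 2 * ln a)); last by rewrite mulrN mulrA.
by move: (expR _) (_ ^+ n) (expR _) (expR _) => u v w z; ring.
Qed.

Lemma FB_scale (k : R) m (W : X -> R) : 0 <= k -> symbol m ->
  measurable_fun [set: X] W -> (forall x, 0 <= W x) -> FB m W ->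
  FB (fun xi => k * m xi) (fun x => k * W x).
Proof.
move=> k0 sm mW W0 H d T rho Z phi x wp; have wm := waveM sm wp.
have -> : wv rho Z (fun w => (k * m (Z w))%:C * phi w) x =
    k%:C * wv rho Z (fun w => (m (Z w))%:C * phi w) x.
  rewrite /wv -cintZ; last exact: wave_cis_int.
  by apply: eq_cint => w; rewrite rmorphM/= !mulrA.
rewrite normcM normc_real ger0_norm// EFinM.
under eq_integral do rewrite -mulrA.
rewrite ge0_integralrZl//; last 2 first.
- apply: measurable_funM; last exact: measurable_normc_wv.
  by apply: measurableT_comp mW _; exact: measurable_rVB.
- by move=> y; apply: mulr_ge0 => //; exact: normc_ge0.
by apply: lee_wpmul2l; rewrite ?lee_fin//; exact: H.
Qed.

(** [hexp] changes by at most [t / r^2] times a sum of [e r^2], a constant and a multiple of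
    [(1 + |x|/r)^2]. The first is absorbed by [exp(-e r^2)], uniformly in [e], and the last by two
    spare powers of decay, whence [N + 2]. *)
Lemma hk_time (N : R) : n%:R <= N -> exists2 C : R, 0 < C &
  forall e r t x, 0 <= e -> 0 < r -> 0 < t <= r ^+ 2 ->
  `|hk e (r ^+ 2) x - hk e (r ^+ 2 + t) x| <= C * (t / r ^+ 2) * wgt r N x.
Proof.
move=> nN; have N0 : 0 <= N by rewrite (le_trans _ nN).
have N20 : 0 <= N + 2 by lra.
have [C C0 H] := gk_le_wgt (n := n) N20.
have p2 : 0 < pi ^+ 2 :> R by rewrite exprn_gt0// pi_gt0.
pose A : R := 1 + n%:R / 2 + pi ^+ 2 * n%:R.
have A0 : 0 < A.
  apply: ltr_wpDr; first by apply: mulr_ge0 => //; exact: ltW.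
  by apply: ltr_wpDr => //; exact: divr_ge0.
pose B : R := C * (1 + 2 `^ (N + 2 - n%:R)).
have B0 : 0 < B by rewrite mulr_gt0// ltr_wpDr// powR_ge0.
exists (A * B); first exact: mulr_gt0.
move=> e r t x e0 r0 /andP[t0 tr].
have r20 : 0 < r ^+ 2 by rewrite exprn_gt0.
have rt0 : 0 < r ^+ 2 + t by rewrite addr_gt0.
have o0 := one_plus_gt0 x r0.
set w := wgt r (N + 2) x.
have w0 : 0 < w by exact: wgt_gt0.
have g1 : gk (r ^+ 2) x <= C * w by exact: H.
have g2 : gk (r ^+ 2 + t) x <= C * 2 `^ (N + 2 - n%:R) * w.
  set s := Num.sqrt (r ^+ 2 + t).
  have s0 : 0 < s by rewrite sqrtr_gt0.
  have sE : s ^+ 2 = r ^+ 2 + t by rewrite sqr_sqrtr// ltW.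
  have rs : r <= s.
    by rewrite -(ler_pXn2r (n := 2)) ?nnegrE ?(ltW r0) ?(ltW s0)// sE lerDl ltW.
  have sr : s / r <= 2.
    rewrite ler_pdivrMr// -(ler_pXn2r (n := 2)) ?nnegrE ?(ltW s0)//; last by rewrite mulr_ge0// ltW.
    by rewrite sE exprMn; move: (r ^+ 2) tr r20 => q; lra.
  rewrite -sE; apply: (le_trans (H s x s0)); rewrite -mulrA; apply: ler_wpM2l; first exact: ltW.
  have nN2 : n%:R <= N + 2 by lra.
  apply: (le_trans (wgt_scale x r0 rs nN2)); apply: ler_wpM2r; first exact: ltW.
  apply: ge0_ler_powR; rewrite ?nnegrE//; first by lra.
  by rewrite divr_ge0// ltW.
have gg : gk (r ^+ 2) x + gk (r ^+ 2 + t) x <= B * w.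
  by have := lerD g1 g2; rewrite -mulrDl -{1}(mulr1 C) -mulrDr.
rewrite !hkE// -mulrBr normrM ger0_norm ?exprn_ge0 ?sqrtr_ge0//.
set z1 := hexp e _ x; set z2 := hexp e _ x.
have cst0 : 0 <= Num.sqrt pi ^+ n :> R by rewrite exprn_ge0 ?sqrtr_ge0.
have mx : Num.sqrt pi ^+ n * expR (Num.max z1 z2) <= expR (- (e * r ^+ 2)) * (gk (r ^+ 2) x + gk (r ^+ 2 + t) x).
  have h1 : Num.sqrt pi ^+ n * expR z1 = expR (- (e * r ^+ 2)) * gk (r ^+ 2) x by rewrite -hkE.
  have h2 : Num.sqrt pi ^+ n * expR z2 <= expR (- (e * r ^+ 2)) * gk (r ^+ 2 + t) x.
    rewrite -hkE//; apply: ler_wpM2r; first exact: gk_ge0.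
    by rewrite ler_expR lerN2; apply: ler_wpM2l => //; rewrite lerDl ltW.
  have k1 : 0 <= expR (- (e * r ^+ 2)) * gk (r ^+ 2) x by rewrite mulr_ge0 ?expR_ge0// gk_ge0.
  have k2 : 0 <= expR (- (e * r ^+ 2)) * gk (r ^+ 2 + t) x by rewrite mulr_ge0 ?expR_ge0// gk_ge0.
  rewrite mulrDr /Num.max; case: ifP => _; first by rewrite (le_trans h2)// lerDr.
  by rewrite h1 lerDl.
have dz : `|z1 - z2| <= (t / r ^+ 2) * (e * r ^+ 2 + n%:R / 2 + pi ^+ 2 * n%:R * (1 + `|x| / r) ^+ 2).
  have l1 : 0 <= ln (r ^+ 2 + t) - ln (r ^+ 2) <= t / r ^+ 2.
    rewrite -ln_div ?posrE// mulrDl divff ?gt_eqF//.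
    have q0 : 0 <= t / r ^+ 2 by rewrite divr_ge0 ?(ltW t0) ?(ltW r20).
    rewrite ln_ge0 ?lerDl//=; apply: le_ln1Dx; lra.
  have q1 : 0 <= dotprod x x / r ^+ 2 - dotprod x x / (r ^+ 2 + t) <=
      t / r ^+ 2 * (n%:R * (1 + `|x| / r) ^+ 2).
    have d0 := dotprod_ge0 x.
    rewrite (_ : _ - _ = t / (r ^+ 2 + t) * (dotprod x x / r ^+ 2)); last first.
      by move: (r ^+ 2) r20 rt0 => a a0 at0; field; rewrite !gt_eqF.
    have f0 : 0 <= t / (r ^+ 2 + t) by rewrite divr_ge0 ?(ltW t0) ?(ltW rt0).
    have k0 : 0 <= dotprod x x / r ^+ 2 by rewrite divr_ge0 ?(ltW r20).
    rewrite mulr_ge0//=; apply: ler_pM => //.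
      by apply: ler_wpM2l; [exact: ltW|rewrite lef_pV2 ?posrE// lerDl ltW].
    rewrite ler_pdivrMr//; apply: (le_trans (dotprod_le_sqr_norm x)).
    rewrite -mulrA; apply: ler_wpM2l => //; rewrite -exprMn.
    have xr : 0 <= (1 + `|x| / r) * r by rewrite mulr_ge0 ?(ltW o0) ?(ltW r0).
    rewrite lerXn2r ?nnegrE//.
    by rewrite mulrDl mulfVK ?gt_eqF// lerDr mul1r ltW.
  rewrite (_ : z1 - z2 = e * t + n%:R / 2 * (ln (r ^+ 2 + t) - ln (r ^+ 2)) -
     pi ^+ 2 * (dotprod x x / r ^+ 2 - dotprod x x / (r ^+ 2 + t))); last first.
    by rewrite /z1 /z2 /hexp; move: (pi) => p; ring.
  have et : e * t = t / r ^+ 2 * (e * r ^+ 2).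
    by rewrite mulrCA mulfVK// gt_eqF.
  have et0 : 0 <= e * t by rewrite mulr_ge0// ltW.
  have c0 : 0 <= n%:R / 2 :> R by rewrite divr_ge0.
  case/andP: l1 => l0 l1; case/andP: q1 => q0 q1.
  have := ler_wpM2l c0 l0; have := ler_wpM2l c0 l1.
  have := ler_wpM2l (ltW p2) q0; have := ler_wpM2l (ltW p2) q1.
  have -> : t / r ^+ 2 * (e * r ^+ 2 + n%:R / 2 + pi ^+ 2 * n%:R * (1 + `|x| / r) ^+ 2) =
    e * t + t / r ^+ 2 * (n%:R / 2) + t / r ^+ 2 * (pi ^+ 2 * n%:R * (1 + `|x| / r) ^+ 2).
    by rewrite et !mulrDr.
  rewrite !mulr0.
  rewrite (_ : pi ^+ 2 * (t / r ^+ 2 * (n%:R * (1 + `|x| / r) ^+ 2)) =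
    t / r ^+ 2 * (pi ^+ 2 * n%:R * (1 + `|x| / r) ^+ 2)); last first.
    by rewrite mulrCA (mulrA (pi ^+ 2)).
  rewrite (mulrC (n%:R / 2) (t / _)) ler_norml.
  have : 0 <= t / r ^+ 2 * (n%:R / 2) by rewrite mulr_ge0// divr_ge0 ?(ltW t0) ?(ltW r20).
  move: (t / r ^+ 2 * (n%:R / 2)) (n%:R / 2 * _) (pi ^+ 2 * (_ - _)) (t / _ * _) => a b c d.
  by lra.
have er : (1 + e * r ^+ 2) * expR (- (e * r ^+ 2)) <= 1.
  rewrite expRN ler_pdivrMr ?expR_gt0// mul1r; exact: expR_ge1Dx.
apply: (@le_trans _ _ (`|z1 - z2| * (expR (- (e * r ^+ 2)) * (gk (r ^+ 2) x + gk (r ^+ 2 + t) x)))).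
  apply: le_trans (ler_wpM2l cst0 (expR_diff_le _ _)) _.
  by rewrite mulrCA; apply: ler_wpM2l.
apply: (@le_trans _ _ (t / r ^+ 2 * (A * (1 + `|x| / r) ^+ 2) * (B * w))).
  rewrite mulrA; apply: ler_pM => //.
  - by rewrite addr_ge0// gk_ge0.
  apply: (le_trans (ler_wpM2r (expR_ge0 _) dz)).
  rewrite -[leLHS]mulrA; apply: ler_wpM2l; first by rewrite divr_ge0 ?(ltW t0) ?(ltW r20).
  have o1 : 1 <= (1 + `|x| / r) ^+ 2 by rewrite exprn_ege1// one_plus_ge1.
  move: ((1 + `|x| / r) ^+ 2) o1 => o o1.
  have ex1 : expR (- (e * r ^+ 2)) <= 1 by rewrite -expR0 ler_expR oppr_le0 mulr_ge0 ?(ltW r20).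
  have ex0 := expR_ge0 (- (e * r ^+ 2)).
  have er0 : 0 <= e * r ^+ 2 by rewrite mulr_ge0 ?(ltW r20).
  have b0 : 0 <= n%:R / 2 + pi ^+ 2 * n%:R :> R.
    by rewrite addr_ge0 ?divr_ge0// mulr_ge0// ltW.
  have c0 : 0 <= n%:R / 2 :> R by rewrite divr_ge0.
  have d0 : 0 <= pi ^+ 2 * n%:R :> R by rewrite mulr_ge0// ltW.
  rewrite /A; move: er ex0 ex1; move: (expR (- (e * r ^+ 2))) => p er ex0 ex1.
  move: er er0; move: (e * r ^+ 2) => u er u0.
  move: c0 d0; move: (n%:R / 2 : R) (pi ^+ 2 * n%:R : R) => c d c0 d0.
  have h1 : u * p <= 1 by nra.
  have h2 : c * p <= c * o by apply: ler_wpM2l => //; lra.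
  have h3 : d * o * p <= d * o by rewrite ler_piMr// mulr_ge0//; lra.
  lra.
rewrite (_ : wgt r N x = (1 + `|x| / r) ^+ 2 * w).
  by rewrite le_eqVlt; apply/orP; left; apply/eqP; ring.
rewrite /w /wgt opprD powRD; last by rewrite (gt_eqF o0) implybT.
rewrite -[in RHS](powR_mulrn _ (ltW o0)) mulrCA [X in _ = _ * X]mulrCA -powRD; last by rewrite (gt_eqF o0) implybT.
by rewrite subrr powRr0 mulr1.
Qed.

(** [L exp(-r^2 L)] is the limit of difference quotients in time of the heat semigroup, whose
    kernels [hk_time] bounds uniformly; no kernel has to be differentiated. *)
Lemma FB_lap (N : R) : n%:R < N -> exists2 C : R, 0 < C & forall e r, 0 <= e -> 0 < r ->
  FB (fun xi => lap e xi * expR (- (r ^+ 2 * lap e xi))) (fun x => C * r^-1 ^+ 2 * wgt r N x).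
Proof.
move=> nN; have N0 : 0 <= N by rewrite (le_trans _ (ltW nN)).
have [C C0 H] := hk_time (ltW nN); exists C => // e r e0 r0.
have r20 : 0 < r ^+ 2 by rewrite exprn_gt0.
pose E t xi := expR (- (t * lap e xi)).
have sE t : 0 < t -> symbol (fun xi => E (r ^+ 2) xi - E (r ^+ 2 + t) xi).
  move=> t0; apply: (@symbol_bounded _ _ _ 1).
    apply: measurable_funB; first exact: (symbol_heat e0 (ltW r20)).1.
    exact: (symbol_heat e0 (ltW (addr_gt0 r20 t0))).1.
  move=> xi; have h a : 0 < a -> 0 <= E a xi <= 1.
    by move=> a0; rewrite expR_ge0/= -expR0 ler_expR oppr_le0 mulr_ge0 ?lap_ge0// ltW.
  by have := h _ r20; have := h _ (addr_gt0 r20 t0); rewrite ler_norml; lra.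
apply: (@FB_lim _ _ _ (fun xi => lap e xi ^+ 2) (fun t xi => t^-1 * (E (r ^+ 2) xi - E (r ^+ 2 + t) xi)) _ (r ^+ 2)) => //.
- apply: symbolM; first exact: symbol_lap.
  exact: symbol_heat (ltW r20).
- by apply: symbolX; exact: symbol_lap.
- move=> t /andP[t0 _]; apply: symbolM; last exact: sE.
  by apply: (@symbol_bounded _ _ _ `|t^-1|) => //; exact: measurable_cst.
- move=> t xi /andP[t0 _].
  rewrite /E; move: (lap e xi) (lap_ge0 xi e0) => L L0.
  rewrite mulrDl opprD expRD.
  have Er : 0 <= expR (- (r ^+ 2 * L)) <= 1.
    by rewrite expR_ge0/= -expR0 ler_expR oppr_le0 mulr_ge0// ltW.
  move: (expR (- (r ^+ 2 * L))) Er => q /andP[q0 q1].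
  have u0 : 0 <= t * L by rewrite mulr_ge0// ltW.
  have e1 := expR_ge1Dx (- (t * L)).
  (* By this second-order bound the difference quotient is within [t L^2] of [L exp(-r^2 L)], which
     dictates the error symbol [L^2]. *)
  have e2 : expR (- (t * L)) <= 1 - t * L + (t * L) ^+ 2.
    move: (t * L) u0 => u u0; rewrite expRN -[leLHS]mul1r ler_pdivrMr ?expR_gt0//.
    apply: (@le_trans _ _ ((1 - u + u ^+ 2) * (1 + u))).
      rewrite (_ : _ * _ = 1 + u ^+ 3); last by ring.
      by rewrite lerDl exprn_ge0.
    by apply: ler_wpM2l; [nra|exact: expR_ge1Dx].
  move: (expR (- (t * L))) e1 e2 => p e1 e2.
  rewrite (_ : L * q - _ = q * (t^-1 * (t * L - (1 - p)))); last by field; rewrite gt_eqF.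
  rewrite normrM ger0_norm//; apply: (@le_trans _ _ (1 * `|t^-1 * (t * L - (1 - p))|)).
    exact: ler_wpM2r.
  rewrite mul1r normrM gtr0_norm ?invr_gt0// ler_pdivrMl//.
  rewrite ger0_norm; last by move: e1; lra.
  by move: e2; rewrite exprMn [t ^+ 2]expr2 -mulrA; lra.
- move=> t ht; have /andP[t0 _] := ht.
  apply: (@FB_mono _ _ _ (fun x => t^-1 * `|hk e (r ^+ 2) x - hk e (r ^+ 2 + t) x|)).
  + apply: FB_scale; first by rewrite invr_ge0 ltW.
    * exact: sE.
    * by apply: measurableT_comp => //; apply: measurable_funB; exact: measurable_hk.
    * by [].
    * by apply: FB_heat_diff => //; exact: addr_gt0.
  + apply: measurable_funM => //; apply: measurableT_comp => //; apply: measurable_funB; exact: measurable_hk.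
  + by apply: measurable_funM => //; exact: measurable_wgt.
  + by move=> x; rewrite mulr_ge0// invr_ge0 ltW.
  + move=> x; rewrite ler_pdivrMl//; apply: le_trans (H _ _ _ x e0 r0 ht) _.
    by rewrite exprVn (mulrA t) (mulrCA t) (mulrA _ t).
Qed.

End heat.

(** * Integral and fractional powers of [L] *)

Section lap_powers.
Context {R : realType} {n : nat}.
Local Notation X := 'rV[R]_n.
Local Notation mu := (lebesgue_rV R n).
Implicit Types (x y xi : X) (a e r : R).

Lemma symbol_lapX_heat e a K : 0 <= e -> 0 <= a ->
  symbol (fun xi : X => lap e xi ^+ K * expR (- (a * lap e xi))).
Proof.
move=> e0 a0; apply: symbolM; last exact: symbol_heat.
by apply: symbolX; exact: symbol_lap.
Qed.

Lemma symbol_lap_powR e b : 0 <= e -> 0 <= b -> symbol (fun xi : X => lap e xi `^ b).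
Proof.
move=> e0 b0; split; first by apply: (measurableT_comp (f := @powR R ^~ b)); [exact: measurable_powR|exact: measurable_lap].
have [K hK] : exists K : nat, b < K%:R by exists (Num.bound b); exact: archi_boundP b0.
have [_ [C [k [C0 hC]]]] := symbolX K (symbol_lap (n := n) e0).
exists (1 + C), k; split=> [|xi]; first exact: addr_ge0.
have l0 := lap_ge0 xi e0; have := hC xi; rewrite [`|_ ^+ K|]ger0_norm ?exprn_ge0// [`|_ `^ _|]ger0_norm ?powR_ge0//.
have o1 : 1 <= (1 + `|xi|) ^+ k by rewrite exprn_ege1// one_plus_norm_ge1.
move: (_ ^+ k) o1 => o o1; rewrite mulrDl mul1r => h.
have [l1|l1] := lerP (lap e xi) 1.
  apply: (@le_trans _ _ 1); last by apply: (le_trans o1); rewrite lerDl mulr_ge0//; lra.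
  have <- : (1 : R) `^ b = 1 by rewrite powR1.
  by apply: ge0_ler_powR => //; rewrite nnegrE.
apply: (@le_trans _ _ (lap e xi ^+ K)); last by lra.
by rewrite -powR_mulrn// ler_powR// ltW.
Qed.

Lemma FB_ext (m m' W W' : X -> R) : m =1 m' -> W =1 W' -> FB m W -> FB m' W'.
Proof. by move=> /funext -> /funext ->. Qed.

(** A composition of [K] factors [L exp(-r^2 L)] and one factor [exp(-r^2 L)], which explains the
    time [(K + 1) r^2]. *)
Lemma FB_lapX_aux (N : R) K : n%:R < N -> exists2 C : R, 0 < C & forall e r, 0 <= e -> 0 < r ->
  FB (fun xi : X => lap e xi ^+ K * expR (- (K.+1%:R * r ^+ 2 * lap e xi)))
     (fun x => C * r^-1 ^+ (2 * K) * wgt r N x).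
Proof.
move=> nN; have N0 : 0 <= N by rewrite (le_trans _ (ltW nN)).
elim: K => [|K [C1 C10 H1]].
  have [C C0 H] := gk_le_wgt (n := n) N0; exists C => // e r e0 r0.
  have r20 : 0 < r ^+ 2 by rewrite exprn_gt0.
  rewrite (_ : (fun xi => _) = (fun xi => expR (- (r ^+ 2 * lap e xi)))); last first.
    by apply/funext => xi; rewrite expr0 !mul1r.
  apply: FB_mono (FB_heat e r20) _ _ _ _.
  - exact: measurable_hk.
  - by apply: measurable_funM => //; exact: measurable_wgt.
  - exact: hk_ge0.
  - move=> x; rewrite muln0 expr0 mulr1; apply: le_trans (H r x r0).
    rewrite /hk ler_piMl ?gk_ge0// -expR0 ler_expR oppr_le0 mulr_ge0// ltW//.
have [C2 C20 H2] := FB_lap nN.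
have [C C0 H] := FB_comp (R := R) nN.
exists (C * C1 * C2) => [|e r e0 r0]; first by rewrite !mulr_gt0.
have ri : 0 <= r^-1 by rewrite invr_ge0 ltW.
have a1 : 0 <= C1 * r^-1 ^+ (2 * K) by rewrite mulr_ge0 ?exprn_ge0// ltW.
have a2 : 0 <= C2 * r^-1 ^+ 2 by rewrite mulr_ge0 ?exprn_ge0// ltW.
have s2 : symbol (fun xi : X => lap e xi * expR (- (r ^+ 2 * lap e xi))).
  exact: symbol_lapX_heat 1 e0 (sqr_ge0 r).
apply: FB_ext (H r _ _ _ _ r0 a1 a2 s2 (H1 e r e0 r0) (H2 e r e0 r0)).
- move=> xi; rewrite mulrACA -exprSr -expRD; congr (_ * expR _).
  by rewrite -opprD -mulrDl [in RHS]mulrSr [in RHS]mulrDl [in RHS]mul1r.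
- by move=> x; rewrite mulnS exprD; move: (wgt r N x) (r^-1 ^+ 2) (r^-1 ^+ (2 * K)) => u v w; ring.
Qed.

(** [FB_lapX_aux] at scale [r / sqrt(K + 1)]; returning to the weight of scale [r] costs a
    constant. *)
Lemma FB_lapX (N : R) K : n%:R < N -> exists2 C : R, 0 < C & forall e r, 0 <= e -> 0 < r ->
  FB (fun xi : X => lap e xi ^+ K * expR (- (r ^+ 2 * lap e xi)))
     (fun x => C * r^-1 ^+ (2 * K) * wgt r N x).
Proof.
move=> nN; have N0 : 0 <= N by rewrite (le_trans _ (ltW nN)).
have [C C0 H] := FB_lapX_aux K nN.
pose q : R := Num.sqrt K.+1%:R.
have q0 : 0 < q by rewrite sqrtr_gt0.
have q1 : 1 <= q by rewrite -[leLHS]sqrtr1 ler_sqrt// ler1n.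
exists (C * q ^+ (2 * K) * q ^+ n) => [|e r e0 r0]; first by rewrite !mulr_gt0 ?exprn_gt0.
have rq : 0 < r / q by rewrite divr_gt0.
have ri : 0 <= r^-1 by rewrite invr_ge0 ltW.
have := H e (r / q) e0 rq.
rewrite (_ : K.+1%:R * (r / q) ^+ 2 = r ^+ 2); last first.
  by rewrite expr_div_n sqr_sqrtr// mulrCA mulfV ?mulr1// pnatr_eq0.
move=> h; apply: FB_mono h _ _ _ _.
- by apply: measurable_funM => //; exact: measurable_wgt.
- by apply: measurable_funM => //; exact: measurable_wgt.
- move=> x; rewrite mulr_ge0 ?wgt_ge0// mulr_ge0 ?exprn_ge0 ?invr_ge0 ?(ltW rq) ?(ltW C0)//.
move=> x; rewrite invf_div exprMn -!mulrA; apply: ler_wpM2l; first exact: ltW.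
apply: ler_wpM2l; first by rewrite exprn_ge0// ltW.
rewrite [leRHS]mulrCA; apply: ler_wpM2l; first by rewrite exprn_ge0.
have rqr : r / q <= r by rewrite ler_pdivrMr// ler_peMr// ltW.
have hq : r / (r / q) = q by field; rewrite !gt_eqF.
by have := wgt_up x rq rqr N0; rewrite hq.
Qed.

(* [c * L^a exp(-tL)] is the integral over [v] of [e^{(K-a)v} L^K exp(-(t+e^v)L)]; the decay rate
   [N < n + 2a] is what makes the scales [e^v >> t] summable. *)
Lemma FB_lap_powR (N b : R) : n%:R < N -> 0 < b -> N < n%:R + 2 * b ->
  exists2 C : R, 0 < C & forall e r, 0 <= e -> 0 < r ->
  FB (fun xi : X => lap e xi `^ b * expR (- (r ^+ 2 * lap e xi)))
     (fun x => C * (r ^+ 2) `^ (- b) * wgt r N x).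
Proof.
move=> nN b0 Nb; have N0 : 0 <= N by rewrite (le_trans _ (ltW nN)).
have [K hK] : exists K : nat, b < K%:R.
  by exists (Num.bound b); exact: archi_boundP (ltW b0).
have K0 : (0 < K)%N by rewrite -(ltr_nat R); exact: lt_trans hK.
pose c := K%:R - b; have c0 : 0 < c by rewrite subr_gt0.
pose M := (N - n%:R) / 2; have M0 : 0 < M by rewrite divr_gt0// subr_gt0.
(* At scale [s^2 = r^2 + e^v] the kernel of [L^K exp(-s^2 L)] has size [s^(-2K)], and passing from
   its weight to that of scale [r] costs [(s/r)^(2M)]. What remains is [logistic c k] at
   [v - ln(r^2)], integrable since [c < k], that is, [M < b]. *)
pose k := K%:R - M; have ck : c < k by rewrite ltrD2l ltrN2 /M; move: Nb; lra.
have [C1 C10 H1] := FB_lapX K nN.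
have [C2 C20 H2] := integral_logistic c0 ck.
have [_ g0] := integral_eulerG c0.
exists (C1 * C2 / eulerG c) => [|e r e0 r0]; first by rewrite !mulr_gt0// invr_gt0.
have r20 : 0 < r ^+ 2 by rewrite exprn_gt0.
pose u := ln (r ^+ 2).
pose A v xi := (eulerG c)^-1 * (expR (c * v) * (lap e xi ^+ K * expR (- ((r ^+ 2 + expR v) * lap e xi)))).
pose D v := C1 / eulerG c * (r ^+ 2) `^ (- b) * logistic c k (v - u).
have D0 v : 0 <= D v.
  by rewrite mulr_ge0 ?logistic_ge0// mulr_ge0 ?powR_ge0// divr_ge0// ltW.
have mD : measurable_fun [set: R] D.
  apply: measurable_funM => //; apply: measurableT_comp (measurable_logistic c k) _.
  exact: measurable_funB.
rewrite (_ : C1 * C2 / eulerG c * (r ^+ 2) `^ (- b) = C1 / eulerG c * (r ^+ 2) `^ (- b) * C2); last by ring.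
apply: (@FB_int _ _ A _ D).
- apply: measurable_funM => //; apply: measurable_funM.
    apply: (measurableT_comp (f := @expR R)) => //; apply: measurable_funM => //.
  have ml : measurable_fun [set: (measurableTypeR R * X)%type] (fun z : measurableTypeR R * X => lap e z.2).
    exact: measurableT_comp (measurable_lap e) measurable_snd.
  apply: measurable_funM; first exact: measurable_funX.
  apply: (measurableT_comp (f := @expR R)) => //; apply: measurable_funN; apply: measurable_funM => //.
  apply: measurable_funD => //; apply: (measurableT_comp (f := @expR R)) => //; exact: measurable_fst.
- move=> v xi; rewrite /A !mulr_ge0 ?expR_ge0 ?exprn_ge0 ?lap_ge0// invr_ge0 ltW//.
- move=> v; apply: symbolM.
    by apply: (@symbol_bounded _ _ _ `|(eulerG c)^-1|) => //; exact: measurable_cst.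
  apply: symbolM.
    by apply: (@symbol_bounded _ _ _ `|expR (c * v)|) => //; exact: measurable_cst.
  by apply: symbol_lapX_heat => //; rewrite addr_ge0 ?expR_ge0// ltW.
- move=> xi; set l := lap e xi; have l0 : 0 <= l by exact: lap_ge0.
  transitivity (\int[lebesgue_measure]_v
     ((eulerG c)^-1 * (l ^+ K * expR (- (r ^+ 2 * l))) * (expR (c * v) * expR (- (expR v * l))))%:E)%E.
    apply: eq_integral => v _; congr EFin; rewrite /A -/l.
    have -> : - ((r ^+ 2 + expR v) * l) = - (r ^+ 2 * l) + - (expR v * l) by ring.
    by rewrite expRD; ring.
  have ml : measurable_fun [set: R] (fun v : R => expR (c * v) * expR (- (expR v * l))).
    by have := measurable_eulerG_integrand c l; under eq_fun do rewrite (mulrC l).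
  rewrite ge0_integralrZl; last 3 first.
  + by rewrite !mulr_ge0 ?expR_ge0 ?exprn_ge0// invr_ge0 ltW.
  + exact: ml.
  + by move=> v; rewrite mulr_ge0 ?expR_ge0.
  (* The scaling by [l] requires [l > 0]; at [l = 0] both sides vanish because [K] and [b] are
     positive. *)
  have [le0|ln0] := eqVneq l 0.
    rewrite le0 powR0 ?gt_eqF// expr0n (gtn_eqF K0) !mul0r mulr0 mul0e//.
  have lp : 0 < l by rewrite lt_neqAle eq_sym ln0.
  rewrite integral_eulerG_scale// -EFinM; congr EFin.
  have -> : l `^ b = l ^+ K * l `^ (- c).
    rewrite -powR_mulrn// -powRD; last by rewrite ln0 implybT.
    by congr (_ `^ _); rewrite /c; ring.
  by field; rewrite gt_eqF.
- apply: symbolM; last exact: symbol_heat (ltW r20).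
  exact: symbol_lap_powR (ltW b0).
- exact: mD.
- exact: D0.
- rewrite ge0_integralrZl; last 3 first.
  + by rewrite mulr_ge0 ?powR_ge0// divr_ge0// ltW.
  + apply: measurableT_comp (measurable_logistic c k) _; exact: measurable_funB.
  + by move=> v; exact: logistic_ge0.
  rewrite [leRHS]EFinM; apply: lee_wpmul2l.
    by rewrite lee_fin mulr_ge0 ?powR_ge0// divr_ge0// ltW.
  rewrite (ge0_integral_shift (- u) (f := fun v => (logistic c k v)%:E))//.
    by apply/measurable_EFinP; exact: measurable_logistic.
  by move=> v; rewrite lee_fin logistic_ge0.
- exact: measurable_wgt.
- by move=> x; exact: wgt_ge0.
move=> v; set s := Num.sqrt (r ^+ 2 + expR v).
have s20 : 0 < r ^+ 2 + expR v by rewrite addr_gt0 ?expR_gt0.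
have s0 : 0 < s by rewrite sqrtr_gt0.
have sE : s ^+ 2 = r ^+ 2 + expR v by rewrite sqr_sqrtr// ltW.
have rs : r <= s.
  by rewrite -(ler_pXn2r (n := 2)) ?nnegrE ?(ltW r0) ?(ltW s0)// sE lerDl expR_ge0.
have g00 : 0 <= (eulerG c)^-1 * expR (c * v) by rewrite mulr_ge0 ?expR_ge0// invr_ge0 ltW.
have si : 0 <= s^-1 by rewrite invr_ge0 ltW.
have W0 x : 0 <= C1 * s^-1 ^+ (2 * K) * wgt s N x.
  by rewrite mulr_ge0 ?wgt_ge0// mulr_ge0 ?exprn_ge0// ltW.
have mW : measurable_fun [set: X] (fun x => C1 * s^-1 ^+ (2 * K) * wgt s N x).
  by apply: measurable_funM => //; exact: measurable_wgt.
have := FB_scale g00 (symbol_lapX_heat K e0 (ltW s20)) mW W0.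
rewrite -sE => /(_ (H1 e s e0 s0)).
rewrite (_ : (fun xi => _) = A v); last first.
  by apply/funext => xi; rewrite /A sE !mulrA.
move=> h; apply: FB_mono h _ _ _ _.
- exact: measurable_funM.
- by apply: measurable_funM => //; exact: measurable_wgt.
- by move=> x; rewrite mulr_ge0.
move=> x.
apply: (@le_trans _ _ ((eulerG c)^-1 * expR (c * v) * (C1 * s^-1 ^+ (2 * K) * ((s / r) `^ (N - n%:R) * wgt r N x)))).
  apply: ler_wpM2l => //; apply: ler_wpM2l; first by rewrite mulr_ge0 ?exprn_ge0// ltW.
  exact: wgt_scale (ltW nN).
rewrite le_eqVlt; apply/orP; left; apply/eqP; rewrite /D /logistic !mulrA; congr (_ * _).
have o0 : 0 < 1 + expR (v - u) by rewrite addr_gt0 ?expR_gt0.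
have e1 : r ^+ 2 + expR v = r ^+ 2 * (1 + expR (v - u)).
  by rewrite mulrDr mulr1 expRB lnK// mulrC mulfVK// gt_eqF.
have e2 : (s / r) `^ (N - n%:R) = (1 + expR (v - u)) `^ M.
  have -> : s / r = (1 + expR (v - u)) `^ 2^-1.
    rewrite powR12_sqrt ?(ltW o0)// /s e1 sqrtrM ?(ltW r20)// sqrtr_sqr gtr0_norm//.
    by rewrite mulrAC mulfV ?mul1r// gt_eqF.
  by rewrite -powRrM; congr (_ `^ _); rewrite /M mulrC.
have e3 : s^-1 ^+ (2 * K) = (r ^+ 2) `^ (- K%:R) * (1 + expR (v - u)) `^ (- K%:R).
  rewrite -powRM ?(ltW r20) ?(ltW o0)// -e1 -sE powRN powR_mulrn ?sqr_ge0//.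
  by rewrite exprVn exprM.
have e4 : expR (c * (v - u)) = expR (c * v) * (r ^+ 2) `^ (- c).
  rewrite mulrBr expRD; congr (_ * _).
  by rewrite /powR gt_eqF// mulNr.
have e5 : (r ^+ 2) `^ (- K%:R) = (r ^+ 2) `^ (- b) * (r ^+ 2) `^ (- c).
  rewrite -powRD; last by rewrite (gt_eqF r20) implybT.
  by congr (_ `^ _); rewrite /c; ring.
have e6 : (1 + expR (v - u)) `^ (- k) = (1 + expR (v - u)) `^ (- K%:R) * (1 + expR (v - u)) `^ M.
  rewrite -powRD; last by rewrite (gt_eqF o0) implybT.
  by congr (_ `^ _); rewrite /k; ring.
by rewrite e2 e3 e4 e5 e6; ring.
Qed.

End lap_powers.

Section sigma_finite_product.
Context {R : realType} {d1 d2} {T1 : measurableType d1} {T2 : measurableType d2}.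
Context (m1 : {sigma_finite_measure set T1 -> \bar R}) (m2 : {sigma_finite_measure set T2 -> \bar R}).

(* [m1 \x m2] with its sigma-finiteness, which the library does not infer *)
Definition prodm : set (T1 * T2) -> \bar R := (m1 \x m2)%E.

HB.instance Definition _ := Measure.on prodm.

Let prodm_sigma_finite : sigma_finite [set: T1 * T2] prodm.
Proof.
have /sigma_finiteP[F [FT Fmono Foo]] := sigma_finiteT m1.
have /sigma_finiteP[G [GT Gmono Goo]] := sigma_finiteT m2.
exists (fun k => F k `*` G k) => [|k]; last first.
  have [mF Fk] := Foo k; have [mG Gk] := Goo k; split; first exact: measurableX.
  by rewrite /prodm product_measure1E// lte_mul_pinfty// ge0_fin_numE.
apply/seteqP; split => // -[x y] _.
have [k _ Fx] : (\bigcup_k F k) x by rewrite -FT.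
have [l _ Gy] : (\bigcup_k G k) y by rewrite -GT.
exists (maxn k l) => //; split => /=.
  by apply: (subsetPset _ _ (Fmono _ _ (leq_maxl k l))).
by apply: (subsetPset _ _ (Gmono _ _ (leq_maxr k l))).
Qed.

HB.instance Definition _ := Measure_isSigmaFinite.Build _ _ _ prodm prodm_sigma_finite.

End sigma_finite_product.

(** * Differences of waves, and convolution operators acting on waves *)

Section wave_pairs.
Context {R : realType} {n : nat}.
Local Notation X := 'rV[R]_n.
Local Notation mu := (lebesgue_rV R n).
Implicit Types (x y xi : X) (m : X -> R).

Lemma Rintegral_fair (F : bool -> R) : \int[bernoulli_prob 2^-1]_b F b = 2^-1 * (F true + F false).
Proof.
have h : 0 <= (2^-1 : R) <= 1 by rewrite invr_ge0 ler0n/= invf_le1 ?ler1n.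
have p1 : 1 - 2^-1 = 2^-1 :> R by field.
rewrite /Rintegral integralE !integral_bernoulli_prob// /unstable.onem p1.
rewrite !funeposE !funenegE -!EFinN -!EFin_max -!EFinM -!EFinD/=.
have hm (a : R) : Num.max a 0 - Num.max (- a) 0 = a.
  by have [a0|a0] := lerP 0 a; [rewrite max_r ?oppr_le0// subr0|rewrite max_l ?oppr_ge0 ?ltW// opprK add0r].
by rewrite -[in RHS](hm (F true)) -[in RHS](hm (F false)); ring.
Qed.

Lemma cint_fair (F : bool -> R[i]) : cint (bernoulli_prob (2^-1 : R)) F = (2^-1)%:C * (F true + F false).
Proof.
by apply: complex_eqP; rewrite ?Re_mul ?Im_mul/= Rintegral_fair !mul0r ?subr0 ?addr0 ?Re_add ?Im_add.
Qed.

(* A fair coin carries both waves at once, the second one with a minus sign, so that a single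
   domination controls their difference. *)
Lemma FB_pair m (W : X -> R) d (T : measurableType d) (rho : {sigma_finite_measure set T -> \bar R})
    (Z1 Z2 : T -> X) (phi1 phi2 : T -> R[i]) x : FB m W -> symbol m ->
  measurable_fun [set: X] W -> (forall y, 0 <= W y) ->
  wave rho Z1 phi1 -> wave rho Z2 phi2 ->
  ((normc (wv rho Z1 (fun w => (m (Z1 w))%:C * phi1 w) x - wv rho Z2 (fun w => (m (Z2 w))%:C * phi2 w) x))%:E <=
   \int[mu]_y (W (x - y) * normc (wv rho Z1 phi1 y - wv rho Z2 phi2 y))%:E)%E.
Proof.
move=> Wm sm mW W0 w1 w2; have [mZ1 mp1 o1] := w1; have [mZ2 mp2 o2] := w2.
pose Z (z : T * bool) := if z.2 then Z1 z.1 else Z2 z.1.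
pose phi (z : T * bool) := if z.2 then phi1 z.1 else - phi2 z.1.
pose B : {sigma_finite_measure set (T * bool)%type -> \bar R} := prodm rho (bernoulli_prob (2^-1 : R)).
have mZ : measurable_fun [set: T * bool] Z.
  by apply: measurable_fun_ifT => //; apply: (measurableT_comp (f := _)); eauto.
have mphi : cmeas phi.
  split.
    rewrite (_ : (fun _ => _) = (fun z : T * bool => if z.2 then complex.Re (phi1 z.1) else - complex.Re (phi2 z.1))).
      apply: measurable_fun_ifT => //; first exact: measurableT_comp mp1.1 measurable_fst.
      by apply: measurable_funN; exact: measurableT_comp mp2.1 measurable_fst.
    by apply/funext => -[w b]; rewrite /phi/=; case: b => //; rewrite Re_opp.
  rewrite (_ : (fun _ => _) = (fun z : T * bool => if z.2 then complex.Im (phi1 z.1) else - complex.Im (phi2 z.1))).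
    apply: measurable_fun_ifT => //; first exact: measurableT_comp mp1.2 measurable_fst.
    by apply: measurable_funN; exact: measurableT_comp mp2.2 measurable_fst.
  by apply/funext => -[w b]; rewrite /phi/=; case: b => //; rewrite Im_opp.
have h01 : 0 <= (2^-1 : R) <= 1 by rewrite invr_ge0 ler0n/= invf_le1 ?ler1n.
have wZ : wave B Z phi.
  split => // k.
  rewrite fubini_tonelli1//; last 2 first.
  - apply/measurable_EFinP; apply: measurable_funM; last exact: measurable_normc.
    by apply: measurable_funX; apply: measurable_funD => //; exact: measurable_rV_norm.
  - by move=> z; rewrite lee_fin; apply: mulr_ge0; [exact: exprn_ge0|exact: normc_ge0].
  have mo i (Zi : T -> X) (psi : T -> R[i]) : wave rho Zi psi ->
    measurable_fun [set: T] (fun w => (1 + `|Zi w|) ^+ i * normc (psi w)) by move=> h; exact: (wave_moment i h).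
  apply: (@le_lt_trans _ _ (\int[rho]_w ((1 + `|Z1 w|) ^+ k * normc (phi1 w) + (1 + `|Z2 w|) ^+ k * normc (phi2 w))%:E)%E).
    apply: ge0_le_integral => //.
    - by move=> w _; apply: integral_ge0 => b _; rewrite lee_fin; apply: mulr_ge0; [exact: exprn_ge0|exact: normc_ge0].
    - apply: measurable_fun_fubini_tonelli_F => [|z].
        apply/measurable_EFinP; apply: measurable_funM; last exact: measurable_normc.
        by apply: measurable_funX; apply: measurable_funD => //; exact: measurable_rV_norm.
      by rewrite lee_fin; apply: mulr_ge0; [exact: exprn_ge0|exact: normc_ge0].
    - by apply/measurable_EFinP; apply: measurable_funD; exact: mo.
    move=> w _; rewrite /fubini_F integral_bernoulli_prob//; last first.
      by move=> b; rewrite lee_fin; apply: mulr_ge0; [exact: exprn_ge0|exact: normc_ge0].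
    rewrite /Z /phi/= normcN -!EFinM -EFinD lee_fin.
    have a1 : 0 <= (1 + `|Z1 w|) ^+ k * normc (phi1 w) by apply: mulr_ge0; [exact: exprn_ge0|exact: normc_ge0].
    have a2 : 0 <= (1 + `|Z2 w|) ^+ k * normc (phi2 w) by apply: mulr_ge0; [exact: exprn_ge0|exact: normc_ge0].
    by rewrite /unstable.onem; move: a1 a2; lra.
  rewrite ge0_integralrD//; [|exact: mo|exact: mo| |].
  - by apply: lte_add_pinfty.
  - by move=> w; apply: mulr_ge0; [exact: exprn_ge0|exact: normc_ge0].
  - by move=> w; apply: mulr_ge0; [exact: exprn_ge0|exact: normc_ge0].
have split_wv (q : X -> R) y : symbol q -> wv B Z (fun z => (q (Z z))%:C * phi z) y =
    (2^-1)%:C * (wv rho Z1 (fun w => (q (Z1 w))%:C * phi1 w) y - wv rho Z2 (fun w => (q (Z2 w))%:C * phi2 w) y).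
  move=> sq; have i0 := wave_cis_int y (waveM sq wZ).
  have i1 := wave_cis_int y (waveM sq w1); have i2 := wave_cis_int y (waveM sq w2).
  rewrite /wv (cint_fubini1 i0) -cintB// -cintZ; last exact: cintegrableB.
  apply: eq_cint => w; rewrite /Z /phi/=.
  by rewrite cint_fair mulrN mulNr.
have s1 : symbol (fun _ : X => 1 : R).
  by apply: (@symbol_bounded _ _ _ 1) => [|xi]; [exact: measurable_cst|rewrite normr1].
have := Wm _ _ _ Z phi x wZ; rewrite (split_wv _ _ sm) normcM normc_real ger0_norm ?invr_ge0//.
have wvE y : wv B Z phi y = (2^-1)%:C * (wv rho Z1 phi1 y - wv rho Z2 phi2 y).
  have := split_wv _ y s1; rewrite (_ : (fun z => _) = phi); last by apply/funext => z; rewrite mul1r.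
  move=> ->; congr (_ * (_ - _)); by apply: eq_cint => w; rewrite mul1r.
under eq_integral do rewrite wvE normcM normc_real (@ger0_norm _ 2^-1) ?invr_ge0// mulrCA.
rewrite ge0_integralrZl ?invr_ge0//; last 2 first.
- apply: measurable_funM.
    by apply: measurableT_comp mW _; exact: measurable_rVB.
  apply: measurable_normc; apply: cmeasB; exact: cmeas_wv.
- by move=> y; apply: mulr_ge0 => //; exact: normc_ge0.
by rewrite EFinM lee_pmul2l// lte_fin invr_gt0.
Qed.

Lemma Rintegral_rV_flip (c : X) (F : X -> R) : measurable_fun [set: X] F ->
  \int[mu]_x F (c - x) = \int[mu]_x F x.
Proof.
move=> /measurable_EFinP mF; rewrite /Rintegral; congr fine.
rewrite [LHS]integralE [RHS]integralE; congr (_ - _)%E.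
  rewrite -(ge0_integral_rV_flip c (F := (EFin \o F)^\+%E))//; last exact: measurable_funepos.
  by apply: eq_integral => x _; rewrite !funeposE.
rewrite -(ge0_integral_rV_flip c (F := (EFin \o F)^\-%E))//; last exact: measurable_funeneg.
by apply: eq_integral => x _; rewrite !funenegE.
Qed.

Lemma cint_rV_flip (c : X) (F : X -> R[i]) : cmeas F -> cint mu (fun x => F (c - x)) = cint mu F.
Proof.
move=> [F1 F2]; rewrite /cint.
by rewrite (Rintegral_rV_flip c F1) (Rintegral_rV_flip c F2).
Qed.

Lemma wv_cintegrable (K : X -> R) d (T : measurableType d) (rho : {sigma_finite_measure set T -> \bar R})
    (Z : T -> X) phi (f : X -> X) : cintegrable mu (fun y => (K y)%:C) -> measurable_fun [set: X] f ->
  wave rho Z phi -> cintegrable mu (fun y => (K y)%:C * wv rho Z phi (f y)).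
Proof.
move=> [mK Koo] mf wp; have [j jE] := wv_bounded wp.
have mK' : measurable_fun [set: X] K by have := mK.1.
apply: (cintegrable_le (u := fun y => j * `|K y|)) => //.
- by apply: cmeasM => //; exact: cmeas_comp (cmeas_wv wp) _.
- by apply: measurable_funM => //; exact: measurableT_comp.
- by move=> y; rewrite normcM normc_real mulrC; apply: ler_wpM2r.
have j0 : 0 <= j by apply: le_trans (jE 0); exact: normc_ge0.
rewrite ge0_integralrZl//; last exact: measurableT_comp.
rewrite lte_mul_pinfty//; move: Koo; by under eq_integral do rewrite normc_real.
Qed.

Lemma wv_kernel (K : X -> R) m : cintegrable mu (fun y => (K y)%:C) ->
  (forall th xi, cint mu (fun y => (K y)%:C * cis (th - 2 * pi * dotprod y xi)) = (m xi)%:C * cis th) ->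
  forall d (T : measurableType d) (rho : {sigma_finite_measure set T -> \bar R}) (Z : T -> X) phi x,
  wave rho Z phi -> wv rho Z (fun w => (m (Z w))%:C * phi w) x =
    cint mu (fun y => (K y)%:C * wv rho Z phi (x - y)).
Proof.
move=> Ki Km d T rho Z phi x wp; have [mZ mphi _] := wp; have [mK' Koo] := Ki.
have mK : measurable_fun [set: X] K by have := mK'.1.
have mF : cmeas (fun z : X * T => ((K z.1)%:C * phi z.2) * cis (2 * pi * dotprod (x - z.1) (Z z.2))).
  apply: cmeasM; first apply: cmeasM.
  - by apply: cmeas_real; exact: measurableT_comp mK measurable_fst.
  - exact: cmeas_comp mphi measurable_snd.
  - apply: cmeas_cis; apply: measurable_funM => //; apply: measurable_dotprod.
      by apply: measurable_rVB => //; exact: measurable_cst.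
    exact: measurableT_comp mZ measurable_snd.
have Fi : cintegrable (mu \x rho)%E (fun z : X * T => ((K z.1)%:C * phi z.2) * cis (2 * pi * dotprod (x - z.1) (Z z.2))).
  apply: (cintegrable_tensor Ki (wave_int wp)) => // z.
  by rewrite normcM normc_cis mulr1 normcM.
rewrite /wv; transitivity (cint rho (fun w => cint mu (fun y => ((K y)%:C * phi w) * cis (2 * pi * dotprod (x - y) (Z w))))).
  apply: eq_cint => w.
  rewrite mulrAC -Km mulrC -cintZ; last first.
    apply: (cintegrable_le (u := fun y => `|K y|)) => //.
    - apply: cmeasM; first exact: cmeas_real.
      apply: cmeas_cis; apply: measurable_funB => //; apply: measurable_funM => //.
      exact: measurable_dotprod.
    - exact: measurableT_comp.
    - by move=> y; rewrite normcM normc_cis mulr1 normc_real.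
    - by move: Koo; under eq_integral do rewrite normc_real.
  by apply: eq_cint => y; rewrite dotprodBl mulrBr mulrA (mulrC (phi w)).
rewrite -(cint_fubini Fi); apply: eq_cint => y.
rewrite -cintZ; last exact: wave_cis_int.
by apply: eq_cint => w; rewrite mulrA.
Qed.

Lemma wv_heat e a d (T : measurableType d) (rho : {sigma_finite_measure set T -> \bar R})
    (Z : T -> X) phi x : 0 < a -> wave rho Z phi ->
  wv rho Z (fun w => (expR (- (a * lap e (Z w))))%:C * phi w) x =
    cint mu (fun y => (hk e a (x - y))%:C * wv rho Z phi y).
Proof.
move=> a0 wp; have [mZ mphi _] := wp.
rewrite (wv_kernel (hk_int e a0) (fun th xi => hk_fourier e th xi a0) x wp).
rewrite -(cint_rV_flip x); last first.
  apply: cmeasM; last by apply: cmeas_comp (cmeas_wv wp) _; exact: measurable_rVB.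
  by apply: cmeas_real; exact: measurable_hk.
by apply: eq_cint => y; rewrite subKr.
Qed.

(** [FB_lap_powR] at scale [sqrt c * r], made dimensionless; since [c <= 1] this scale is finer than
    [r], and its weight is bounded by that of scale [r]. *)
Lemma FB_lap_homog (N a c : R) : n%:R < N -> 0 < a -> N < n%:R + 2 * a -> 0 < c <= 1 ->
  exists2 C : R, 0 < C & forall e r, 0 <= e -> 0 < r ->
  FB (fun xi : X => (r ^+ 2 * lap e xi) `^ a * expR (- (c * r ^+ 2 * lap e xi)))
     (fun x => C * wgt r N x).
Proof.
move=> nN a0 Na /andP[c0 c1]; have N0 : 0 <= N by rewrite (le_trans _ (ltW nN)).
have [C C0 H] := FB_lap_powR nN a0 Na.
pose q := Num.sqrt c; have q0 : 0 < q by rewrite sqrtr_gt0.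
have q1 : q <= 1 by rewrite -sqrtr1 ler_sqrt.
have qc : q ^+ 2 = c by rewrite sqr_sqrtr// ltW.
exists (C * c `^ (- a) * q^-1 ^+ n) => [|e r e0 r0].
  by rewrite !mulr_gt0 ?powR_gt0 ?exprn_gt0 ?invr_gt0.
have r20 : 0 < r ^+ 2 by rewrite exprn_gt0.
have qr : 0 < q * r by rewrite mulr_gt0.
have cr : (q * r) ^+ 2 = c * r ^+ 2 by rewrite exprMn qc.
have mw (k : R) s : measurable_fun [set: X] (fun x => k * wgt s N x).
  by apply: measurable_funM => //; exact: measurable_wgt.
have cr0 : 0 <= C * (c * r ^+ 2) `^ (- a) by rewrite mulr_ge0 ?powR_ge0// ltW.
have w0 x : 0 <= C * (c * r ^+ 2) `^ (- a) * wgt (q * r) N x by rewrite mulr_ge0 ?wgt_ge0.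
have sm : symbol (fun xi : X => lap e xi `^ a * expR (- (c * r ^+ 2 * lap e xi))).
  apply: symbolM; first exact: symbol_lap_powR (ltW a0).
  by apply: symbol_heat => //; rewrite mulr_ge0 ?(ltW c0) ?(ltW r20).
have := H e (q * r) e0 qr; rewrite cr => h.
have := FB_scale (powR_ge0 (r ^+ 2) a) sm (mw _ _) w0 h.
rewrite (_ : (fun xi => _) = (fun xi : X => (r ^+ 2 * lap e xi) `^ a * expR (- (c * r ^+ 2 * lap e xi)))); last first.
  by apply/funext => xi; rewrite (powRM _ (ltW r20) (lap_ge0 xi e0)) mulrA.
move=> h2; apply: FB_mono h2 _ _ _ _ => //.
- exact: measurable_funM.
- by move=> x; rewrite mulr_ge0// powR_ge0.
move=> x; rewrite powRM ?(ltW c0) ?(ltW r20)//.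
have e1 : (r ^+ 2) `^ a * (r ^+ 2) `^ (- a) = 1.
  by rewrite -powRD ?(gt_eqF r20) ?implybT// subrr powRr0.
rewrite (_ : _ * _ = C * c `^ (- a) * wgt (q * r) N x); last first.
  move: e1; move: ((r ^+ 2) `^ a) ((r ^+ 2) `^ (- a)) (c `^ (- a)) (wgt _ _ _) => v w u z e1.
  by rewrite [LHS](_ : _ = (v * w) * (C * u * z)); [rewrite e1 mul1r|ring].
rewrite -[leRHS]mulrA; apply: ler_wpM2l; first by rewrite mulr_ge0 ?powR_ge0// ltW.
have qrr : q * r <= r by rewrite ler_piMl// ltW.
have := wgt_up x qr qrr N0; rewrite (_ : r / (q * r) = q^-1)//.
by field; rewrite !gt_eqF.
Qed.

End wave_pairs.

(** * Maximal averages as weights *)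

Section tame.
Context {R : realType} {n : nat}.
Local Notation X := 'rV[R]_n.
Local Notation mu := (lebesgue_rV R n).
Local Notation NN := (n%:R + 1 : R).
Implicit Types (x y v xi : X).

Lemma powR_ge1 (a p : R) : 1 <= a -> 0 <= p -> 1 <= a `^ p.
Proof. by move=> a1 p0; rewrite -(powRr0 a) ler_powR. Qed.

Lemma powR_le_self (a p : R) : 1 <= a -> p <= 1 -> a `^ p <= a.
Proof. by move=> a1 p1; rewrite -[leRHS]powRr1 ?(le_trans ler01)// ler_powR. Qed.

Lemma powR_le_mul (a b P p : R) : 0 <= b -> 0 <= a -> 1 <= P -> b <= a * P -> 0 <= p <= 1 ->
  b `^ p <= a `^ p * P.
Proof.
move=> b0 a0 P1 bP /andP[p0 p1]; have P0 : 0 <= P by rewrite (le_trans ler01).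
apply: (@le_trans _ _ ((a * P) `^ p)); first by apply: ge0_ler_powR; rewrite ?nnegrE// mulr_ge0.
by rewrite powRM//; apply: ler_wpM2l; [exact: powR_ge0|exact: powR_le_self].
Qed.

Lemma one_plus_scale r s v : 0 < r -> r <= s -> 1 + `|v| / s <= 1 + `|v| / r.
Proof.
move=> r0 rs; rewrite lerD2l; apply: ler_wpM2l => //.
by rewrite lef_pV2 ?posrE// (lt_le_trans r0).
Qed.

(* [U] behaves at scale [r] like an average of a function whose maximal function at [x] is at most [C] *)
Definition tame (C b r : R) x (U : X -> R) := [/\ measurable_fun [set: X] U, forall v, 0 <= U v,
  forall v, U v <= C * (1 + `|v - x| / r) ^+ n,
  forall v y, U (v - y) <= U v * (1 + `|y| / r) `^ NN &
  (\int[mu]_v (wgt r (n%:R + b) (x - v) * U v)%:E <= C%:E)%E].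

Lemma tameD C1 C2 b r x U1 U2 : 0 < r -> tame C1 b r x U1 -> tame C2 b r x U2 ->
  tame (C1 + C2) b r x (fun v => U1 v + U2 v).
Proof.
move=> r0 [m1 p1 g1 t1 i1] [m2 p2 g2 t2 i2]; split.
- exact: measurable_funD.
- by move=> v; exact: addr_ge0.
- by move=> v; rewrite mulrDl; exact: lerD.
- by move=> v y; rewrite mulrDl; exact: lerD.
have mw : measurable_fun [set: X] (fun v => wgt r (n%:R + b) (x - v)).
  by apply: measurable_wgt; exact: measurable_rVB.
under eq_integral do rewrite mulrDr.
rewrite ge0_integralrD; last 4 first.
- exact: measurable_funM.
- exact: measurable_funM.
- by move=> v; rewrite mulr_ge0// wgt_ge0.
- by move=> v; rewrite mulr_ge0// wgt_ge0.
by rewrite EFinD; exact: leeD.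
Qed.

Lemma tame_cst b : 0 < b -> exists2 C : R, 0 < C & forall r x, 0 < r -> tame C b r x (fun=> 1).
Proof.
move=> b0; have nb : n%:R < n%:R + b by rewrite ltrDl.
have [C C0 H] := wgt_integral_le (n := n) nb.
exists (1 + C) => [|r x r0]; first by rewrite addr_gt0.
split => //.
- move=> v; have : 1 <= (1 + `|v - x| / r) ^+ n by rewrite exprn_ege1// one_plus_ge1.
  by move=> h; rewrite (le_trans h)// ler_peMl// ?(le_trans _ h)// lerDl ltW.
- by move=> v y; rewrite mul1r powR_ge1// ?one_plus_ge1// addr_ge0.
- under eq_integral do rewrite mulr1.
  by apply: le_trans (H r x r0) _; rewrite lee_fin lerDr.
Qed.

(** Each clause of [tame] is a property of weighted averages: the growth away from [x] is [wgt_HL],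
    the slow variation is [wgt_peetre], and the integral clause is [wgt_smooth], where [b <= 1]
    allows the weight with exponent [n + 1] to be replaced by the heavier one with [n + b]. *)
Lemma tame_average b : 0 < b <= 1 -> exists2 C : R, 0 < C &
  forall r s x (psi : X -> R) (K : R), 0 < r -> r <= s -> measurable_fun [set: X] psi ->
  (forall y, 0 <= psi y) -> 0 < K -> (HL psi x <= K%:E)%E ->
  exists2 u, tame C b r x u &
    forall v, (\int[mu]_y (wgt s NN (v - y) * psi y)%:E = (K * u v)%:E)%E.
Proof.
move=> /andP[b0 b1]; have nb : n%:R < n%:R + b by rewrite ltrDl.
have nN : n%:R < NN by rewrite ltrDl.
have NN0 : 0 <= NN by rewrite addr_ge0.
have [C1 C10 H1] := wgt_HL (n := n) nN.
have [C2 C20 H2] := wgt_HL (n := n) nb.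
have [C3 C30 H3] := wgt_smooth (n := n) nb.
exists (C1 + C3 * C2) => [|r s x psi K r0 rs mpsi p0 K0 HK]; first by rewrite addr_gt0 ?mulr_gt0.
have s0 := lt_le_trans r0 rs.
pose I v := (\int[mu]_y (wgt s NN (v - y) * psi y)%:E)%E.
have mwpsi t M v : measurable_fun [set: X] (fun y => wgt t M (v - y) * psi y).
  by apply: measurable_funM => //; apply: measurable_wgt; exact: measurable_rVB.
have wpsi0 t M v y : 0 < t -> 0 <= wgt t M (v - y) * psi y by move=> t0; rewrite mulr_ge0// wgt_ge0.
have I0 v : (0 <= I v)%E by apply: integralr_ge0 => y; exact: wpsi0.
have Ile v : (I v <= (K * (C1 * (1 + `|v - x| / r) ^+ n))%:E)%E.
  apply: le_trans (H1 s v x psi s0 mpsi p0) _.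
  have c0 : 0 <= C1 * (1 + `|v - x| / s) ^+ n.
    by rewrite mulr_ge0 ?exprn_ge0 ?(ltW (one_plus_gt0 _ s0))// ltW.
  apply: (@le_trans _ _ ((C1 * (1 + `|v - x| / s) ^+ n)%:E * K%:E)%E).
    by apply: lee_wpmul2l; rewrite ?lee_fin.
  rewrite -EFinM lee_fin mulrC; apply: ler_wpM2l; first exact: ltW.
  apply: ler_wpM2l; first exact: ltW.
  by rewrite lerXn2r ?nnegrE ?(ltW (one_plus_gt0 _ _))//; exact: one_plus_scale.
have If v : I v \is a fin_num.
  by rewrite ge0_fin_numE//; apply: le_lt_trans (Ile v) _; rewrite ltry.
pose U v := fine (I v) / K.
have IE v : I v = (K * U v)%:E by rewrite /U mulrC divfK ?gt_eqF// fineK.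
have mI M : measurable_fun [set: X] (fun v => \int[mu]_y (wgt s M (v - y) * psi y)%:E)%E.
  apply: (measurable_ge0_param mu (F := fun z : X * X => (wgt s M (z.1 - z.2) * psi z.2)%:E)) => [|z].
    apply/measurable_EFinP; apply: measurable_funM.
      by apply: measurable_wgt; exact: measurable_rVB.
    exact: measurableT_comp mpsi measurable_snd.
  by rewrite lee_fin; exact: wpsi0.
have mU : measurable_fun [set: X] U.
  apply: measurable_funM => //; have := mI NN; exact: measurableT_comp.
have U0 v : 0 <= U v by rewrite /U divr_ge0 ?fine_ge0// ltW.
clearbody U; exists U => //; split => //.
- move=> v; rewrite -(ler_pM2l K0) -lee_fin -IE; apply: le_trans (Ile v) _.
  rewrite lee_fin; apply: ler_wpM2l; first exact: ltW.
  apply: ler_wpM2r; first by rewrite exprn_ge0// ltW// one_plus_gt0.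
  by rewrite lerDl mulr_ge0// ltW.
- move=> v y; have P0 : 0 <= (1 + `|y| / r) `^ NN by exact: powR_ge0.
  rewrite -(ler_pM2l K0) mulrA [leRHS]mulrC -lee_fin [leRHS]EFinM -!IE.
  rewrite /I -ge0_integralrZl//; last by move=> z; exact: wpsi0.
  apply: ge0_le_integralr.
  + exact: mwpsi.
  + by apply: measurable_funM => //; exact: mwpsi.
  + by move=> z; exact: wpsi0.
  + move=> z; rewrite [leRHS]mulrA; apply: ler_wpM2r => //.
    rewrite (_ : v - y - z = v - z - y); last by rewrite addrAC.
    apply: (le_trans (wgt_peetre (v - z) y s0 NN0)); rewrite mulrC.
    apply: ler_wpM2r; first exact: wgt_ge0.
    apply: ge0_ler_powR; rewrite ?nnegrE ?(ltW (one_plus_gt0 _ _))//.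
    exact: one_plus_scale.
have mw : measurable_fun [set: X] (fun v => wgt r (n%:R + b) (x - v)).
  by apply: measurable_wgt; exact: measurable_rVB.
have bN : n%:R + b <= NN by rewrite lerD2l.
rewrite -(@lee_pmul2l _ K%:E)// -ge0_integralrZl ?(ltW K0)//; last 2 first.
- exact: measurable_funM.
- by move=> v; rewrite mulr_ge0// wgt_ge0.
apply: (@le_trans _ _ (\int[mu]_v ((wgt r (n%:R + b) (x - v))%:E * \int[mu]_y (wgt s (n%:R + b) (v - y) * psi y)%:E))%E).
  apply: ge0_le_integral => //.
  - by move=> v _; rewrite lee_fin; apply: mulr_ge0; [exact: ltW|apply: mulr_ge0 => //; exact: wgt_ge0].
  - by apply/measurable_EFinP; apply: measurable_funM => //; exact: measurable_funM.
  - by apply: emeasurable_funM => //; exact/measurable_EFinP.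
  move=> v _; rewrite mulrCA EFinM -IE; apply: lee_wpmul2l; first by rewrite lee_fin wgt_ge0.
  apply: ge0_le_integralr.
  - exact: mwpsi.
  - exact: mwpsi.
  - by move=> y; exact: wpsi0.
  - by move=> y; apply: ler_wpM2r => //; exact: wgt_mono.
apply: le_trans (H3 r s psi x r0 rs mpsi p0) _.
have HL0 := HL_ge0 x p0.
apply: (@le_trans _ _ (C3%:E * (C2%:E * K%:E))%E).
  apply: lee_wpmul2l; first by rewrite lee_fin ltW.
  apply: le_trans (H2 s x x psi s0 mpsi p0) _.
  rewrite subrr normr0 mul0r addr0 expr1n mulr1; apply: lee_wpmul2l => //; by rewrite lee_fin ltW.
rewrite -!EFinM lee_fin mulrA mulrC; apply: ler_wpM2l; first exact: ltW.
by rewrite lerDr ltW.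
Qed.

(** A truncation takes the place of convexity: [psi <= l + l^(1-p) psi^p] pointwise, with
    [l = K (1 + u)^(1/p)] chosen so that both terms average to at most a multiple of [l]. The [1 +]
    keeps [l] positive when [u = 0]. *)
Lemma jensen_average : exists2 C : R, 0 < C & forall s (psi : X -> R) (p K u : R) v,
  0 < s -> measurable_fun [set: X] psi -> (forall y, 0 <= psi y) -> 1 <= p -> 0 < K -> 0 <= u ->
  (\int[mu]_y (wgt s NN (v - y) * psi y `^ p)%:E = (K `^ p * u)%:E)%E ->
  (\int[mu]_y (wgt s NN (v - y) * psi y)%:E <= (C * (K * (1 + u) `^ p^-1))%:E)%E.
Proof.
have nN : n%:R < NN by rewrite ltrDl.
have [C C0 H] := wgt_integral_le (n := n) nN.
exists (C + 1) => [|s psi p K u v s0 mpsi p0 p1 K0 u0 hu]; first by rewrite addr_gt0.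
have pp : 0 < p by rewrite (lt_le_trans ltr01).
pose l := K * (1 + u) `^ p^-1.
have l0 : 0 < l by rewrite mulr_gt0// powR_gt0// ltr_wpDr.
have mw : measurable_fun [set: X] (fun y => wgt s NN (v - y)).
  by apply: measurable_wgt; exact: measurable_rVB.
have mpp : measurable_fun [set: X] (fun y => psi y `^ p).
  exact: (measurableT_comp (f := @powR R ^~ p) (measurable_powR p) mpsi).
have w0 y : 0 <= wgt s NN (v - y) by exact: wgt_ge0.
have key y : psi y <= l + l `^ (1 - p) * psi y `^ p.
  have [h|h] := lerP (psi y) l; first by rewrite (le_trans h)// lerDl mulr_ge0 ?powR_ge0.
  have psi0 := lt_trans l0 h.
  apply: (@le_trans _ _ (l `^ (1 - p) * psi y `^ p)); last by rewrite lerDr ltW.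
  have -> : l `^ (1 - p) = (l `^ (p - 1))^-1 by rewrite -powRN opprB.
  rewrite ler_pdivlMl ?powR_gt0// -[X in _ * X](powRr1 (ltW psi0)).
  apply: (@le_trans _ _ (psi y `^ (p - 1) * psi y `^ 1)).
    apply: ler_wpM2r; first exact: powR_ge0.
    by apply: ge0_ler_powR; rewrite ?subr_ge0// ?nnegrE ltW.
  by rewrite -powRD ?subrK// (gt_eqF psi0) implybT.
apply: (@le_trans _ _ (\int[mu]_y (l * wgt s NN (v - y) + l `^ (1 - p) * (wgt s NN (v - y) * psi y `^ p))%:E)%E).
  apply: ge0_le_integralr.
  - exact: measurable_funM.
  - by apply: measurable_funD; apply: measurable_funM => //; exact: measurable_funM.
  - by move=> y; rewrite mulr_ge0.
  - move=> y; have := ler_wpM2l (w0 y) (key y); rewrite mulrDr.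
    by rewrite (mulrC l) (mulrCA (l `^ _)).
rewrite ge0_integralrD; last 4 first.
- exact: measurable_funM.
- by apply: measurable_funM => //; exact: measurable_funM.
- by move=> y; rewrite mulr_ge0// ltW.
- by move=> y; rewrite mulr_ge0 ?powR_ge0// mulr_ge0 ?powR_ge0.
rewrite (ge0_integralrZl _ (k := l)) ?(ltW l0)// (ge0_integralrZl _ (k := l `^ (1 - p))) ?powR_ge0//; last 2 first.
- exact: measurable_funM.
- by move=> y; rewrite mulr_ge0 ?powR_ge0.
rewrite hu -EFinM; apply: (@le_trans _ _ (l%:E * C%:E + l%:E)%E); last first.
  by rewrite -EFinM -EFinD lee_fin -/l mulrDl mul1r (mulrC C).
apply: leeD; first by apply: lee_wpmul2l; [rewrite lee_fin ltW|exact: H].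
rewrite lee_fin -[leRHS]mulr1.
have -> : l `^ (1 - p) = l * (l `^ p)^-1.
  by rewrite powRD ?(gt_eqF l0) ?implybT// powRr1 ?ltW// powRN.
rewrite -mulrA ler_pM2l// ler_pdivrMl ?powR_gt0// mulr1.
rewrite /l powRM ?powR_ge0 ?(ltW K0)// -powRrM mulVf ?gt_eqF// powRr1 ?addr_ge0//.
by apply: ler_wpM2l; [exact: powR_ge0|rewrite lerDr].
Qed.

End tame.

(** * Hölder continuity of smoothed waves *)

Section increments.
Context {R : realType} {n : nat}.
Local Notation X := 'rV[R]_n.
Local Notation mu := (lebesgue_rV R n).
Local Notation NN := (n%:R + 1 : R).
Implicit Types (x y v xi : X).

Lemma hk0 a x : hk 0 a x = gk a x :> R.
Proof. by rewrite /hk mul0r oppr0 expR0 mul1r. Qed.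

Lemma wave_heat e a d (T : measurableType d) (rho : {sigma_finite_measure set T -> \bar R}) (Z : T -> X) phi :
  0 <= e -> 0 <= a -> wave rho Z phi -> wave rho Z (fun w => (expR (- (a * lap e (Z w))))%:C * phi w).
Proof. by move=> e0 a0 wp; apply: (waveM (symbol_heat e0 a0) wp). Qed.

Lemma hk_flip_int e z a : 0 < a -> cintegrable mu (fun y => (hk e a (z - y))%:C).
Proof.
move=> a0; have [_ hoo] := hk_int (n := n) e a0; have mh := measurable_hk (n := n) e a.
split.
  by apply: cmeas_real; apply: measurableT_comp mh _; exact: measurable_rVB.
rewrite (ge0_integral_rV_flip z (F := fun y => (normc (hk e a y)%:C)%:E))//.
  by apply/measurable_EFinP; apply: measurable_normc; exact: cmeas_real.
by move=> y; rewrite lee_fin normc_ge0.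
Qed.

(** [gk_increment] integrated against the wave. The time [a] is only required to be comparable to
    [s^2], as it will be [3/4 s^2 - r^2/2]. *)
Lemma heat_increment (ep : R) : 0 < ep <= 1 -> exists2 C : R, 0 < C &
  forall s a d (T : measurableType d) (rho : {sigma_finite_measure set T -> \bar R}) (Z : T -> X) phi
    (g : X -> R) u v,
  0 < s -> s ^+ 2 / 4 <= a <= s ^+ 2 -> wave rho Z phi ->
  (forall v, \int[mu]_y (wgt s NN (v - y) * normc (wv rho Z phi y))%:E <= (g v)%:E)%E ->
  normc (wv rho Z (fun w => (expR (- (a * lap 0 (Z w))))%:C * phi w) u -
         wv rho Z (fun w => (expR (- (a * lap 0 (Z w))))%:C * phi w) v)
    <= C * (`|u - v| / s) `^ ep * (g u + g v).
Proof.
move=> ep01; have /andP[ep0 ep1] := ep01; have N0 : 0 <= NN by rewrite addr_ge0.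
have [C C0 H] := gk_increment (n := n) N0 ep01.
exists (C * 2 * 2 ^+ n) => [|s a d T rho Z phi g u v s0 /andP[a1 a2] wp hg]; first by rewrite !mulr_gt0 ?exprn_gt0.
have a0 : 0 < a by apply: lt_le_trans a1; rewrite divr_gt0 ?exprn_gt0.
pose q := Num.sqrt a; have q0 : 0 < q by rewrite sqrtr_gt0.
have qE : q ^+ 2 = a by rewrite sqr_sqrtr// ltW.
have qs : q <= s by rewrite -(ler_pXn2r (n := 2)) ?nnegrE ?(ltW q0) ?(ltW s0)// qE.
have sq : s / q <= 2.
  rewrite ler_pdivrMr// -(ler_pXn2r (n := 2)) ?nnegrE ?(ltW s0)//; last by rewrite mulr_ge0// ltW.
  by rewrite exprMn qE; move: (s ^+ 2) a1 => b; lra.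
have ci z : cintegrable mu (fun y => (hk 0 a (z - y))%:C * wv rho Z phi y).
  exact: (wv_cintegrable (hk_flip_int 0 z a0) (@measurable_id _ _ [set: X]) wp).
rewrite !(wv_heat _ _ a0 wp) -cintB//.
rewrite -lee_fin; apply: le_trans (normc_cint _) _; first exact: cintegrableB.
have mn := measurable_normc_wv wp (@measurable_id _ _ [set: X]).
have mw z : measurable_fun [set: X] (fun y => wgt s NN (z - y)).
  by apply: measurable_wgt; exact: measurable_rVB.
have mh z : measurable_fun [set: X] (fun y => hk 0 a (z - y)).
  by apply: measurableT_comp (measurable_hk 0 a) _; exact: measurable_rVB.
have nw y : 0 <= normc (wv rho Z phi y) by exact: normc_ge0.
set K := C * 2 * 2 ^+ n * (`|u - v| / s) `^ ep.
have K0 : 0 <= K by rewrite !mulr_ge0 ?powR_ge0 ?exprn_ge0// ltW.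
apply: (@le_trans _ _ (\int[mu]_y (K * (wgt s NN (u - y) * normc (wv rho Z phi y) + wgt s NN (v - y) * normc (wv rho Z phi y)))%:E)%E).
  apply: ge0_le_integralr.
  - under eq_fun do rewrite -mulrBl normcM normcB_real.
    by apply: measurable_funM => //; apply: measurableT_comp => //; exact: measurable_funB.
  - by apply: measurable_funM => //; apply: measurable_funD; exact: measurable_funM.
  - by move=> y; exact: normc_ge0.
  move=> y; rewrite -mulrBl normcM normcB_real -mulrDl mulrA; apply: ler_wpM2r => //.
  rewrite !hk0 -qE; apply: le_trans (H q (u - y) (v - y) q0) _.
  rewrite opprB addrA subrK.
  have w0 (z : X) t : 0 < t -> 0 <= wgt t NN z by exact: wgt_ge0.
  have h1 : (`|u - v| / q) `^ ep <= 2 * (`|u - v| / s) `^ ep.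
    apply: (@le_trans _ _ ((2 * (`|u - v| / s)) `^ ep)).
      apply: ge0_ler_powR; rewrite ?nnegrE ?mulr_ge0 ?divr_ge0 ?invr_ge0 ?(ltW q0) ?(ltW s0) ?(ltW ep0)//.
      rewrite mulrCA; apply: ler_wpM2l => //.
      by rewrite ler_pdivlMr// mulrC.
    rewrite powRM ?divr_ge0 ?(ltW s0)//; apply: ler_wpM2r; first exact: powR_ge0.
    by apply: powR_le_self => //; rewrite ler1n.
  have h2 (z : X) : wgt q NN z <= 2 ^+ n * wgt s NN z.
    apply: (le_trans (wgt_up z q0 qs N0)); apply: ler_wpM2r; first exact: w0.
    by rewrite lerXn2r ?nnegrE ?divr_ge0 ?(ltW s0) ?(ltW q0).
  have h3 : (`|u - v| / q) `^ ep * (wgt q NN (u - y) + wgt q NN (v - y)) <=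
      2 * (`|u - v| / s) `^ ep * (2 ^+ n * (wgt s NN (u - y) + wgt s NN (v - y))).
    apply: ler_pM h1 _; first exact: powR_ge0.
      by rewrite addr_ge0// w0.
    by rewrite mulrDr; apply: lerD.
  rewrite -mulrA; apply: (le_trans (ler_wpM2l (ltW C0) h3)).
  rewrite le_eqVlt; apply/orP; left; apply/eqP; rewrite /K.
  by move: (_ `^ ep) (2 ^+ n) (wgt s NN (u - y) + wgt s NN (v - y)) => a' b' c'; ring.
rewrite ge0_integralrZl//; last 2 first.
- by apply: measurable_funD; exact: measurable_funM.
- by move=> y; rewrite addr_ge0// mulr_ge0// wgt_ge0.
rewrite ge0_integralrD; last 4 first.
- exact: measurable_funM.
- exact: measurable_funM.
- by move=> y; rewrite mulr_ge0// wgt_ge0.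
- by move=> y; rewrite mulr_ge0// wgt_ge0.
by rewrite [leRHS]EFinM EFinD; apply: lee_wpmul2l; [rewrite lee_fin|exact: leeD].
Qed.

Lemma gk_moment_int (p : R) : 0 <= p -> exists2 C : R, 0 < C & forall c r, 0 < r -> 4^-1 <= c <= 1 ->
  (\int[mu]_y (gk (c * r ^+ 2) y * (1 + `|y| / r) `^ p)%:E <= C%:E)%E.
Proof.
move=> p0; have P0 : 0 <= p + NN by rewrite !addr_ge0.
have nN : n%:R < NN by rewrite ltrDl.
have [C C0 H] := gk_le_wgt (n := n) P0.
have [D D0 HD] := wgt_integral_le0 (n := n) nN.
exists (C * 2 ^+ n * D) => [|c r r0 /andP[c1 c2]]; first by rewrite !mulr_gt0 ?exprn_gt0.
have c0 : 0 < c by rewrite (lt_le_trans _ c1)// invr_gt0.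
pose q := Num.sqrt c * r; have sc : 0 < Num.sqrt c by rewrite sqrtr_gt0.
have q0 : 0 < q by rewrite mulr_gt0.
have qE : q ^+ 2 = c * r ^+ 2 by rewrite exprMn sqr_sqrtr// ltW.
have qr : q <= r by rewrite ler_piMl ?(ltW r0)// -sqrtr1 ler_sqrt.
have rq : r / q <= 2.
  rewrite ler_pdivrMr// -(ler_pXn2r (n := 2)) ?nnegrE ?(ltW r0)//; last by rewrite mulr_ge0// ltW.
  by rewrite exprMn qE mulrA ler_peMl ?sqr_ge0//; move: c1; lra.
have o0 y := one_plus_gt0 y r0.
apply: (@le_trans _ _ (\int[mu]_y (C * 2 ^+ n * wgt r NN y)%:E)%E).
  apply: ge0_le_integralr.
  - apply: measurable_funM; first exact: measurable_gk.
    apply: (measurableT_comp (f := @powR R ^~ p)); first exact: measurable_powR.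
    by apply: measurable_funD => //; apply: measurable_funM => //; exact: measurable_rV_norm.
  - by apply: measurable_funM => //; exact: measurable_wgt.
  - by move=> y; rewrite mulr_ge0 ?powR_ge0// gk_ge0.
  move=> y; rewrite -qE.
  apply: (@le_trans _ _ (C * (2 ^+ n * wgt r (p + NN) y) * (1 + `|y| / r) `^ p)).
    apply: ler_wpM2r; first exact: powR_ge0.
    apply: (le_trans (H q y q0)); apply: ler_wpM2l; first exact: ltW.
    apply: (le_trans (wgt_up y q0 qr P0)); apply: ler_wpM2r; first exact: wgt_ge0.
    by rewrite lerXn2r ?nnegrE ?divr_ge0 ?(ltW r0) ?(ltW q0).
  rewrite le_eqVlt; apply/orP; left; apply/eqP; rewrite -!mulrA; congr (_ * (_ * _)).
  rewrite /wgt -powRD; last by rewrite (gt_eqF (o0 y)) implybT.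
  by congr (_ * _ `^ _); ring.
rewrite ge0_integralrZl; last 3 first.
- by rewrite mulr_ge0 ?exprn_ge0// ltW.
- exact: measurable_wgt.
- by move=> y; rewrite wgt_ge0.
rewrite [leRHS]EFinM; apply: lee_wpmul2l; last exact: HD.
by rewrite lee_fin mulr_ge0 ?exprn_ge0// ltW.
Qed.

(* At frequencies below [1/s >= 1/r] the smoothing [exp (r^2 Delta / 2)] barely changes a wave, and the
   wave is Hölder continuous at scale [s]. *)
Lemma low_increment (ep C0 : R) : 0 < ep <= 1 -> 0 < C0 -> exists2 C : R, 0 < C &
  forall r s b x d (T : measurableType d) (rho : {sigma_finite_measure set T -> \bar R}) (Z : T -> X) phi
    (U : X -> R) (L om : R) u,
  0 < r -> r <= s -> wave rho Z phi -> tame C0 b r x U -> (forall v, 1 <= U v) -> 0 <= L -> 0 <= om <= 1 ->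
  (forall v, \int[mu]_y (wgt s NN (v - y) * normc (wv rho Z phi y))%:E <= (L * U v `^ om)%:E)%E ->
  forall psi, psi = (fun w => (expR (- ((3 / 4 * s ^+ 2 - r ^+ 2 / 2) * lap 0 (Z w))))%:C * phi w) ->
  forall G0 G, G0 = wv rho Z psi ->
  G = wv rho Z (fun w => (expR (- (2^-1 * r ^+ 2 * lap 0 (Z w))))%:C * psi w) ->
  normc (G0 u - G x) <= C * L * (r / s) `^ ep * (1 + `|u - x| / r) `^ ep * U u `^ om.
Proof.
move=> ep01 C00; have [C1 C10 H1] := heat_increment ep01; have /andP[ep0 ep1] := ep01.
have N20 : 0 <= 1 + NN by rewrite !addr_ge0.
have [C2 C20 H2] := gk_moment_int N20.
exists (C1 * (1 + C0) + C1 * C0 * (2 * C2)) => [|r s b x d T rho Z phi U L om u].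
  by rewrite addr_gt0 ?mulr_gt0 ?addr_gt0.
move=> r0 rs wp tU U1 L0 om01 hg psi psiE G0 G G0E0 GE0; have /andP[om0 om1] := om01.
have s0 := lt_le_trans r0 rs.
have [mU U0 Ug Up _] := tU.
have r2s : r ^+ 2 <= s ^+ 2 by rewrite lerXn2r ?nnegrE ?(ltW r0) ?(ltW s0).
have r20 : 0 < r ^+ 2 by rewrite exprn_gt0.
set a := 3 / 4 * s ^+ 2 - r ^+ 2 / 2 in psiE.
(* As [r <= s], at least [s^2/4] of the smoothing is left. *)
have a1 : s ^+ 2 / 4 <= a <= s ^+ 2 by rewrite /a; lra.
have a0 : 0 <= a by rewrite /a; lra.
have wp0 : wave rho Z psi by rewrite psiE; exact: (wave_heat (lexx 0) a0 wp).
have inc y z : normc (G0 y - G0 z) <= C1 * (`|y - z| / s) `^ ep * (L * U y `^ om + L * U z `^ om).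
  rewrite G0E0 psiE; exact: (H1 s a _ _ _ _ _ (fun v => L * U v `^ om) y z s0 a1 wp hg).
have Ux : U x `^ om <= C0.
  have := Ug x; rewrite subrr normr0 mul0r addr0 expr1n mulr1; apply: le_trans.
  exact: powR_le_self.
have Uu1 : 1 <= U u `^ om by exact: powR_ge1.
have ou := one_plus_ge1 (u - x) r0.
have oe : 1 <= (1 + `|u - x| / r) `^ ep by exact: powR_ge1 (ltW ep0).
have rse : 0 <= (r / s) `^ ep by exact: powR_ge0.
have dist y : (`|y| / s) `^ ep <= (r / s) `^ ep * (1 + `|y| / r) `^ ep.
  rewrite -powRM ?divr_ge0 ?(ltW r0) ?(ltW s0)//; last by rewrite (le_trans ler01)// one_plus_ge1.
  apply: ge0_ler_powR; rewrite ?nnegrE ?(ltW ep0) ?divr_ge0 ?(ltW s0)//.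
    by rewrite mulr_ge0 ?divr_ge0 ?(ltW r0) ?(ltW s0)// (le_trans ler01)// one_plus_ge1.
  rewrite mulrDr mulr1 (_ : r / s * (`|y| / r) = `|y| / s); last by field; rewrite !gt_eqF.
  by rewrite lerDr divr_ge0 ?(ltW r0) ?(ltW s0).
apply: (@le_trans _ _ (normc (G0 u - G0 x) + normc (G0 x - G x))).
  by rewrite -{1}(subrKA (G0 x) (G0 u) (- G x)); exact: normcD_le.
have part1 : normc (G0 u - G0 x) <= C1 * (1 + C0) * L * (r / s) `^ ep * (1 + `|u - x| / r) `^ ep * U u `^ om.
  apply: (le_trans (inc u x)).
  apply: (@le_trans _ _ (C1 * ((r / s) `^ ep * (1 + `|u - x| / r) `^ ep) * (L * ((1 + C0) * U u `^ om)))).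
    apply: ler_pM.
    - by rewrite mulr_ge0 ?powR_ge0// ltW.
    - by rewrite addr_ge0// mulr_ge0// powR_ge0.
    - by apply: ler_wpM2l; [exact: ltW|exact: dist].
    rewrite -mulrDr; apply: ler_wpM2l => //; rewrite mulrDl mul1r lerD2l.
    by apply: (le_trans Ux); rewrite ler_peMr// ltW.
  rewrite le_eqVlt; apply/orP; left; apply/eqP.
  by move: (_ `^ ep) ((1 + _) `^ ep) (_ `^ om) => p q t; ring.
have part2 : normc (G0 x - G x) <= C1 * C0 * (2 * C2) * L * (r / s) `^ ep.
  have h0 : (0 : R) < 2^-1 * r ^+ 2 by rewrite mulr_gt0// invr_gt0.
  have GE : G x = cint mu (fun z => (hk 0 (2^-1 * r ^+ 2) z)%:C * G0 (x - z)).
    rewrite GE0 G0E0; exact: (wv_kernel (hk_int 0 h0) (fun th xi => hk_fourier 0 th xi h0) x wp0).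
  have ki := hk_int (n := n) 0 h0.
  (* The Gaussian has mass one, so [G0 x] is its own mean and can be subtracted under the integral
     defining [G x]. *)
  have G0E : G0 x = cint mu (fun z => G0 x * (hk 0 (2^-1 * r ^+ 2) z)%:C).
    rewrite cintZ//; rewrite (_ : cint _ _ = 1) ?mulr1//.
    apply: complex_eqP => /=.
      rewrite /Rintegral; under eq_integral do rewrite hk0; by rewrite integral_gk.
    by rewrite /Rintegral integral0.
  have mG : measurable_fun [set: X] (fun z => x - z) by exact: measurable_rVB.
  have wi : cintegrable mu (fun z => (hk 0 (2^-1 * r ^+ 2) z)%:C * G0 (x - z)).
    by rewrite G0E0; exact: (wv_cintegrable ki mG wp0).
  rewrite GE {1}G0E -cintB; last 2 first.
  - exact: cintegrableZ.
  - exact: wi.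
  rewrite -lee_fin; apply: le_trans (normc_cint _) _.
    by apply: cintegrableB; [exact: cintegrableZ|exact: wi].
  apply: (@le_trans _ _ (\int[mu]_z (C1 * C0 * 2 * L * (r / s) `^ ep * (gk (2^-1 * r ^+ 2) z * (1 + `|z| / r) `^ (1 + NN)))%:E)%E).
    apply: ge0_le_integralr.
    - apply: measurable_normc; apply: cmeasB; first exact: (cintegrableZ _ ki).1.
      exact: wi.1.
    - apply: measurable_funM => //; apply: measurable_funM; first exact: measurable_gk.
      apply: (measurableT_comp (f := @powR R ^~ (1 + NN))); first exact: measurable_powR.
      by apply: measurable_funD => //; apply: measurable_funM => //; exact: measurable_rV_norm.
    - by move=> z; exact: normc_ge0.
    move=> z; rewrite [G0 x * _]mulrC -mulrBr normcM normc_real ger0_norm ?hk_ge0// hk0 [leRHS]mulrCA.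
    apply: ler_wpM2l; first exact: gk_ge0.
    have o1 := one_plus_ge1 z r0.
    have o1N : 1 <= (1 + `|z| / r) `^ NN by apply: powR_ge1 => //; rewrite addr_ge0.
    apply: (le_trans (inc x (x - z))); rewrite subKr.
    apply: (@le_trans _ _ (C1 * ((r / s) `^ ep * (1 + `|z| / r)) * (L * (2 * C0 * (1 + `|z| / r) `^ NN)))).
      apply: ler_pM.
      - by rewrite mulr_ge0 ?powR_ge0// ltW.
      - by rewrite addr_ge0// mulr_ge0// powR_ge0.
      - apply: ler_wpM2l; first exact: ltW.
        apply: (le_trans (dist z)); apply: ler_wpM2l => //; exact: powR_le_self.
      rewrite -mulrDr; apply: ler_wpM2l => //.
      have h1 : U (x - z) `^ om <= C0 * (1 + `|z| / r) `^ NN.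
        apply: (le_trans (powR_le_mul (U0 _) (U0 x) o1N (Up x z) om01)).
        by apply: ler_wpM2r; rewrite ?powR_ge0.
      have : C0 <= C0 * (1 + `|z| / r) `^ NN by rewrite ler_peMr// ltW.
      by move: h1 Ux; rewrite -mulrA; lra.
    have -> : (1 + `|z| / r) `^ (1 + NN) = (1 + `|z| / r) * (1 + `|z| / r) `^ NN.
      rewrite [LHS]powRD; last by rewrite (gt_eqF (lt_le_trans ltr01 o1)) implybT.
      by rewrite powRr1 ?(le_trans ler01 o1).
    rewrite le_eqVlt; apply/orP; left; apply/eqP.
    by move: (_ `^ ep) (1 + _) ((1 + _) `^ NN) => p q t; ring.
  have k0 : 0 <= C1 * C0 * 2 * L * (r / s) `^ ep.
    by rewrite !mulr_ge0 ?powR_ge0// ltW.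
  rewrite ge0_integralrZl//; last 2 first.
  - apply: measurable_funM; first exact: measurable_gk.
    apply: (measurableT_comp (f := @powR R ^~ (1 + NN))); first exact: measurable_powR.
    by apply: measurable_funD => //; apply: measurable_funM => //; exact: measurable_rV_norm.
  - by move=> z; rewrite mulr_ge0 ?powR_ge0// gk_ge0.
  apply: (@le_trans _ _ ((C1 * C0 * 2 * L * (r / s) `^ ep)%:E * C2%:E)%E).
    apply: lee_wpmul2l; first by rewrite lee_fin.
    by apply: H2 => //; lra.
  rewrite -EFinM lee_fin le_eqVlt; apply/orP; left; apply/eqP.
  by move: (_ `^ ep) => p; ring.
apply: (le_trans (lerD part1 part2)).
rewrite [leRHS](_ : _ = C1 * (1 + C0) * L * (r / s) `^ ep * (1 + `|u - x| / r) `^ ep * U u `^ om +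
  C1 * C0 * (2 * C2) * L * (r / s) `^ ep * ((1 + `|u - x| / r) `^ ep * U u `^ om)); last first.
  by move: (_ `^ ep) ((1 + _) `^ ep) (_ `^ om) => p q t; ring.
have q0 : 0 <= C1 * C0 * (2 * C2) * L * (r / s) `^ ep by rewrite !mulr_ge0// ltW.
by rewrite lerD2l ler_peMr// -[leLHS]mulr1; apply: ler_pM.
Qed.

End increments.

(** * The Leibniz defect *)

Section commutator.
Context {R : realType} {n : nat}.
Local Notation X := 'rV[R]_n.
Local Notation mu := (lebesgue_rV R n).
Local Notation mu2 := (prodm mu mu).
Local Notation NN := (n%:R + 1 : R).
Implicit Types (x y v xi : X) (al be : X -> R[i]).

(** Densities on the frequency space itself, for which [synth] is the inverse Fourier transform. *)
Definition wid al := wave mu (fun xi : X => xi) al.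
Definition synth al := wv mu (fun xi : X => xi) al.

(** The product bound on [Z] covers both [z.1 + z.2], for products of functions, and [z.1], for
    products whose second variable is frozen. *)
Lemma wave_tensor (Z : X * X -> X) (f : X * X -> R[i]) al be : wid al -> wid be ->
  measurable_fun [set: X * X] Z -> cmeas f ->
  (forall z, 1 + `|Z z| <= (1 + `|z.1|) * (1 + `|z.2|)) ->
  (forall z, normc (f z) <= normc (al z.1) * normc (be z.2)) -> wave mu2 Z f.
Proof.
move=> wa wb mZ mf hZ hf; split => // k.
have ma := wave_moment k wa; have mb := wave_moment k wb.
have oa := let: And3 _ _ h := wa in h k; have ob := let: And3 _ _ h := wb in h k.
have p0 (c : X -> R[i]) y : 0 <= (1 + `|y|) ^+ k * normc (c y).
  by rewrite mulr_ge0 ?normc_ge0// exprn_ge0// addr_ge0.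
apply: (@le_lt_trans _ _ (\int[mu2]_z (((1 + `|z.1|) ^+ k * normc (al z.1)) * ((1 + `|z.2|) ^+ k * normc (be z.2)))%:E)%E).
  apply: ge0_le_integralr.
  - apply: measurable_funM; last exact: measurable_normc.
    by apply: measurable_funX; apply: measurable_funD => //; exact: measurable_rV_norm.
  - apply: measurable_funM.
      exact: (measurableT_comp ma measurable_fst).
    exact: (measurableT_comp mb measurable_snd).
  - by move=> z; rewrite mulr_ge0 ?normc_ge0// exprn_ge0// addr_ge0.
  move=> z; rewrite mulrACA -exprMn; apply: ler_pM; rewrite ?normc_ge0 ?exprn_ge0 ?addr_ge0//.
  by rewrite lerXn2r ?nnegrE ?mulr_ge0 ?addr_ge0.
rewrite [ltLHS]fubini_tonelli1; last 2 first.
- apply/measurable_EFinP; apply: measurable_funM.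
    exact: (measurableT_comp ma measurable_fst).
  exact: (measurableT_comp mb measurable_snd).
- by move=> z; rewrite lee_fin mulr_ge0.
rewrite /fubini_F/= (eq_integral (fun y => (((1 + `|y|) ^+ k * normc (al y))%:E *
    \int[mu]_z ((1 + `|z|) ^+ k * normc (be z))%:E)%E)); last first.
  by move=> y _; rewrite ge0_integralrZl.
rewrite ge0_integralZr//; last 3 first.
- exact/measurable_EFinP.
- by move=> y _; rewrite lee_fin.
- by apply: integralr_ge0 => y; exact: p0.
rewrite lte_mul_pinfty//; first by apply: integralr_ge0 => y; exact: p0.
by rewrite ge0_fin_numE//; apply: integralr_ge0 => y; exact: p0.
Qed.

Lemma one_plus_norm_add (z : X * X) : 1 + `|z.1 + z.2| <= (1 + `|z.1|) * (1 + `|z.2|).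
Proof. by have := one_plus_submul z.1 z.2 (@ltr01 R); rewrite !divr1. Qed.

Lemma one_plus_norm_fst (z : X * X) : 1 + `|z.1| <= (1 + `|z.1|) * (1 + `|z.2|).
Proof. by rewrite ler_peMr ?addr_ge0// one_plus_norm_ge1. Qed.

Lemma cmeas_tensor al be : cmeas al -> cmeas be -> cmeas (fun z : X * X => al z.1 * be z.2).
Proof.
move=> ma mb; apply: cmeasM.
  exact: cmeas_comp ma measurable_fst.
exact: cmeas_comp mb measurable_snd.
Qed.

Lemma wid_meas al : wid al -> cmeas al. Proof. by case. Qed.

Lemma measurable_gsym q d (T : measurableType d) (f : T -> X) : measurable_fun [set: T] f ->
  measurable_fun [set: T] (fun z => expR (- (q * lap 0 (f z)))).
Proof.
move=> mf; apply: measurableT_comp => //; apply: measurable_funN; apply: measurable_funM => //.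
exact: measurableT_comp (measurable_lap 0) mf.
Qed.

Lemma gsym_le1 q xi : 0 <= q -> normc (expR (- (q * lap 0 xi)))%:C <= 1 :> R.
Proof. by move=> q0; rewrite normc_real ger0_norm ?expR_ge0// -expR0 ler_expR oppr_le0 mulr_ge0// lap_ge0. Qed.

Lemma wave_gauss_product q al be : 0 <= q -> wid al -> wid be ->
  wave mu2 (fun z => z.1 + z.2) (fun z => (expR (- (q * lap 0 (z.2 - z.1))))%:C * (al z.1 * be z.2)).
Proof.
move=> q0 wa wb; apply: (wave_tensor wa wb).
- exact: measurable_rVD.
- apply: cmeasM; last exact: cmeas_tensor (wid_meas wa) (wid_meas wb).
  by apply: cmeas_real; apply: measurable_gsym; exact: measurable_rVB.
- exact: one_plus_norm_add.
- move=> z; rewrite 2!normcM -[leRHS]mul1r; apply: ler_wpM2r; last exact: gsym_le1.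
  by rewrite mulr_ge0 ?normc_ge0.
Qed.

(** The factor [exp(-q |eta - xi|^2)] is not a function of [xi + eta], but it is the Fourier
    transform of a Gaussian at [xi - eta]; expanding it translates the two functions in opposite
    directions. *)
Lemma gauss_product q al be v : 0 < q -> wid al -> wid be ->
  wv mu2 (fun z => z.1 + z.2) (fun z => (expR (- (q * lap 0 (z.2 - z.1))))%:C * (al z.1 * be z.2)) v =
  cint mu (fun y => (hk 0 q y)%:C * (synth al (v - y) * synth be (v + y))).
Proof.
move=> q0 wa wb; have ma := wid_meas wa; have mb := wid_meas wb.
have ki := hk_int (n := n) 0 q0.
pose F (p : X * (X * X)) := (hk 0 q p.1)%:C * ((al p.2.1 * cis (2 * pi * dotprod (v - p.1) p.2.1)) *
   (be p.2.2 * cis (2 * pi * dotprod (v + p.1) p.2.2))).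
have tsr : cintegrable mu2 (fun z : X * X => al z.1 * be z.2).
  apply: (cintegrable_tensor (wave_int wa) (wave_int wb) (cmeas_tensor ma mb)) => z.
  by rewrite normcM.
have mF : cmeas F.
  apply: cmeasM; first by apply: cmeas_real; exact: measurableT_comp (measurable_hk 0 q) measurable_fst.
  have m21 : measurable_fun [set: X * (X * X)] (fun p : X * (X * X) => p.2.1).
    exact: measurableT_comp measurable_fst measurable_snd.
  have m22 : measurable_fun [set: X * (X * X)] (fun p : X * (X * X) => p.2.2).
    exact: measurableT_comp measurable_snd measurable_snd.
  have m1 : measurable_fun [set: X * (X * X)] (fun p : X * (X * X) => p.1) by exact: measurable_fst.
  apply: cmeasM; apply: cmeasM.
  - exact: cmeas_comp ma m21.
  - apply: cmeas_cis; apply: measurable_funM => //; apply: measurable_dotprod => //.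
    by apply: measurable_rVB => //; exact: measurable_cst.
  - exact: cmeas_comp mb m22.
  - apply: cmeas_cis; apply: measurable_funM => //; apply: measurable_dotprod => //.
    by apply: measurable_rVD => //; exact: measurable_cst.
have Fi : cintegrable (mu \x mu2)%E F.
  apply: (cintegrable_tensor ki tsr mF) => p.
  by rewrite /F !normcM !normc_cis !mulr1.
transitivity (cint mu2 (fun z => cint mu (fun y => F (y, z)))).
  apply: eq_cint => z; rewrite /F/=.
  set th := 2 * pi * dotprod v (z.1 + z.2).
  transitivity (cint mu (fun y => (al z.1 * be z.2) * ((hk 0 q y)%:C * cis (th - 2 * pi * dotprod y (z.1 - z.2))))).
    rewrite cintZ; last exact: hk_cis_int.
    rewrite hk_fourier// (_ : lap 0 (z.1 - z.2) = lap 0 (z.2 - z.1)).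
      by rewrite [RHS]mulrCA [RHS]mulrA.
    by rewrite /lap -opprB dotprodNl dotprodNr opprK.
  apply: eq_cint => y; rewrite [LHS]mulrCA; congr (_ * _); rewrite [RHS]mulrACA -cisD; congr (_ * cis _).
  by rewrite /th dotprodBl dotprodDl !dotprodDr dotprodNr; ring.
rewrite -(cint_fubini Fi); apply: eq_cint => y; rewrite /F/=.
rewrite cintZ.
  congr (_ * _); rewrite /synth /wv -cint_tensor//.
    exact: wave_cis_int.
  exact: wave_cis_int.
apply: (cintegrable_tensor (wave_cis_int (v - y) wa) (wave_cis_int (v + y) wb)).
  exact: (cmeas_tensor (wave_cis_int (v - y) wa).1 (wave_cis_int (v + y) wb).1).
by move=> z; rewrite normcM.
Qed.

(** The two alternatives are [FB_lap_powR] and [FB_lapX]; the fraction 1/4 is the part of the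
    smoothing that the parallelogram law leaves for [xi + eta]. *)
Lemma FB_quarter (N h : R) : n%:R < N -> 0 < h -> N < n%:R + 2 * h \/ (exists K : nat, h = K%:R) ->
  exists2 C : R, 0 < C & forall e r, 0 <= e -> 0 < r ->
  FB (fun xi : X => lap e xi `^ h * expR (- (4^-1 * r ^+ 2 * lap e xi)))
     (fun x => C * (r ^+ 2) `^ (- h) * wgt r N x).
Proof.
move=> nN h0 hh; have N0 : 0 <= N by rewrite (le_trans _ (ltW nN)).
have [C C0 H] : exists2 C : R, 0 < C & forall e r, 0 <= e -> 0 < r ->
  FB (fun xi : X => lap e xi `^ h * expR (- (r ^+ 2 * lap e xi)))
     (fun x => C * (r ^+ 2) `^ (- h) * wgt r N x).
  case: hh => [Nh|[K hK]]; first exact: FB_lap_powR.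
  have [C C0 H] := FB_lapX (R := R) K nN; exists C => // e r e0 r0.
  apply: FB_ext (H e r e0 r0) => [xi|x]; first by rewrite hK powR_mulrn// lap_ge0.
  by rewrite hK powRN powR_mulrn ?sqr_ge0// exprVn exprM.
exists (C * 4 `^ h * 2 ^+ n) => [|e r e0 r0]; first by rewrite !mulr_gt0 ?powR_gt0 ?exprn_gt0.
have r2 : 0 < r / 2 by rewrite divr_gt0.
have := H e (r / 2) e0 r2; rewrite (_ : (r / 2) ^+ 2 = 4^-1 * r ^+ 2); last by field.
move=> h2; apply: FB_mono h2 _ _ _ _.
- by apply: measurable_funM => //; exact: measurable_wgt.
- by apply: measurable_funM => //; exact: measurable_wgt.
- by move=> x; rewrite mulr_ge0 ?wgt_ge0// mulr_ge0 ?powR_ge0// ltW.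
move=> x; have -> : (4^-1 * r ^+ 2) `^ (- h) = 4 `^ h * (r ^+ 2) `^ (- h).
  by rewrite powRM ?sqr_ge0// -powR_inv1// -powRrM mulN1r opprK.
have rr : r / 2 <= r by rewrite ler_pdivrMr//; lra.
have := wgt_up x r2 rr N0; rewrite (_ : r / (r / 2) = 2); last by field; rewrite gt_eqF.
move/(ler_wpM2l (_ : 0 <= C * 4 `^ h * (r ^+ 2) `^ (- h))) => h3.
have {}h3 := h3 ltac:(by rewrite !mulr_ge0 ?powR_ge0// ltW).
rewrite -!mulrA in h3 *; apply: (le_trans h3); rewrite le_eqVlt; apply/orP; left; apply/eqP.
by move: (4 `^ h) (_ `^ (- h)) (2 ^+ n) (wgt _ _ _) => a b c d; ring.
Qed.

Fact mulr_shuffle1 (K L C p q u t w1 w2 : R) :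
  C * p * (K * L) * q * (t * t * u) * (w1 * w2) = K * (w1 * t) * (C * L * p * (q * u) * (w2 * t)).
Proof. by ring. Qed.

Fact mulr_shuffle2 (A q w t : R) : A * q * t * w = A * (q * w) * t.
Proof. by ring. Qed.

Fact mulr_shuffle3 (A B a1 a3 a7 : R) : A * B * a1 * a3 * a7 = A * a1 * (B * (a3 * a7)).
Proof. by ring. Qed.

Fact mulr_shuffle4 (A B a1 a3 a5 a6 a8 : R) :
  A * B * a1 * a3 * (a8 * (a5 * a6)) = A * B * a5 * (a1 * (a3 * a6) * a8).
Proof. by ring. Qed.

(* The second wave has the variable [z.2] frozen at [x], so it contributes the constant [G x]: the
   difference is [L^h exp(-r^2 L / 4)] applied to [v => F v * (G v - G x)]. *)
Lemma commutator_bound (ep b h S C0 : R) : 0 < ep <= 1 -> 0 < b -> 0 < h -> 1 <= S -> 0 < C0 ->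
  n%:R + b + ep + n%:R * (S - 1) < n%:R + 2 * h \/ (exists K : nat, h = K%:R) ->
  exists2 C : R, 0 < C & forall e r s x al be (U : X -> R) (K L si om : R),
  0 <= e -> 0 < r -> r <= s -> wid al -> wid be -> tame C0 b r x U -> (forall v, 1 <= U v) ->
  0 <= K -> 0 <= L -> 0 <= si <= 1 -> 0 <= om <= 1 -> si + om <= S ->
  (forall v, normc (synth al v) <= K * U v `^ si) ->
  (forall v, \int[mu]_y (wgt s NN (v - y) * normc (synth be y))%:E <= (L * U v `^ om)%:E)%E ->
  forall be0, be0 = (fun xi => (expR (- ((3 / 4 * s ^+ 2 - r ^+ 2 / 2) * lap 0 xi)))%:C * be xi) ->
  normc (wv mu2 (fun z => z.1 + z.2) (fun z => (lap e (z.1 + z.2) `^ h * expR (- (4^-1 * r ^+ 2 * lap e (z.1 + z.2))))%:C *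
           ((expR (- (4^-1 * r ^+ 2 * lap 0 (z.2 - z.1))))%:C * (al z.1 * be0 z.2))) x -
         wv mu2 (fun z => z.1) (fun z => (lap e z.1 `^ h * expR (- (4^-1 * r ^+ 2 * lap e z.1)))%:C *
           ((expR (- (4^-1 * r ^+ 2 * lap 0 z.1)))%:C * al z.1 *
            ((expR (- (2^-1 * r ^+ 2 * lap 0 z.2)))%:C * be0 z.2 * cis (2 * pi * dotprod x z.2)))) x)
  <= C * (r ^+ 2) `^ (- h) * (r / s) `^ ep * (K * L).
Proof.
move=> ep01 b0 h0 S1 C00 hN; have /andP[ep0 ep1] := ep01.
(* The decay demanded of the kernel: [n + b] for the integral clause of [tame], [ep] for the growth
   of the Hölder factor, [n (S - 1)] for the powers of [U] beyond the first. *)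
set N := n%:R + b + ep + n%:R * (S - 1) in hN.
have NS0 : 0 <= n%:R * (S - 1) by rewrite mulr_ge0// subr_ge0.
have nN : n%:R < N by rewrite /N; move: (n%:R : R) (_ * _) NS0 => p q NS0; lra.
have [CB CB0 HB] := FB_quarter nN h0 hN.
have [CI CI0 HI] := low_increment (n := n) ep01 C00.
have M0 : 0 <= NN + NN + 1 by rewrite !addr_ge0.
have [CM CM0 HM] := gk_moment_int (n := n) M0.
exists (CB * (CI * CM) * C0 `^ (S - 1) * C0) => [|e r s x al be U K L si om].
  by rewrite !mulr_gt0 ?powR_gt0.
move=> e0 r0 rs wa wb tU U1 K0 L0 si01 om01 sioS hal hbe be0 be0E.
have s0 := lt_le_trans r0 rs; have /andP[si0 si1] := si01; have /andP[om0 om1] := om01.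
have [mU U0 Ug Up Ui] := tU.
have r20 : 0 < r ^+ 2 by rewrite exprn_gt0.
have r2s : r ^+ 2 <= s ^+ 2 by rewrite lerXn2r ?nnegrE ?(ltW r0) ?(ltW s0).
have a0 : 0 <= 3 / 4 * s ^+ 2 - r ^+ 2 / 2 by lra.
have wb0 : wid be0 by rewrite be0E; exact: (wave_heat (lexx 0) a0 wb).
have q0 : 0 < 4^-1 * r ^+ 2 by rewrite mulr_gt0// invr_gt0.
have q20 : 0 <= 2^-1 * r ^+ 2 by rewrite mulr_ge0 ?invr_ge0// ltW.
pose m (xi : X) := lap e xi `^ h * expR (- (4^-1 * r ^+ 2 * lap e xi)).
have sm : symbol m.
  by apply: symbolM; [exact: symbol_lap_powR (ltW h0)|exact: symbol_heat (ltW q0)].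
pose W (y : X) := CB * (r ^+ 2) `^ (- h) * wgt r N y.
have mW : measurable_fun [set: X] W by apply: measurable_funM => //; exact: measurable_wgt.
have W0 y : 0 <= W y by rewrite mulr_ge0 ?wgt_ge0// mulr_ge0 ?powR_ge0// ltW.
pose phi1 (z : X * X) := (expR (- (4^-1 * r ^+ 2 * lap 0 (z.2 - z.1))))%:C * (al z.1 * be0 z.2).
pose phi2 (z : X * X) := (expR (- (4^-1 * r ^+ 2 * lap 0 z.1)))%:C * al z.1 *
  ((expR (- (2^-1 * r ^+ 2 * lap 0 z.2)))%:C * be0 z.2 * cis (2 * pi * dotprod x z.2)).
have w1 : wave mu2 (fun z => z.1 + z.2) phi1 by exact: wave_gauss_product (ltW q0) wa wb0.
have wa1 : wid (fun xi => (expR (- (4^-1 * r ^+ 2 * lap 0 xi)))%:C * al xi).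
  exact: (wave_heat (lexx 0) (ltW q0) wa).
have wb1 : wid (fun xi => (expR (- (2^-1 * r ^+ 2 * lap 0 xi)))%:C * be0 xi).
  exact: (wave_heat (lexx 0) q20 wb0).
have mcis : cmeas (fun xi : X => (expR (- (2^-1 * r ^+ 2 * lap 0 xi)))%:C * be0 xi * cis (2 * pi * dotprod x xi)).
  exact: (wave_cis_int x wb1).1.
have w2 : wave mu2 (fun z => z.1) phi2.
  apply: (wave_tensor wa1 wb1).
  - exact: measurable_fst.
  - exact: cmeas_tensor (wid_meas wa1) mcis.
  - exact: one_plus_norm_fst.
  - by move=> z; rewrite /phi2 normcM [X in _ * X]normcM normc_cis mulr1.
have := FB_pair x (HB e r e0 r0) sm mW W0 w1 w2.
rewrite -/m -/phi1 -/phi2 => /le_trans FBx.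
pose G0 := synth be0; pose G := synth (fun xi => (expR (- (2^-1 * r ^+ 2 * lap 0 xi)))%:C * be0 xi).
pose H v := wv mu2 (fun z => z.1 + z.2) phi1 v - wv mu2 (fun z => z.1) phi2 v.
have ki := hk_int (n := n) 0 q0.
have mB v : measurable_fun [set: X] (fun y : X => v - y) by exact: measurable_rVB.
have mD v : measurable_fun [set: X] (fun y : X => v + y) by exact: measurable_rVD.
have [ja jaE] := wv_bounded wa.
have prodi v (c : X -> R[i]) (j : R) : cmeas c -> (forall y, normc (c y) <= j) ->
    cintegrable mu (fun y => (hk 0 (4^-1 * r ^+ 2) y)%:C * (synth al (v - y) * c y)).
  move=> mc cj; have [mk koo] := ki.
  have ja0 : 0 <= ja by apply: le_trans (jaE 0); exact: normc_ge0.
  have j0 : 0 <= j by apply: le_trans (cj 0); exact: normc_ge0.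
  apply: (cintegrable_le (u := fun y => (ja * j) * normc (hk 0 (4^-1 * r ^+ 2) y)%:C)).
  - by apply: cmeasM => //; apply: cmeasM => //; exact: cmeas_comp (cmeas_wv wa) (mB v).
  - by apply: measurable_funM => //; exact: measurable_normc.
  - move=> y; rewrite normcM mulrC; apply: ler_wpM2r; first exact: normc_ge0.
    by rewrite normcM; apply: ler_pM; rewrite ?normc_ge0//; exact: jaE.
  rewrite ge0_integralrZl; last 3 first.
  - exact: mulr_ge0.
  - exact: measurable_normc.
  - by move=> y; exact: normc_ge0.
  by rewrite lte_mul_pinfty// lee_fin mulr_ge0.
have [jb jbE] := wv_bounded wb0.
have mG0 v : cmeas (fun y : X => G0 (v + y)) by exact: cmeas_comp (cmeas_wv wb0) (mD v).
have HE v : H v = cint mu (fun y => (hk 0 (4^-1 * r ^+ 2) y)%:C * (synth al (v - y) * (G0 (v + y) - G x))).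
  have e1 : wv mu2 (fun z => z.1) phi2 v = G x * cint mu (fun y => (hk 0 (4^-1 * r ^+ 2) y)%:C * synth al (v - y)).
    rewrite -(wv_kernel ki (fun th xi => hk_fourier 0 th xi q0) v wa) mulrC /G /synth /wv.
    rewrite -cint_tensor; [|exact: (wave_cis_int v wa1)|exact: (wave_cis_int x wb1)].
    by apply: eq_cint => z; rewrite /phi2 [LHS]mulrAC.
  rewrite /H e1 -cintZ; last by apply: (wv_cintegrable ki (mB v) wa).
  rewrite /phi1 gauss_product// -cintB.
  - by apply: eq_cint => y; rewrite (mulrC (G x)) -(mulrA _ _ (G x)) -!mulrBr.
  - exact: (prodi v _ jb).
  - apply: cintegrableZ; exact: (wv_cintegrable ki (mB v) wa).
have o1 y : 1 <= 1 + `|y| / r by exact: one_plus_ge1.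
have o0 y : 0 < 1 + `|y| / r by exact: one_plus_gt0.
have P1 y : 1 <= (1 + `|y| / r) `^ NN by apply: powR_ge1 => //; rewrite addr_ge0.
have pw0 y p : 0 <= (1 + `|y| / r) `^ p by exact: powR_ge0.
have rse : 0 <= (r / s) `^ ep by exact: powR_ge0.
(* The translations by [y] cost only powers of [1 + |y|/r], integrable against the Gaussian: [n + 1]
   for each of the two factors and one for the Hölder increment. *)
have Hle v : normc (H v) <= CI * CM * (r / s) `^ ep * (K * L) * ((1 + `|v - x| / r) `^ ep * U v `^ S).
  set Q := CI * (r / s) `^ ep * (K * L) * ((1 + `|v - x| / r) `^ ep * U v `^ S).
  have Q0 : 0 <= Q.
    exact: mulr_ge0 (mulr_ge0 (mulr_ge0 (ltW CI0) rse) (mulr_ge0 K0 L0)) (mulr_ge0 (pw0 _ _) (powR_ge0 _ _)).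
  have mk : measurable_fun [set: X] (fun y => gk (4^-1 * r ^+ 2) y * (1 + `|y| / r) `^ (NN + NN + 1)).
    apply: measurable_funM; first exact: measurable_gk.
    apply: (measurableT_comp (f := @powR R ^~ (NN + NN + 1))); first exact: measurable_powR.
    by apply: measurable_funD => //; apply: measurable_funM => //; exact: measurable_rV_norm.
  have hi : cintegrable mu (fun y => (hk 0 (4^-1 * r ^+ 2) y)%:C * (synth al (v - y) * (G0 (v + y) - G x))).
    apply: (prodi v _ (jb + normc (G x))).
      by apply: cmeasB => //; exact: cmeas_cst.
    by move=> y; apply: (le_trans (normcB_le _ _)); rewrite lerD2r; exact: jbE.
  rewrite HE -lee_fin; apply: le_trans (normc_cint hi) _.
  apply: (@le_trans _ _ (\int[mu]_y (Q * (gk (4^-1 * r ^+ 2) y * (1 + `|y| / r) `^ (NN + NN + 1)))%:E)%E).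
    apply: ge0_le_integralr.
    - exact: measurable_normc hi.1.
    - exact: measurable_funM.
    - by move=> y; exact: normc_ge0.
    move=> y; rewrite 2!normcM normc_real ger0_norm ?hk_ge0// hk0 [leRHS]mulrCA.
    apply: ler_wpM2l; first exact: gk_ge0.
    have h1 : normc (synth al (v - y)) <= K * (U v `^ si * (1 + `|y| / r) `^ NN).
      apply: (le_trans (hal _)); apply: ler_wpM2l => //.
      exact: (powR_le_mul (U0 _) (U0 _) (P1 y) (Up v y) si01).
    have h2 : normc (G0 (v + y) - G x) <= CI * L * (r / s) `^ ep * ((1 + `|v - x| / r) `^ ep * (1 + `|y| / r)) *
        (U v `^ om * (1 + `|y| / r) `^ NN).
      apply: (le_trans (HI r s b x _ _ _ _ _ U L om (v + y) r0 rs wb tU U1 L0 om01 hbe be0 be0E G0 G erefl erefl)).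
      have c0 : 0 <= CI * L * (r / s) `^ ep by rewrite !mulr_ge0// ltW.
      apply: ler_pM.
      - exact: mulr_ge0 c0 (powR_ge0 _ _).
      - exact: powR_ge0.
      - apply: ler_wpM2l => //.
        apply: (@le_trans _ _ (((1 + `|v - x| / r) * (1 + `|y| / r)) `^ ep)).
          apply: ge0_ler_powR; rewrite ?nnegrE ?mulr_ge0 ?(ltW (o0 _)) ?(ltW ep0)//.
          by rewrite addrAC; exact: one_plus_submul.
        by rewrite powRM ?(ltW (o0 _))//; apply: ler_wpM2l => //; exact: powR_le_self.
      have Upy : U (v + y) <= U v * (1 + `|y| / r) `^ NN by have := Up v (- y); rewrite opprK normrN.
      - exact: (powR_le_mul (U0 _) (U0 _) (P1 y) Upy om01).
    apply: (le_trans (ler_pM (normc_ge0 _) (normc_ge0 _) h1 h2)).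
    have hU : U v `^ si * U v `^ om <= U v `^ S.
      rewrite -powRD; last by rewrite (gt_eqF (lt_le_trans ltr01 (U1 v))) implybT.
      exact: ler_powR.
    have -> : (1 + `|y| / r) `^ (NN + NN + 1) = (1 + `|y| / r) `^ NN * (1 + `|y| / r) `^ NN * (1 + `|y| / r).
      rewrite [LHS]powRD; last by rewrite (gt_eqF (o0 y)) implybT.
      rewrite [X in X * _]powRD; last by rewrite (gt_eqF (o0 y)) implybT.
      by rewrite (powRr1 (ltW (o0 y))).
    have c0 : 0 <= CI * (r / s) `^ ep * (K * L) * (1 + `|v - x| / r) `^ ep *
        ((1 + `|y| / r) `^ NN * (1 + `|y| / r) `^ NN * (1 + `|y| / r)).
      have cc : 0 <= CI * (r / s) `^ ep * (K * L) by exact: mulr_ge0 (mulr_ge0 (ltW CI0) rse) (mulr_ge0 K0 L0).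
      exact: mulr_ge0 (mulr_ge0 cc (pw0 _ _)) (mulr_ge0 (mulr_ge0 (pw0 _ _) (pw0 _ _)) (ltW (o0 _))).
    have := ler_wpM2l c0 hU; rewrite /Q.
    rewrite mulr_shuffle1 => hh; apply: (le_trans hh).
    by rewrite le_eqVlt; apply/orP; left; apply/eqP; exact: mulr_shuffle2.
  rewrite ge0_integralrZl//; last by move=> y; rewrite mulr_ge0// gk_ge0.
  apply: (@le_trans _ _ (Q%:E * CM%:E)%E).
    apply: lee_wpmul2l; first by rewrite lee_fin.
    by apply: HM => //; lra.
  rewrite -EFinM lee_fin le_eqVlt; apply/orP; left; apply/eqP; rewrite /Q.
  by move: (_ `^ ep) ((1 + _) `^ ep) (U v `^ S) => p q w; ring.
have mH : cmeas H by apply: cmeasB; [exact: cmeas_wv w1|exact: cmeas_wv w2].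
set J := CB * (r ^+ 2) `^ (- h) * (CI * CM * (r / s) `^ ep * (K * L)) * C0 `^ (S - 1).
have j1 : 0 <= CB * (r ^+ 2) `^ (- h) by exact: mulr_ge0 (ltW CB0) (powR_ge0 _ _).
have j2 : 0 <= CI * CM * (r / s) `^ ep * (K * L).
  exact: mulr_ge0 (mulr_ge0 (mulr_ge0 (ltW CI0) (ltW CM0)) rse) (mulr_ge0 K0 L0).
have J0 : 0 <= J by exact: mulr_ge0 (mulr_ge0 j1 j2) (powR_ge0 _ _).
have mwU : measurable_fun [set: X] (fun y => wgt r (n%:R + b) (x - y) * U y).
  by apply: measurable_funM => //; apply: measurable_wgt; exact: measurable_rVB.
rewrite -lee_fin; apply: FBx.
apply: (@le_trans _ _ (\int[mu]_y (J * (wgt r (n%:R + b) (x - y) * U y))%:E)%E).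
  apply: ge0_le_integralr.
  - apply: measurable_funM; last exact: measurable_normc mH.
    by apply: measurableT_comp mW _; exact: measurable_rVB.
  - exact: measurable_funM.
  - by move=> y; apply: mulr_ge0; [exact: W0|exact: normc_ge0].
  move=> y; apply: (le_trans (ler_wpM2l (W0 _) (Hle y))); rewrite /W /J.
  (* One power of [U] is kept for the integral clause of [tame]; the surplus [S - 1] is spent on the
     growth clause. *)
  have hU : U y `^ S <= U y * (C0 `^ (S - 1) * (1 + `|y - x| / r) `^ (n%:R * (S - 1))).
    have -> : U y `^ S = U y * U y `^ (S - 1).
      rewrite -[X in X * _](powRr1 (U0 y)) -powRD; first by congr (_ `^ _); ring.
      by rewrite (gt_eqF (lt_le_trans ltr01 (U1 y))) implybT.
    apply: ler_wpM2l => //.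
    apply: (@le_trans _ _ ((C0 * (1 + `|y - x| / r) ^+ n) `^ (S - 1))).
      apply: ge0_ler_powR; rewrite ?nnegrE ?subr_ge0//.
      by rewrite mulr_ge0 ?exprn_ge0 ?(ltW (o0 _)) ?(ltW C00).
    by rewrite powRM ?exprn_ge0 ?(ltW (o0 _)) ?(ltW C00)// -powR_mulrn ?(ltW (o0 _))// -powRrM.
  have wE : wgt r (n%:R + b) (x - y) = wgt r N (x - y) * ((1 + `|y - x| / r) `^ ep * (1 + `|y - x| / r) `^ (n%:R * (S - 1))).
    rewrite /wgt distrC -powRD; last by rewrite (gt_eqF (o0 _)) implybT.
    rewrite -mulrA -powRD; last by rewrite (gt_eqF (o0 _)) implybT.
    by congr (_ * _ `^ _); rewrite /N; ring.
  rewrite wE.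
  have c0 : 0 <= CB * (r ^+ 2) `^ (- h) * (CI * CM * (r / s) `^ ep * (K * L)) * wgt r N (x - y) * (1 + `|y - x| / r) `^ ep.
    exact: mulr_ge0 (mulr_ge0 (mulr_ge0 j1 j2) (wgt_ge0 _ _ r0)) (pw0 _ _).
  rewrite -(mulr_shuffle3 (CB * (r ^+ 2) `^ (- h)) (CI * CM * (r / s) `^ ep * (K * L)) (wgt r N (x - y))
    ((1 + `|y - x| / r) `^ ep) (U y `^ S)).
  rewrite -(mulr_shuffle4 (CB * (r ^+ 2) `^ (- h)) (CI * CM * (r / s) `^ ep * (K * L)) (wgt r N (x - y))
    ((1 + `|y - x| / r) `^ ep) (C0 `^ (S - 1)) _ (U y)).
  exact: (ler_wpM2l c0 hU).
rewrite ge0_integralrZl//; last by move=> y; apply: mulr_ge0 => //; exact: wgt_ge0.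
apply: (@le_trans _ _ (J%:E * C0%:E)%E); first by apply: lee_wpmul2l; rewrite ?lee_fin.
rewrite -EFinM lee_fin le_eqVlt; apply/orP; left; apply/eqP; rewrite /J.
by move: (_ `^ ep) (_ `^ (- h)) (C0 `^ (S - 1)) => p q w; ring.
Qed.

End commutator.

(** [h1] and [h2] factor the same product of bands, once with a Gaussian in [xi + eta] and once with
    the variables separated. The first form serves the term [L(xi + eta)^h], the second the term
    [L(xi)^h]; the term [L(eta)^h] keeps the unfactored product. *)
Fact defect_algebra {R : realType} (l12 l1 l2 Br Bs E e12 e3 e1 e1' bh e2 e02 e0s b4 : R) (f g c1 c2 : R[i]) :
  Br * Bs = E * e12 * e3 * bh * (e02 * (e0s * b4)) ->
  Br * Bs = E * e1 * (e1' * bh) * (e2 * (e02 * (e0s * b4))) ->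
  ((l12 - l1 - l2) * (Br * Bs))%:C * (f * g) * (c1 * c2) =
  E%:C * ((l12 * e12)%:C * (e3%:C * ((bh%:C * f) * (e02%:C * (e0s%:C * (b4%:C * g))))) * (c1 * c2) -
    (l1 * e1)%:C * (e1'%:C * (bh%:C * f) * (e2%:C * (e02%:C * (e0s%:C * (b4%:C * g))) * c2)) * c1) -
  (Br%:C * f * c1) * (Bs%:C * (l2%:C * g) * c2).
Proof.
move=> h1 h2.
have -> : (l12 - l1 - l2) * (Br * Bs) = l12 * (E * e12 * e3 * bh * (e02 * (e0s * b4))) -
    l1 * (E * e1 * (e1' * bh) * (e2 * (e02 * (e0s * b4)))) - l2 * (Br * Bs).
  by rewrite -h1 -h2; ring.
rewrite !(rmorphB, rmorphM)/=.
move: (l12%:C) (l1%:C) (l2%:C) (Br%:C) (Bs%:C) (E%:C) (e12%:C) (e3%:C) (e1%:C) (e1'%:C) (bh%:C)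
 (e2%:C) (e02%:C) (e0s%:C) (b4%:C) => a1 a2 a3 a4 a5 a6 a7 a8 a9 b1 b2 b3 b5 b6 b7.
ring.
Qed.

(** * Frequency bands and the pieces of the defect *)

Section bands.
Context {R : realType} {n : nat}.
Local Notation X := 'rV[R]_n.
Local Notation mu := (lebesgue_rV R n).
Local Notation mu2 := (prodm mu mu).
Local Notation NN := (n%:R + 1 : R).
Implicit Types (x y v xi : X) (fh gh : X -> R[i]).

(** A smooth localisation to [L ~ r^(-2)] made of heat symbols: the power suppresses low
    frequencies, the exponential high ones. *)
Definition band (a c e r : R) xi : R := (r ^+ 2 * lap e xi) `^ a * expR (- (c * r ^+ 2 * lap e xi)).

Lemma band_ge0 a c e r xi : 0 <= band a c e r xi.
Proof. by rewrite mulr_ge0 ?powR_ge0// expR_ge0. Qed.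

Lemma symbol_band a c e r : 0 <= a -> 0 <= c -> 0 <= e -> 0 < r -> symbol (band a c e r : X -> R).
Proof.
move=> a0 c0 e0 r0; have r20 : 0 <= r ^+ 2 by rewrite sqr_ge0.
apply: symbolM; last by apply: symbol_heat => //; rewrite mulr_ge0.
rewrite (_ : (fun xi => _) = (fun xi : X => (r ^+ 2) `^ a * lap e xi `^ a)); last first.
  by apply/funext => xi; rewrite powRM ?lap_ge0.
apply: symbolM; last exact: symbol_lap_powR.
by apply: (@symbol_bounded _ _ _ `|(r ^+ 2) `^ a|) => //; exact: measurable_cst.
Qed.

Lemma wid_mul (m : X -> R) fh : symbol m -> wid fh -> wid (fun xi => (m xi)%:C * fh xi).
Proof. by move=> sm wf; exact: (waveM sm wf). Qed.

Lemma measurable_synth fh : wid fh -> measurable_fun [set: X] (fun y => normc (synth fh y)).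
Proof. by move=> wf; exact: (measurable_normc_wv wf (@measurable_id _ _ [set: X])). Qed.

(** Decay of order [n + 1] of the kernel asks for [2a > 1], hence [a >= 1]; [jensen_average] then
    turns the control of p-th powers into control of means. The pointwise form serves the factor at
    the finer scale, the averaged form the one that is smoothed further. *)
Lemma band_bound (a c : R) : 1 <= a -> 0 < c <= 1 -> exists2 C : R, 0 < C &
  forall e r fh (p K : R) (u : X -> R), 0 <= e -> 0 < r -> wid fh -> 1 <= p -> 0 < K ->
  (forall v, 0 <= u v) ->
  (forall v, \int[mu]_y (wgt r NN (v - y) * normc (synth fh y) `^ p)%:E = (K `^ p * u v)%:E)%E ->
  forall v, normc (synth (fun xi => (band a c e r xi)%:C * fh xi) v) <= C * (K * (1 + u v) `^ p^-1) /\
    (\int[mu]_y (wgt r NN (v - y) * normc (synth (fun xi => (band a c e r xi)%:C * fh xi) y))%:E <=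
     (C * (K * (1 + u v) `^ p^-1))%:E)%E.
Proof.
move=> a1 c01; have a0 : 0 < a by rewrite (lt_le_trans ltr01).
have nN : n%:R < NN by rewrite ltrDl.
have Na : NN < n%:R + 2 * a by rewrite ltrD2l; lra.
have [C1 C10 H1] := FB_lap_homog nN a0 Na c01.
have [C2 C20 H2] := jensen_average (R := R) (n := n).
have [C3 C30 H3] := wgt_smooth (n := n) nN.
exists (C1 * C2 + C1 * C3 * C2) => [|e r fh p K u e0 r0 wf p1 K0 u0 hu v].
  by rewrite addr_gt0 ?mulr_gt0.
have /andP[c0 _] := c01.
set psi := fun y => normc (synth fh y) in hu.
have mpsi : measurable_fun [set: X] psi by exact: measurable_synth.
have psi0 y : 0 <= psi y by exact: normc_ge0.
have wg : wid (fun xi => (band a c e r xi)%:C * fh xi).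
  by apply: wid_mul => //; apply: symbol_band => //; exact: ltW.
have mwp z : measurable_fun [set: X] (fun y => wgt r NN (z - y) * psi y).
  by apply: measurable_funM => //; apply: measurable_wgt; exact: measurable_rVB.
have wp0 z y : 0 <= wgt r NN (z - y) * psi y by rewrite mulr_ge0// wgt_ge0.
have Jv : (\int[mu]_y (wgt r NN (v - y) * psi y)%:E <= (C2 * (K * (1 + u v) `^ p^-1))%:E)%E.
  exact: H2.
have B0 : 0 <= K * (1 + u v) `^ p^-1 by rewrite mulr_ge0 ?powR_ge0// ltW.
have P1 z : ((normc (synth (fun xi => (band a c e r xi)%:C * fh xi) z))%:E <=
    C1%:E * \int[mu]_y (wgt r NN (z - y) * psi y)%:E)%E.
  apply: le_trans (H1 e r e0 r0 _ _ _ _ _ z wf) _.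
  by under eq_integral do rewrite -mulrA; rewrite ge0_integralrZl// ltW.
split.
  rewrite -lee_fin; apply: le_trans (P1 v) _.
  apply: le_trans (lee_wpmul2l _ Jv) _; first by rewrite lee_fin ltW.
  rewrite -EFinM lee_fin [leLHS]mulrA; apply: ler_wpM2r => //.
  by rewrite lerDl !mulr_ge0// ltW.
have mI : measurable_fun [set: X] (fun z : X => \int[mu]_y (wgt r NN (z - y) * psi y)%:E)%E.
  apply: (measurable_ge0_param mu (F := fun z : X * X => (wgt r NN (z.1 - z.2) * psi z.2)%:E)) => [|z].
    apply/measurable_EFinP; apply: measurable_funM.
      by apply: measurable_wgt; exact: measurable_rVB.
    exact: measurableT_comp mpsi measurable_snd.
  by rewrite lee_fin; exact: wp0.
have mw : measurable_fun [set: X] (fun z : X => wgt r NN (v - z)).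
  by apply: measurable_wgt; exact: measurable_rVB.
apply: (@le_trans _ _ (\int[mu]_z (C1%:E * ((wgt r NN (v - z))%:E * \int[mu]_y (wgt r NN (z - y) * psi y)%:E)))%E).
  apply: ge0_le_integral => //.
  - by move=> z _; rewrite lee_fin mulr_ge0 ?normc_ge0// wgt_ge0.
  - by apply/measurable_EFinP; apply: measurable_funM => //; exact: measurable_synth.
  - by apply: measurable_funeM; apply: emeasurable_funM => //; exact/measurable_EFinP.
  move=> z _; rewrite EFinM muleCA; apply: lee_wpmul2l; last exact: P1.
  by rewrite lee_fin wgt_ge0.
rewrite ge0_integralZl//; last 3 first.
- by apply: emeasurable_funM => //; exact/measurable_EFinP.
- by move=> z _; apply: mule_ge0; [rewrite lee_fin wgt_ge0|exact: integralr_ge0].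
- by rewrite lee_fin ltW.
apply: (@le_trans _ _ (C1%:E * (C3%:E * (C2 * (K * (1 + u v) `^ p^-1))%:E))%E).
  apply: lee_wpmul2l; first by rewrite lee_fin ltW.
  apply: le_trans (H3 r r psi v r0 (lexx r) mpsi psi0) _.
  by apply: lee_wpmul2l => //; rewrite lee_fin ltW.
rewrite -!EFinM lee_fin [leLHS](_ : _ = C1 * C3 * C2 * (K * (1 + u v) `^ p^-1)); last by rewrite !mulrA.
apply: ler_wpM2r => //.
by rewrite lerDr !mulr_ge0// ltW.
Qed.

(* [-r^2 lap e xi - s^2 lap e eta], split so as to expose the smoothing factors of [commutator_bound] *)
Lemma band_split1 k e r s (xi eta : X) : band k 1 e r xi * band k 1 e s eta =
  expR (- (4^-1 * r ^+ 2 * e)) * expR (- (4^-1 * r ^+ 2 * lap e (xi + eta))) *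
  expR (- (4^-1 * r ^+ 2 * lap 0 (eta - xi))) * band k (2^-1) e r xi *
  (expR (- ((3 / 4 * s ^+ 2 - r ^+ 2 / 2) * lap 0 eta)) *
   (expR (- (3 / 4 * s ^+ 2 * e)) * band k (4^-1) e s eta)).
Proof.
rewrite /band; move: (_ `^ k) (_ `^ k) => B A.
rewrite [RHS](_ : _ = A * B * (expR (- (4^-1 * r ^+ 2 * e)) * expR (- (4^-1 * r ^+ 2 * lap e (xi + eta))) *
  expR (- (4^-1 * r ^+ 2 * lap 0 (eta - xi))) * expR (- (2^-1 * r ^+ 2 * lap e xi)) *
  expR (- ((3 / 4 * s ^+ 2 - r ^+ 2 / 2) * lap 0 eta)) *
  expR (- (3 / 4 * s ^+ 2 * e)) * expR (- (4^-1 * s ^+ 2 * lap e eta)))); last by ring.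
rewrite mulrACA; congr (_ * _); rewrite -!expRD; congr expR.
by rewrite /lap !dotprodBl !dotprodBr !dotprodDl !dotprodDr (dotprodC eta xi); field.
Qed.

(** The same Gaussians regrouped so that [L xi] stands in the place of [L (xi + eta)]: the first two
    terms of the defect then carry the same multiplier [L^h exp(-r^2 L / 4)], which permits
    subtracting before applying it. *)
Lemma band_split2 k e r s (xi eta : X) : band k 1 e r xi * band k 1 e s eta =
  expR (- (4^-1 * r ^+ 2 * e)) * expR (- (4^-1 * r ^+ 2 * lap e xi)) *
  (expR (- (4^-1 * r ^+ 2 * lap 0 xi)) * band k (2^-1) e r xi) *
  (expR (- (2^-1 * r ^+ 2 * lap 0 eta)) *
   (expR (- ((3 / 4 * s ^+ 2 - r ^+ 2 / 2) * lap 0 eta)) *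
   (expR (- (3 / 4 * s ^+ 2 * e)) * band k (4^-1) e s eta))).
Proof.
rewrite /band; move: (_ `^ k) (_ `^ k) => B A.
rewrite [RHS](_ : _ = A * B * (expR (- (4^-1 * r ^+ 2 * e)) * expR (- (4^-1 * r ^+ 2 * lap e xi)) *
  expR (- (4^-1 * r ^+ 2 * lap 0 xi)) * expR (- (2^-1 * r ^+ 2 * lap e xi)) *
  expR (- (2^-1 * r ^+ 2 * lap 0 eta)) *
  expR (- ((3 / 4 * s ^+ 2 - r ^+ 2 / 2) * lap 0 eta)) *
  expR (- (3 / 4 * s ^+ 2 * e)) * expR (- (4^-1 * s ^+ 2 * lap e eta)))); last by ring.
rewrite mulrACA; congr (_ * _); rewrite -!expRD; congr expR.
by rewrite /lap; field.
Qed.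

Definition leibniz_defect (h e : R) (z : X * X) : R := lap e (z.1 + z.2) `^ h - lap e z.1 `^ h - lap e z.2 `^ h.

Definition piece (h k e : R) fh gh x (r s : R) : R[i] :=
  cint mu2 (fun z => (leibniz_defect h e z * (band k 1 e r z.1 * band k 1 e s z.2))%:C *
    (fh z.1 * gh z.2) * cis (2 * pi * dotprod x (z.1 + z.2))).

(** The first two terms of the defect are [commutator_bound]. The third, the product of a band of
    [f] and a band of [D^s g], needs no cancellation: it carries [s^(-2h)], and
    [s^(-2h) <= r^(-2h) (r/s)^ep] since [ep <= 2h]. *)
Lemma piece_bound (ep b h S C0 : R) : 0 < ep <= 1 -> ep <= 2 * h -> 0 < b -> 0 < h -> 1 <= S -> 0 < C0 ->
  n%:R + b + ep + n%:R * (S - 1) < n%:R + 2 * h \/ (exists K : nat, h = K%:R) ->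
  exists2 C : R, 0 < C & forall k e r s x fh gh (U : X -> R) (K L si om : R),
  0 <= k -> 0 <= e -> 0 < r -> r <= s -> wid fh -> wid gh -> tame C0 b r x U -> (forall v, 1 <= U v) ->
  0 <= K -> 0 <= L -> 0 <= si <= 1 -> 0 <= om <= 1 -> si + om <= S ->
  (forall v, normc (synth (fun xi => (band k (2^-1) e r xi)%:C * fh xi) v) <= K * U v `^ si) ->
  normc (synth (fun xi => (band k 1 e r xi)%:C * fh xi) x) <= K * U x `^ si ->
  (forall v, \int[mu]_y (wgt s NN (v - y) * normc (synth (fun xi => (band k (4^-1) e s xi)%:C * gh xi) y))%:E <=
     (L * U v `^ om)%:E)%E ->
  normc (synth (fun xi => (band k 1 e s xi)%:C * ((lap e xi `^ h)%:C * gh xi)) x) <=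
    (s ^+ 2) `^ (- h) * (L * U x `^ om) ->
  normc (piece h k e fh gh x r s) <= C * (r ^+ 2) `^ (- h) * (r / s) `^ ep * (K * L).
Proof.
move=> ep01 eph b0 h0 S1 C00 hN.
have [C C'0 H] := commutator_bound (n := n) ep01 b0 h0 S1 C00 hN.
exists (C + C0 `^ 1 * C0 `^ 1) => [|k e r s x fh gh U K L si om]; first by rewrite addr_gt0 ?mulr_gt0 ?powR_gt0.
move=> k0 e0 r0 rs wf wg tU U1 K0 L0 si01 om01 sioS hF hFx hG hGx.
have s0 := lt_le_trans r0 rs.
have r20 : 0 < r ^+ 2 by rewrite exprn_gt0.
have s20 : 0 < s ^+ 2 by rewrite exprn_gt0.
pose al xi := (band k (2^-1) e r xi)%:C * fh xi.
pose be xi := (expR (- (3 / 4 * s ^+ 2 * e)))%:C * ((band k (4^-1) e s xi)%:C * gh xi).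
pose be0 xi := (expR (- ((3 / 4 * s ^+ 2 - r ^+ 2 / 2) * lap 0 xi)))%:C * be xi.
have wal : wid al by apply: wid_mul => //; apply: symbol_band => //; rewrite invr_ge0.
have wgb : wid (fun xi => (band k (4^-1) e s xi)%:C * gh xi).
  by apply: wid_mul => //; apply: symbol_band => //; rewrite invr_ge0.
have wbe : wid be.
  by apply: wid_mul => //; apply: (@symbol_bounded _ _ _ `|expR (- (3 / 4 * s ^+ 2 * e))|) => //.
have q1 : expR (- (3 / 4 * s ^+ 2 * e)) <= 1.
  by rewrite -expR0 ler_expR oppr_le0 !mulr_ge0// ?ltW// invr_ge0.
have synbe y : synth be y = (expR (- (3 / 4 * s ^+ 2 * e)))%:C * synth (fun xi => (band k (4^-1) e s xi)%:C * gh xi) y.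
  rewrite /synth /wv -cintZ; last exact: (wave_cis_int y wgb).
  by apply: eq_cint => xi; rewrite /be -!mulrA.
have hbe v : (\int[mu]_y (wgt s NN (v - y) * normc (synth be y))%:E <= (L * U v `^ om)%:E)%E.
  apply: le_trans (hG v); apply: ge0_le_integralr.
  - apply: measurable_funM; last exact: measurable_synth.
    by apply: measurable_wgt; exact: measurable_rVB.
  - apply: measurable_funM; last exact: measurable_synth.
    by apply: measurable_wgt; exact: measurable_rVB.
  - by move=> y; rewrite mulr_ge0 ?normc_ge0// wgt_ge0.
  - move=> y; apply: ler_wpM2l; first exact: wgt_ge0.
    by rewrite synbe normcM normc_real ger0_norm ?expR_ge0// ler_piMl// normc_ge0.
have := H e r s x al be U K L si om e0 r0 rs wal wbe tU U1 K0 L0 si01 om01 sioS hF hbe be0 erefl.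
set A1 := wv _ _ _ x; set A2 := wv _ _ _ x => hA.
pose E : R := expR (- (4^-1 * r ^+ 2 * e)).
have E1 : `|E| <= 1.
  by rewrite ger0_norm ?expR_ge0// -expR0 ler_expR oppr_le0 !mulr_ge0// ?ltW// invr_ge0.
pose F := synth (fun xi => (band k 1 e r xi)%:C * fh xi) x.
pose G := synth (fun xi => (band k 1 e s xi)%:C * ((lap e xi `^ h)%:C * gh xi)) x.
have PE : piece h k e fh gh x r s = E%:C * (A1 - A2) - F * G.
  have q0 : 0 <= 4^-1 * r ^+ 2 by rewrite mulr_ge0 ?invr_ge0// ltW.
  have q20 : 0 <= 2^-1 * r ^+ 2 by rewrite mulr_ge0 ?invr_ge0// ltW.
  have r2s : r ^+ 2 <= s ^+ 2 by rewrite lerXn2r ?nnegrE ?(ltW r0) ?(ltW s0).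
  have a0 : 0 <= 3 / 4 * s ^+ 2 - r ^+ 2 / 2 by lra.
  have wb0 : wid be0 by exact: (wave_heat (lexx 0) a0 wbe).
  have sm : symbol (fun xi : X => lap e xi `^ h * expR (- (4^-1 * r ^+ 2 * lap e xi))).
    by apply: symbolM; [exact: symbol_lap_powR (ltW h0)|exact: symbol_heat q0].
  have wb1 := wave_heat (lexx 0) q20 wb0.
  have wa1 := wave_heat (lexx 0) q0 wal.
  have w1 := waveM sm (wave_gauss_product q0 wal wb0).
  have w2 : wave mu2 (fun z => z.1) (fun z : X * X => (expR (- (4^-1 * r ^+ 2 * lap 0 z.1)))%:C * al z.1 *
      ((expR (- (2^-1 * r ^+ 2 * lap 0 z.2)))%:C * be0 z.2 * cis (2 * pi * dotprod x z.2))).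
    apply: (wave_tensor wa1 wb1).
    - exact: measurable_fst.
    - exact: cmeas_tensor (wid_meas wa1) (wave_cis_int x wb1).1.
    - exact: one_plus_norm_fst.
    - by move=> z; rewrite normcM [X in _ * X]normcM normc_cis mulr1.
  have i1 := wave_cis_int x w1; have i2 := wave_cis_int x (waveM sm w2).
  have wF : wid (fun xi => (band k 1 e r xi)%:C * fh xi) by apply: wid_mul => //; exact: symbol_band.
  have wG : wid (fun xi => (band k 1 e s xi)%:C * ((lap e xi `^ h)%:C * gh xi)).
    by apply: wid_mul; [exact: symbol_band|apply: wid_mul => //; exact: symbol_lap_powR (ltW h0)].
  have iF := wave_cis_int x wF; have iG := wave_cis_int x wG.
  have iFG : cintegrable mu2 (fun z : X * X => ((band k 1 e r z.1)%:C * fh z.1 * cis (2 * pi * dotprod x z.1)) *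
      ((band k 1 e s z.2)%:C * ((lap e z.2 `^ h)%:C * gh z.2) * cis (2 * pi * dotprod x z.2))).
    apply: (cintegrable_tensor iF iG); first exact: cmeas_tensor iF.1 iG.1.
    by move=> z; rewrite normcM.
  rewrite /F /G /synth /wv -(cint_tensor iF iG) /A1 /A2 /wv -cintB// -cintZ; last exact: cintegrableB.
  rewrite -cintB//; last by apply: cintegrableZ; exact: cintegrableB.
  apply: eq_cint => z; rewrite dotprodDr mulrDr cisD.
  exact: defect_algebra (band_split1 k e r s z.1 z.2) (band_split2 k e r s z.1 z.2).
rewrite PE; apply: (le_trans (normcB_le _ _)).
rewrite 2!normcM normc_real -!mulrA mulrDl; apply: lerD.
  rewrite !mulrA -[leRHS]mul1r -!mulrA; apply: ler_pM; rewrite ?normc_ge0//.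
  by rewrite !mulrA -(mulrA _ K).
have [_ U0 Ug _ _] := tU.
have Ux p : 0 <= p <= 1 -> U x `^ p <= C0 `^ 1.
  move=> /andP[p0 p1]; rewrite powRr1 ?(ltW C00)//.
  apply: (@le_trans _ _ (U x)); first exact: powR_le_self.
  by have := Ug x; rewrite subrr normr0 mul0r addr0 expr1n mulr1.
apply: (@le_trans _ _ ((K * C0 `^ 1) * ((s ^+ 2) `^ (- h) * (L * C0 `^ 1)))).
  apply: ler_pM; rewrite ?normc_ge0//.
    by apply: (le_trans hFx); apply: ler_wpM2l => //; exact: Ux.
  apply: (le_trans hGx); apply: ler_wpM2l; first exact: powR_ge0.
  by apply: ler_wpM2l => //; exact: Ux.
have hrs : (s ^+ 2) `^ (- h) <= (r ^+ 2) `^ (- h) * (r / s) `^ ep.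
  have -> : (s ^+ 2) `^ (- h) = (r ^+ 2) `^ (- h) * (r / s) `^ (2 * h).
    have -> : (r / s) `^ (2 * h) = (r ^+ 2) `^ h * (s ^+ 2) `^ (- h).
      rewrite powRrM powR_mulrn ?divr_ge0 ?(ltW r0) ?(ltW s0)// expr_div_n.
      rewrite powRM ?(ltW r20) ?invr_ge0 ?(ltW s20)//.
      by rewrite -powR_inv1 ?(ltW s20)// -powRrM mulN1r.
    by rewrite mulrA -powRD ?(gt_eqF r20) ?implybT// addNr powRr0 mul1r.
  apply: ler_wpM2l; first exact: powR_ge0.
  have rs1 : r / s <= 1 by rewrite ler_pdivrMr// mul1r.
  by apply: ger_powR => //; rewrite divr_gt0.
have k00 : 0 <= C0 `^ 1 * C0 `^ 1 * (K * L) by rewrite !mulr_ge0 ?powR_ge0.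
have := ler_wpM2l k00 hrs.
move: (C0 `^ 1) (_ `^ (- h)) (_ `^ (- h)) (_ `^ ep) => c a2 a1 a3 hh.
rewrite [leLHS](_ : _ = c * c * (K * L) * a1); last by ring.
by rewrite [leRHS](_ : _ = c * c * (K * L) * (a2 * a3)); last by ring.
Qed.

End bands.

(** * Interpolation between two bounds *)

Section interpolation.
Context {R : realType}.

Lemma min_le_geo (x y de : R) : 0 < x -> 0 < y -> 0 <= de <= 1 -> Num.min x y <= x * (y / x) `^ de.
Proof.
move=> x0 y0 /andP[d0 d1]; have yx : 0 < y / x by rewrite divr_gt0.
have [xy|yx'] := leP x y.
  by rewrite ler_peMr ?(ltW x0)//; apply: powR_ge1 => //; rewrite ler_pdivlMr// mul1r.
apply: (@le_trans _ _ (x * (y / x))); first by rewrite mulrCA mulfV ?mulr1// gt_eqF.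
apply: ler_wpM2l; first exact: ltW.
rewrite -[leLHS]powRr1 ?(ltW yx)//; apply: ger_powR => //.
by rewrite yx/= ler_pdivrMr// mul1r ltW.
Qed.

Lemma interp_geo (M a b U al be de : R) : 0 < M -> 0 < a -> 0 < b -> 0 < U -> 0 <= de <= 1 ->
  Num.min (M * (a * U `^ al)) (M * (b * U `^ be)) <=
  M * (a * (b / a) `^ de) * U `^ ((1 - de) * al + de * be).
Proof.
move=> M0 a0 b0 U0 de01; apply: (le_trans (min_le_geo _ _ de01)).
- by rewrite !mulr_gt0// powR_gt0.
- by rewrite !mulr_gt0// powR_gt0.
have -> : M * (b * U `^ be) / (M * (a * U `^ al)) = (b / a) * U `^ (be - al).
  by rewrite powRB ?(gt_eqF U0) ?implybT//; field; rewrite !gt_eqF// powR_gt0.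
rewrite powRM ?powR_ge0 ?divr_ge0 ?(ltW a0) ?(ltW b0)// -powRrM.
rewrite [(1 - de) * al + de * be](_ : _ = al + (be - al) * de); last by ring.
rewrite powRD ?(gt_eqF U0) ?implybT//.
rewrite le_eqVlt; apply/orP; left; apply/eqP; ring.
Qed.

(** For [w = v] the two exponents cross at [h v = (al + be) / 2], and on either side of it the
    smaller one decays linearly; replacing [w] by [v] in the second costs the last factor. *)
Lemma min_exp_bump (h de al be v w : R) : 0 <= de ->
  Num.min (expR (de * (al - h * v))) (expR (de * (h * w - be))) <= 
  expR (de * ((al - be) / 2)) * expR (- (de * `|h * v - (al + be) / 2|)) * expR (de * `|h * (w - v)|).
Proof.
move=> d0; rewrite -!expRD.
have w0 : 0 <= de * `|h * (w - v)| by rewrite mulr_ge0.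
have [hv|hv] := leP ((al + be) / 2) (h * v).
  rewrite ge_min; apply/orP; left; rewrite ler_expR (ger0_norm (x := h * v - _)) ?subr_ge0//.
  by rewrite [leLHS](_ : _ = de * ((al - be) / 2) - de * (h * v - (al + be) / 2)) ?lerDl//; field.
rewrite ge_min; apply/orP; right; rewrite ler_expR (ltr0_norm (x := h * v - _)) ?subr_lt0//.
have := ler_wpM2l d0 (ler_norm (h * (w - v))) => h1.
rewrite [leLHS](_ : _ = de * ((al - be) / 2) - de * (- (h * v - (al + be) / 2)) + de * (h * (w - v))); last by field.
by rewrite lerD2l.
Qed.

(** The left side is the weighted geometric mean [a^(1 - de/2) b^(de/2)]. *)
Lemma geo_mean_le (a b de : R) : 0 < a -> 0 < b -> 0 <= de <= 2 -> a * expR (de * (ln (b / a) / 2)) <= a + b.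
Proof.
move=> a0 b0 /andP[d0 d2]; have ba : 0 < b / a by rewrite divr_gt0.
have -> : a + b = a * (1 + b / a) by rewrite mulrDr mulr1 mulrCA mulfV ?mulr1// gt_eqF.
apply: ler_wpM2l; first exact: ltW.
have -> : expR (de * (ln (b / a) / 2)) = (b / a) `^ (de / 2).
  by rewrite /powR gt_eqF//; congr expR; ring.
have [ba1|ba1] := leP 1 (b / a).
  apply: (@le_trans _ _ ((b / a) `^ 1)); last by rewrite powRr1 ?(ltW ba)// lerDr.
  by apply: ler_powR => //; rewrite ler_pdivrMr// mul1r.
apply: (@le_trans _ _ ((b / a) `^ 0)); last by rewrite powRr0 lerDl ltW.
by apply: ger_powR; rewrite ?ba ?(ltW ba1)// divr_ge0.
Qed.

Lemma convex_unit (de a c : R) : 0 <= de <= 1 -> 0 <= a <= 1 -> 0 <= c <= 1 -> 0 <= (1 - de) * a + de * c <= 1.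
Proof.
move=> /andP[d0 d1] /andP[a00 a10] /andP[c00 c10]; have d1' : 0 <= 1 - de by rewrite subr_ge0.
rewrite addr_ge0 ?mulr_ge0//=.
by have := ler_wpM2l d1' a10; have := ler_wpM2l d0 c10; lra.
Qed.

Lemma convex_sum_le (de a b c S : R) : 0 <= de -> b - a <= 1 -> a + c <= S -> (1 - de) * a + de * b + c <= S + de.
Proof. by move=> d0 ba acS; have := ler_wpM2l d0 ba; rewrite mulrBr; lra. Qed.

End interpolation.

Fact scale_cancel {R : realType} (a b c : R) (z : R[i]) : a != 0 ->
  b%:C * (c%:C * z) = (a^-1)%:C * ((a * (b * c))%:C * z).
Proof.
move=> a0; rewrite mulrA -rmorphM [RHS]mulrA -[in RHS]rmorphM; congr (_%:C * _).
by rewrite /= mulKf.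
Qed.

(** * Bounds on the pieces by maximal functions *)

Section controlled.
Context {R : realType} {n : nat}.
Local Notation X := 'rV[R]_n.
Local Notation mu := (lebesgue_rV R n).
Local Notation mu2 := (prodm mu mu).
Local Notation NN := (n%:R + 1 : R).
Implicit Types (x y v xi : X) (fh gh : X -> R[i]).

(** [K] bounds [M(|F|^p)^(1/p)] at [x], with [F = synth fh] and [M] the maximal function. *)
Definition controlled x fh (p K : R) := [/\ wid fh, 1 <= p, 0 < K &
  (HL (fun y => (normc (synth fh y) `^ p)%R) x <= (K `^ p)%:E)%E].

Lemma synthZ (c : R) al y : wid al -> synth (fun xi => c%:C * al xi) y = c%:C * synth al y.
Proof.
move=> wa; rewrite /synth /wv -cintZ; last exact: (wave_cis_int y wa).
by apply: eq_cint => xi; rewrite -!mulrA.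
Qed.

(** Powers of [L] are traded for powers of the scale: a band of [f] is also a band of [D^s f], which
    yields a second bound for the same quantity. *)
Lemma band_lower h a c e r xi : 0 <= h -> 0 < a -> 0 <= e -> 0 < r ->
  band (h + a) c e r xi = (r ^+ 2) `^ h * (band a c e r xi * lap e xi `^ h).
Proof.
move=> h0 a0 e0 r0; rewrite /band powRD; last by rewrite gt_eqF// ltr_wpDl.
by rewrite (powRM h) ?sqr_ge0 ?lap_ge0//; ring.
Qed.

Definition band_bounded (a c C : R) := forall e r fh (p K : R) (u : X -> R), 0 <= e -> 0 < r -> wid fh -> 1 <= p -> 0 < K ->
  (forall v, 0 <= u v) ->
  (forall v, \int[mu]_y (wgt r NN (v - y) * normc (synth fh y) `^ p)%:E = (K `^ p * u v)%:E)%E ->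
  forall v, normc (synth (fun xi => (band a c e r xi)%:C * fh xi) v) <= C * (K * (1 + u v) `^ p^-1) /\
    (\int[mu]_y (wgt r NN (v - y) * normc (synth (fun xi => (band a c e r xi)%:C * fh xi) y))%:E <=
     (C * (K * (1 + u v) `^ p^-1))%:E)%E.

Lemma band_bounded_mono a c C C' : C <= C' -> band_bounded a c C -> band_bounded a c C'.
Proof.
move=> CC H e r fh p K u e0 r0 wf p1 K0 u0 hu v.
have [h1 h2] := H e r fh p K u e0 r0 wf p1 K0 u0 hu v.
have hh : C * (K * (1 + u v) `^ p^-1) <= C' * (K * (1 + u v) `^ p^-1).
  by apply: ler_wpM2r => //; exact: mulr_ge0 (ltW K0) (powR_ge0 _ _).
by split; [exact: le_trans hh|apply: le_trans h2 _; rewrite lee_fin].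
Qed.

(** One constant for the finitely many bands that occur: [h + 1] is the exponent of the pieces, [1]
    what [band_lower] leaves of it, and [h + (h + 1)] arises when a band of [D^s g] is bounded
    through [g]. The values of [c] are the Gaussian fractions in [band_split1]. *)
Lemma band_bounds h : 0 < h -> exists2 C : R, 0 < C & forall a c, a \in [:: 1; h + 1; h + (h + 1)] ->
  c \in [:: 1; 2^-1; 4^-1] -> band_bounded a c C.
Proof.
move=> h0.
suff H (s t : seq R) : all (fun a => 1 <= a) s -> all (fun c => 0 < c <= 1) t ->
    exists2 C : R, 0 < C & forall a c, a \in s -> c \in t -> band_bounded a c C.
  apply: H => /=; first by rewrite lexx addrA !lerDr/= addr_ge0 ?(ltW h0).
  by rewrite ltr01 lexx !invr_gt0 !ltr0n/= !invf_le1 ?ler1n.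
elim: s => [|a s IH] /=; first by move=> _ _; exists 1.
move=> /andP[a1 hs] ht; have [C C0 HC] := IH hs ht.
have [C' C'0 HC'] : exists2 C : R, 0 < C & forall c, c \in t -> band_bounded a c C.
  elim: t ht {HC IH} => [|c t IHt] /=; first by move=> _; exists 1.
  move=> /andP[c01 /IHt[C1 C10 H1]]; have [C2 C20 H2] := band_bound (n := n) a1 c01.
  exists (C1 + C2) => [|c']; first by rewrite addr_gt0.
  rewrite inE => /orP[/eqP->|/H1]; first by apply: (band_bounded_mono _ H2); rewrite lerDr ltW.
  by apply: band_bounded_mono; rewrite lerDl ltW.
exists (C + C') => [|a' c]; first by rewrite addr_gt0.
rewrite inE => /orP[/eqP-> /HC'|as_ ct].
  by apply: band_bounded_mono; rewrite lerDr ltW.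
by apply: (band_bounded_mono _ (HC a' c as_ ct)); rewrite lerDl ltW.
Qed.

(* The power [de] interpolates between the bounds in terms of [f] and [D^s f] (resp. of [D^s g] and [g]),
   which produces decay away from the scale where they balance. *)
Lemma piece_scales (h th ep b de : R) : 0 < h -> 0 <= th -> 0 < ep <= 1 -> ep <= 2 * h -> 0 < b <= 1 -> 0 <= de <= 1 ->
  n%:R + b + ep + n%:R * (th + de) < n%:R + 2 * h \/ (exists K : nat, h = K%:R) ->
  exists2 C : R, 0 < C & forall e r s x fh gh (p0 p1 q0 q1 X0 X1 Y0 Y1 : R),
  0 <= e -> 0 < r -> r <= s ->
  controlled x fh p0 X0 -> controlled x (fun xi => (lap e xi `^ h)%:C * fh xi) p1 X1 ->
  controlled x gh q0 Y0 -> controlled x (fun xi => (lap e xi `^ h)%:C * gh xi) q1 Y1 ->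
  p0^-1 + q1^-1 <= 1 + th -> p1^-1 + q0^-1 <= 1 + th ->
  normc (piece h (h + 1) e fh gh x r s) <= C * (r / s) `^ ep * (X1 * Y0) *
    Num.min ((X0 / ((r ^+ 2) `^ h * X1)) `^ de) (((s ^+ 2) `^ h * Y1 / Y0) `^ de).
Proof.
move=> h0 th0 ep01 eph b01 de01 hN.
have /andP[b0 _] := b01; have /andP[d0 d1] := de01.
have [C1 C10 hT] := tame_average (n := n) b01.
have [C2 C20 hC] := tame_cst (n := n) b0.
have [M M0 hM] := band_bounds h0.
have S1 : 1 <= 1 + th + de by rewrite -addrA lerDl addr_ge0.
have C00 : 0 < C2 + (C1 + C1 + (C1 + C1)) by rewrite !addr_gt0.
have hN' : n%:R + b + ep + n%:R * (1 + th + de - 1) < n%:R + 2 * h \/ (exists K : nat, h = K%:R).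
  by case: hN => [hN|]; [left; rewrite (_ : 1 + th + de - 1 = th + de)//; ring|right].
have [C C'0 H] := piece_bound (n := n) ep01 eph b0 h0 S1 C00 hN'.
exists (C * (M * M)) => [|e r s x fh gh p0 p1 q0 q1 X0 X1 Y0 Y1 e0 r0 rs]; first by rewrite !mulr_gt0.
move=> [wf p01 X00 HX0] [wf1 p11 X10 HX1] [wg q01 Y00 HY0] [wg1 q11 Y10 HY1] hpq1 hpq2.
have s0 := lt_le_trans r0 rs.
have r20 : 0 < r ^+ 2 by rewrite exprn_gt0.
have s20 : 0 < s ^+ 2 by rewrite exprn_gt0.
pose rh := (r ^+ 2) `^ h; pose sh := (s ^+ 2) `^ h.
have rh0 : 0 < rh by rewrite powR_gt0.
have sh0 : 0 < sh by rewrite powR_gt0.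
have avg al p K t : wid al -> 1 <= p -> 0 < K -> r <= t -> (HL (fun y => (normc (synth al y) `^ p)%R) x <= (K `^ p)%:E)%E ->
    exists2 u, tame C1 b r x u & forall v, (\int[mu]_y (wgt t NN (v - y) * normc (synth al y) `^ p)%:E = (K `^ p * u v)%:E)%E.
  move=> wa p1' K0 rt; apply: hT => //; last by rewrite powR_gt0.
    by apply: (measurableT_comp (f := @powR R ^~ p)); [exact: measurable_powR|exact: measurable_synth].
  by move=> y; exact: powR_ge0.
have [u0 tu0 Hu0] := avg _ _ _ r wf p01 X00 (lexx r) HX0.
have [u1 tu1 Hu1] := avg _ _ _ r wf1 p11 X10 (lexx r) HX1.
have [w0 tw0 Hw0] := avg _ _ _ s wg q01 Y00 rs HY0.
have [w1 tw1 Hw1] := avg _ _ _ s wg1 q11 Y10 rs HY1.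
have [_ u00 _ _ _] := tu0; have [_ u10 _ _ _] := tu1.
have [_ w00 _ _ _] := tw0; have [_ w10 _ _ _] := tw1.
(* One majorant for all four averages; the summand 1 makes powers of [U] monotone in the
   exponent. *)
pose U v := 1 + (u0 v + u1 v + (w0 v + w1 v)).
have tU : tame (C2 + (C1 + C1 + (C1 + C1))) b r x U.
  by apply: tameD => //; [exact: hC|apply: tameD => //; apply: tameD].
have U1 v : 1 <= U v by rewrite lerDl !addr_ge0.
have U0 v : 0 < U v by exact: lt_le_trans ltr01 (U1 v).
have inU (u : X -> R) (A p K : R) v : 1 <= p -> 0 < K -> (forall v, 0 <= u v) -> 1 + u v <= U v ->
    A <= M * (K * (1 + u v) `^ p^-1) -> A <= M * (K * U v `^ p^-1).
  move=> p1' K0 uu0 uU /le_trans; apply; apply: ler_wpM2l; first exact: ltW.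
  apply: ler_wpM2l; first exact: ltW.
  apply: ge0_ler_powR; rewrite ?nnegrE// ?(ltW (U0 v))//.
  - by rewrite invr_ge0 (le_trans ler01).
  - by rewrite addr_ge0.
have uU0 v : 1 + u0 v <= U v by rewrite /U lerD2l -addrA lerDl !addr_ge0.
have uU1 v : 1 + u1 v <= U v by rewrite /U lerD2l addrAC lerDr !addr_ge0.
have wU0 v : 1 + w0 v <= U v by rewrite /U lerD2l addrCA lerDl !addr_ge0.
have wU1 v : 1 + w1 v <= U v by rewrite /U lerD2l addrA lerDr !addr_ge0.
have cI c : c \in [:: 1; 2^-1; 4^-1] -> 0 <= c.
  by rewrite !inE => /or3P[]/eqP->//; rewrite invr_ge0.
have lowE t c al y : 0 < t -> 0 <= c -> wid al -> wid (fun xi => (lap e xi `^ h)%:C * al xi) -> synth (fun xi => (band (h + 1) c e t xi)%:C * al xi) y =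
    ((t ^+ 2) `^ h)%:C * synth (fun xi => (band 1 c e t xi)%:C * ((lap e xi `^ h)%:C * al xi)) y.
  move=> t0 c0 wa wa1; rewrite -synthZ; last by apply: wid_mul => //; exact: symbol_band.
  congr (synth _ y); apply/funext => xi; rewrite band_lower// ?(ltW h0)// !rmorphM/= -!mulrA//.
have aI1 : 1 \in [:: 1; h + 1; h + (h + 1)] by rewrite !inE eqxx.
have aI2 : h + 1 \in [:: 1; h + 1; h + (h + 1)] by rewrite !inE eqxx orbT.
have aI3 : h + (h + 1) \in [:: 1; h + 1; h + (h + 1)] by rewrite !inE eqxx !orbT.
have F0 c v : c \in [:: 1; 2^-1; 4^-1] ->
    normc (synth (fun xi => (band (h + 1) c e r xi)%:C * fh xi) v) <= M * (X0 * U v `^ p0^-1).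
  move=> hc; apply: (inU u0) => //.
  by have [] := hM _ _ aI2 hc e r fh p0 X0 u0 e0 r0 wf p01 X00 u00 Hu0 v.
have F1 c v : c \in [:: 1; 2^-1; 4^-1] ->
    normc (synth (fun xi => (band (h + 1) c e r xi)%:C * fh xi) v) <= M * (rh * X1 * U v `^ p1^-1).
  move=> hc; rewrite lowE// ?cI// normcM normc_real ger0_norm ?powR_ge0// -/rh.
  rewrite -(mulrA rh) mulrCA; apply: ler_wpM2l; first exact: ltW.
  apply: (inU u1) => //.
  by have [] := hM _ _ aI1 hc e r _ p1 X1 u1 e0 r0 wf1 p11 X10 u10 Hu1 v.
have F01 c v : c \in [:: 1; 2^-1; 4^-1] -> normc (synth (fun xi => (band (h + 1) c e r xi)%:C * fh xi) v) <=
    M * (rh * X1 * (X0 / (rh * X1)) `^ de) * U v `^ ((1 - de) * p1^-1 + de * p0^-1).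
  move=> hc; apply: le_trans (interp_geo _ _ M0 _ X00 (U0 v) de01); last by rewrite mulr_gt0.
  by rewrite le_min F0// F1.
have Gx0 v : (\int[mu]_y (wgt s NN (v - y) * normc (synth (fun xi => (band (h + 1) 4^-1 e s xi)%:C * gh xi) y))%:E <=
    (M * (Y0 * U v `^ q0^-1))%:E)%E.
  have hc : 4^-1 \in [:: 1; 2^-1; 4^-1 : R] by rewrite !inE eqxx !orbT.
  have [_ h1] := hM _ _ aI2 hc e s gh q0 Y0 w0 e0 s0 wg q01 Y00 w00 Hw0 v.
  by apply: le_trans h1 _; rewrite lee_fin; exact: (inU w0).
have Gx1 v : (\int[mu]_y (wgt s NN (v - y) * normc (synth (fun xi => (band (h + 1) 4^-1 e s xi)%:C * gh xi) y))%:E <=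
    (M * (sh * Y1 * U v `^ q1^-1))%:E)%E.
  have hc : 4^-1 \in [:: 1; 2^-1; 4^-1 : R] by rewrite !inE eqxx !orbT.
  have [_ h1] := hM _ _ aI1 hc e s _ q1 Y1 w1 e0 s0 wg1 q11 Y10 w10 Hw1 v.
  have wB : wid (fun xi => (band 1 4^-1 e s xi)%:C * ((lap e xi `^ h)%:C * gh xi)).
    by apply: wid_mul => //; apply: symbol_band => //; exact: cI.
  under eq_integral do rewrite lowE ?cI// normcM normc_real (ger0_norm (ltW sh0)) -/sh mulrCA.
  rewrite ge0_integralrZl ?(ltW sh0)//; last 2 first.
  - apply: measurable_funM; last exact: measurable_synth.
    by apply: measurable_wgt; exact: measurable_rVB.
  - by move=> y; rewrite mulr_ge0 ?normc_ge0// wgt_ge0.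
  apply: (@le_trans _ _ (sh%:E * (M * (Y1 * U v `^ q1^-1))%:E)%E).
    apply: lee_wpmul2l; first by rewrite lee_fin ltW.
    by apply: le_trans h1 _; rewrite lee_fin; exact: (inU w1).
  by rewrite -EFinM lee_fin -(mulrA sh) [leLHS]mulrCA.
have Gx01 v : (\int[mu]_y (wgt s NN (v - y) * normc (synth (fun xi => (band (h + 1) 4^-1 e s xi)%:C * gh xi) y))%:E <=
    (M * (Y0 * (sh * Y1 / Y0) `^ de) * U v `^ ((1 - de) * q0^-1 + de * q1^-1))%:E)%E.
  apply: (@le_trans _ _ (Num.min (M * (Y0 * U v `^ q0^-1)) (M * (sh * Y1 * U v `^ q1^-1)))%:E).
    by have [_|_] := leP (M * (Y0 * U v `^ q0^-1)) (M * (sh * Y1 * U v `^ q1^-1)); [exact: Gx0|exact: Gx1].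
  by rewrite lee_fin; apply: interp_geo => //; rewrite mulr_gt0.
have oneI : 1 \in [:: 1; 2^-1; 4^-1 : R] by rewrite !inE eqxx.
have shV : (s ^+ 2) `^ (- h) = sh^-1 by rewrite powRN.
(* A band of [D^s g] bounded through [g], by reading [band_lower] upwards; this is the source of the
   factor [s^(-2h)]. *)
have H0 : normc (synth (fun xi => (band (h + 1) 1 e s xi)%:C * ((lap e xi `^ h)%:C * gh xi)) x) <=
    (s ^+ 2) `^ (- h) * (M * (Y0 * U x `^ q0^-1)).
  have -> : synth (fun xi => (band (h + 1) 1 e s xi)%:C * ((lap e xi `^ h)%:C * gh xi)) x =
      (sh^-1)%:C * synth (fun xi => (band (h + (h + 1)) 1 e s xi)%:C * gh xi) x.
    rewrite -synthZ; last by apply: wid_mul => //; apply: symbol_band => //; rewrite !addr_ge0 ?(ltW h0).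
    congr (synth _ x); apply/funext => xi; rewrite (@band_lower h (h + 1)) ?(ltW h0)//; last by rewrite addr_gt0.
    exact: scale_cancel (lt0r_neq0 sh0).
  rewrite shV normcM normc_real ger0_norm ?invr_ge0 ?(ltW sh0)//.
  apply: ler_wpM2l; first by rewrite invr_ge0 ltW.
  apply: (inU w0) => //.
  by have [] := hM _ _ aI3 oneI e s gh q0 Y0 w0 e0 s0 wg q01 Y00 w00 Hw0 x.
have H1 : normc (synth (fun xi => (band (h + 1) 1 e s xi)%:C * ((lap e xi `^ h)%:C * gh xi)) x) <=
    (s ^+ 2) `^ (- h) * (M * (sh * Y1 * U x `^ q1^-1)).
  rewrite shV [leRHS](_ : _ = M * (Y1 * U x `^ q1^-1)); last by field; rewrite gt_eqF.
  apply: (inU w1) => //.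
  by have [] := hM _ _ aI2 oneI e s _ q1 Y1 w1 e0 s0 wg1 q11 Y10 w10 Hw1 x.
have H01 : normc (synth (fun xi => (band (h + 1) 1 e s xi)%:C * ((lap e xi `^ h)%:C * gh xi)) x) <=
    (s ^+ 2) `^ (- h) * (M * (Y0 * (sh * Y1 / Y0) `^ de) * U x `^ ((1 - de) * q0^-1 + de * q1^-1)).
  apply: (@le_trans _ _ ((s ^+ 2) `^ (- h) * Num.min (M * (Y0 * U x `^ q0^-1)) (M * (sh * Y1 * U x `^ q1^-1)))).
    by have [_|_] := leP (M * (Y0 * U x `^ q0^-1)) (M * (sh * Y1 * U x `^ q1^-1)); [exact: H0|exact: H1].
  apply: ler_wpM2l; first exact: powR_ge0.
  by apply: interp_geo => //; rewrite mulr_gt0.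
have i01 (p : R) : 1 <= p -> 0 <= p^-1 <= 1.
  by move=> hp; rewrite invr_ge0 invf_le1 ?(lt_le_trans ltr01)// hp (le_trans ler01).
have conv a c := @convex_unit R de a c de01.
have k0 : 0 <= h + 1 by rewrite addr_ge0 ?(ltW h0).
have rhV : (r ^+ 2) `^ (- h) = rh^-1 by rewrite powRN.
have hI : 2^-1 \in [:: 1; 2^-1; 4^-1 : R] by rewrite !inE eqxx orbT.
have /andP[p0i0 p0i1] := i01 _ p01; have /andP[p1i0 p1i1] := i01 _ p11.
have /andP[q0i0 q0i1] := i01 _ q01; have /andP[q1i0 q1i1] := i01 _ q11.
have Gx0' v : (\int[mu]_y (wgt s NN (v - y) * normc (synth (fun xi => (band (h + 1) 4^-1 e s xi)%:C * gh xi) y))%:E <=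
    (M * Y0 * U v `^ q0^-1)%:E)%E by rewrite -mulrA; exact: Gx0.
have H0' : normc (synth (fun xi => (band (h + 1) 1 e s xi)%:C * ((lap e xi `^ h)%:C * gh xi)) x) <=
    (s ^+ 2) `^ (- h) * (M * Y0 * U x `^ q0^-1) by rewrite -(mulrA M); exact: H0.
(* The factor from [f] is interpolated here and the one from [g] is bounded by [Y0]; [key2] bounds
   [f] by [X1] and interpolates [g]. Both leave the prefactor [X1 Y0]. *)
have key1 : normc (piece h (h + 1) e fh gh x r s) <= C * (M * M) * (r / s) `^ ep * (X1 * Y0) * (X0 / (rh * X1)) `^ de.
  have sio : (1 - de) * p1^-1 + de * p0^-1 + q0^-1 <= 1 + th + de.
    by apply: convex_sum_le => //; rewrite lerBlDr (le_trans p0i1)// lerDl.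
  have KK0 : 0 <= M * (rh * X1 * (X0 / (rh * X1)) `^ de).
    exact: mulr_ge0 (ltW M0) (mulr_ge0 (mulr_ge0 (ltW rh0) (ltW X10)) (powR_ge0 _ _)).
  have := H (h + 1) e r s x fh gh U _ (M * Y0) _ _ k0 e0 r0 rs wf wg tU U1 KK0 (mulr_ge0 (ltW M0) (ltW Y00))
    (conv _ _ (i01 _ p11) (i01 _ p01)) (i01 _ q01) sio (fun v => F01 _ v hI) (F01 _ x oneI).
  move=> /(_ Gx0' H0') /le_trans; apply.
  rewrite rhV; move: ((r / s) `^ ep) ((X0 / (rh * X1)) `^ de) => t1 t2.
  by rewrite [leLHS](_ : _ = C * (M * M) * t1 * (X1 * Y0) * t2)//; field; rewrite gt_eqF.
have key2 : normc (piece h (h + 1) e fh gh x r s) <= C * (M * M) * (r / s) `^ ep * (X1 * Y0) * (sh * Y1 / Y0) `^ de.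
  have sio : p1^-1 + ((1 - de) * q0^-1 + de * q1^-1) <= 1 + th + de.
    by rewrite addrC; apply: convex_sum_le => //; [rewrite lerBlDr (le_trans q1i1)// lerDl|rewrite addrC].
  have LL0 : 0 <= M * (Y0 * (sh * Y1 / Y0) `^ de).
    exact: mulr_ge0 (ltW M0) (mulr_ge0 (ltW Y00) (powR_ge0 _ _)).
  have KK0 : 0 <= M * (rh * X1) by exact: mulr_ge0 (ltW M0) (mulr_ge0 (ltW rh0) (ltW X10)).
  have F1' c v : c \in [:: 1; 2^-1; 4^-1] ->
    normc (synth (fun xi => (band (h + 1) c e r xi)%:C * fh xi) v) <= M * (rh * X1) * U v `^ p1^-1.
    by move=> hc; rewrite -mulrA; exact: F1.
  have := H (h + 1) e r s x fh gh U _ _ _ _ k0 e0 r0 rs wf wg tU U1 KK0 LL0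
    (i01 _ p11) (conv _ _ (i01 _ q01) (i01 _ q11)) sio (fun v => F1' _ v hI) (F1' _ x oneI) Gx01 H01.
  move=> /le_trans; apply.
  rewrite rhV; move: ((r / s) `^ ep) ((sh * Y1 / Y0) `^ de) => t1 t2.
  by rewrite [leLHS](_ : _ = C * (M * M) * t1 * (X1 * Y0) * t2)//; field; rewrite gt_eqF.
by have [_|_] := leP ((X0 / (rh * X1)) `^ de) ((sh * Y1 / Y0) `^ de).
Qed.

Lemma wave_pair al be : wid al -> wid be ->
  wave mu2 (fun z => z.1 + z.2) (fun z : X * X => al z.1 * be z.2).
Proof.
move=> wa wb; apply: (wave_tensor wa wb).
- exact: measurable_rVD.
- exact: cmeas_tensor (wid_meas wa) (wid_meas wb).
- exact: one_plus_norm_add.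
- by move=> z; rewrite normcM.
Qed.

Lemma synth_mul al be x : wid al -> wid be ->
  synth al x * synth be x = wv mu2 (fun z => z.1 + z.2) (fun z : X * X => al z.1 * be z.2) x.
Proof.
move=> wa wb; rewrite /synth /wv -(cint_tensor (wave_cis_int x wa) (wave_cis_int x wb)).
by apply: eq_cint => z; rewrite dotprodDr (mulrDr (2 * pi)) cisD mulrACA.
Qed.

Lemma defect_int h e al be x : 0 <= h -> 0 <= e -> wid al -> wid be ->
  cintegrable mu2 (fun z => (leibniz_defect h e z)%:C * (al z.1 * be z.2) * cis (2 * pi * dotprod x (z.1 + z.2))) /\
  cint mu2 (fun z => (leibniz_defect h e z)%:C * (al z.1 * be z.2) * cis (2 * pi * dotprod x (z.1 + z.2))) =
  wv mu2 (fun z => z.1 + z.2) (fun z => (lap e (z.1 + z.2) `^ h)%:C * (al z.1 * be z.2)) x -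
  synth (fun xi => (lap e xi `^ h)%:C * al xi) x * synth be x - synth al x * synth (fun xi => (lap e xi `^ h)%:C * be xi) x.
Proof.
move=> h0 e0 wa wb; have sl := symbol_lap_powR (n := n) e0 h0.
have i1 := wave_cis_int x (waveM sl (wave_pair wa wb)).
have wa1 := wid_mul sl wa; have wb1 := wid_mul sl wb.
have i2 := wave_cis_int x (wave_pair wa1 wb); have i3 := wave_cis_int x (wave_pair wa wb1).
have E z : (leibniz_defect h e z)%:C * (al z.1 * be z.2) * cis (2 * pi * dotprod x (z.1 + z.2)) =
    (lap e (z.1 + z.2) `^ h)%:C * (al z.1 * be z.2) * cis (2 * pi * dotprod x (z.1 + z.2)) -
    (lap e z.1 `^ h)%:C * al z.1 * be z.2 * cis (2 * pi * dotprod x (z.1 + z.2)) -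
    al z.1 * ((lap e z.2 `^ h)%:C * be z.2) * cis (2 * pi * dotprod x (z.1 + z.2)).
  rewrite /leibniz_defect !rmorphB/=.
  move: (_%:C) (_%:C) (_%:C) (al z.1) (be z.2) (cis _) => a1 a2 a3 a b c; ring.
have -> : (fun z => (leibniz_defect h e z)%:C * (al z.1 * be z.2) * cis (2 * pi * dotprod x (z.1 + z.2))) =
  (fun z => (lap e (z.1 + z.2) `^ h)%:C * (al z.1 * be z.2) * cis (2 * pi * dotprod x (z.1 + z.2)) -
    (lap e z.1 `^ h)%:C * al z.1 * be z.2 * cis (2 * pi * dotprod x (z.1 + z.2)) -
    al z.1 * ((lap e z.2 `^ h)%:C * be z.2) * cis (2 * pi * dotprod x (z.1 + z.2))) by apply/funext.
split; first by do 2 apply: cintegrableB => //.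
by rewrite cintB//; [rewrite cintB// !synth_mul|exact: cintegrableB].
Qed.

Lemma cint_swap (f : X * X -> R[i]) : cintegrable mu2 f -> cintegrable mu2 (fun z => f (z.2, z.1)) ->
  cint mu2 (fun z => f (z.2, z.1)) = cint mu2 f.
Proof. by move=> f1 f2; rewrite (cint_fubini2 f2) (cint_fubini1 f1). Qed.

Lemma pieceE h k e fh gh x r s : piece h k e fh gh x r s =
  cint mu2 (fun z => (leibniz_defect h e z)%:C * ((band k 1 e r z.1)%:C * fh z.1 * ((band k 1 e s z.2)%:C * gh z.2)) *
    cis (2 * pi * dotprod x (z.1 + z.2))).
Proof.
apply: eq_cint => z; rewrite !rmorphM/=; congr (_ * _).
move: (_%:C) (_%:C) (_%:C) (fh z.1) (gh z.2) => a1 a2 a3 a b; ring.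
Qed.

(** The defect is symmetric in its two frequencies, so the restriction [r <= s] loses nothing. *)
Lemma piece_swap h k e fh gh x r s : 0 <= h -> 0 <= k -> 0 <= e -> 0 < r -> 0 < s -> wid fh -> wid gh ->
  piece h k e fh gh x r s = piece h k e gh fh x s r.
Proof.
move=> h0 k0 e0 r0 s0 wf wg; rewrite !pieceE.
have wa : wid (fun xi => (band k 1 e r xi)%:C * fh xi) by apply: wid_mul => //; exact: symbol_band.
have wb : wid (fun xi => (band k 1 e s xi)%:C * gh xi) by apply: wid_mul => //; exact: symbol_band.
have [i1 _] := defect_int x h0 e0 wa wb; have [i2 _] := defect_int x h0 e0 wb wa.
rewrite -(cint_swap i1).
  by apply: eq_cint => z /=; rewrite (addrC z.2) {1}/leibniz_defect/= (addrC z.2) addrAC mulrA (mulrC (_ * gh z.1)) -!mulrA.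
apply: eq_ind i2 _ _; apply/funext => z /=.
by rewrite (addrC z.2) {2}/leibniz_defect/= (addrC z.2) addrAC (mulrC (_ * gh z.1)).
Qed.

Lemma expR_powR (a b : R) : expR a `^ b = expR (b * a).
Proof. by rewrite /powR gt_eqF ?expR_gt0// expRK. Qed.

(** The [v] at which [X0 / (e^(h v) X1) = e^(h v) Y1 / Y0]. *)
Definition log_center (h X0 X1 Y0 Y1 : R) := (ln (X0 / X1) + ln (Y0 / Y1)) / (2 * h).

(** With [v = 2 ln r] and [w = 2 ln s] the factor [(r/s)^ep] is [exp(-ep (w - v) / 2)], of which
    [min_exp_bump] consumes at most [exp(ep (w - v) / 8)], as [8 de h <= ep]. The peak of the bump
    times [X1 Y0] is a weighted geometric mean of [X1 Y0] and [X0 Y1]. *)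
Lemma piece_decay_up (h th ep b de : R) : 0 < h -> 0 <= th -> 0 < ep <= 1 -> ep <= 2 * h -> 0 < b <= 1 -> 0 <= de <= 1 ->
  8 * (de * h) <= ep ->
  n%:R + b + ep + n%:R * (th + de) < n%:R + 2 * h \/ (exists K : nat, h = K%:R) ->
  exists2 C : R, 0 < C & forall e x fh gh (p0 p1 q0 q1 X0 X1 Y0 Y1 : R),
  0 <= e ->
  controlled x fh p0 X0 -> controlled x (fun xi => (lap e xi `^ h)%:C * fh xi) p1 X1 ->
  controlled x gh q0 Y0 -> controlled x (fun xi => (lap e xi `^ h)%:C * gh xi) q1 Y1 ->
  p0^-1 + q1^-1 <= 1 + th -> p1^-1 + q0^-1 <= 1 + th -> forall v w : R, v <= w ->
  normc (piece h (h + 1) e fh gh x (expR (v / 2)) (expR (w / 2))) <= C * (X1 * Y0 + X0 * Y1) *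
    (expR (- (ep / 4 * (w - v))) * expR (- (de * h * `|v - log_center h X0 X1 Y0 Y1|))).
Proof.
move=> h0 th0 ep01 eph b01 de01 deh hN; have /andP[d0 d1] := de01; have /andP[ep0 ep1] := ep01.
have [C C0 H] := piece_scales h0 th0 ep01 eph b01 de01 hN.
exists C => // e x fh gh p0 p1 q0 q1 X0 X1 Y0 Y1 e0 cf cf1 cg cg1 hpq1 hpq2 v w vw.
have X00 : 0 < X0 by case: cf. have X10 : 0 < X1 by case: cf1.
have Y00 : 0 < Y0 by case: cg. have Y10 : 0 < Y1 by case: cg1.
have vw2 : expR (v / 2) <= expR (w / 2) by rewrite ler_expR ler_pM2r ?invr_gt0.
have := H e _ _ x fh gh p0 p1 q0 q1 X0 X1 Y0 Y1 e0 (expR_gt0 (v / 2)) vw2 cf cf1 cg cg1 hpq1 hpq2.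
move=> /le_trans; apply.
have sq (u : R) : expR (u / 2) ^+ 2 = expR u by rewrite expr2 -expRD -splitr.
rewrite !sq !expR_powR.
have -> : X0 / (expR (h * v) * X1) = expR (ln (X0 / X1) - h * v).
  by rewrite expRD expRN lnK ?posrE ?divr_gt0//; field; rewrite !gt_eqF// expR_gt0.
have -> : expR (h * w) * Y1 / Y0 = expR (h * w - ln (Y0 / Y1)).
  by rewrite expRD expRN lnK ?posrE ?divr_gt0//; field; rewrite !gt_eqF.
have -> : expR (v / 2) / expR (w / 2) = expR (- ((w - v) / 2)).
  by rewrite -expRN -expRD; congr expR; field.
rewrite !expR_powR.
have m0 : 0 <= C * expR (ep * - ((w - v) / 2)) * (X1 * Y0).
  exact: mulr_ge0 (mulr_ge0 (ltW C0) (expR_ge0 _)) (mulr_ge0 (ltW X10) (ltW Y00)).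
apply: (le_trans (ler_wpM2l m0 (min_exp_bump h (ln (X0 / X1)) (ln (Y0 / Y1)) v w d0))).
have := geo_mean_le (mulr_gt0 X10 Y00) (mulr_gt0 X00 Y10) (_ : 0 <= de <= 2).
have -> : ln (X0 * Y1 / (X1 * Y0)) = ln (X0 / X1) - ln (Y0 / Y1).
  rewrite -ln_div ?posrE ?divr_gt0//; congr ln; field; rewrite !gt_eqF//.
have d02 : 0 <= de <= 2 by rewrite d0/= (le_trans d1)// ler1n.
move=> /(_ d02) hg.
have -> : `|h * v - (ln (X0 / X1) + ln (Y0 / Y1)) / 2| = h * `|v - log_center h X0 X1 Y0 Y1|.
  rewrite -[X in _ = X * _](gtr0_norm h0) -normrM; congr (`|_|); rewrite /log_center.
  by field; rewrite gt_eqF.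
rewrite [de * (h * _)]mulrA.
have t10 := expR_ge0 (de * ((ln (X0 / X1) - ln (Y0 / Y1)) / 2)).
have t20 := expR_ge0 (- (de * h * `|v - log_center h X0 X1 Y0 Y1|)).
move: hg t10 t20; move: (expR (de * ((_ - _) / 2))) (expR (- (de * h * _))) => t1 t2 hg t10 t20.
have -> : `|h * (w - v)| = h * (w - v) by rewrite ger0_norm// mulr_ge0 ?subr_ge0// ltW.
have ee : expR (ep * - ((w - v) / 2)) * expR (de * (h * (w - v))) <= expR (- (ep / 4 * (w - v))).
  by rewrite -expRD ler_expR; have := vw; rewrite -subr_ge0 => wv; nra.
have A0 : 0 <= expR (ep * - ((w - v) / 2)) * expR (de * (h * (w - v))) by rewrite mulr_ge0// expR_ge0.
have B0 : 0 <= X1 * Y0 * t1.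
  by have := mulr_ge0 (ltW X10) (ltW Y00); move=> /mulr_ge0; apply; exact: t10.
have := ler_pM A0 B0 ee hg => hh.
have := ler_wpM2l (mulr_ge0 (ltW C0) t20) hh.
move: (expR _) (expR _) (expR _) => E3 E2 E1 h3.
rewrite [leLHS](_ : _ = C * t2 * (E1 * E2 * (X1 * Y0 * t1))); last by ring.
by rewrite [leRHS](_ : _ = C * t2 * (E3 * (X1 * Y0 + X0 * Y1))); last by ring.
Qed.

(** For [w < v] the roles of [f] and [g] are exchanged. Recentring the second exponential from [w]
    to [v] then costs [exp(de h (v - w))], at most half of the available decay. *)
Lemma piece_decay (h th ep b de : R) : 0 < h -> 0 <= th -> 0 < ep <= 1 -> ep <= 2 * h -> 0 < b <= 1 -> 0 <= de <= 1 ->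
  8 * (de * h) <= ep ->
  n%:R + b + ep + n%:R * (th + de) < n%:R + 2 * h \/ (exists K : nat, h = K%:R) ->
  exists2 C : R, 0 < C & forall e x fh gh (p0 p1 q0 q1 X0 X1 Y0 Y1 : R),
  0 <= e ->
  controlled x fh p0 X0 -> controlled x (fun xi => (lap e xi `^ h)%:C * fh xi) p1 X1 ->
  controlled x gh q0 Y0 -> controlled x (fun xi => (lap e xi `^ h)%:C * gh xi) q1 Y1 ->
  p0^-1 + q1^-1 <= 1 + th -> p1^-1 + q0^-1 <= 1 + th -> forall v w : R,
  normc (piece h (h + 1) e fh gh x (expR (v / 2)) (expR (w / 2))) <= C * (X1 * Y0 + X0 * Y1) *
    (expR (- (ep / 8 * `|w - v|)) * expR (- (de * h * `|v - log_center h X0 X1 Y0 Y1|))).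
Proof.
move=> h0 th0 ep01 eph b01 de01 deh hN; have /andP[d0 d1] := de01; have /andP[ep0 ep1] := ep01.
have [C C0 H] := piece_decay_up h0 th0 ep01 eph b01 de01 deh hN.
exists C => // e x fh gh p0 p1 q0 q1 X0 X1 Y0 Y1 e0 cf cf1 cg cg1 hpq1 hpq2 v w.
have X00 : 0 < X0 by case: cf. have X10 : 0 < X1 by case: cf1.
have Y00 : 0 < Y0 by case: cg. have Y10 : 0 < Y1 by case: cg1.
have m0 : 0 <= C * (X1 * Y0 + X0 * Y1) by rewrite !(mulr_ge0, addr_ge0)// ltW.
have dh0 : 0 <= de * h by rewrite mulr_ge0// ltW.
have [vw|wv] := leP v w.
  apply: (le_trans (H e x fh gh p0 p1 q0 q1 X0 X1 Y0 Y1 e0 cf cf1 cg cg1 hpq1 hpq2 v w vw)).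
  apply: ler_wpM2l => //; apply: ler_wpM2r; first exact: expR_ge0.
  rewrite ger0_norm ?subr_ge0// ler_expR; move: vw; rewrite -subr_ge0 => ?; nra.
have k0 : 0 <= h + 1 by rewrite addr_ge0 ?(ltW h0).
rewrite piece_swap ?expR_gt0 ?(ltW h0)//; [|by case: cf|by case: cg].
have := H e x gh fh q0 q1 p0 p1 Y0 Y1 X0 X1 e0 cg cg1 cf cf1.
rewrite addrC => /(_ hpq2); rewrite addrC => /(_ hpq1 w v (ltW wv)) /le_trans; apply.
rewrite (_ : Y1 * X0 + Y0 * X1 = X1 * Y0 + X0 * Y1); last by ring.
apply: ler_wpM2l => //.
have -> : log_center h Y0 Y1 X0 X1 = log_center h X0 X1 Y0 Y1 by rewrite /log_center addrC.
rewrite -!expRD ler_expR (distrC w v) (gtr0_norm (x := v - w)) ?subr_gt0//.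
set c := log_center _ _ _ _ _.
have : `|v - c| <= (v - w) + `|w - c|.
  have := ler_normD (v - w) (w - c); rewrite (gtr0_norm (x := v - w)) ?subr_gt0//.
  by rewrite addrA subrK.
move: wv; rewrite -subr_gt0; move: (v - w) (`|w - c|) (`|v - c|) => a1 a2 a3 a10 haa.
nra.
Qed.

End controlled.

(** * Resolution of the identity over scales *)

Section resolution.
Context {R : realType} {d1 d2} {T1 : measurableType d1} {T2 : measurableType d2}.
Context (m1 : {sigma_finite_measure set T1 -> \bar R}) (m2 : {sigma_finite_measure set T2 -> \bar R}).

(** The weight [B] is inserted under the integral and the integrals are exchanged; its total mass
    has to be [Q] only where [F] does not vanish. *)
Lemma cint_resolution (B : T1 * T2 -> R) (F : T2 -> R[i]) (Q W : R) (u : T1 -> R) :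
  measurable_fun [set: T1 * T2] B -> (forall q, 0 <= B q) -> cintegrable m2 F -> 0 <= Q ->
  (forall z, F z = 0 \/ (\int[m1]_p (B (p, z))%:E = Q%:E)%E) ->
  measurable_fun [set: T1] u -> (forall p, normc (cint m2 (fun z => (B (p, z))%:C * F z)) <= u p) ->
  (\int[m1]_p (u p)%:E <= W%:E)%E -> Q * normc (cint m2 F) <= W.
Proof.
move=> mB B0 iF Q0 hF mu_ hu uW.
have [mF Foo] := iF.
have mBF : cmeas (fun q : T1 * T2 => (B q)%:C * F q.2).
  by apply: cmeasM; [exact: cmeas_real|exact: cmeas_comp mF measurable_snd].
have mBz z : measurable_fun [set: T1] (fun p => B (p, z)).
  exact: measurableT_comp mB (measurable_pair2 _).
have E z : (\int[m1]_p (normc ((B (p, z))%:C * F z))%:E = (Q * normc (F z))%:E)%E.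
  case: (hF z) => [->|h].
    by under eq_integral do rewrite mulr0 normc0; rewrite integral0 normc0 mulr0.
  under eq_integral do rewrite normcM normc_real ger0_norm// mulrC.
  by rewrite ge0_integralrZl ?normc_ge0// h -EFinM mulrC.
have iBF : cintegrable (m1 \x m2)%E (fun q : T1 * T2 => (B q)%:C * F q.2).
  split=> //; rewrite fubini_tonelli2//; last 2 first.
  - by apply/measurable_EFinP; exact: measurable_normc.
  - by move=> z; rewrite lee_fin normc_ge0.
  rewrite /fubini_G/=; under eq_integral do rewrite E.
  rewrite ge0_integralrZl//; [|exact: measurable_normc|by move=> x; exact: normc_ge0].
  by rewrite lte_mul_pinfty// ?lee_fin// normc_ge0.
have e1 : cint m1 (fun p => cint m2 (fun z => (B (p, z))%:C * F z)) = Q%:C * cint m2 F.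
  rewrite (cint_fubini iBF)/= -cintZ//; apply: eq_cint => z.
  case: (hF z) => [->|h].
    rewrite mulr0; under eq_cint do rewrite mulr0.
    by apply: complex_eqP => /=; rewrite /Rintegral integral0.
  have Bi : cintegrable m1 (fun p => (B (p, z))%:C).
    split; first exact: (cmeas_real (mBz z)).
    rewrite (_ : (\int[_]_v _)%E = Q%:E) ?ltry// -h.
    by apply: eq_integral => v _; rewrite normc_real ger0_norm.
  transitivity (cint m1 (fun p => F z * (B (p, z))%:C)); first by apply: eq_cint => p; rewrite mulrC.
  rewrite cintZ// mulrC; congr (_ * _).
  by apply: complex_eqP => /=; rewrite /Rintegral ?h//= integral0.
have mp : cmeas (fun p => cint m2 (fun z => (B (p, z))%:C * F z)) by exact: (cmeas_param m2 mBF).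
rewrite -[Q]ger0_norm// -normc_real -normcM -e1 -lee_fin.
have ii : cintegrable m1 (fun p => cint m2 (fun z => (B (p, z))%:C * F z)).
  apply: (cintegrable_le mp mu_ hu); exact: le_lt_trans uW (ltry _).
apply: le_trans (normc_cint ii) _; apply: le_trans uW.
apply: ge0_le_integralr => //; first exact: measurable_normc.
by move=> p; exact: normc_ge0.
Qed.

End resolution.

Fact scale_shuffle {R : realType} (b d : R) (F c : R[i]) : b%:C * (d%:C * F * c) = (d * b)%:C * F * c.
Proof. by rewrite rmorphM /=; ring. Qed.

(** * Summation over scales *)

Section defect.
Context {R : realType} {n : nat}.
Local Notation X := 'rV[R]_n.
Local Notation mu := (lebesgue_rV R n).
Local Notation mu2 := (prodm mu mu).
Local Notation leb := (@lebesgue_measure R).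
Local Notation leb2 := (prodm leb leb).
Implicit Types (x y xi : X) (fh gh : X -> R[i]).

Lemma dotprod_eq0 xi : dotprod xi xi = 0 -> xi = 0.
Proof.
move=> /eqP; rewrite /dotprod psumr_eq0 => [/allP h|i _]; last by rewrite -expr2 sqr_ge0.
apply/rowP => i; rewrite mxE; have := h i (mem_index_enum _).
by rewrite mulf_eq0 orbb => /eqP.
Qed.

Lemma lap_eq0 e xi : 0 <= e -> lap e xi = 0 -> e = 0 /\ xi = 0.
Proof.
move=> e0 /eqP; rewrite /lap paddr_eq0 ?dotprod_ge0// => /andP[/eqP-> /eqP h].
by split=> //; exact: dotprod_eq0.
Qed.

(** Bands cannot resolve a frequency with [L = 0], which occurs for [e = 0] at the origin. There the
    defect vanishes: one of its terms is zero and the other two cancel. *)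
Lemma leibniz_defect_eq0 h e (z : X * X) : 0 < h -> 0 <= e -> leibniz_defect h e z != 0 ->
  0 < lap e z.1 /\ 0 < lap e z.2.
Proof.
move=> h0 e0 dz; rewrite !lt_neqAle !lap_ge0//= !andbT ![0 == _]eq_sym.
have hn : h != 0 by rewrite gt_eqF.
have l0 : lap 0 (0 : X) = 0 by rewrite /lap add0r /dotprod big1// => i _; rewrite mxE mul0r.
split; apply: contra dz => /eqP /(lap_eq0 e0)[ee zz]; rewrite /leibniz_defect zz ee.
  by rewrite add0r l0 powR0// subr0 subrr.
by rewrite addr0 l0 powR0// subrr subr0.
Qed.

Lemma measurable_band2 k e : measurable_fun [set: (measurableTypeR R * X)%type]
  (fun q : measurableTypeR R * X => band k 1 e (expR (q.1 / 2)) q.2).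
Proof.
have m1 : measurable_fun [set: (measurableTypeR R * X)%type] (fun q : measurableTypeR R * X => expR (q.1 / 2) ^+ 2 : R).
  apply: measurable_funX; apply: (measurableT_comp (f := @expR R)) => //.
  by apply: measurable_funM => //; exact: measurable_fst.
have m2 : measurable_fun [set: (measurableTypeR R * X)%type] (fun q : measurableTypeR R * X => lap e q.2).
  exact: measurableT_comp (measurable_lap e) measurable_snd.
apply: measurable_funM.
  apply: (measurableT_comp (f := @powR R ^~ k)); first exact: measurable_powR.
  exact: measurable_funM.
apply: (measurableT_comp (f := @expR R)) => //; apply: measurable_funN; apply: measurable_funM => //.
exact: measurable_funM.
Qed.

(** [integral_eulerG_scale] with [c = L xi]: the powers of [L xi] cancel, so the total mass is the
    same at every frequency. *)
Lemma band_integral k e xi : 0 < k -> 0 < lap e xi ->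
  (\int[leb]_v (band k 1 e (expR (v / 2)) xi)%:E = (eulerG k)%:E)%E.
Proof.
move=> k0 l0.
have E v : band k 1 e (expR (v / 2)) xi = lap e xi `^ k * (expR (k * v) * expR (- (expR v * lap e xi))).
  rewrite /band expr2 -expRD -splitr mul1r powRM ?expR_ge0 ?(ltW l0)// expR_powR; ring.
under eq_integral do rewrite E.
have ml : measurable_fun [set: R] (fun v : R => expR (k * v) * expR (- (expR v * lap e xi))).
  by have := measurable_eulerG_integrand k (lap e xi); under eq_fun do rewrite (mulrC (lap e xi)).
rewrite ge0_integralrZl; last 3 first.
- exact: powR_ge0.
- exact: ml.
- by move=> v; rewrite mulr_ge0 ?expR_ge0.
by rewrite integral_eulerG_scale// -EFinM mulrA -powRD ?(gt_eqF l0) ?implybT// subrr powRr0 mul1r.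
Qed.

Lemma measurable_exp_abs2 (c1 c2 v0 : R) : measurable_fun [set: (measurableTypeR R * measurableTypeR R)%type]
  (fun p : measurableTypeR R * measurableTypeR R => expR (- (c1 * `|p.2 - p.1|)) * expR (- (c2 * `|p.1 - v0|))).
Proof.
apply: measurable_funM; apply: (measurableT_comp (f := @expR R)) => //;
    apply: measurable_funN; apply: measurable_funM => //; apply: measurableT_comp => //; apply: measurable_funB => //.
Qed.

Lemma exp_abs_double (c1 c2 v0 : R) : 0 < c1 -> 0 < c2 ->
  (\int[leb2]_p (expR (- (c1 * `|p.2 - p.1|)) * expR (- (c2 * `|p.1 - v0|)))%:E <= (2 / c1 * (2 / c2))%:E)%E.
Proof.
move=> c10 c20.
have me (c w : R) : measurable_fun [set: R] (fun v : R => expR (- (c * `|v - w|))).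
  apply: (measurableT_comp (f := @expR R)) => //; apply: measurable_funN; apply: measurable_funM => //.
  by apply: measurableT_comp => //; exact: measurable_funB.
have I c w : 0 < c -> (\int[leb]_v (expR (- (c * `|v - w|)))%:E <= (2 / c)%:E)%E.
  move=> c0; rewrite (ge0_integral_shift (- w) (f := fun v => (expR (- (c * `|v|)))%:E)).
  - exact: integral_exp_abs.
  - by apply/measurable_EFinP; have := me c 0; under eq_fun do rewrite subr0.
  - by move=> v; rewrite lee_fin expR_ge0.
rewrite fubini_tonelli1; last 2 first.
- by apply/measurable_EFinP; exact: measurable_exp_abs2.
- by move=> p; rewrite lee_fin mulr_ge0 ?expR_ge0.
rewrite /fubini_F/=.
apply: (@le_trans _ _ (\int[leb]_v (2 / c1 * expR (- (c2 * `|v - v0|)))%:E)%E).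
  apply: ge0_le_integral => //.
  - by move=> v _; apply: integral_ge0 => w _; rewrite lee_fin mulr_ge0 ?expR_ge0.
  - apply: (@measurable_ge0_param _ _ _ (measurableTypeR R) (measurableTypeR R) leb (fun p => (expR (- (c1 * `|p.2 - p.1|)) * expR (- (c2 * `|p.1 - v0|)))%:E)).
      by apply/measurable_EFinP; exact: measurable_exp_abs2.
    by move=> p; rewrite lee_fin mulr_ge0 ?expR_ge0.
  - by apply/measurable_EFinP; apply: measurable_funM => //; exact: me.
  move=> v _; under eq_integral do rewrite mulrC.
  rewrite ge0_integralrZl ?expR_ge0//; last exact: me.
  rewrite (mulrC (2 / c1)) [leRHS]EFinM; apply: lee_wpmul2l; first by rewrite lee_fin expR_ge0.
  exact: I.
rewrite ge0_integralrZl//; [|by rewrite divr_ge0// ltW|exact: me].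
by rewrite [leRHS]EFinM; apply: lee_wpmul2l; [rewrite lee_fin divr_ge0// ltW|exact: I].
Qed.

(** Each of the three losses takes at most a quarter of [gap], and [de] is also kept small enough
    for the interpolation to preserve the decay in the ratio of scales. *)
Fact exponent_choice (h gap N : R) : 0 < h -> 0 < gap -> 0 <= N -> exists ep b de : R,
  [/\ 0 < ep <= 1, ep <= 2 * h, 0 < b <= 1, 0 < de <= 1 & 8 * (de * h) <= ep /\ b + ep + N * de < gap].
Proof.
move=> h0 g0 N0.
pose ep := Num.min 1 (Num.min (2 * h) (gap / 4)).
have ep0 : 0 < ep by rewrite !lt_min ltr01 mulr_gt0//= divr_gt0.
have [e1 e2 e3] : [/\ ep <= 1, ep <= 2 * h & ep <= gap / 4].
  by rewrite !ge_min !lexx !orbT.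
pose b := Num.min 1 (gap / 4).
have b0 : 0 < b by rewrite lt_min ltr01 divr_gt0.
have [b1 b2] : b <= 1 /\ b <= gap / 4 by rewrite !ge_min !lexx !orbT.
have N1 : 0 < N + 1 by rewrite ltr_wpDl.
pose de := Num.min 1 (Num.min (ep / (8 * h)) (gap / 4 / (N + 1))).
have de0 : 0 < de by rewrite !lt_min ltr01 !divr_gt0// mulr_gt0.
have [d1 d2 d3] : [/\ de <= 1, de <= ep / (8 * h) & de <= gap / 4 / (N + 1)].
  by rewrite !ge_min !lexx !orbT.
exists ep, b, de; rewrite ep0 b0 de0; split=> //; split.
  by move: d2; rewrite ler_pdivlMr ?mulr_gt0//; lra.
by move: d3; rewrite ler_pdivlMr//; lra.
Qed.

Theorem defect_bound (h th : R) : 0 < h -> 0 <= th -> n%:R * th < 2 * h \/ (exists K : nat, h = K%:R) ->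
  exists2 C : R, 0 < C & forall e x fh gh (p0 p1 q0 q1 X0 X1 Y0 Y1 : R),
  0 <= e ->
  controlled x fh p0 X0 -> controlled x (fun xi => (lap e xi `^ h)%:C * fh xi) p1 X1 ->
  controlled x gh q0 Y0 -> controlled x (fun xi => (lap e xi `^ h)%:C * gh xi) q1 Y1 ->
  p0^-1 + q1^-1 <= 1 + th -> p1^-1 + q0^-1 <= 1 + th ->
  normc (cint mu2 (fun z => (leibniz_defect h e z)%:C * (fh z.1 * gh z.2) * cis (2 * pi * dotprod x (z.1 + z.2)))) <=
  C * (X1 * Y0 + X0 * Y1).
Proof.
move=> h0 th0 hN.
have [gap [g0 hg]] : exists gap, 0 < gap /\ (gap <= 2 * h - n%:R * th \/ (exists K : nat, h = K%:R)).
  case: hN => [hn|hK]; first by exists (2 * h - n%:R * th); split; [rewrite subr_gt0|left].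
  by exists 1; split=> //; right.
have [ep [b [de [ep01 eph b01 de01 [deh sm]]]]] := exponent_choice h0 g0 (ler0n R n).
have /andP[d0 d1] := de01; have /andP[ep0 _] := ep01.
have de01' : 0 <= de <= 1 by rewrite ltW.
have hN' : n%:R + b + ep + n%:R * (th + de) < n%:R + 2 * h \/ (exists K : nat, h = K%:R).
  by case: hg => [hg|]; [left; rewrite mulrDr; lra|right].
have [C C0 H] := piece_decay h0 th0 ep01 eph b01 de01' deh hN'.
have k0 : 0 < h + 1 by rewrite addr_gt0.
have [_ G0] := integral_eulerG k0.
have c10 : 0 < ep / 8 by rewrite divr_gt0.
have c20 : 0 < de * h by rewrite mulr_gt0.
exists (C * (2 / (ep / 8) * (2 / (de * h))) / eulerG (h + 1) ^+ 2) => [|e x fh gh p0 p1 q0 q1 X0 X1 Y0 Y1 e0 cf cf1 cg cg1 hpq1 hpq2].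
  by rewrite !(mulr_gt0, divr_gt0, invr_gt0, exprn_gt0).
have wf : wid fh by case: cf. have wg : wid gh by case: cg.
have X00 : 0 < X0 by case: cf. have X10 : 0 < X1 by case: cf1.
have Y00 : 0 < Y0 by case: cg. have Y10 : 0 < Y1 by case: cg1.
set D := X1 * Y0 + X0 * Y1; have D0 : 0 < D by rewrite addr_gt0 ?mulr_gt0.
set T := cint mu2 _.
set v0 := log_center h X0 X1 Y0 Y1.
pose B (q : (measurableTypeR R * measurableTypeR R) * (X * X)) := band (h + 1) 1 e (expR (q.1.1 / 2)) q.2.1 * band (h + 1) 1 e (expR (q.1.2 / 2)) q.2.2.
pose u (p : measurableTypeR R * measurableTypeR R) := C * D * (expR (- (ep / 8 * `|p.2 - p.1|)) * expR (- (de * h * `|p.1 - v0|))).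
suff : eulerG (h + 1) ^+ 2 * normc T <= C * D * (2 / (ep / 8) * (2 / (de * h))).
  rewrite mulrC -ler_pdivlMr ?exprn_gt0// => /le_trans; apply.
  rewrite le_eqVlt; apply/orP; left; apply/eqP; ring.
have [iT _] := defect_int x (ltW h0) e0 wf wg.
have bb q : 0 <= B q by rewrite mulr_ge0// band_ge0.
apply: (cint_resolution (m1 := leb2) (m2 := mu2) (B := B) (u := u)) => //.
- apply: measurable_funM.
    apply: (measurableT_comp (measurable_band2 (h + 1) e) (g := fun q : (measurableTypeR R * measurableTypeR R) * (X * X) => (q.1.1, q.2.1) : measurableTypeR R * X)).
    apply/measurable_fun_pair.
      exact: (measurableT_comp measurable_fst measurable_fst).
    exact: (measurableT_comp measurable_fst measurable_snd).
  apply: (measurableT_comp (measurable_band2 (h + 1) e) (g := fun q : (measurableTypeR R * measurableTypeR R) * (X * X) => (q.1.2, q.2.2) : measurableTypeR R * X)).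
  apply/measurable_fun_pair.
    exact: (measurableT_comp measurable_snd measurable_fst).
  exact: (measurableT_comp measurable_snd measurable_snd).
- by rewrite exprn_ge0// ltW.
- move=> z; have [->|dz] := eqVneq (leibniz_defect h e z) 0; first by left; rewrite !mul0r.
  right; have [l1 l2] := leibniz_defect_eq0 h0 e0 dz.
  have mb xi : measurable_fun [set: R] (fun v : R => band (h + 1) 1 e (expR (v / 2)) xi).
    exact: (measurableT_comp (measurable_band2 (h + 1) e) (measurable_pair2 (T1 := measurableTypeR R) xi)).
  rewrite fubini_tonelli1; last 2 first.
  + apply/measurable_EFinP; apply: measurable_funM.
      exact: (measurableT_comp (mb z.1) measurable_fst).
    exact: (measurableT_comp (mb z.2) measurable_snd).
  + by move=> p; rewrite lee_fin bb.
  rewrite /fubini_F/= /B/=.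
  transitivity (\int[leb]_v (eulerG (h + 1) * band (h + 1) 1 e (expR (v / 2)) z.1)%:E)%E.
    apply: eq_integral => v _; rewrite ge0_integralrZl ?band_ge0//; [|exact: mb|by move=> w; exact: band_ge0].
    by rewrite band_integral// -EFinM mulrC.
  rewrite ge0_integralrZl; [|exact: ltW|exact: mb|by move=> v; exact: band_ge0].
  by rewrite band_integral// -EFinM expr2.
- by apply: measurable_funM => //; exact: measurable_exp_abs2.
- move=> p; have := H e x fh gh p0 p1 q0 q1 X0 X1 Y0 Y1 e0 cf cf1 cg cg1 hpq1 hpq2 p.1 p.2.
  apply: le_trans; rewrite le_eqVlt; apply/orP; left; apply/eqP; congr (normc _); apply: eq_cint => z.
  exact: scale_shuffle.
rewrite /u ge0_integralrZl; last 3 first.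
- by rewrite mulr_ge0// ltW.
- exact: measurable_exp_abs2.
- by move=> p; rewrite mulr_ge0 ?expR_ge0.
rewrite [leRHS]EFinM; apply: lee_wpmul2l; first by rewrite lee_fin mulr_ge0// ltW.
exact: exp_abs_double.
Qed.

End defect.

(** * Schwartz functions and Fourier inversion *)

Section continuous_measurable.
Context {R : realType} {n : nat}.
Local Notation X := 'rV[R]_n.

Lemma hlcube_dense (x : X) (r : R) : 0 < r -> exists2 k, hlcube k x & hlcube k `<=` cube x r.
Proof.
move=> r0.
have /choice[g hg] : forall i : 'I_n, exists q : rat, ratr q \in `](x 0 i - r / 4), (x 0 i + r / 4)[.
  by move=> i; apply: rat_in_itvoo; lra.
have [q] : exists q : rat, ratr q \in `](r / 4), (r / 2)[ by apply: rat_in_itvoo; lra.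
rewrite in_itv/= => /andP[q2 q3].
have q0 : 0 < ratr q :> R by lra.
pose k := pickle (\row_i g i, q).
have hk : hlp k = (map_mx ratr (\row_i g i), ratr q) :> X * R by rewrite /hlp /k pickleK -(ltr0q R) q0.
have h1 : (hlp k).1 = map_mx ratr (\row_i g i) :> X by rewrite hk.
have h2 : (@hlp R n k).2 = ratr q by rewrite hk.
have r4 : 0 < r / 4 by rewrite divr_gt0.
have xc : `|x - (hlp k).1| < r / 4.
  rewrite h1; apply/(rV_norm_ltP _ r4) => i; rewrite !mxE.
  by have := hg i; rewrite in_itv/= ltr_norml; lra.
exists k; first by rewrite /hlcube /cube/= h2; lra.
move=> y; rewrite /hlcube /cube/= h2 => yx.
have := ler_normD (y - (hlp k).1) ((hlp k).1 - x).
by rewrite addrA subrK (distrC (hlp k).1 x); lra.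
Qed.

(** The sigma-algebra is generated by the coordinates; every open set belongs to it as the countable
    union of the rational cubes it contains. *)
Lemma continuous_measurable_rV (u : X -> R) : continuous u -> measurable_fun [set: X] u.
Proof.
move=> cu; apply: (measurability _ (RGenOInfty.measurableE R)).
move=> _ [_ [a ->] <-]; rewrite setTI.
rewrite (_ : _ @^-1` _ = \bigcup_(k in [set k | @hlcube R n k `<=` u @^-1` `]a, +oo[%classic]) hlcube k).
  by apply: bigcup_measurable => k _; exact: measurable_cube.
apply/seteqP; split => [x xa|x [k /= hk kx]]; last exact: hk.
have : nbhs x (u @^-1` `]a, +oo[%classic).
  by apply: cu; apply: open_nbhs_nbhs; split => //; exact: itv_open.
move=> /nbhs_ballP[e /= e0 xe].
have [k kx ke] := hlcube_dense x e0.
exists k => //= y ky; apply: xe; rewrite -ball_normE /=.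
by have := ke y ky; rewrite /cube/= distrC.
Qed.

End continuous_measurable.

(** * Differential calculus along lines *)

Section line_calculus.
Context {R : realType} {n : nat}.
Local Notation X := 'rV[R]_n.
Implicit Types (u : X -> R) (x v : X).

Lemma derive_line u x v (t : R) :
  (forall y, differentiable u y) -> is_derive t (1 : R) (fun t => u (x + t *: v)) ('D_v u (x + t *: v)).
Proof.
move=> du.
have E : (fun h : R => h^-1 *: (((fun t => u (x + t *: v)) \o shift t) (h *: (1 : R)) - u (x + t *: v))) =
    (fun h : R => h^-1 *: ((u \o shift (x + t *: v)) (h *: v) - u (x + t *: v))).
  apply/funext => h /=; congr (_ *: (u _ - _)).
  by rewrite scaler1 /shift/= scalerDl addrCA.
have dv : derivable u (x + t *: v) v by exact: diff_derivable.
apply: DeriveDef; first by rewrite /derivable E.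
by rewrite /derive E.
Qed.

Lemma line_MVT u x v : (forall y, differentiable u y) ->
  exists2 c : R, 0 <= c <= 1 & u (x + v) - u x = 'D_v u (x + c *: v).
Proof.
move=> du; have h t := derive_line x v t du.
have [c cI] := @MVT R (fun t => u (x + t *: v)) (fun t => 'D_v u (x + t *: v)) 0 1 ltr01 (fun t _ => h t)
  (derivable_within_continuous (fun t _ => @ex_derive _ _ _ _ _ _ _ (h t))).
rewrite subr0 mulr1 scale1r scale0r addr0 => ->.
by exists c => //; move: cI; rewrite in_itv/= => /andP[/ltW-> /ltW->].
Qed.

Lemma derive_coord u x v : differentiable u x -> 'D_v u x = \sum_i v 0 i * 'D_(delta_mx 0 i) u x.
Proof.
move=> du; rewrite deriveE// {1}(row_sum_delta v) linear_sum.
by apply: eq_bigr => i _; rewrite linearZ/= deriveE.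
Qed.

Lemma derive_cvg_seq (V : normedModType R) (u : V -> R) (x v : V) : derivable u x v ->
  k.+1%:R * (u (k.+1%:R^-1 *: v + x) - u x) @[k --> \oo] --> 'D_v u x.
Proof.
move=> du.
have hk : (fun k : nat => k.+1%:R^-1 : R) @ \oo --> (0 : R)^'.
  move=> A; rewrite /nbhs/= /dnbhs => hA; rewrite /within/= in hA.
  have := @cvg_harmonic R _ hA; rewrite /nbhs/= => h; apply: filterS h => k /=.
  by apply; rewrite invr_eq0 pnatr_eq0.
have := cvg_comp _ _ hk du; apply: cvg_trans; apply: near_eq_cvg.
by near=> k; rewrite /= invrK.
Unshelve. all: by end_near.
Qed.

End line_calculus.

(** * Decay of Schwartz functions and of their Fourier transforms *)

Section schwartz_decay.
Context {R : realType} {n : nat}.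
Context (n_gt0 : (0 < n)%N).
Local Notation X := 'rV[R]_n.
Local Notation mu := (lebesgue_rV R n).
Implicit Types (f : X -> R[i]) (x y xi : X).

(** Decay in the norm is read off from monomials in a single coordinate, the largest one, which
    exists because [n > 0]. *)
Lemma norm_attained x : exists i, `|x| <= `|x 0 i|.
Proof.
apply: contrapT => /forallNP h.
have h' i : `|x 0 i| < `|x| by rewrite ltNge; apply/negP; exact: h.
have x0 : 0 < `|x| by apply: le_lt_trans (h' (Ordinal n_gt0)); rewrite normr_ge0.
by have /(rV_norm_ltP _ x0) := h'; rewrite ltxx.
Qed.

Lemma schwartz_cpartials l f : schwartz f -> schwartz (cpartials l f).
Proof.
have E l' : cpartials l' (cpartials l f) = cpartials (l' ++ l) f by rewrite /cpartials foldr_cat.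
move=> [sf bf]; split => [l' x|a l']; rewrite E; first exact: sf.
exact: bf.
Qed.

Lemma one_plus_exp_le (t : R) K : 0 <= t -> (1 + t) ^+ K <= 2 ^+ K * (1 + t ^+ K).
Proof.
move=> t0; have [t1|t1] := leP t 1.
  apply: (@le_trans _ _ (2 ^+ K)); last by rewrite ler_peMr ?exprn_ge0// lerDl exprn_ge0.
  by rewrite lerXn2r ?nnegrE ?addr_ge0//; lra.
apply: (@le_trans _ _ ((2 * t) ^+ K)).
  by rewrite lerXn2r ?nnegrE ?addr_ge0 ?mulr_ge0//; lra.
by rewrite exprMn ler_wpM2l ?exprn_ge0// lerDr.
Qed.

Lemma schwartz_decay f K : schwartz f -> exists2 C : R, 0 <= C & forall x, (1 + `|x|) ^+ K * normc (f x) <= C.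
Proof.
move=> [_ bf].
have /choice[M hM] : forall i : 'I_n, exists M : R, forall x, `|x 0 i| ^+ K * normc (f x) <= M.
  move=> i; have [M hM] := bf (fun j => if j == i then K else 0%N) [::].
  exists M => x; have := hM x; rewrite /monomial (bigD1 i)//= eqxx big1 ?mulr1 ?normrX// => j ji.
  by rewrite (negbTE ji) expr0.
have [M0 hM0] := bf (fun=> 0%N) [::].
have M00 x : normc (f x) <= M0.
  by have := hM0 x; rewrite /monomial big1 ?normr1 ?mul1r.
have Mi i : 0 <= M i.
  by apply: le_trans (hM i 0); rewrite mulr_ge0 ?exprn_ge0 ?normc_ge0.
exists (2 ^+ K * (M0 + \sum_i M i)) => [|x].
  by rewrite mulr_ge0 ?exprn_ge0// addr_ge0 ?sumr_ge0// (le_trans _ (M00 0))// normc_ge0.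
have [i xi] := norm_attained x.
apply: (@le_trans _ _ (2 ^+ K * (1 + `|x| ^+ K) * normc (f x))).
  by apply: ler_wpM2r; [exact: normc_ge0|exact: one_plus_exp_le].
rewrite -mulrA; apply: ler_wpM2l; first by rewrite exprn_ge0.
rewrite mulrDl mul1r; apply: lerD; first exact: M00.
apply: (@le_trans _ _ (M i)).
  apply: le_trans (hM i x); apply: ler_wpM2r; first exact: normc_ge0.
  by rewrite lerXn2r ?nnegrE.
by rewrite (bigD1 i)//= lerDl sumr_ge0.
Qed.

Lemma schwartz_cmeas f : schwartz f -> cmeas f.
Proof.
move=> [sf _]; have h x := sf [::] x.
by split; apply: continuous_measurable_rV => x; apply: differentiable_continuous; case: (h x).
Qed.

Lemma decay_wid f : cmeas f -> (forall K, exists2 C : R, 0 <= C & forall x, (1 + `|x|) ^+ K * normc (f x) <= C) ->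
  wid f.
Proof.
move=> mf hf; split=> // k.
have n1 : n%:R < n.+1%:R :> R by rewrite ltr_nat.
have [D D0 HD] := wgt_integral_le0 (n := n) n1.
have [C C0 HC] := hf (k + n.+1)%N.
apply: (@le_lt_trans _ _ (\int[mu]_x (C * wgt 1 n.+1%:R x)%:E)%E); last first.
  rewrite ge0_integralrZl//; [|exact: measurable_wgt|by move=> x; exact: wgt_ge0].
  rewrite lte_mul_pinfty// ?lee_fin//; exact: le_lt_trans (HD 1 ltr01) (ltry _).
have o0 x : 0 < 1 + `|x| :> R by rewrite ltr_wpDr.
apply: ge0_le_integralr.
- apply: measurable_funM; last exact: measurable_normc.
  by apply: measurable_funX; apply: measurable_funD => //; exact: measurable_rV_norm.
- by apply: measurable_funM => //; exact: measurable_wgt.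
- by move=> x; rewrite mulr_ge0 ?normc_ge0// exprn_ge0// ltW.
move=> x; rewrite /wgt invr1 expr1n mul1r mulr1 powRN powR_mulrn ?(ltW (o0 x))//.
rewrite ler_pdivlMr ?exprn_gt0//; apply: le_trans (HC x).
by rewrite mulrAC -exprD.
Qed.

Lemma schwartz_wid f : schwartz f -> wid f.
Proof. by move=> sf; apply: decay_wid => [|K]; [exact: schwartz_cmeas|exact: schwartz_decay]. Qed.

(** A Schwartz function is itself a density, so the results on waves apply to its Fourier transform
    as well. *)
Lemma fourier_synth f xi : fourier f xi = synth f (- xi).
Proof.
rewrite /fourier /synth /wv; apply: eq_cint => x; congr (_ * cis _).
by rewrite dotprodNl mulrN dotprodC.
Qed.

Lemma synth_shift f y c : wid f -> synth (fun x => f (x + c)) y = cis (- (2 * pi * dotprod y c)) * synth f y.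
Proof.
move=> wf; rewrite /synth /wv -cintZ; last exact: (wave_cis_int y wf).
pose H x := f (x + c) * cis (2 * pi * dotprod y x).
have mH : cmeas H.
  apply: cmeasM; first by apply: (cmeas_comp (wid_meas wf)); exact: measurable_rVD.
  by apply: cmeas_cis; apply: measurable_funM => //; exact: measurable_dotprod.
rewrite -(cint_rV_flip 0 mH) -[RHS](cint_rV_flip c); last first.
  apply: cmeasM; first exact: cmeas_cst.
  exact: (wave_cis_int y wf).1.
apply: eq_cint => x; rewrite /H sub0r addrC mulrCA -cisD; congr (_ * cis _).
by rewrite dotprodBr dotprodNr; ring.
Qed.

(** The mean value theorem for the real and the imaginary part separately, whence the factor 2. *)
Lemma increment_le f (B : R) x v : schwartz f ->
  (forall i c, 0 <= c <= 1 -> normc (cpartial i f (x + c *: v)) <= B) ->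
  normc (f (x + v) - f x) <= 2 * n%:R * `|v| * B.
Proof.
move=> [sf _] hB; have h y := sf [::] y.
have dRe y : differentiable (fun z => complex.Re (f z)) y by case: (h y).
have dIm y : differentiable (fun z => complex.Im (f z)) y by case: (h y).
have bnd (u : X -> R) : (forall y, differentiable u y) ->
    (forall i c, 0 <= c <= 1 -> `|'D_(delta_mx 0 i) u (x + c *: v)| <= B) -> `|u (x + v) - u x| <= n%:R * `|v| * B.
  move=> du hu; have [c c01 ->] := line_MVT x v du; rewrite derive_coord//.
  apply: (le_trans (ler_norm_sum _ _ _)).
  apply: (@le_trans _ _ (\sum_(i < n) (`|v| * B))).
    by apply: ler_sum => i _; rewrite normrM; apply: ler_pM => //; [exact: le_rV_norm|exact: hu].
  by rewrite sumr_const card_ord -[leLHS]mulr_natl [leLHS]mulrA.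
have hb (u : X -> R) (pu : 'I_n -> X -> R) : (forall i y, pu i y = 'D_(delta_mx 0 i) u y) -> (forall i y, `|pu i y| <= normc (cpartial i f y)) ->
    (forall y, differentiable u y) -> `|u (x + v) - u x| <= n%:R * `|v| * B.
  by move=> E hp du; apply: bnd => // i c c01; rewrite -E; apply: le_trans (hp i _) (hB i c c01).
apply: (le_trans (normc_le_ReIm _)).
rewrite Re_add Re_opp Im_add Im_opp -!mulrA -[2]/(1 + 1 : R) mulrDl !mul1r !mulrA; apply: lerD.
  apply: (hb (fun z => complex.Re (f z)) (fun i y => complex.Re (cpartial i f y))) => // i y; exact: normr_Re_le.
apply: (hb (fun z => complex.Im (f z)) (fun i y => complex.Im (cpartial i f y))) => // i y; exact: normr_Im_le.
Qed.

Lemma partials_decay f K : schwartz f ->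
  exists2 C : R, 0 <= C & forall i x, (1 + `|x|) ^+ K * normc (cpartial i f x) <= C.
Proof.
move=> sf.
have /choice[M hM] : forall i : 'I_n, exists M : R, 0 <= M /\ forall x, (1 + `|x|) ^+ K * normc (cpartial i f x) <= M.
  by move=> i; have [C C0 HC] := schwartz_decay K (schwartz_cpartials [:: i] sf); exists C.
exists (\sum_i M i) => [|i x]; first by apply: sumr_ge0 => i _; case: (hM i).
apply: le_trans ((hM i).2 x) _.
by rewrite (bigD1 i)//= lerDl sumr_ge0// => j _; case: (hM j).
Qed.

(** Difference quotients stand in for integration by parts: their transforms are explicit, and
    dominated convergence passes to the derivative. *)
Definition diff_quot f i (k : nat) x : R[i] := (k.+1%:R)%:C * (f (x + k.+1%:R^-1 *: delta_mx 0 i) - f x).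

Lemma norm_delta_le i : `|delta_mx 0 i : X| <= 1.
Proof. by apply/rV_norm_leP => // j; rewrite mxE; case: (_ && _); rewrite ?normr1 ?normr0. Qed.

Lemma diff_quot_le f i K : schwartz f -> exists2 C : R, 0 <= C & forall k x, normc (diff_quot f i k x) <= C * (1 + `|x|) ^- K.
Proof.
move=> sf; have [C C0 HC] := partials_decay K sf.
exists (2 * n%:R * (2 ^+ K * C)) => [|k x]; first by rewrite !mulr_ge0 ?exprn_ge0.
have o0 y : 0 < 1 + `|y| :> R by rewrite ltr_wpDr.
have k0 : 0 < k.+1%:R :> R by [].
set v := k.+1%:R^-1 *: delta_mx 0 i : X.
have v1 : `|v| <= k.+1%:R^-1.
  by rewrite normrZ gtr0_norm ?invr_gt0// ler_piMr ?invr_ge0// norm_delta_le.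
have v1' : `|v| <= 1 by apply: (le_trans v1); rewrite invf_le1// ler1n.
have H : normc (f (x + v) - f x) <= 2 * n%:R * `|v| * (2 ^+ K * C / (1 + `|x|) ^+ K).
  apply: increment_le => // j c /andP[c0 c1].
  have := HC j (x + c *: v); rewrite -ler_pdivlMl ?exprn_gt0// => /le_trans; apply.
  rewrite mulrC ler_pdivlMr ?exprn_gt0// mulrAC ler_pdivrMr ?exprn_gt0//.
  rewrite [leRHS](_ : _ = C * (2 ^+ K * (1 + `|x + c *: v|) ^+ K)); last by ring.
  apply: ler_wpM2l => //.
  rewrite -exprMn lerXn2r ?nnegrE ?mulr_ge0 ?(ltW (o0 _))//.
  have := ler_normB (x + c *: v) (c *: v); rewrite addrK normrZ ger0_norm// => h1.
  have := ler_pM c0 (normr_ge0 v) c1 v1'; rewrite mul1r => h2.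
  by have := normr_ge0 (x + c *: v); lra.
rewrite /diff_quot normcM normc_real ger0_norm//.
apply: (le_trans (ler_wpM2l (ltW k0) H)).
rewrite [leLHS](_ : _ = (k.+1%:R * `|v|) * (2 * n%:R * (2 ^+ K * C / (1 + `|x|) ^+ K))); last by ring.
rewrite -[leRHS]mulrA -[leRHS]mul1r -!mulrA mulrA; apply: ler_wpM2r.
  by rewrite !mulr_ge0 ?exprn_ge0// invr_ge0 exprn_ge0// ltW.
by rewrite -ler_pdivlMl// mulr1.
Qed.

Lemma Re_diff_quot f i k x : complex.Re (diff_quot f i k x) =
  k.+1%:R * (complex.Re (f (k.+1%:R^-1 *: delta_mx 0 i + x)) - complex.Re (f x)).
Proof. by rewrite /diff_quot Re_mul/= mul0r subr0 Re_add Re_opp (addrC x). Qed.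

Lemma Im_diff_quot f i k x : complex.Im (diff_quot f i k x) =
  k.+1%:R * (complex.Im (f (k.+1%:R^-1 *: delta_mx 0 i + x)) - complex.Im (f x)).
Proof. by rewrite /diff_quot Im_mul/= mul0r addr0 Im_add Im_opp (addrC x). Qed.

Lemma schwartz_shift_wid f c : schwartz f -> wid (fun x => f (x + c)).
Proof.
move=> sf; apply: decay_wid => [|K].
  by apply: (cmeas_comp (schwartz_cmeas sf)); exact: measurable_rVD.
have [C C0 HC] := schwartz_decay K sf.
exists ((1 + `|c|) ^+ K * C) => [|x]; first by rewrite mulr_ge0 ?exprn_ge0// addr_ge0.
apply: (@le_trans _ _ ((1 + `|c|) ^+ K * ((1 + `|x + c|) ^+ K * normc (f (x + c))))); last first.
  by apply: ler_wpM2l => //; rewrite exprn_ge0// addr_ge0.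
rewrite mulrA; apply: ler_wpM2r; first exact: normc_ge0.
rewrite -exprMn lerXn2r ?nnegrE ?mulr_ge0 ?addr_ge0//.
have := ler_normB (x + c) c; rewrite addrK => h1.
have := mulr_ge0 (normr_ge0 c) (normr_ge0 (x + c)); lra.
Qed.

Lemma synth_diff_quot f i k y : schwartz f ->
  synth (diff_quot f i k) y = (k.+1%:R)%:C * (cis (- (2 * pi * y 0 i) * k.+1%:R^-1) - 1) * synth f y.
Proof.
move=> sf; have wf := schwartz_wid sf.
set c := k.+1%:R^-1 *: delta_mx 0 i : X.
have wc := schwartz_shift_wid c sf.
have ic := wave_cis_int y wc; have if_ := wave_cis_int y wf.
have -> : synth (diff_quot f i k) y = (k.+1%:R)%:C * (synth (fun x => f (x + c)) y - synth f y).
  rewrite /synth /wv -cintB// -cintZ; last exact: cintegrableB.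
  by apply: eq_cint => x; rewrite /diff_quot -mulrA mulrBl.
rewrite synth_shift// -[RHS]mulrA; congr (_ * _); rewrite mulrBl mul1r; congr (cis _ * _ - _).
have -> : dotprod y c = k.+1%:R^-1 * y 0 i.
  rewrite /dotprod (bigD1 i)//= !mxE !eqxx mulr1 big1 ?addr0 1?mulrC// => j ji.
  by rewrite !mxE (negbTE ji) andbF !mulr0.
ring.
Qed.

Lemma cis_diff_quot (a : R) : normc ((k.+1%:R)%:C * (cis (a * k.+1%:R^-1) - 1)) @[k --> \oo] --> `|a|.
Proof.
have -> : `|a| = normc (0 +i* a) by rewrite normc_sqrt/= expr0n add0r sqrtr_sqr.
apply: normc_cvg => /=.
  have D : is_derive (0 : R) (1 : R) (fun t => cos (a * t)) 0.
    by apply: is_derive_eq; rewrite /GRing.scale/= mulr0 sin0; ring.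
  have := derive_cvg_seq (@ex_derive _ _ _ _ _ _ _ D); rewrite derive_val.
  apply: cvg_trans; apply: near_eq_cvg; near=> k.
  by rewrite !mul0r subr0 !addr0 mulr0 cos0 /GRing.scale/= mulr1.
have D : is_derive (0 : R) (1 : R) (fun t => sin (a * t)) a.
  by apply: is_derive_eq; rewrite /GRing.scale/= mulr0 cos0; ring.
have := derive_cvg_seq (@ex_derive _ _ _ _ _ _ _ D); rewrite derive_val.
apply: cvg_trans; apply: near_eq_cvg; near=> k.
by rewrite !mul0r !subr0 !addr0 mulr0 sin0 /GRing.scale/= mulr1 subr0.
Unshelve. all: by end_near.
Qed.

(** The limit of [synth_diff_quot], taken on both sides. Comparing moduli is all that the decay
    estimate requires. *)
Lemma synth_partial f i y : schwartz f -> normc (synth (cpartial i f) y) = `|2 * pi * y 0 i| * normc (synth f y).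
Proof.
move=> sf; have wf := schwartz_wid sf.
have n1 : n%:R < n.+1%:R :> R by rewrite ltr_nat.
have [D D0 HD] := wgt_integral_le0 (n := n) n1.
have [C C0 HC] := diff_quot_le i n.+1 sf.
have [sm _] := sf.
have mf := schwartz_cmeas sf.
have mpf := schwartz_cmeas (schwartz_cpartials [:: i] sf).
have mcis : cmeas (fun x : X => cis (2 * pi * dotprod y x)).
  by apply: cmeas_cis; apply: measurable_funM => //; exact: measurable_dotprod.
have cRe x : complex.Re (diff_quot f i k x) @[k --> \oo] --> complex.Re (cpartial i f x).
  under eq_fun do rewrite Re_diff_quot.
  apply: (derive_cvg_seq (u := fun x => complex.Re (f x)) (x := x) (v := delta_mx 0 i)).
  by apply: diff_derivable; case: (sm [::] x).
have cIm x : complex.Im (diff_quot f i k x) @[k --> \oo] --> complex.Im (cpartial i f x).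
  under eq_fun do rewrite Im_diff_quot.
  apply: (derive_cvg_seq (u := fun x => complex.Im (f x)) (x := x) (v := delta_mx 0 i)).
  by apply: diff_derivable; case: (sm [::] x).
have [lRe lIm] : complex.Re (synth (diff_quot f i k) y) @[k --> \oo] --> complex.Re (synth (cpartial i f) y) /\
    complex.Im (synth (diff_quot f i k) y) @[k --> \oo] --> complex.Im (synth (cpartial i f) y).
  apply: (cint_dominated (u := fun x => C * wgt 1 n.+1%:R x)).
  - move=> k; apply: cmeasM => //; apply: cmeasM; first exact: cmeas_cst.
    by apply: cmeasB => //; apply: (cmeas_comp mf); exact: measurable_rVD.
  - exact: cmeasM.
  - move=> x; under eq_fun do rewrite Re_mul.
    by rewrite Re_mul; apply: cvgB; apply: cvgMl.
  - move=> x; under eq_fun do rewrite Im_mul.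
    by rewrite Im_mul; apply: cvgD; apply: cvgMl.
  - by apply: measurable_funM => //; exact: measurable_wgt.
  - rewrite ge0_integralrZl//; [|exact: measurable_wgt|by move=> x; exact: wgt_ge0].
    rewrite lte_mul_pinfty// ?lee_fin//; exact: le_lt_trans (HD 1 ltr01) (ltry _).
  move=> k x; rewrite normcM normc_cis mulr1; apply: (le_trans (HC k x)).
  by rewrite /wgt invr1 expr1n mul1r mulr1 powRN powR_mulrn// addr_ge0.
have L1 := normc_cvg lRe lIm.
have L2 : normc (synth (diff_quot f i k) y) @[k --> \oo] --> `|2 * pi * y 0 i| * normc (synth f y).
  under eq_fun do rewrite synth_diff_quot// normcM.
  by apply: cvgMl; rewrite -normrN; exact: cis_diff_quot.
exact: (cvg_unique _ L1 L2).
Qed.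

(** [K] derivatives in the coordinate of largest size multiply the modulus of the transform by
    [|2 pi y_i|^K], and [2 pi >= 1]. *)
Lemma fourier_decay f K : schwartz f -> exists2 C : R, 0 <= C & forall xi, (1 + `|xi|) ^+ K * normc (fourier f xi) <= C.
Proof.
move=> sf.
have P i k y : normc (synth (cpartials (nseq k i) f) y) = `|2 * pi * y 0 i| ^+ k * normc (synth f y).
  elim: k => [|k IH]; first by rewrite expr0 mul1r.
  rewrite -[cpartials (nseq k.+1 i) f]/(cpartial i (cpartials (nseq k i) f)) synth_partial; last exact: schwartz_cpartials.
  by rewrite IH exprS mulrA.
have /choice[M hM] : forall i : 'I_n, exists M : R, forall y, normc (synth (cpartials (nseq K i) f) y) <= M.
  by move=> i; apply: wv_bounded; apply: schwartz_wid; exact: schwartz_cpartials.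
have [M0 hM0] := wv_bounded (schwartz_wid sf).
have M00 : 0 <= M0 by apply: le_trans (hM0 0); exact: normc_ge0.
have Mi i : 0 <= M i by apply: le_trans (hM i 0); exact: normc_ge0.
exists (2 ^+ K * (M0 + \sum_i M i)) => [|xi].
  by rewrite mulr_ge0 ?exprn_ge0// addr_ge0 ?sumr_ge0.
rewrite fourier_synth; set y := - xi; have -> : `|xi| = `|y| by rewrite normrN.
have [i yi] := norm_attained y.
apply: (@le_trans _ _ (2 ^+ K * (1 + `|y| ^+ K) * normc (synth f y))).
  by apply: ler_wpM2r; [exact: normc_ge0|exact: one_plus_exp_le].
rewrite -mulrA; apply: ler_wpM2l; first by rewrite exprn_ge0.
rewrite mulrDl mul1r; apply: lerD; first exact: hM0.
apply: (@le_trans _ _ (M i)); last by rewrite (bigD1 i)//= lerDl sumr_ge0.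
apply: le_trans (hM i y); rewrite P; apply: ler_wpM2r; first exact: normc_ge0.
rewrite lerXn2r ?nnegrE//; apply: (le_trans yi).
rewrite normrM ler_peMl// ger0_norm ?mulr_ge0 ?pi_ge0//.
by have := pi_ge2 R; lra.
Qed.

Lemma fourier_wid f : schwartz f -> wid (fourier f).
Proof.
move=> sf; apply: decay_wid => [|K]; last exact: fourier_decay.
have -> : fourier f = fun xi => synth f (- xi) by apply/funext => xi; exact: fourier_synth.
by apply: (cmeas_comp (cmeas_wv (schwartz_wid sf))); exact: measurable_rVN.
Qed.

End schwartz_decay.

(** * Fourier inversion and the transform of a product *)

Section inversion.
Context {R : realType} {n : nat}.
Context (n_gt0 : (0 < n)%N).
Local Notation X := 'rV[R]_n.
Local Notation mu := (lebesgue_rV R n).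
Local Notation mu2 := (prodm mu mu).
Implicit Types (f g : X -> R[i]) (x y xi : X).

Lemma cint_rV_shift (c : X) (F : X -> R[i]) : cmeas F -> cint mu (fun x => F (x + c)) = cint mu F.
Proof.
move=> mF; have mH : cmeas (fun x => F (x + c)).
  by apply: (cmeas_comp mF); exact: measurable_rVD.
rewrite -(cint_rV_flip 0 mH) -(cint_rV_flip c mF).
by apply: eq_cint => x; rewrite sub0r addrC.
Qed.

Lemma gx_gk (a : R) y : 0 < a -> gx a y = Num.sqrt (pi / a) ^+ n * gk (pi ^+ 2 / a) y.
Proof.
move=> a0; have p0 : 0 < pi :> R by exact: pi_gt0.
rewrite /gk (_ : pi ^+ 2 / (pi ^+ 2 / a) = a); last first.
  by rewrite invf_div mulrCA mulfV ?mulr1// expf_neq0// gt_eqF.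
by rewrite mulrA gk_cstM// mul1r.
Qed.

Lemma gx_cis (a : R) (th : R) xi : 0 < a ->
  cint mu (fun y => (gx a y)%:C * cis (th - 2 * pi * dotprod y xi)) = (gk a xi)%:C * cis th.
Proof.
move=> a0; have p0 : 0 < pi :> R by exact: pi_gt0.
have pa0 : 0 < pi ^+ 2 / a by rewrite divr_gt0// exprn_gt0.
have ci := hk_cis_int (n := n) 0 th xi pa0; have := hk_fourier (n := n) 0 th xi pa0.
rewrite /lap add0r => h.
transitivity (cint mu (fun y => (Num.sqrt (pi / a) ^+ n)%:C * ((hk 0 (pi ^+ 2 / a) y)%:C * cis (th - 2 * pi * dotprod y xi)))).
  apply: eq_cint => y; rewrite gx_gk// rmorphM -[LHS]mulrA; congr (_ * (_%:C * _)).
  by rewrite /hk mul0r oppr0 expR0 mul1r.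
by rewrite cintZ// h mulrA -rmorphM.
Qed.

Lemma gx_int (a : R) : 0 < a -> cintegrable mu (fun y => (gx a y)%:C).
Proof.
move=> a0; have p0 : 0 < pi :> R by exact: pi_gt0.
have pa0 : 0 < pi ^+ 2 / a by rewrite divr_gt0// exprn_gt0.
have := cintegrableZ (Num.sqrt (pi / a) ^+ n)%:C (hk_int (n := n) 0 pa0).
rewrite (_ : (fun x => _) = (fun y => (gx a y)%:C))//; apply/funext => y.
by rewrite gx_gk// [in RHS]rmorphM /hk mul0r oppr0 expR0 mul1r.
Qed.

(** [wv_kernel] with space and frequency exchanged: the translate of [f] is the density, the
    Gaussian [gx a] the kernel, and the wave is evaluated at 0. *)
Lemma gauss_inversion (a : R) f x : 0 < a -> schwartz f ->
  synth (fun xi => (expR (- (a * lap 0 xi)))%:C * fourier f xi) x = cint mu (fun y => (gk a y)%:C * f (y + x)).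
Proof.
move=> a0 sf; have wf := schwartz_wid n_gt0 sf; have wc := schwartz_shift_wid n_gt0 x sf.
have := wv_kernel (gx_int a0) (fun th xi => gx_cis th xi a0) 0 wc.
have -> : wv mu (fun xi => xi) (fun w => (gk a w)%:C * f (w + x)) 0 = cint mu (fun y => (gk a y)%:C * f (y + x)).
  apply: eq_cint => w; rewrite /dotprod big1 ?mulr0 ?cis0 ?mulr1// => i _.
  by rewrite mxE mul0r.
move=> ->; apply: eq_cint => xi; rewrite sub0r.
have := synth_shift (- xi) x wf; rewrite /synth => ->.
rewrite dotprodNl mulrN opprK fourier_synth /synth -mulrA (mulrC (wv _ _ _ _)) /gx /lap add0r.
by rewrite (dotprodC x).
Qed.

Lemma wv_heat_diff d (T : measurableType d) (rho : {sigma_finite_measure set T -> \bar R}) (Z : T -> X) phi x :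
  wave rho Z phi -> exists2 C : R, 0 <= C & forall a, 0 < a ->
  normc (wv rho Z phi x - wv rho Z (fun w => (expR (- (a * lap 0 (Z w))))%:C * phi w) x) <= a * C.
Proof.
move=> wp; have wl := waveM (symbol_lap (n := n) (lexx 0)) wp.
have [_ foo] := wave_int wl; have [mZ mphi _] := wp.
set I := (\int[rho]_w _)%E in foo.
have mI : measurable_fun [set: T] (fun w => normc ((lap 0 (Z w))%:C * phi w)).
  by apply: measurable_normc; case: wl.
have I0 : (0 <= I)%E by apply: integralr_ge0 => w; exact: normc_ge0.
have If : (I = (fine I)%:E)%E by rewrite fineK// ge0_fin_numE.
exists (fine I) => [|a a0]; first exact: fine_ge0.
have i1 := wave_cis_int x wp; have i2 := wave_cis_int x (waveM (symbol_heat (n := n) (lexx 0) (ltW a0)) wp).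
rewrite /wv -cintB// -lee_fin; apply: le_trans (normc_cint (cintegrableB i1 i2)) _.
rewrite EFinM -If /I -ge0_integralrZl ?(ltW a0)//; last by move=> w; exact: normc_ge0.
apply: ge0_le_integralr.
- apply: measurable_normc; exact: (cintegrableB i1 i2).1.
- exact: measurable_funM.
- by move=> w; exact: normc_ge0.
move=> w; rewrite -mulrBl normcM normc_cis mulr1 -[X in normc (X - _)]mul1r -mulrBl [leLHS]normcM [in leRHS]normcM mulrA.
apply: ler_wpM2r; first exact: normc_ge0.
rewrite -[1]/((1 : R)%:C) -rmorphB !normc_real (ger0_norm (lap_ge0 _ (lexx 0))).
have l0 : 0 <= a * lap 0 (Z w) by rewrite mulr_ge0 ?lap_ge0// ltW.
rewrite ger0_norm ?subr_ge0 -?[leRHS]expR0 ?ler_expR ?oppr_le0//.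
by have := expR_ge1Dx (- (a * lap 0 (Z w))); lra.
Qed.

Lemma gauss_approx f x : schwartz f -> exists2 C : R, 0 <= C & forall r, 0 < r ->
  normc (cint mu (fun y => (gk (r ^+ 2) y)%:C * f (y + x)) - f x) <= r * C.
Proof.
move=> sf; have [B B0 HB] := partials_decay n_gt0 0 sf.
have [M M0 HM] := gk_moment_int (n := n) (@ler01 R).
exists (2 * n%:R * B * M) => [|r r0]; first by rewrite !mulr_ge0// ltW.
have r20 : 0 < r ^+ 2 by rewrite exprn_gt0.
have gi : cintegrable mu (fun y => (gk (r ^+ 2) y)%:C).
  have := hk_int (n := n) 0 r20; rewrite (_ : (fun y => _) = (fun y => (gk (r ^+ 2) y)%:C))//.
  by apply/funext => y; rewrite /hk mul0r oppr0 expR0 mul1r.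
have g1 : cint mu (fun y => (gk (r ^+ 2) y)%:C) = 1.
  by apply: complex_eqP => /=; rewrite /Rintegral ?integral_gk//= integral0.
have mf := schwartz_cmeas sf.
have mfx : cmeas (fun y => f (y + x)) by apply: (cmeas_comp mf); exact: measurable_rVD.
have [j jE] : exists j, forall y, normc (f y) <= j.
  by have [C C0 HC] := schwartz_decay n_gt0 0 sf; exists C => y; have := HC y; rewrite expr0 mul1r.
have j0 : 0 <= j by apply: le_trans (jE 0); exact: normc_ge0.
have fi : cintegrable mu (fun y => (gk (r ^+ 2) y)%:C * f (y + x)).
  have [mg goo] := gi; apply: (cintegrable_le (u := fun y => j * normc (gk (r ^+ 2) y)%:C)).
  - exact: cmeasM.
  - by apply: measurable_funM => //; exact: measurable_normc.
  - by move=> y; rewrite normcM mulrC; apply: ler_wpM2r; [exact: normc_ge0|exact: jE].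
  rewrite ge0_integralrZl//; [|exact: measurable_normc|by move=> y; exact: normc_ge0].
  by rewrite lte_mul_pinfty.
rewrite -[X in _ - X]mulr1 -g1 -cintZ// -cintB//; last exact: cintegrableZ.
rewrite -lee_fin; apply: le_trans (normc_cint _) _.
  by apply: cintegrableB => //; exact: cintegrableZ.
have mk : measurable_fun [set: X] (fun y => gk (1 * r ^+ 2) y * (1 + `|y| / r) `^ 1).
  apply: measurable_funM; first exact: measurable_gk.
  apply: (measurableT_comp (f := @powR R ^~ 1)); first exact: measurable_powR.
  by apply: measurable_funD => //; apply: measurable_funM => //; exact: measurable_rV_norm.
apply: (@le_trans _ _ (\int[mu]_y (r * (2 * n%:R * B) * (gk (1 * r ^+ 2) y * (1 + `|y| / r) `^ 1))%:E)%E).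
  apply: ge0_le_integralr.
  - apply: measurable_normc; apply: cmeasB; first exact: (cmeasM gi.1 mfx).
    exact: (cmeasM (cmeas_cst (f x)) gi.1).
  - exact: measurable_funM.
  - by move=> y; exact: normc_ge0.
  move=> y; rewrite [f x * _]mulrC -mulrBr normcM normc_real ger0_norm ?gk_ge0// mul1r.
  have o0 : 0 <= 1 + `|y| / r by rewrite addr_ge0// divr_ge0// ltW.
  rewrite powRr1// mulrCA; apply: ler_wpM2l; first exact: gk_ge0.
  rewrite (addrC y x); apply: (@le_trans _ _ (2 * n%:R * `|y| * B)).
    by apply: increment_le => // i c _; have := HB i (x + c *: y); rewrite expr0 mul1r.
  rewrite [leRHS](_ : _ = 2 * n%:R * B * (r + `|y|)); last by field; rewrite gt_eqF.
  rewrite [leLHS](_ : _ = 2 * n%:R * B * `|y|); last by ring.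
  by apply: ler_wpM2l; [rewrite !mulr_ge0|rewrite lerDr ltW].
rewrite ge0_integralrZl//; last 2 first.
- by rewrite !mulr_ge0// ltW.
- by move=> y; rewrite mulr_ge0 ?gk_ge0// powR_ge0.
rewrite [r * _]mulrA -[leRHS]/((r * (2 * n%:R * B * M))%:E) [r * (2 * n%:R * B * M)]mulrA [leRHS]EFinM.
rewrite -mulrA; apply: lee_wpmul2l; first by rewrite lee_fin !mulr_ge0// ltW.
by apply: HM => //; rewrite lexx andbT invf_le1// ler1n.
Qed.

Lemma small_normc_eq (z w : R[i]) (C : R) : 0 <= C -> (forall r, 0 < r <= 1 -> normc (z - w) <= r * C) -> z = w.
Proof.
move=> C0 h; apply/eqP; rewrite -subr_eq0; apply/eqP; apply: eq0_normc; apply/eqP.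
rewrite eq_le normc_ge0 andbT; apply/ler_addgt0Pl => e e0; rewrite addr0.
pose r := Num.min 1 (e / (C + 1)).
have C1 : 0 < C + 1 by rewrite ltr_wpDl.
have r0 : 0 < r by rewrite lt_min ltr01 divr_gt0.
have [r1 re] : r <= 1 /\ r <= e / (C + 1) by rewrite !ge_min !lexx !orbT.
apply: (@le_trans _ _ (r * C)); first by apply: h; rewrite r0.
move: re; rewrite ler_pdivlMr// mulrDr mulr1; move: r0; lra.
Qed.

(** Both sides are within [O(r)] of the Gaussian mean of [f] at scale [r], for every [r] in []0,
    1]]. *)
Lemma fourier_inversion f x : schwartz f -> synth (fourier f) x = f x.
Proof.
move=> sf; have [C1 C10 H1] := wv_heat_diff x (fourier_wid n_gt0 sf).
have [C2 C20 H2] := gauss_approx x sf.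
apply: (small_normc_eq (addr_ge0 C10 C20)) => r /andP[r0 r1].
have r20 : 0 < r ^+ 2 by rewrite exprn_gt0.
have := H1 _ r20; rewrite -/(synth _ _) -/(synth _ _) gauss_inversion// => h1.
have h2 := H2 _ r0.
set G := cint mu _ in h1 h2.
have := normcD_le (synth (fourier f) x - G) (G - f x); rewrite subrKA => /le_trans; apply.
apply: (le_trans (lerD h1 h2)); rewrite mulrDr lerD2r; apply: ler_wpM2r => //.
by rewrite expr2 ler_piMr// ltW.
Qed.

Lemma riesz_synth s f x : riesz s f x = synth (fun xi => (lap 0 xi `^ (s / 2))%:C * fourier f xi) x.
Proof.
apply: eq_cint => xi; rewrite (dotprodC xi x); congr (_%:C * _ * _).
rewrite /enorm /lap add0r -powR12_sqrt ?dotprod_ge0// -powRrM.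
by congr (_ `^ _); rewrite mulrC.
Qed.

Lemma bessel_synth s f x : bessel s f x = synth (fun xi => (lap 1 xi `^ (s / 2))%:C * fourier f xi) x.
Proof.
apply: eq_cint => xi; rewrite (dotprodC xi x); congr (_%:C * _ * _).
by rewrite /enorm /lap sqr_sqrtr ?dotprod_ge0.
Qed.

(** Inversion is applied to [g] and the integrals are exchanged. *)
Lemma fourier_mul f g zeta : schwartz f -> schwartz g ->
  fourier (fun x => f x * g x) zeta = cint mu (fun eta => fourier g eta * fourier f (zeta - eta)).
Proof.
move=> sf sg; have wf := schwartz_wid n_gt0 sf; have wg := fourier_wid n_gt0 sg.
rewrite fourier_synth /synth {1}/wv.
pose F (z : X * X) := (f z.1 * cis (2 * pi * dotprod (- zeta) z.1)) * (fourier g z.2 * cis (2 * pi * dotprod z.1 z.2)).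
have mF : cmeas F.
  apply: cmeasM; first exact: (cmeas_comp (wave_cis_int (- zeta) wf).1 measurable_fst).
  apply: cmeasM; first exact: (cmeas_comp (wid_meas wg) measurable_snd).
  by apply: cmeas_cis; apply: measurable_funM => //; exact: measurable_dotprod.
have iF : cintegrable (mu \x mu)%E F.
  apply: (cintegrable_tensor (wave_cis_int (- zeta) wf) (wave_int wg) mF) => z.
  by rewrite normcM [X in _ * X]normcM normc_cis mulr1.
transitivity (cint mu (fun x => cint mu (fun eta => F (x, eta)))).
  apply: eq_cint => x; rewrite /F/= cintZ; last exact: (wave_cis_int x wg).
  by rewrite -(fourier_inversion x sg) mulrAC.
rewrite (cint_fubini iF); apply: eq_cint => eta.
rewrite (fourier_synth f) /synth /wv -cintZ; last exact: (wave_cis_int (- (zeta - eta)) wf).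
apply: eq_cint => x; rewrite /F/= mulrCA -!mulrA; congr (_ * (_ * _)).
rewrite -cisD; congr cis.
by rewrite opprB dotprodBl dotprodNl (dotprodC x); ring.
Qed.

(** The shear [(zeta, eta) -> (zeta - eta, eta)] preserves measure and turns the convolution of the
    transforms into an integral over independent frequencies. *)
Lemma multiplier_mul (m : X -> R) f g x : symbol m -> schwartz f -> schwartz g ->
  synth (fun xi => (m xi)%:C * fourier (fun x => f x * g x) xi) x =
  wv mu2 (fun z => z.1 + z.2) (fun z => (m (z.1 + z.2))%:C * (fourier f z.1 * fourier g z.2)) x.
Proof.
move=> sm sf sg; have wf := fourier_wid n_gt0 sf; have wg := fourier_wid n_gt0 sg.
pose H (z : X * X) := (m (z.1 + z.2))%:C * (fourier f z.1 * fourier g z.2) * cis (2 * pi * dotprod x (z.1 + z.2)).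
have iH : cintegrable mu2 H := wave_cis_int x (waveM sm (wave_pair wf wg)).
have [mH Hoo] := iH.
have mG : cmeas (fun z : X * X => H (z.1 - z.2, z.2)).
  apply: (cmeas_comp mH); apply/measurable_fun_pair => //; exact: measurable_rVB.
have mHy eta : cmeas (fun xi => H (xi, eta)) by exact: (cmeas_comp mH (measurable_pair2 eta)).
have iG : cintegrable (mu \x mu)%E (fun z : X * X => H (z.1 - z.2, z.2)).
  split=> //; rewrite fubini_tonelli2//; last 2 first.
  - by apply/measurable_EFinP; exact: measurable_normc.
  - by move=> z; rewrite lee_fin normc_ge0.
  have mN : measurable_fun [set: X * X] (fun z => (normc (H z))%:E).
    by apply/measurable_EFinP; exact: measurable_normc.
  have N0 z : (0 <= (normc (H z))%:E)%E by rewrite lee_fin normc_ge0.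
  have Hoo' : (\int[mu \x mu]_z (normc (H z))%:E < +oo)%E by exact: Hoo.
  rewrite (fubini_tonelli2 (m1 := mu) (m2 := mu) _ mN N0) in Hoo'.
  apply: le_lt_trans Hoo'; rewrite le_eqVlt; apply/orP; left; apply/eqP.
  apply: eq_integral => eta _; rewrite /fubini_G/=.
  apply: (ge0_integral_rV_shift (- eta) (F := fun xi => (normc (H (xi, eta)))%:E)).
    by apply/measurable_EFinP; exact: measurable_normc.
  by move=> xi; rewrite lee_fin normc_ge0.
transitivity (cint mu (fun zeta => cint mu (fun eta => H (zeta - eta, eta)))).
  apply: eq_cint => zeta; rewrite fourier_mul//.
  have iE : cintegrable mu (fun eta => fourier g eta * fourier f (zeta - eta)).
    have [j jE] := wv_bounded (schwartz_wid n_gt0 sf).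
    have [mg goo] := wave_int wg.
    have j0 : 0 <= j by apply: le_trans (jE 0); exact: normc_ge0.
    apply: (cintegrable_le (u := fun eta => j * normc (fourier g eta))).
    - by apply: cmeasM => //; apply: (cmeas_comp (wid_meas wf)); exact: measurable_rVB.
    - by apply: measurable_funM => //; exact: measurable_normc.
    - move=> eta; rewrite normcM mulrC; apply: ler_wpM2r; first exact: normc_ge0.
      by rewrite fourier_synth; exact: jE.
    rewrite ge0_integralrZl//; [|exact: measurable_normc|by move=> y; exact: normc_ge0].
    by rewrite lte_mul_pinfty.
  rewrite mulrAC -cintZ//; apply: eq_cint => eta; rewrite /H/= subrK.
  by rewrite (mulrC (fourier g eta)) mulrAC.
rewrite (cint_fubini iG) /wv (cint_fubini2 iH); apply: eq_cint => eta /=.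
exact: (cint_rV_shift (- eta) (mHy eta)).
Qed.

End inversion.

(** * Norm estimates *)

Section strong_maximal.
Context {R : realType} {n : nat}.
Local Notation X := 'rV[R]_n.
Local Notation mu := (lebesgue_rV R n).
Local Notation leb := (@lebesgue_measure R).
Implicit Types (x y : X) (psi : X -> R).

Lemma HL_le_add psi psi1 (c : R) x : measurable_fun [set: X] psi1 -> measurable_fun [set: X] psi ->
  (forall x, 0 <= psi x) -> (forall x, 0 <= psi1 x) ->
  0 <= c -> (forall y, psi y <= c + psi1 y) -> (HL psi x <= c%:E + HL psi1 x)%E.
Proof.
move=> m1 m0 p0 p10 c0 le; apply: ge_ereal_sup => _ [k _ <-].
have [kx|kx] := boolP (x \in @hlcube R n k); last first.
  rewrite indicE (negbTE kx) mule0; apply: adde_ge0; first by rewrite lee_fin.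
  exact: HL_ge0.
rewrite indicE kx mule1.
have q0 : 0 < (2 * (@hlp R n k).2) ^+ n by rewrite exprn_gt0// mulr_gt0// hlp_gt0.
have mk : measurable (@hlcube R n k) by exact: measurable_cube.
apply: (@le_trans _ _ (c%:E + hlavg psi1 k)%E); last first.
  apply: leeD => //; apply: ereal_sup_ubound; exists k => //.
  by rewrite indicE kx mule1.
have mS (u : X -> R) : measurable_fun [set: X] u -> measurable_fun (@hlcube R n k) (fun y => (u y)%:E).
  by move=> mu_; apply/measurable_EFinP; exact: measurable_funS mu_.
have ce : c%:E = (((2 * (@hlp R n k).2) ^+ n)^-1%:E * ((2 * (@hlp R n k).2) ^+ n * c)%:E)%E.
  by rewrite -EFinM mulKf// gt_eqF.
rewrite /hlavg ce.
rewrite -ge0_muleDr; last 2 first.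
- by rewrite lee_fin mulr_ge0// ltW.
- by apply: integral_ge0 => y _; rewrite lee_fin.
apply: lee_wpmul2l; first by rewrite lee_fin invr_ge0 ltW.
rewrite EFinM -(lebesgue_cube (@hlp R n k).1 (hlp_gt0 k)) muleC -integral_cst// -ge0_integralD//; last 2 first.
- by move=> y _; rewrite lee_fin.
- exact: mS.
apply: ge0_le_integral => //.
- by move=> y _; rewrite lee_fin.
- exact: mS.
- by apply: emeasurable_funD => //; exact: mS.
by move=> y _; rewrite -EFinD lee_fin.
Qed.

Lemma measurable_bool_natr d (T : measurableType d) (b : T -> bool) : measurable_fun [set: T] b ->
  measurable_fun [set: T] (fun t => (b t)%:R : R).
Proof. by move=> mb; apply: (measurableT_comp (f := fun b : bool => b%:R : R)). Qed.

(** The layer-cake formula in the logarithmic variable; the integrand is a multiple of an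
    exponential density reflected about [ln t]. *)
Lemma layer (c t : R) : 0 < c -> 0 <= t ->
  (\int[leb]_v (expR (c * v) * (expR v <= t)%R%:R)%:E = (t `^ c / c)%:E)%E.
Proof.
move=> c0; rewrite le_eqVlt => /orP[/eqP <-|t0].
  rewrite powR0 ?gt_eqF// mul0r; apply: integral0_eq => v _.
  by rewrite leNgt expR_gt0 mulr0.
have me := @measurable_exponential_pdf R c.
transitivity (\int[leb]_v (t `^ c / c * exponential_pdf c (ln t - v))%:E)%E.
  apply: eq_integral => v _; congr EFin.
  have -> : (expR v <= t) = (0 <= ln t - v) by rewrite -[t in LHS]lnK ?posrE// ler_expR subr_ge0.
  have [h|h] := leP 0 (ln t - v); last by rewrite lt0_exponential_pdf// !mulr0.
  rewrite exponential_pdfE// mulr1 mulrA mulfVK ?gt_eqF// /powR gt_eqF// -expRD; congr expR; ring.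
rewrite ge0_integralrZl; last 3 first.
- by rewrite divr_ge0 ?powR_ge0// ltW.
- by apply: measurableT_comp me _; exact: measurable_funB.
- by move=> v; apply: exponential_pdf_ge0; exact: ltW.
rewrite (ge0_integral_flip (ln t) (f := fun v => (exponential_pdf c v)%:E)).
- by rewrite integral_exponential_pdf// mule1.
- exact/measurable_EFinP.
- by move=> v; rewrite lee_fin; apply: exponential_pdf_ge0; exact: ltW.
Qed.

(** The part of [psi] below [e^v / 4] raises the maximal function by at most [e^v / 4], so the weak
    type bound is needed only for the part above. *)
Lemma HL_level psi (v : R) : measurable_fun [set: X] psi -> (forall x, 0 <= psi x) ->
  ((mu [set x | (expR v)%:E <= HL psi x]) <=
   (4 * 3 ^+ n * expR (- v))%:E * \int[mu]_x (psi x * (expR v <= 4 * psi x)%R%:R)%:E)%E.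
Proof.
move=> mpsi p0; have e0 : 0 < expR v / 4 by rewrite divr_gt0 ?expR_gt0.
pose psi1 y := psi y * (expR v <= 4 * psi y)%R%:R.
have m1 : measurable_fun [set: X] psi1.
  apply: measurable_funM => //; apply: measurable_bool_natr.
  by apply: measurable_fun_ler => //; exact: measurable_funM.
have p10 y : 0 <= psi1 y by rewrite mulr_ge0.
have h y : psi y <= expR v / 4 + psi1 y.
  rewrite /psi1; have [hy|hy] := leP (expR v) (4 * psi y); first by rewrite mulr1 lerDr ltW.
  by rewrite mulr0 addr0; lra.
have := HL_weak11 m1 p10 e0.
rewrite -lee_pdivlMl// -/psi1.
rewrite muleA -EFinM (_ : (expR v / 4)^-1 * 3 ^+ n = 4 * 3 ^+ n * expR (- v)); last first.
  by rewrite expRN; field; rewrite gt_eqF// expR_gt0.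
apply: le_trans; apply: le_measure; rewrite ?inE.
- rewrite -[X in measurable X]setTI; apply: emeasurable_fun_c_infty => //; exact: measurable_HL.
- rewrite -[X in measurable X]setTI; apply: emeasurable_fun_o_infty => //; exact: measurable_HL.
move=> x /= hx; have := le_trans hx (HL_le_add x m1 mpsi p0 p10 (ltW e0) h).
rewrite -leeBlDl//; apply: lt_le_trans.
by rewrite -EFinB lte_fin; have := expR_gt0 v; lra.
Qed.

(** Marcinkiewicz interpolation: [HL_level] is integrated over all levels by means of [layer].
    Boundedness of [psi] keeps [HL psi] finite, so that [fine] does not send an infinite value to
    0. *)
Lemma HL_strong (q : R) : 1 < q -> exists2 C : R, 0 < C & forall psi (B : R), measurable_fun [set: X] psi ->
  (forall x, 0 <= psi x) -> (forall x, psi x <= B) ->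
  (\int[mu]_x ((fine (HL psi x)) `^ q)%:E <= C%:E * \int[mu]_x (psi x `^ q)%:E)%E.
Proof.
move=> q1; have q0 : 0 < q by lra. have q10 : 0 < q - 1 by lra.
exists (q * (4 * 3 ^+ n) * (4 `^ (q - 1) / (q - 1))) => [|psi B mpsi p0 pB].
  by rewrite !(mulr_gt0, divr_gt0, invr_gt0, exprn_gt0, powR_gt0).
have B0 : 0 <= B by apply: le_trans (pB 0).
pose M x := fine (HL psi x).
have Hfin x : HL psi x = (M x)%:E.
  rewrite /M fineK// ge0_fin_numE ?HL_ge0//.
  apply: le_lt_trans (ltry B); apply: HL_le_cst => //.
  exact/nearW.
have M0 x : 0 <= M x by apply: fine_ge0; exact: HL_ge0.
have mM : measurable_fun [set: X] M.
  by apply: measurableT_comp (measurable_HL p0) => //.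
pose chi (z : X * measurableTypeR R) : R := (expR z.2 <= M z.1)%R%:R.
pose chi' (z : X * measurableTypeR R) : R := (expR z.2 <= 4 * psi z.1)%R%:R.
have mexp (c : R) : measurable_fun [set: (X * measurableTypeR R)%type] (fun z : X * measurableTypeR R => expR (c * z.2)).
  by apply: (measurableT_comp (f := @expR R)) => //; apply: measurable_funM => //; exact: measurable_snd.
have mexp1 : measurable_fun [set: (X * measurableTypeR R)%type] (fun z : X * measurableTypeR R => expR z.2).
  by apply: (measurableT_comp (f := @expR R)) => //; exact: measurable_snd.
have mchi : measurable_fun [set: (X * measurableTypeR R)%type] chi.
  apply: measurable_bool_natr; apply: measurable_fun_ler => //.
  exact: (measurableT_comp mM measurable_fst).
have mchi' : measurable_fun [set: (X * measurableTypeR R)%type] chi'.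
  apply: measurable_bool_natr; apply: measurable_fun_ler => //.
  by apply: measurable_funM => //; exact: (measurableT_comp mpsi measurable_fst).
have ch0 z : 0 <= chi z by [].
have ch0' z : 0 <= chi' z by [].
pose K := q * (4 * 3 ^+ n).
have K0 : 0 < K by rewrite !mulr_gt0// exprn_gt0.
have mF1 : measurable_fun [set: (X * measurableTypeR R)%type] (fun z : X * measurableTypeR R => (q * (expR (q * z.2) * chi z))%:E).
  by apply/measurable_EFinP; apply: measurable_funM => //; apply: measurable_funM.
have mF2 : measurable_fun [set: (X * measurableTypeR R)%type] (fun z : X * measurableTypeR R => (K * psi z.1 * (expR ((q - 1) * z.2) * chi' z))%:E).
  apply/measurable_EFinP; apply: measurable_funM; last exact: measurable_funM.
  by apply: measurable_funM => //; exact: (measurableT_comp mpsi measurable_fst).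
have F10 z : (0 <= (q * (expR (q * z.2) * chi z))%:E)%E by rewrite lee_fin !mulr_ge0 ?expR_ge0// ltW.
have F20 z : (0 <= (K * psi z.1 * (expR ((q - 1) * z.2) * chi' z))%:E)%E.
  by rewrite lee_fin !mulr_ge0 ?expR_ge0// ltW.
have mlay (c t : R) : measurable_fun [set: R] (fun v : R => expR (c * v) * (expR v <= t)%R%:R).
  apply: measurable_funM.
    by apply: (measurableT_comp (f := @expR R)) => //; apply: measurable_funM.
  by apply: measurable_bool_natr; apply: measurable_fun_ler => //.
have lay0 (c t v : R) : 0 <= expR (c * v) * (expR v <= t)%R%:R by rewrite mulr_ge0 ?expR_ge0.
have -> : (\int[mu]_x ((fine (HL psi x)) `^ q)%:E = \int[mu]_x \int[leb]_v (q * (expR (q * v) * chi (x, v)))%:E)%E.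
  apply: eq_integral => x _; rewrite ge0_integralrZl ?(ltW q0)//; [|exact: (mlay q (M x))|exact: (lay0 q (M x))].
  rewrite [X in (_ * X)%E](layer q0 (M0 x)).
  by rewrite -EFinM -/(M x) mulrCA mulfV ?mulr1// gt_eqF.
rewrite (fubini_tonelli (m1 := mu) (m2 := leb) _ mF1 F10)/=.
apply: (@le_trans _ _ (\int[leb]_v \int[mu]_x (K * psi x * (expR ((q - 1) * v) * chi' (x, v)))%:E)%E).
  apply: ge0_le_integral => //.
  - by move=> v _; apply: integral_ge0 => x _; exact: (F10 (x, v)).
  - exact: (measurable_fun_fubini_tonelli_G (m1 := mu) _ mF1 F10).
  - exact: (measurable_fun_fubini_tonelli_G (m1 := mu) _ mF2 F20).
  move=> v _; have mA : measurable [set x | ((expR v)%:E <= HL psi x)%E].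
    by rewrite -[X in measurable X]setTI; apply: emeasurable_fun_c_infty => //; exact: measurable_HL.
  have E1 x : (q * (expR (q * v) * chi (x, v)))%:E = ((q * expR (q * v)) * \1_[set x | ((expR v)%:E <= HL psi x)%E] x)%:E.
    rewrite mulrA /chi/= indicE; congr (_ * _)%:E; congr (_%:R); congr nat_of_bool.
    apply/idP/idP => [h|]; first by rewrite inE/= Hfin lee_fin.
    by rewrite inE/= Hfin lee_fin.
  under eq_integral do rewrite E1.
  have qe0 : 0 <= q * expR (q * v) by rewrite mulr_ge0 ?expR_ge0// ltW.
  rewrite ge0_integralrZl//.
  rewrite integral_indic// setIT.
  apply: (le_trans (lee_wpmul2l _ (HL_level v mpsi p0))); first by rewrite lee_fin.
  rewrite muleA -EFinM -ge0_integralrZl; last 3 first.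
  - by rewrite !mulr_ge0 ?expR_ge0// ?exprn_ge0// ltW.
  - apply: measurable_funM => //; apply: measurable_bool_natr.
    by apply: measurable_fun_ler => //; exact: measurable_funM.
  - by move=> x; rewrite mulr_ge0.
  rewrite le_eqVlt; apply/orP; left; apply/eqP; apply: eq_integral => x _; congr EFin.
  have -> : expR ((q - 1) * v) = expR (q * v) * expR (- v) by rewrite -expRD; congr expR; ring.
  by rewrite /chi' /K/=; ring.
rewrite -(fubini_tonelli (m1 := mu) (m2 := leb) _ mF2 F20)/=.
rewrite -ge0_integralrZl; last 3 first.
- exact: mulr_ge0 (ltW K0) (divr_ge0 (powR_ge0 _ _) (ltW q10)).
- by apply: (measurableT_comp (f := @powR R ^~ q)) => //; exact: measurable_powR.
- by move=> x; exact: powR_ge0.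
rewrite le_eqVlt; apply/orP; left; apply/eqP; apply: eq_integral => x _.
rewrite ge0_integralrZl; [|by rewrite mulr_ge0// ltW|exact: (mlay (q - 1) (4 * psi x))|exact: (lay0 (q - 1) (4 * psi x))].
have p40 : 0 <= 4 * psi x by rewrite mulr_ge0.
rewrite [X in (_ * X)%E](layer q10 p40).
rewrite -EFinM; congr EFin; rewrite powRM// /K.
have -> : psi x `^ q = psi x * psi x `^ (q - 1).
  have [->|h] := eqVneq (psi x) 0; first by rewrite powR0 ?gt_eqF// mul0r.
  rewrite -[X in X * _ `^ _](powRr1 (p0 x)) -powRD ?h ?implybT//; congr (_ `^ _); ring.
ring.
Qed.

End strong_maximal.

(** * From norms to pointwise control *)

Section gauges.
Context {R : realType} {n : nat}.
Local Notation X := 'rV[R]_n.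
Local Notation mu := (lebesgue_rV R n).
Local Notation mu2 := (prodm mu mu).
Local Notation NN := (n%:R + 1 : R).
Implicit Types (x y v xi : X) (al be : X -> R[i]).

Lemma le_lim0 (a b c : R) : 0 <= c -> (forall r, 0 < r -> a <= b + r * c) -> a <= b.
Proof.
move=> c0 h; apply/ler_addgt0Pr => e e0.
have c1 : 0 < c + 1 by rewrite ltr_wpDl.
apply: (le_trans (h (e / (c + 1)) (divr_gt0 e0 c1))); rewrite lerD2l.
by rewrite mulrAC ler_pdivrMr// mulrDr mulr1 lerDl ltW.
Qed.

(** Gaussian means around [x] are bounded by the maximal function, and they converge to the value at
    [x] because the density has finite moments; this takes the place of Lebesgue's differentiation
    theorem. *)
Lemma controlled_le : exists2 C : R, 0 < C & forall x al p K, controlled x al p K -> normc (synth al x) <= C * K.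
Proof.
have N0 : 0 <= NN by rewrite addr_ge0.
have b01 : 0 < (1 : R) <= 1 by rewrite ltr01 lexx.
have [C1 C10 H1] := tame_average (n := n) b01.
have [C2 C20 H2] := jensen_average (R := R) (n := n).
have [C3 C30 H3] := gk_le_wgt (n := n) N0.
exists (C3 * C2 * (1 + C1)) => [|x al p K [wa p1 K0 hK]]; first by rewrite !mulr_gt0// addr_gt0.
have ms := measurable_synth wa.
have [D D0 HD] := wv_heat_diff x wa.
apply: (le_lim0 D0) => r r0.
pose q := Num.sqrt r; have q0 : 0 < q by rewrite sqrtr_gt0.
have qE : q ^+ 2 = r by rewrite sqr_sqrtr// ltW.
have mp : measurable_fun [set: X] (fun y => normc (synth al y) `^ p).
  by apply: (measurableT_comp (f := @powR R ^~ p)); [exact: measurable_powR|exact: ms].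
have Kp : 0 < K `^ p by rewrite powR_gt0.
have [u [_ u0 ug _ _] hu] := H1 q q x _ _ q0 (lexx q) mp (fun y => powR_ge0 _ _) Kp hK.
have ux : u x <= C1 by have := ug x; rewrite subrr normr0 mul0r addr0 expr1n mulr1.
have J := H2 q (fun y => normc (synth al y)) p K (u x) x q0 ms (fun y => normc_ge0 _) p1 K0 (u0 x) (hu x).
have mw : measurable_fun [set: X] (fun y => wgt q NN (x - y) * normc (synth al y)).
  by apply: measurable_funM => //; apply: measurable_wgt; exact: measurable_rVB.
have B : normc (synth (fun xi => (expR (- (r * lap 0 xi)))%:C * al xi) x) <= C3 * C2 * (1 + C1) * K.
  rewrite -lee_fin; apply: le_trans (FB_heat 0 r0 x wa) _.
  apply: (@le_trans _ _ (\int[mu]_y (C3 * (wgt q NN (x - y) * normc (synth al y)))%:E)%E).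
    apply: ge0_le_integralr.
    - apply: measurable_funM => //; apply: (measurableT_comp (f := hk 0 r)); first exact: measurable_hk.
      exact: measurable_rVB.
    - exact: measurable_funM.
    - by move=> y; rewrite mulr_ge0 ?normc_ge0// hk_ge0.
    move=> y; rewrite mulrA; apply: ler_wpM2r; first exact: normc_ge0.
    by rewrite /hk mul0r oppr0 expR0 mul1r -qE; exact: H3.
  rewrite ge0_integralrZl ?(ltW C30)//; last by move=> y; rewrite mulr_ge0 ?normc_ge0// wgt_ge0.
  apply: (le_trans (lee_wpmul2l _ J)); first by rewrite lee_fin ltW.
  rewrite -EFinM lee_fin -!mulrA; apply: ler_wpM2l; first exact: ltW.
  apply: ler_wpM2l; first exact: ltW.
  rewrite mulrC; apply: ler_wpM2r; first exact: ltW.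
  apply: (@le_trans _ _ (1 + u x)); last by rewrite lerD2l.
  have u1 : 1 <= 1 + u x by rewrite lerDl.
  rewrite -[leRHS]powRr1 ?(le_trans ler01)//; apply: ler_powR => //.
  by rewrite invf_le1// (lt_le_trans ltr01).
have := normcD_le (synth al x - synth (fun xi => (expR (- (r * lap 0 xi)))%:C * al xi) x) (synth (fun xi => (expR (- (r * lap 0 xi)))%:C * al xi) x).
rewrite subrK => /le_trans; apply; rewrite addrC; apply: lerD => //.
exact: HD.
Qed.

(* As the exponents [ip] of the two factors of a product add up to [1 / r], Hölder's inequality reduces
   to [t `^ i * t `^ j = t `^ r^-1]. *)
Definition gauge (ip a : R) al (N : R) (G : X -> \bar R) := [/\ measurable_fun [set: X] G,
  forall x, (0 <= G x)%E & forall x (t : R), 0 < t -> (G x <= t%:E)%E -> controlled x al a (N * t `^ ip)].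

Lemma LpN_le (P N : R) (u : X -> R[i]) : 0 < P -> 0 <= N -> (LpN P%:E u <= N%:E)%E ->
  (\int[mu]_x (normc (u x) `^ P)%:E <= (N `^ P)%:E)%E.
Proof.
move=> P0 N0 h; have := poweR_Lnorm mu (fun x => (normc (u x))%:E) (lt0r_neq0 P0).
rewrite (_ : (\int[_]_x _)%E = (\int[mu]_x (normc (u x) `^ P)%:E)%E); last first.
  by apply: eq_integral => x _; rewrite abse_EFin poweR_EFin ger0_norm ?normc_ge0.
move=> <-; rewrite -poweR_EFin; apply: gt0_ler_poweR; rewrite ?in_itv/= ?leey ?andbT//.
- exact: ltW.
- exact: Lnorm_ge0.
Qed.

(** [G] is [M(|F|^a)^(P/a)] divided by [N^P], with [M] the maximal function, which is bounded on
    [L^(P/a)] as [a < P]. *)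
Lemma gauge_strong (P a : R) : 1 <= a -> a < P -> exists2 C : R, 0 < C &
  forall al (N : R), wid al -> 0 < N -> (LpN P%:E (synth al) <= N%:E)%E ->
  exists2 G, gauge P^-1 a al N G & (\int[mu]_x G x <= C%:E)%E.
Proof.
move=> a1 aP; have a0 : 0 < a by rewrite (lt_le_trans ltr01).
have P0 : 0 < P by rewrite (lt_trans a0).
have q1 : 1 < P / a by rewrite ltr_pdivlMr// mul1r.
have [C C0 H] := HL_strong (n := n) q1.
exists C => // al N wa N0 hN.
have ms := measurable_synth wa.
have mp : measurable_fun [set: X] (fun y => normc (synth al y) `^ a).
  by apply: (measurableT_comp (f := @powR R ^~ a)); [exact: measurable_powR|exact: ms].
have p0 y : 0 <= normc (synth al y) `^ a by exact: powR_ge0.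
have [j jE] := wv_bounded wa.
have pB y : normc (synth al y) `^ a <= j `^ a.
  apply: ge0_ler_powR; rewrite ?nnegrE ?normc_ge0//; first exact: ltW.
    by apply: le_trans (jE 0); exact: normc_ge0.
  exact: jE.
pose psi y := normc (synth al y) `^ a; pose M x := fine (HL psi x).
have Hfin x : HL psi x = (M x)%:E.
  rewrite /M fineK// ge0_fin_numE ?HL_ge0//.
  apply: le_lt_trans (ltry (j `^ a)); apply: HL_le_cst => //; last exact/nearW.
  exact: powR_ge0.
have M0 x : 0 <= M x by apply: fine_ge0; exact: HL_ge0.
have mM : measurable_fun [set: X] M by apply: measurableT_comp (measurable_HL p0) => //.
have Np : 0 < N `^ P by rewrite powR_gt0.
have mMq : measurable_fun [set: X] (fun x => M x `^ (P / a)).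
  by apply: (measurableT_comp (f := @powR R ^~ (P / a))); [exact: measurable_powR|].
exists (fun x => ((N `^ P)^-1 * M x `^ (P / a))%:E).
  split; first by apply/measurable_EFinP; exact: measurable_funM.
    by move=> x; rewrite lee_fin mulr_ge0 ?powR_ge0// invr_ge0 ltW.
  move=> x t t0; rewrite lee_fin ler_pdivrMl// => ht; split=> //.
    by rewrite mulr_gt0// powR_gt0.
  rewrite -/psi Hfin lee_fin.
  have -> : M x = (M x `^ (P / a)) `^ (a / P).
    by rewrite -powRrM (_ : P / a * (a / P) = 1) ?powRr1//; field; rewrite !gt_eqF.
  apply: (@le_trans _ _ ((N `^ P * t) `^ (a / P))).
    have aP0 : 0 <= a / P by rewrite divr_ge0 ?(ltW a0) ?(ltW P0).
    apply: (ge0_ler_powR aP0) => //; rewrite nnegrE; first exact: powR_ge0.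
    exact: mulr_ge0 (ltW Np) (ltW t0).
  rewrite powRM ?powR_ge0 ?(ltW t0)// (powRM a) ?powR_ge0 ?(ltW N0)// -!powRrM.
  by rewrite (_ : P * (a / P) = a) 1?[P^-1 * a]mulrC//; field; rewrite gt_eqF.
rewrite ge0_integralrZl; [|by rewrite invr_ge0 ltW|exact: mMq|by move=> x; exact: powR_ge0].
apply: (@le_trans _ _ (((N `^ P)^-1)%:E * (C%:E * (N `^ P)%:E))%E); last first.
  by rewrite -!EFinM lee_fin mulrCA mulVf ?mulr1// gt_eqF.
apply: lee_wpmul2l; first by rewrite lee_fin invr_ge0 ltW.
apply: le_trans (H psi _ mp p0 pB) _; apply: lee_wpmul2l; first by rewrite lee_fin ltW.
apply: le_trans (LpN_le P0 (ltW N0) hN).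
rewrite le_eqVlt; apply/orP; left; apply/eqP; apply: eq_integral => x _.
by rewrite /psi -powRrM mulrCA mulfV ?mulr1// gt_eqF.
Qed.

(** The endpoint [a = P], where the weak type (1,1) bound takes over. *)
Lemma gauge_weak (P : R) al (N : R) : 1 <= P -> wid al -> 0 < N -> (LpN P%:E (synth al) <= N%:E)%E ->
  exists2 G, gauge P^-1 P al N G & forall l, 0 < l -> (l%:E * mu [set x | (l%:E < G x)%E] <= (3 ^+ n)%:E)%E.
Proof.
move=> P1 wa N0 hN; have P0 : 0 < P by rewrite (lt_le_trans ltr01).
have ms := measurable_synth wa.
have mp : measurable_fun [set: X] (fun y => normc (synth al y) `^ P).
  by apply: (measurableT_comp (f := @powR R ^~ P)); [exact: measurable_powR|exact: ms].
have p0 y : 0 <= normc (synth al y) `^ P by exact: powR_ge0.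
have Np : 0 < N `^ P by rewrite powR_gt0.
pose psi y := normc (synth al y) `^ P.
have mH := measurable_HL p0.
exists (fun x => ((N `^ P)^-1)%:E * HL psi x)%E.
  split; first exact: measurable_funeM.
    by move=> x; apply: mule_ge0; [rewrite lee_fin invr_ge0 ltW|exact: HL_ge0].
  move=> x t t0; rewrite lee_pdivrMl// => ht; split=> //; first by rewrite mulr_gt0// powR_gt0.
  apply: (le_trans ht); rewrite -EFinM lee_fin powRM ?powR_ge0 ?(ltW N0)// -powRrM.
  by rewrite mulVf ?powRr1 ?(ltW t0)// gt_eqF.
move=> l l0; have lN0 : 0 < N `^ P * l by rewrite mulr_gt0.
have := HL_weak11 mp p0 lN0 => /le_trans /(_ (lee_wpmul2l _ (LpN_le P0 (ltW N0) hN))).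
rewrite lee_fin exprn_ge0// => /(_ isT) h.
have -> : [set x | (l%:E < ((N `^ P)^-1)%:E * HL psi x)%E] = [set x | ((N `^ P * l)%:E < HL psi x)%E].
  by apply/seteqP; split => x /=; rewrite lte_pdivlMl// EFinM.
move: h; rewrite -/psi !EFinM -muleA [leRHS]muleC lee_pmul2l//.
Qed.

(** The norm with exponent [+oo] is the essential supremum only on a space of positive measure. *)
Lemma lebesgue_rV_gt0 : (0 < mu [set: X])%E.
Proof.
apply: (@lt_le_trans _ _ (mu (@cube R n 0 1))).
  by rewrite lebesgue_cube// lte_fin exprn_gt0// mulr1.
by apply: le_measure; rewrite ?inE//; exact: measurable_cube.
Qed.

(** A uniform bound controls the function at every point, hence the reciprocal exponent 0 and the
    gauge 0. *)
Lemma gauge_infty (a : R) al (N : R) : 1 <= a -> wid al -> 0 < N -> (LpN +oo%E (synth al) <= N%:E)%E ->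
  gauge 0 a al N (fun=> 0%E).
Proof.
move=> a1 wa N0; rewrite /LpN unlock /Lnorm lebesgue_rV_gt0 => /ess_supP hN.
split=> // x t t0 _; rewrite powRr0 mulr1; split=> //.
apply: HL_le_cst.
- apply: (measurableT_comp (f := @powR R ^~ a)); [exact: measurable_powR|exact: measurable_synth].
- by move=> y; exact: powR_ge0.
- exact: powR_ge0.
apply: filterS hN => y /=; rewrite lee_fin ger0_norm ?normc_ge0// => h.
by apply: ge0_ler_powR; rewrite ?nnegrE ?normc_ge0 ?(ltW N0)// (le_trans ler01).
Qed.

Section pointwise.
Context (n_gt0 : (0 < n)%N).

Definition lapP (h e : R) al xi : R[i] := (lap e xi `^ h)%:C * al xi.

(** By [multiplier_mul], with [h = s / 2], this is [D^s (f g)] for [e = 0] and [J^s (f g)] for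
    [e = 1]. *)
Definition product_wave (h e : R) (f g : X -> R[i]) x : R[i] :=
  wv mu2 (fun z => z.1 + z.2) (fun z => (lap e (z.1 + z.2) `^ h)%:C * (fourier f z.1 * fourier g z.2)) x.

(** The two products that the defect subtracts are put back and bounded by [controlled_le]. *)
Lemma product_bound (h th : R) : 0 < h -> 0 <= th -> n%:R * th < 2 * h \/ (exists K : nat, h = K%:R) ->
  exists2 C : R, 0 < C & forall e f g x (p0 p1 q0 q1 X0 X1 Y0 Y1 : R), 0 <= e -> schwartz f -> schwartz g ->
  controlled x (fourier f) p0 X0 -> controlled x (lapP h e (fourier f)) p1 X1 ->
  controlled x (fourier g) q0 Y0 -> controlled x (lapP h e (fourier g)) q1 Y1 ->
  p0^-1 + q1^-1 <= 1 + th -> p1^-1 + q0^-1 <= 1 + th ->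
  normc (product_wave h e f g x) <= C * (X1 * Y0 + X0 * Y1).
Proof.
move=> h0 th0 hN; have [C1 C10 H1] := defect_bound h0 th0 hN.
have [C2 C20 H2] := controlled_le.
exists (C1 + C2 * C2) => [|e f g x p0 p1 q0 q1 X0 X1 Y0 Y1 e0 sf sg cf cf1 cg cg1 h1 h2].
  by rewrite addr_gt0// mulr_gt0.
have wf := fourier_wid n_gt0 sf; have wg := fourier_wid n_gt0 sg.
have [_ E] := defect_int x (ltW h0) e0 wf wg.
have := H1 e x _ _ p0 p1 q0 q1 X0 X1 Y0 Y1 e0 cf cf1 cg cg1 h1 h2; rewrite E.
rewrite -/(product_wave h e f g x) -/(lapP h e (fourier f)) -/(lapP h e (fourier g)).
set W := product_wave _ _ _ _ _; set F0 := synth (fourier f) x; set F1 := synth (lapP _ _ (fourier f)) x.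
set G0 := synth (fourier g) x; set G1 := synth (lapP _ _ (fourier g)) x => hd.
have := normcD_le (W - F1 * G0 - F0 * G1) (F1 * G0 + F0 * G1).
rewrite (_ : W - F1 * G0 - F0 * G1 + (F1 * G0 + F0 * G1) = W); last by ring.
move=> /le_trans; apply; rewrite [leRHS]mulrDl; apply: lerD => //.
apply: (le_trans (normcD_le _ _)); rewrite !normcM mulrDr.
have pr a b A B : normc a <= C2 * A -> normc b <= C2 * B -> normc a * normc b <= C2 * C2 * (A * B).
  by move=> ha hb; rewrite mulrACA; apply: ler_pM => //; exact: normc_ge0.
have hF0 := H2 _ _ _ _ cf; have hF1 := H2 _ _ _ _ cf1; have hG0 := H2 _ _ _ _ cg; have hG1 := H2 _ _ _ _ cg1.
exact: lerD (pr _ _ _ _ hF1 hG0) (pr _ _ _ _ hF0 hG1).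
Qed.

(** With [t] the sum of the four gauges at [x], all four functions are controlled at level [t], and
    each of the two products of bounds carries exactly [t^(1/r)]. *)
Lemma product_gauge (h th r : R) : 0 < h -> 0 <= th -> 0 < r -> n%:R * th < 2 * h \/ (exists K : nat, h = K%:R) ->
  exists2 C : R, 0 < C & forall e f g (p0 p1 q0 q1 i0 i1 j0 j1 A0 A1 B0 B1 : R) (F0 F1 G0 G1 : X -> \bar R),
  0 <= e -> schwartz f -> schwartz g -> 0 < A0 -> 0 < A1 -> 0 < B0 -> 0 < B1 ->
  gauge i0 p0 (fourier f) A0 F0 -> gauge i1 p1 (lapP h e (fourier f)) A1 F1 ->
  gauge j0 q0 (fourier g) B0 G0 -> gauge j1 q1 (lapP h e (fourier g)) B1 G1 ->
  p0^-1 + q1^-1 <= 1 + th -> p1^-1 + q0^-1 <= 1 + th -> i1 + j0 = r^-1 -> i0 + j1 = r^-1 ->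
  forall x, ((normc (product_wave h e f g x) `^ r)%:E <=
    ((C * (A1 * B0 + A0 * B1)) `^ r)%:E * (F0 x + F1 x + (G0 x + G1 x)))%E.
Proof.
move=> h0 th0 r0 hN; have [C C0 H] := product_bound h0 th0 hN.
exists C => // e f g p0 p1 q0 q1 i0 i1 j0 j1 A0 A1 B0 B1 F0 F1 G0 G1 e0 sf sg A00 A10 B00 B10.
move=> [_ F00 gF0] [_ F10 gF1] [_ G00 gG0] [_ G10 gG1] pq1 pq2 ij1 ij2 x.
set S := A1 * B0 + A0 * B1; have S0 : 0 < S by rewrite addr_gt0// mulr_gt0.
have K0 : 0 < (C * S) `^ r by rewrite powR_gt0// mulr_gt0.
set T := (_ + _ + _)%E; have T0 : (0 <= T)%E by rewrite !adde_ge0.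
have [Tfin|Tinf] := boolP (T \is a fin_num); last first.
  have -> : T = +oo%E by apply/eqP; rewrite -leye_eq leNgt -ge0_fin_numE.
  by rewrite gt0_muley ?lte_fin// leey.
have TE : T = (fine T)%:E by rewrite fineK.
have t0 : 0 <= fine T by exact: fine_ge0.
rewrite TE -EFinM lee_fin; apply: (le_lim0 (ltW K0)) => d d0.
(* Control is available for positive [t] only, while the gauges may all vanish at [x]; hence the
   [d], which [le_lim0] removes. *)
set t := fine T + d; have tp : 0 < t by rewrite ltr_wpDl.
have Tt : (T <= t%:E)%E by rewrite TE lee_fin lerDl ltW.
have le4 (a b c d' : \bar R) : (0 <= a)%E -> (0 <= b)%E -> (0 <= c)%E -> (0 <= d')%E -> (a + b + (c + d') <= t%:E)%E ->
    [/\ (a <= t%:E)%E, (b <= t%:E)%E, (c <= t%:E)%E & (d' <= t%:E)%E].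
  move=> a0 b0 c0 d0' ht; split; apply: le_trans ht.
  - by rewrite -addeA leeDl// !adde_ge0.
  - by rewrite addeAC leeDr// !adde_ge0.
  - by rewrite addeCA leeDl// !adde_ge0.
  - by rewrite addeA leeDr// !adde_ge0.
have [tF0 tF1 tG0 tG1] := le4 _ _ _ _ (F00 x) (F10 x) (G00 x) (G10 x) Tt.
have := H e f g x p0 p1 q0 q1 _ _ _ _ e0 sf sg (gF0 x t tp tF0) (gF1 x t tp tF1) (gG0 x t tp tG0) (gG1 x t tp tG1) pq1 pq2.
have tD a b : t `^ a * t `^ b = t `^ (a + b) by rewrite powRD// (gt_eqF tp) implybT.
rewrite (mulrACA A1) (mulrACA A0) !tD ij1 ij2 -mulrDl -/S => hx.
apply: (@le_trans _ _ ((C * (S * t `^ r^-1)) `^ r)).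
  apply: ge0_ler_powR; rewrite ?nnegrE ?normc_ge0 ?(ltW r0)//.
  by rewrite !mulr_ge0 ?powR_ge0// ltW.
rewrite mulrA powRM ?powR_ge0 ?(ltW (mulr_gt0 C0 S0))// -powRrM mulVf ?gt_eqF//.
by rewrite powRr1 ?(ltW tp)// /t mulrDr (mulrC d).
Qed.

End pointwise.

End gauges.

(** * Degenerate norms and the choice of exponents *)

Section exponents.
Context {R : realType}.

(** Gauges require positive real majorants of all four norms. If the norm of [f] or [g] vanishes, so
    does the left side; otherwise an infinite norm makes the right side infinite; in the remaining
    case every norm is enlarged by a small [et], which is then removed. *)
Lemma bilinear_ereal (Q a1 b0 a0 b1 : \bar R) (C : R) : 0 < C ->
  (0 <= a1)%E -> (0 <= b0)%E -> (0 <= a0)%E -> (0 <= b1)%E -> (b0 < +oo)%E -> (a0 < +oo)%E ->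
  (b0 = 0%E -> (Q <= 0)%E) -> (a0 = 0%E -> (Q <= 0)%E) ->
  (forall A1 B0 A0 B1 : R, 0 < A1 -> 0 < B0 -> 0 < A0 -> 0 < B1 ->
    (a1 <= A1%:E)%E -> (b0 <= B0%:E)%E -> (a0 <= A0%:E)%E -> (b1 <= B1%:E)%E ->
    (Q <= (C * (A1 * B0 + A0 * B1))%:E)%E) ->
  (Q <= C%:E * (a1 * b0 + a0 * b1))%E.
Proof.
move=> C0 a10 b00 a00 b10 b0oo a0oo Qb Qa H.
have R0 : (0 <= C%:E * (a1 * b0 + a0 * b1))%E by rewrite mule_ge0 ?adde_ge0 ?mule_ge0// lee_fin ltW.
have [b0E|b0n] := eqVneq b0 0%E; first exact: le_trans (Qb b0E) R0.
have [a0E|a0n] := eqVneq a0 0%E; first exact: le_trans (Qa a0E) R0.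
have b0p : (0 < b0)%E by rewrite lt0e b0n.
have a0p : (0 < a0)%E by rewrite lt0e a0n.
have Cy : (C%:E * +oo = +oo)%E by rewrite gt0_muley ?lte_fin.
have [a1oo|a1oo] := eqVneq a1 +oo%E.
  rewrite a1oo gt0_mulye// addye ?Cy ?leey// gt_eqF// (lt_le_trans ltNy0)// mule_ge0//.
have [b1oo|b1oo] := eqVneq b1 +oo%E.
  rewrite b1oo gt0_muley// addey ?Cy ?leey// gt_eqF// (lt_le_trans ltNy0)// mule_ge0//.
have fin (z : \bar R) : (0 <= z)%E -> (z < +oo)%E -> exists2 t : R, z = t%:E & 0 <= t.
  by case: z => [t|//|//]; rewrite lee_fin => t0 _; exists t.
have [y0 y0E y00] := fin _ b00 b0oo; have [x0 x0E x00] := fin _ a00 a0oo.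
have [x1 x1E x10] : exists2 t : R, a1 = t%:E & 0 <= t by apply: fin; rewrite ?ltey.
have [y1 y1E y10] : exists2 t : R, b1 = t%:E & 0 <= t by apply: fin; rewrite ?ltey.
apply/lee_addgt0Pr => d d0.
pose D := C * (x1 + y0 + x0 + y1 + 2).
have D0 : 0 < D by rewrite mulr_gt0// ltr_wpDl// !addr_ge0.
pose et := Num.min 1 (d / D).
have et0 : 0 < et by rewrite lt_min ltr01 divr_gt0.
have [et1 etd] : et <= 1 /\ et <= d / D by rewrite !ge_min !lexx !orbT.
have := H (x1 + et) (y0 + et) (x0 + et) (y1 + et).
rewrite !ltr_wpDl// x1E y0E x0E y1E !lee_fin !lerDl (ltW et0) => /(_ isT isT isT isT isT isT isT isT) /le_trans; apply.
have -> : (C%:E * (x1%:E * y0%:E + x0%:E * y1%:E) + d%:E)%E = (C * (x1 * y0 + x0 * y1) + d)%:E by [].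
rewrite lee_fin.
move: etd; rewrite ler_pdivlMr// => etd.
have h1 : et * et <= et by rewrite ler_piMl// ltW.
have h2 := ler_wpM2l (ltW C0) h1.
rewrite [leLHS](_ : _ = C * (x1 * y0 + x0 * y1) + (et * (C * (x1 + y0 + x0 + y1)) + C * (et * et) * 2)); last by ring.
rewrite lerD2l; apply: le_trans etd; rewrite /D; lra.
Qed.

(** [th] is the admissible excess of the reciprocal exponents over 1. Above the threshold it is the
    midpoint of [max(0, 1/r - 1)] and [s / n]; for even [s] the value 1 serves, because
    [1/r <= 2]. *)
Lemma theta_choice (n : nat) (r s : R) : (0 < n)%N -> 2^-1 <= r ->
  Num.max 0 (n%:R / r - n%:R) < s \/ (exists2 k : nat, (0 < k)%N & s = (2 * k)%:R) ->
  0 < s / 2 /\ exists th : R, [/\ 0 <= th, r^-1 <= 1 + th, (2^-1 < r -> r^-1 < 1 + th) &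
    n%:R * th < 2 * (s / 2) \/ (exists K : nat, s / 2 = K%:R)].
Proof.
move=> n0 r2; have r0 : 0 < r by rewrite (lt_le_trans _ r2)// invr_gt0.
have nR : 0 < n%:R :> R by rewrite ltr0n.
case=> [|[k k0 ->]].
  rewrite gt_max => /andP[s0 hs]; split; first by rewrite divr_gt0.
  have hs' : r^-1 - 1 < s / n%:R by rewrite ltr_pdivlMr// mulrBl mul1r mulrC.
  have sn0 : 0 < s / n%:R by rewrite divr_gt0.
  pose m := Num.max 0 (r^-1 - 1).
  have m0 : 0 <= m by rewrite le_max lexx.
  have m1 : r^-1 - 1 <= m by rewrite le_max lexx orbT.
  have ms : m < s / n%:R by rewrite gt_max sn0.
  exists ((m + s / n%:R) / 2).
  split; [lra|lra|move=> _; lra|left].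
  rewrite mulrC -ltr_pdivlMr// [2 * (s / 2)]mulrC mulfVK ?pnatr_eq0//; lra.
split; first by rewrite natrM mulrAC mulfV ?mul1r ?ltr0n// pnatr_eq0.
exists 1; split => //.
- by rewrite -[leRHS]invrK lef_pV2 ?posrE ?invr_gt0 ?addr_gt0.
- by move=> r2'; rewrite -[ltRHS]invrK ltf_pV2 ?posrE ?invr_gt0 ?addr_gt0.
by right; exists k; rewrite natrM mulrAC mulfV ?mul1r// pnatr_eq0.
Qed.

Definition inv_exp (p : \bar R) : R := fine p^-1.

Lemma inv_expE (p : \bar R) : (1 <= p)%E -> (p^-1 = (inv_exp p)%:E)%E /\ 0 <= inv_exp p <= 1.
Proof.
rewrite /inv_exp; case: p => [p| |//]; last by rewrite invey/= lexx ler01.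
rewrite lee_fin => p1; have p0 : 0 < p by rewrite (lt_le_trans ltr01).
by rewrite inver gt_eqF//= invr_ge0 (ltW p0) invf_le1.
Qed.

Lemma inv_exp_lt1 (p : \bar R) : (1 < p)%E -> inv_exp p < 1.
Proof.
rewrite /inv_exp; case: p => [p| |//]; last by rewrite invey.
rewrite lte_fin => p1; have p0 : 0 < p by rewrite (lt_trans ltr01).
by rewrite inver gt_eqF//= invf_lt1.
Qed.

Lemma inv_exp_sum (r : R) (p q : \bar R) : 0 < r -> (1 <= p)%E -> (1 <= q)%E ->
  (r%:E^-1 = p^-1 + q^-1)%E -> inv_exp p + inv_exp q = r^-1.
Proof.
move=> r0 /inv_expE[-> _] /inv_expE[-> _]; rewrite inver gt_eqF//.
by rewrite -EFinD => /eqP; rewrite eqe => /eqP.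
Qed.

End exponents.

(** * Strong and weak bounds for the product *)

Section quasinorms.
Context {R : realType} {n : nat}.
Context (n_gt0 : (0 < n)%N).
Local Notation X := 'rV[R]_n.
Local Notation mu := (lebesgue_rV R n).
Local Notation mu2 := (prodm mu mu).
Implicit Types (x y xi : X) (f g al : X -> R[i]).

Lemma schwartz_LpN_fin f (p : \bar R) : schwartz f -> (1 <= p)%E -> (LpN p f < +oo)%E.
Proof.
move=> sf; have [j j0 jE] := schwartz_decay n_gt0 0 sf.
have fj x : normc (f x) <= j by have := jE x; rewrite expr0 mul1r.
have [mf foo] := wave_int (schwartz_wid n_gt0 sf).
have mN := measurable_normc mf.
rewrite /LpN unlock; case: p => [p|_|//]; last first.
  case: ifP => // _; apply: (@le_lt_trans _ _ j%:E); last exact: ltry.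
  by apply/ess_supP; apply/nearW => x /=; rewrite lee_fin ger0_norm ?normc_ge0.
rewrite lee_fin => p1 /=; apply: poweR_lty.
apply: (@le_lt_trans _ _ (\int[mu]_x (j `^ (p - 1) * normc (f x))%:E)%E); last first.
  rewrite ge0_integralrZl ?powR_ge0//; last by move=> x; exact: normc_ge0.
  by rewrite lte_mul_pinfty// lee_fin powR_ge0.
under eq_integral do rewrite ger0_norm ?normc_ge0//.
apply: ge0_le_integralr.
- by apply: (measurableT_comp (f := @powR R ^~ p)); [exact: measurable_powR|].
- exact: measurable_funM.
- by move=> x; exact: powR_ge0.
move=> x; have [->|nz] := eqVneq (normc (f x)) 0; first by rewrite powR0 ?mulr0// gt_eqF// (lt_le_trans ltr01).
rewrite -[X in X <= _](_ : normc (f x) `^ (p - 1) * normc (f x) = _); last first.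
  by rewrite -[X in _ * X]powRr1 ?normc_ge0// -powRD ?nz ?implybT// subrK.
apply: ler_wpM2r; first exact: normc_ge0.
by apply: ge0_ler_powR; rewrite ?nnegrE ?normc_ge0 ?subr_ge0.
Qed.

Lemma fourier_eq0 f (p : \bar R) : schwartz f -> (1 <= p)%E -> LpN p f = 0%E -> forall xi, fourier f xi = 0.
Proof.
move=> sf p1 h xi; have mf := schwartz_cmeas sf.
have p0 : (0 < p)%E by rewrite (lt_le_trans _ p1)// lte_fin.
have mN : measurable_fun [set: X] (fun x => (normc (f x))%:E) by apply/measurable_EFinP; exact: measurable_normc.
have ae0 := Lnorm_eq0_eq0 mN p0 h.
have wf := schwartz_wid n_gt0 sf.
rewrite fourier_synth; apply: eq0_normc; apply/eqP; rewrite eq_le normc_ge0 andbT -lee_fin.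
apply: le_trans (normc_cint (wave_cis_int (- xi) wf)) _.
rewrite (_ : (\int[_]_x _)%E = (\int[mu]_x (normc (f x))%:E)%E); last first.
  by apply: eq_integral => x _; rewrite normcM normc_cis mulr1.
rewrite (ge0_ae_eq_integral measurableT mN (measurable_cst 0%E)) ?integral0//.
by move=> x _; rewrite lee_fin normc_ge0.
Qed.

Lemma product_wave_eq0 h e f g x : (forall xi, fourier f xi = 0) \/ (forall xi, fourier g xi = 0) ->
  product_wave h e f g x = 0.
Proof.
move=> H; transitivity (cint mu2 (fun=> 0 : R[i])); last first.
  by apply: complex_eqP; rewrite /cint/= /Rintegral integral0.
by apply: eq_cint => z; case: H => ->; rewrite ?mulr0 ?mul0r ?mulr0 ?mul0r.
Qed.

Lemma product_wave_meas h e f g : 0 <= h -> 0 <= e -> schwartz f -> schwartz g -> cmeas (product_wave h e f g).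
Proof.
move=> h0 e0 sf sg; apply: cmeas_wv; apply: (waveM (symbol_lap_powR (n := n) e0 h0)).
exact: wave_pair (fourier_wid n_gt0 sf) (fourier_wid n_gt0 sg).
Qed.

Lemma LpN_gauge (r K c : R) (u : X -> R[i]) (S : X -> \bar R) : 0 < r -> 0 < K -> 0 <= c -> cmeas u ->
  measurable_fun [set: X] S -> (forall x, 0 <= S x)%E ->
  (forall x, ((normc (u x) `^ r)%:E <= (K `^ r)%:E * S x)%E) -> (\int[mu]_x S x <= c%:E)%E ->
  (LpN r%:E u <= (K * c `^ r^-1)%:E)%E.
Proof.
move=> r0 K0 c0 mu_ mS S0 hu hS; rewrite /LpN unlock /=.
have Kr : 0 < K `^ r by rewrite powR_gt0.
apply: (@le_trans _ _ ((K `^ r * c)%:E `^ r^-1)%E); last first.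
  rewrite poweR_EFin lee_fin powRM ?powR_ge0// -powRrM mulfV ?gt_eqF// powRr1 ?(ltW K0)//.
apply: gt0_ler_poweR.
- by rewrite invr_ge0 ltW.
- by rewrite in_itv/= leey andbT; apply: integral_ge0 => x _; rewrite lee_fin powR_ge0.
- by rewrite in_itv/= leey andbT lee_fin mulr_ge0// ltW.
apply: (@le_trans _ _ (\int[mu]_x ((K `^ r)%:E * S x))%E); last first.
  rewrite ge0_integralZl//; last by rewrite lee_fin ltW.
  by rewrite EFinM; apply: lee_wpmul2l => //; rewrite lee_fin ltW.
apply: ge0_le_integral => //.
- apply/measurable_EFinP; apply: (measurableT_comp (f := @powR R ^~ r)); first exact: measurable_powR.
  by apply: measurableT_comp => //; exact: measurable_normc.
- exact: measurable_funeM.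
by move=> x _; rewrite ger0_norm ?normc_ge0//; exact: hu.
Qed.

Lemma weakLpN_gauge (r K c : R) (u : X -> R[i]) (F0 F1 G0 G1 : X -> \bar R) : 0 < r -> 0 < K -> 0 < c ->
  measurable_fun [set: X] F0 -> measurable_fun [set: X] F1 -> measurable_fun [set: X] G0 -> measurable_fun [set: X] G1 ->
  cmeas u -> (forall x, ((normc (u x) `^ r)%:E <= (K `^ r)%:E * (F0 x + F1 x + (G0 x + G1 x)))%E) ->
  (forall l, 0 < l -> (l%:E * mu [set x | (l%:E < F0 x)%E] <= c%:E)%E) ->
  (forall l, 0 < l -> (l%:E * mu [set x | (l%:E < F1 x)%E] <= c%:E)%E) ->
  (forall l, 0 < l -> (l%:E * mu [set x | (l%:E < G0 x)%E] <= c%:E)%E) ->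
  (forall l, 0 < l -> (l%:E * mu [set x | (l%:E < G1 x)%E] <= c%:E)%E) ->
  (weakLpN r u <= (K * (16 * c) `^ r^-1)%:E)%E.
Proof.
move=> r0 K0 c0 mF0 mF1 mG0 mG1 mu_ hu hF0 hF1 hG0 hG1; apply: ge_ereal_sup => _ [l /= l0 <-].
(* Where the sum of the gauges exceeds [(l/K)^r], one of the four exceeds a quarter of it; the four
   level sets, each at a quarter of the level, give the factor 16. *)
pose t := (l / K) `^ r / 4; have lK : 0 < l / K by rewrite divr_gt0.
have t0 : 0 < t by rewrite divr_gt0// powR_gt0.
have mL (G : X -> \bar R) : measurable_fun [set: X] G -> measurable [set x | (t%:E < G x)%E].
  by move=> mG; rewrite -[X in measurable X]setTI; apply: emeasurable_fun_o_infty.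
have bL (G : X -> \bar R) : (forall l, 0 < l -> (l%:E * mu [set x | (l%:E < G x)%E] <= c%:E)%E) ->
    (mu [set x | (t%:E < G x)%E] <= (c / t)%:E)%E.
  by move=> /(_ t t0); rewrite -lee_pdivlMl// -EFinM mulrC.
set E := [set x | l < normc (u x)].
have sub : E `<=` ([set x | (t%:E < F0 x)%E] `|` [set x | (t%:E < F1 x)%E]) `|`
    ([set x | (t%:E < G0 x)%E] `|` [set x | (t%:E < G1 x)%E]).
  move=> x /= lx; apply: contrapT => /not_orP[/not_orP[/negP h1 /negP h2] /not_orP[/negP h3 /negP h4]].
  rewrite -!leNgt in h1 h2 h3 h4.
  have := leeD (leeD h1 h2) (leeD h3 h4); rewrite -!EFinD => hS.
  have Kr : (0 <= (K `^ r)%:E)%E by rewrite lee_fin powR_ge0.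
  have := le_trans (hu x) (lee_wpmul2l Kr hS); rewrite -EFinM lee_fin.
  rewrite (_ : t + t + (t + t) = (l / K) `^ r); last by rewrite /t; field.
  rewrite -powRM ?(ltW K0) ?(ltW lK)// mulrCA mulfV ?gt_eqF// mulr1.
  by rewrite leNgt gt0_ltr_powR// nnegrE ?normc_ge0// ltW.
have mE : measurable E.
  rewrite (_ : E = [set x | (l%:E < (normc (u x))%:E)%E]); last first.
    by apply/seteqP; split => x /=; rewrite lte_fin.
  rewrite -[X in measurable X]setTI; apply: emeasurable_fun_o_infty => //.
  by apply/measurable_EFinP; exact: measurable_normc.
have muE : (mu E <= (c / t + c / t + (c / t + c / t))%:E)%E.
  apply: (@le_trans _ _ (mu (([set x | (t%:E < F0 x)%E] `|` [set x | (t%:E < F1 x)%E]) `|`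
    ([set x | (t%:E < G0 x)%E] `|` [set x | (t%:E < G1 x)%E])))).
    by apply: le_measure; rewrite ?inE//; do 2 apply: measurableU; exact: mL.
  have U2 (A B : set X) : measurable A -> measurable B -> (mu (A `|` B) <= mu A + mu B)%E.
    by move=> mA mB; exact: measureU2.
  apply: (le_trans (U2 _ _ (measurableU _ _ (mL _ mF0) (mL _ mF1)) (measurableU _ _ (mL _ mG0) (mL _ mG1)))).
  rewrite [leRHS]EFinD; apply: leeD.
    by apply: (le_trans (U2 _ _ (mL _ mF0) (mL _ mF1))); rewrite [leRHS]EFinD; apply: leeD; exact: bL.
  by apply: (le_trans (U2 _ _ (mL _ mG0) (mL _ mG1))); rewrite [leRHS]EFinD; apply: leeD; exact: bL.
have ct0 : 0 <= c / t by rewrite divr_ge0// ltW.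
have -> : K * (16 * c) `^ r^-1 = l * (c / t + c / t + (c / t + c / t)) `^ r^-1.
  have -> : c / t + c / t + (c / t + c / t) = 16 * c * (K / l) `^ r.
    have -> : (K / l) `^ r = ((l / K) `^ r)^-1 by rewrite -[K / l]invf_div -[(l / K)^-1]powR_inv1 ?(ltW lK)// -powRrM mulN1r powRN.
    by rewrite /t; field; rewrite gt_eqF// powR_gt0.
  rewrite [in RHS]powRM ?powR_ge0 ?mulr_ge0 ?(ltW c0)// -powRrM mulfV ?gt_eqF// powRr1.
    by field; rewrite gt_eqF.
  by rewrite divr_ge0// ltW.
rewrite EFinM; apply: lee_wpmul2l; first by rewrite lee_fin ltW.
rewrite -poweR_EFin; apply: gt0_ler_poweR => //.
- by rewrite invr_ge0 ltW.
- by rewrite in_itv/= leey andbT measure_ge0.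
by rewrite in_itv/= leey andbT lee_fin !addr_ge0.
Qed.

Lemma gauge_any (p : \bar R) (a : R) : 1 <= a -> (1 < p)%E -> inv_exp p < a^-1 -> exists2 C : R, 0 < C &
  forall al (N : R), wid al -> 0 < N -> (LpN p (synth al) <= N%:E)%E ->
  exists2 G, gauge (inv_exp p) a al N G & (\int[mu]_x G x <= C%:E)%E.
Proof.
move=> a1; have a0 : 0 < a by rewrite (lt_le_trans ltr01).
rewrite /inv_exp; case: p => [p p1|_ _|//]; last first.
  exists 1 => // al N wa N0 hN; exists (fun=> 0%E); last by rewrite integral0 lee_fin ler01.
  by rewrite invey; exact: gauge_infty.
have p0 : 0 < p by rewrite (lt_trans ltr01).
rewrite fine_invr => pa; apply: gauge_strong => //.
by rewrite -[a]invrK -[p]invrK ltf_pV2 ?posrE ?invr_gt0.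
Qed.

Lemma measurable_gauges (F0 F1 G0 G1 : X -> \bar R) : measurable_fun [set: X] F0 -> measurable_fun [set: X] F1 ->
  measurable_fun [set: X] G0 -> measurable_fun [set: X] G1 ->
  measurable_fun [set: X] (fun x => F0 x + F1 x + (G0 x + G1 x))%E.
Proof. by move=> ? ? ? ?; apply: emeasurable_funD; exact: emeasurable_funD. Qed.

Lemma lapP_wid h e f : 0 <= h -> 0 <= e -> schwartz f -> wid (lapP h e (fourier f)).
Proof. by move=> h0 e0 sf; apply: wid_mul (fourier_wid n_gt0 sf); exact: symbol_lap_powR. Qed.

Lemma synth_fourier f : schwartz f -> synth (fourier f) = f.
Proof. by move=> sf; apply/funext => x; exact: fourier_inversion. Qed.

Lemma strong_product (r s : R) (u1 v0 u0 v1 : \bar R) : 2^-1 < r ->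
  (1 < u1)%E -> (1 < v0)%E -> (1 < u0)%E -> (1 < v1)%E ->
  (r%:E^-1 = u1^-1 + v0^-1)%E -> (r%:E^-1 = u0^-1 + v1^-1)%E ->
  Num.max 0 (n%:R / r - n%:R) < s \/ (exists2 k : nat, (0 < k)%N & s = (2 * k)%:R) ->
  exists2 C : R, 0 < C & forall e f g, 0 <= e -> schwartz f -> schwartz g ->
  (LpN r%:E (product_wave (s / 2) e f g) <=
    C%:E * (LpN u1 (synth (lapP (s / 2) e (fourier f))) * LpN v0 g + LpN u0 f * LpN v1 (synth (lapP (s / 2) e (fourier g)))))%E.
Proof.
move=> r2 hu1 hv0 hu0 hv1 e1 e2 hs.
have r0 : 0 < r by rewrite (lt_trans _ r2)// invr_gt0.
have [h0 [th [th0 _ /(_ r2) thr hth]]] := theta_choice n_gt0 (ltW r2) hs.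
have E1 := inv_exp_sum r0 (ltW hu1) (ltW hv0) e1; have E2 := inv_exp_sum r0 (ltW hu0) (ltW hv1) e2.
(* Each reciprocal exponent is moved a fraction [ka] of the way to 1. It then strictly exceeds
   [1/p], so that the strong maximal inequality applies, while the sums stay below [1 + th]; there
   is room because [r > 1/2] makes [1/r < 1 + th] strict. *)
pose ka := Num.min 2^-1 ((1 + th - r^-1) / 2).
have ka0 : 0 < ka by rewrite lt_min invr_gt0 ltr0n divr_gt0// subr_gt0.
have [ka1 ka2] : ka <= 2^-1 /\ ka <= (1 + th - r^-1) / 2 by rewrite !ge_min !lexx !orbT.
have ka11 : ka < 1 by apply: le_lt_trans ka1 _; rewrite invf_lt1 ?ltr1n.
pose ex (p : \bar R) := (1 - ka) * inv_exp p + ka.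
have exP p : (1 < p)%E -> [/\ 0 < ex p, ex p <= 1 & inv_exp p < ex p].
  move=> p1; have [_ /andP[i0 _]] := inv_expE (ltW p1); have i1 := inv_exp_lt1 p1.
  have k1 : 0 < 1 - ka by rewrite subr_gt0.
  have m1 := mulr_ge0 (ltW k1) i0.
  have m2 : 0 < ka * (1 - inv_exp p) by rewrite mulr_gt0// subr_gt0.
  rewrite /ex; split; first by rewrite ltr_wpDl.
    by have : 0 <= (1 - ka) * (1 - inv_exp p) by [rewrite mulr_ge0 ?ltW// subr_gt0]; lra.
  by lra.
have aP p : (1 < p)%E -> 1 <= (ex p)^-1 /\ inv_exp p < ((ex p)^-1)^-1.
  by move=> /exP[x0 x1 xi]; rewrite invrK invf_ge1.
have [a1u1 a2u1] := aP _ hu1; have [a1v0 a2v0] := aP _ hv0.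
have [a1u0 a2u0] := aP _ hu0; have [a1v1 a2v1] := aP _ hv1.
have sumle p q : inv_exp p + inv_exp q = r^-1 -> ((ex p)^-1)^-1 + ((ex q)^-1)^-1 <= 1 + th.
  move=> pq; rewrite !invrK /ex.
  rewrite [leLHS](_ : _ = (1 - ka) * (inv_exp p + inv_exp q) + 2 * ka); last by ring.
  rewrite pq; have : 0 <= ka * r^-1 by rewrite mulr_ge0 ?invr_ge0 ?(ltW ka0) ?(ltW r0).
  by rewrite mulrBl mul1r; lra.
have [C C0 H] := product_gauge n_gt0 h0 th0 r0 hth.
have [c1 c10 g1] := gauge_any a1u1 hu1 a2u1; have [c2 c20 g2] := gauge_any a1v0 hv0 a2v0.
have [c3 c30 g3] := gauge_any a1u0 hu0 a2u0; have [c4 c40 g4] := gauge_any a1v1 hv1 a2v1.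
pose c := c3 + c1 + (c2 + c4); have cp : 0 < c by rewrite !addr_gt0.
exists (C * c `^ r^-1) => [|e f g he sf sg]; first by rewrite mulr_gt0// powR_gt0.
have wf := fourier_wid n_gt0 sf; have wg := fourier_wid n_gt0 sg.
have wf1 := lapP_wid (ltW h0) he sf; have wg1 := lapP_wid (ltW h0) he sg.
have mW := product_wave_meas (ltW h0) he sf sg.
have Q0 : (forall xi, fourier f xi = 0) \/ (forall xi, fourier g xi = 0) -> (LpN r%:E (product_wave (s / 2) e f g) <= 0)%E.
  move=> hz; have -> : product_wave (s / 2) e f g = fun=> 0 by apply/funext => x; exact: product_wave_eq0.
  rewrite /LpN normc0 Lnorm0//; first by rewrite eqe gt_eqF.
apply: bilinear_ereal; rewrite ?Lnorm_ge0//.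
- by rewrite mulr_gt0// powR_gt0.
- by apply: schwartz_LpN_fin => //; exact: ltW.
- by apply: schwartz_LpN_fin => //; exact: ltW.
- by move=> hz; apply: Q0; right; exact: fourier_eq0 sg (ltW hv0) hz.
- by move=> hz; apply: Q0; left; exact: fourier_eq0 sf (ltW hu0) hz.
move=> A1 B0 A0 B1 A10 B00 A00 B10 hA1 hB0 hA0 hB1.
rewrite -(synth_fourier sg) in hB0; rewrite -(synth_fourier sf) in hA0.
have [F1 gF1 iF1] := g1 _ _ wf1 A10 hA1; have [G0 gG0 iG0] := g2 _ _ wg B00 hB0.
have [F0 gF0 iF0] := g3 _ _ wf A00 hA0; have [G1 gG1 iG1] := g4 _ _ wg1 B10 hB1.
have hx := H e f g _ _ _ _ _ _ _ _ A0 A1 B0 B1 F0 F1 G0 G1 he sf sg A00 A10 B00 B10 gF0 gF1 gG0 gG1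
  (sumle _ _ E2) (sumle _ _ E1) E1 E2.
have [mF0 F00 _] := gF0; have [mF1 F10 _] := gF1; have [mG0 G00 _] := gG0; have [mG1 G10 _] := gG1.
have S0 x : (0 <= F0 x + F1 x + (G0 x + G1 x))%E by rewrite !adde_ge0.
have K0 : 0 < C * (A1 * B0 + A0 * B1) by rewrite mulr_gt0// addr_gt0// mulr_gt0.
have iS : (\int[mu]_x (F0 x + F1 x + (G0 x + G1 x)) <= c%:E)%E.
  rewrite ge0_integralD//; last 4 first.
  - by move=> x _; rewrite adde_ge0.
  - exact: emeasurable_funD.
  - by move=> x _; rewrite adde_ge0.
  - exact: emeasurable_funD.
  rewrite (ge0_integralD _ _ (fun x _ => F00 x) mF0 (fun x _ => F10 x) mF1)//.
  rewrite (ge0_integralD _ _ (fun x _ => G00 x) mG0 (fun x _ => G10 x) mG1)//.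
  by rewrite /c !EFinD; apply: leeD; apply: leeD.
have := LpN_gauge r0 K0 (ltW cp) mW (measurable_gauges mF0 mF1 mG0 mG1) S0 hx iS.
by rewrite mulrAC.
Qed.

(** For [r < 1] all exponents are finite, since [1/p >= 1/r - 1 > 0]. The maximal exponents are then
    the Lebesgue exponents themselves, with reciprocals adding up to [1/r <= 1 + th]. *)
Lemma weak_product (r s : R) (u1 v0 u0 v1 : \bar R) : 2^-1 <= r -> r < 1 ->
  (1 <= u1)%E -> (1 <= v0)%E -> (1 <= u0)%E -> (1 <= v1)%E ->
  (r%:E^-1 = u1^-1 + v0^-1)%E -> (r%:E^-1 = u0^-1 + v1^-1)%E ->
  Num.max 0 (n%:R / r - n%:R) < s \/ (exists2 k : nat, (0 < k)%N & s = (2 * k)%:R) ->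
  exists2 C : R, 0 < C & forall e f g, 0 <= e -> schwartz f -> schwartz g ->
  (weakLpN r (product_wave (s / 2) e f g) <=
    C%:E * (LpN u1 (synth (lapP (s / 2) e (fourier f))) * LpN v0 g + LpN u0 f * LpN v1 (synth (lapP (s / 2) e (fourier g)))))%E.
Proof.
move=> r2 r1 hu1 hv0 hu0 hv1 e1 e2 hs.
have r0 : 0 < r by rewrite (lt_le_trans _ r2)// invr_gt0.
have [h0 [th [th0 thr _ hth]]] := theta_choice n_gt0 r2 hs.
have E1 := inv_exp_sum r0 hu1 hv0 e1; have E2 := inv_exp_sum r0 hu0 hv1 e2.
have ri1 : 1 < r^-1 by rewrite invf_gt1.
have real (p q : \bar R) : (1 <= p)%E -> (1 <= q)%E -> inv_exp p + inv_exp q = r^-1 ->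
    exists2 P : R, p = P%:E & 1 <= P /\ inv_exp p = P^-1.
  move=> p1 q1 pq; have [_ /andP[_ q1']] := inv_expE q1.
  case: p p1 pq => [P P1 _|_|//]; first by exists P => //; rewrite /inv_exp fine_invr.
  by rewrite /inv_exp invey/= add0r -/(inv_exp q) => pq; move: q1'; rewrite pq leNgt ri1.
have [P1 u1E [P11 iu1]] := real _ _ hu1 hv0 E1.
have [Q0 v0E [Q01 iv0]] := real _ _ hv0 hu1 (etrans (addrC _ _) E1).
have [P0 u0E [P01 iu0]] := real _ _ hu0 hv1 E2.
have [Q1 v1E [Q11 iv1]] := real _ _ hv1 hu0 (etrans (addrC _ _) E2).
have [C C0 H] := product_gauge n_gt0 h0 th0 r0 hth.
have c0 : 0 < 3 ^+ n :> R by rewrite exprn_gt0.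
exists (C * (16 * 3 ^+ n) `^ r^-1) => [|e f g he sf sg].
  by rewrite mulr_gt0// powR_gt0// mulr_gt0.
have wf := fourier_wid n_gt0 sf; have wg := fourier_wid n_gt0 sg.
have wf1 := lapP_wid (ltW h0) he sf; have wg1 := lapP_wid (ltW h0) he sg.
have mW := product_wave_meas (ltW h0) he sf sg.
have Qz : (forall xi, fourier f xi = 0) \/ (forall xi, fourier g xi = 0) -> (weakLpN r (product_wave (s / 2) e f g) <= 0)%E.
  move=> hz; have -> : product_wave (s / 2) e f g = fun=> 0 by apply/funext => x; exact: product_wave_eq0.
  apply: ge_ereal_sup => _ [l /= l0 <-].
  rewrite (_ : [set x | _] = set0) ?measure0 ?poweR0r ?mule0// ?invr_neq0 ?gt_eqF//.
  apply/seteqP; split => x //; change (l < normc (0 : R[i]) -> False).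
  by rewrite normc0 ltNge (ltW l0).
apply: bilinear_ereal; rewrite ?Lnorm_ge0//.
- by rewrite mulr_gt0// powR_gt0// mulr_gt0.
- exact: schwartz_LpN_fin.
- exact: schwartz_LpN_fin.
- by move=> hz; apply: Qz; right; exact: fourier_eq0 sg hv0 hz.
- by move=> hz; apply: Qz; left; exact: fourier_eq0 sf hu0 hz.
move=> A1 B0 A0 B1 A10 B00 A00 B10 hA1 hB0 hA0 hB1.
rewrite -(synth_fourier sg) in hB0; rewrite -(synth_fourier sf) in hA0.
rewrite u1E in hA1; rewrite v0E in hB0; rewrite u0E in hA0; rewrite v1E in hB1.
have [F1 gF1 iF1] := gauge_weak P11 wf1 A10 hA1; have [G0 gG0 iG0] := gauge_weak Q01 wg B00 hB0.
have [F0 gF0 iF0] := gauge_weak P01 wf A00 hA0; have [G1 gG1 iG1] := gauge_weak Q11 wg1 B10 hB1.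
rewrite iu1 iv0 in E1; rewrite iu0 iv1 in E2.
have s1 : P0^-1 + Q1^-1 <= 1 + th by rewrite E2.
have s2 : P1^-1 + Q0^-1 <= 1 + th by rewrite E1.
have hx := H e f g _ _ _ _ _ _ _ _ A0 A1 B0 B1 F0 F1 G0 G1 he sf sg A00 A10 B00 B10 gF0 gF1 gG0 gG1 s1 s2 E1 E2.
have [mF0 F00 _] := gF0; have [mF1 F10 _] := gF1; have [mG0 G00 _] := gG0; have [mG1 G10 _] := gG1.
have K0 : 0 < C * (A1 * B0 + A0 * B1) by rewrite mulr_gt0// addr_gt0// mulr_gt0.
have := weakLpN_gauge r0 K0 c0 mF0 mF1 mG0 mG1 mW hx iF0 iF1 iG0 iG1.
by rewrite mulrAC.
Qed.

Lemma riesz_mul s f g : 0 <= s -> schwartz f -> schwartz g ->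
  riesz s (fun x => f x * g x) = product_wave (s / 2) 0 f g.
Proof.
move=> s0 sf sg; apply/funext => x; rewrite riesz_synth.
by apply: multiplier_mul => //; apply: symbol_lap_powR => //; rewrite divr_ge0.
Qed.

Lemma bessel_mul s f g : 0 <= s -> schwartz f -> schwartz g ->
  bessel s (fun x => f x * g x) = product_wave (s / 2) 1 f g.
Proof.
move=> s0 sf sg; apply/funext => x; rewrite bessel_synth.
by apply: multiplier_mul => //; apply: symbol_lap_powR => //; rewrite divr_ge0.
Qed.

Lemma riesz_lapP s f : riesz s f = synth (lapP (s / 2) 0 (fourier f)).
Proof. by apply/funext => x; exact: riesz_synth. Qed.

Lemma bessel_lapP s f : bessel s f = synth (lapP (s / 2) 1 (fourier f)).
Proof. by apply/funext => x; exact: bessel_synth. Qed.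

Lemma le_const (Q S : \bar R) (C C' : R) : (0 <= S)%E -> C <= C' -> (Q <= C%:E * S)%E -> (Q <= C'%:E * S)%E.
Proof. by move=> S0 CC /le_trans; apply; apply: lee_wpmul2r => //; rewrite lee_fin. Qed.

End quasinorms.

Theorem theorem1 (R : realType) (n : nat) (hn : (1 <= n)%N) :
  (forall (r s : R) (p1 p2 q1 q2 : \bar R),
    2^-1 < r ->
    (1 < p1)%E -> (1 < p2)%E -> (1 < q1)%E -> (1 < q2)%E ->
    (r%:E^-1 = p1^-1 + q1^-1)%E -> (r%:E^-1 = p2^-1 + q2^-1)%E ->
    Num.max 0 (n%:R / r - n%:R) < s
      \/ (exists2 k : nat, (0 < k)%N & s = (2 * k)%:R) ->
    exists C : R, forall f g : 'rV[R]_n -> R[i], schwartz f -> schwartz g ->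
      (LpN r%:E (riesz s (fun x => (f x * g x)%R)) <=
        C%:E * (LpN p1 (riesz s f) * LpN q1 g
                + LpN p2 f * LpN q2 (riesz s g)))%E /\
      (LpN r%:E (bessel s (fun x => (f x * g x)%R)) <=
        C%:E * (LpN p1 f * LpN q1 (bessel s g)
                + LpN p2 (bessel s f) * LpN q2 g))%E)
  /\
  (forall (r s : R) (p1 p2 q1 q2 : \bar R),
    2^-1 <= r < 1 ->
    (1 <= p1)%E -> (1 <= p2)%E -> (1 <= q1)%E -> (1 <= q2)%E ->
    (r%:E^-1 = p1^-1 + q1^-1)%E -> (r%:E^-1 = p2^-1 + q2^-1)%E ->
    Num.max 0 (n%:R / r - n%:R) < s
      \/ (exists2 k : nat, (0 < k)%N & s = (2 * k)%:R) ->
    [\/ p1 = 1%E, p2 = 1%E, q1 = 1%E | q2 = 1%E] ->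
    exists C : R, forall f g : 'rV[R]_n -> R[i], schwartz f -> schwartz g ->
      (weakLpN r (riesz s (fun x => (f x * g x)%R)) <=
        C%:E * (LpN p1 (riesz s f) * LpN q1 g
                + LpN p2 f * LpN q2 (riesz s g)))%E /\
      (weakLpN r (bessel s (fun x => (f x * g x)%R)) <=
        C%:E * (LpN p1 f * LpN q1 (bessel s g)
                + LpN p2 (bessel s f) * LpN q2 g))%E).
Proof.
split=> [r s p1 p2 q1 q2 r2 hp1 hp2 hq1 hq2 e1 e2 hs|r s p1 p2 q1 q2 /andP[r2 r1] hp1 hp2 hq1 hq2 e1 e2 hs _].
  have [h0 _] := theta_choice hn (ltW r2) hs.
  have s0 : 0 <= s by move: h0; rewrite pmulr_lgt0 ?invr_gt0// => /ltW.
  have [C1 C10 H1] := strong_product hn r2 hp1 hq1 hp2 hq2 e1 e2 hs.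
  (* In the Bessel inequality the derivative falls on [g] in the first product, so the two index
     pairs change places. *)
  have [C2 C20 H2] := strong_product hn r2 hp2 hq2 hp1 hq1 e2 e1 hs.
  exists (C1 + C2) => f g sf sg; split.
    rewrite riesz_mul// !riesz_lapP; apply: le_const (H1 0 f g _ sf sg) => //.
      by rewrite adde_ge0// mule_ge0// Lnorm_ge0.
    by rewrite lerDl ltW.
  rewrite bessel_mul// !bessel_lapP [X in (_ * X)%E]addeC; apply: le_const (H2 1 f g _ sf sg) => //.
    by rewrite adde_ge0// mule_ge0// Lnorm_ge0.
  by rewrite lerDr ltW.
have [h0 _] := theta_choice hn r2 hs.
have s0 : 0 <= s by move: h0; rewrite pmulr_lgt0 ?invr_gt0// => /ltW.
have [C1 C10 H1] := weak_product hn r2 r1 hp1 hq1 hp2 hq2 e1 e2 hs.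
have [C2 C20 H2] := weak_product hn r2 r1 hp2 hq2 hp1 hq1 e2 e1 hs.
exists (C1 + C2) => f g sf sg; split.
  rewrite riesz_mul// !riesz_lapP; apply: le_const (H1 0 f g _ sf sg) => //.
    by rewrite adde_ge0// mule_ge0// Lnorm_ge0.
  by rewrite lerDl ltW.
rewrite bessel_mul// !bessel_lapP [X in (_ * X)%E]addeC; apply: le_const (H2 1 f g _ sf sg) => //.
  by rewrite adde_ge0// mule_ge0// Lnorm_ge0.
by rewrite lerDr ltW.
Qed.
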